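(* For every $\varepsilon>0$, \[ \sum_{0<d<X} h_3(-d)^4 \ll_{\varepsilon} X^{\frac{11}{6}+\varepsilon}\] for all $X\ge 2$, where the sum runs over square-free integers $d$ with $0<d<X$.
   Context: For a square-free positive integer $d$, $h_3(-d)$ denotes the number of ideal classes in the class group of $\mathbb{Q}(\sqrt{-d})$ whose cube is the principal class. The implied constant may depend on $\varepsilon$. *)

(* Defs.v *)
From HB Require Import structures.
From mathcomp Require Import all_boot all_order all_algebra all_field.
From mathcomp Require Import finmap.
From mathcomp Require Import all_classical all_reals all_analysis.

Set Implicit Arguments.
Unset Strict Implicit.
Unset Printing Implicit Defensive.

Import Order.TTheory GRing.Theory Num.Theory.

Local Open Scope classical_set_scope.
Local Open Scope ring_scope.

(* Number fields are subfields of algC, represented by their carrier sets. *)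

Definition quad_field (d : nat) : set algC :=
  [set z | exists a b : rat, z = ratr a + ratr b * sqrtC (- d%:R)].

Definition ring_of_integers (K : set algC) : set algC :=
  [set z | K z /\ z \in Aint].

Definition scale_set (x : algC) (I : set algC) : set algC :=
  [set x * y | y in I].

(* Fractional ideals are nonzero by definition here. *)
Record frac_ideal (K I : set algC) : Prop := FracIdeal {
  frac_ideal_sub : I `<=` K;
  frac_ideal0 : I 0;
  frac_idealD : forall x y, I x -> I y -> I (x + y);
  frac_idealM : forall a x, ring_of_integers K a -> I x -> I (a * x);
  frac_ideal_neq0 : exists2 x, I x & x != 0;
  frac_ideal_den : exists c,
    [/\ ring_of_integers K c, c != 0 & scale_set c I `<=` ring_of_integers K]
}.

Definition ideal_mul (I J : set algC) : set algC :=
  [set z | exists (n : nat) (x y : 'I_n -> algC),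
    [/\ forall i, I (x i), forall i, J (y i) & z = \sum_(i < n) x i * y i]].

(* The coset of I modulo the nonzero principal fractional ideals of K. *)
Definition ideal_class (K I : set algC) : set (set algC) :=
  [set J | exists x, [/\ K x, x != 0 & J = scale_set x I]].

Definition class_group (K : set algC) : set (set (set algC)) :=
  [set ideal_class K I | I in frac_ideal K].

Definition principal_class (K : set algC) : set (set algC) :=
  ideal_class K (ring_of_integers K).

(* Elementwise product of cosets: [I][J] = { I'J' | I' in [I], J' in [J] }. *)
Definition class_mul (C D : set (set algC)) : set (set algC) :=
  [set ideal_mul I J | I in C & J in D].

(* h3 d is h_3(-d). The class group is finite, so the default value 0 of
   fset_set on infinite sets is never used. *)
Definition h3 (d : nat) : nat :=
  #|` fset_set [set C | class_group (quad_field d) C /\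
        class_mul (class_mul C C) C = principal_class (quad_field d)] |%fset.

Definition squarefree (d : nat) : Prop :=
  forall m : nat, (m ^ 2 %| d)%N -> m = 1%N.

(* Main.v *)
Require Import Defs.
From mathcomp Require Import all_boot all_order all_algebra all_field.
From mathcomp Require Import zify ring lra.
Set Implicit Arguments. Unset Strict Implicit. Unset Printing Implicit Defensive.
Import Order.TTheory GRing.Theory Num.Theory.
Local Open Scope ring_scope.

(** Write X = y^(12m) and consider the square-free d near X; B is a set of
    primes q = 2 mod 3 below Y = y^j.
    If a positive proportion of B splits in Q(sqrt(-d)), the products of a
    3-torsion class with primes over B land in about X^(1/2) reduced forms, and
    every collision gives a point on d z^2 = 4 a^3 - w^2 with a <= Y^2.  Hence
    h_3 is at most about X^(1/2) / Y plus X^(1/2) / Y^2 times the number E_d of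
    such points, and E_d = 0 for Y < X^(1/6).
    If instead a positive proportion of B is inert, these primes split in
    Q(sqrt(3d)).  A matrix of cubic residue symbols, of 3-rank at least
    log_3 h_3, is paired by cubic reciprocity with ideals of norm q^3 in
    Q(sqrt(3d)); distinct symbol vectors and distinct q give distinct binary
    forms, which bounds h_3 by X^(1/2) / Y for Y up to X^(1/12).  So
    h_3 <= X^(5/12 + o(1)) for every d, by the choice Y = X^(1/12).
    By the large sieve, only X^o(1) of the d have few split primes at a given
    scale, and for the others the second moment of E_d, taken at the scale Y at
    which X^(1/2) / Y is just below h_3, bounds the number of d with h_3 of a
    given size. *)

(** * Gauss and Jacobi sums *)

(** The exponent 11/6 comes from two ends. Weighted for the d whose h_3 belongs to the scale Y =
    y^j, the second moment of E_d is about y^(24m - j) + y^(18m + j); for 2m <= j <= 4m this is at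
    most y^(22m), reached at j = 2m by the first term and at j = 4m by the second. Divisor counts,
    logarithms and constants are each bounded by y, so a loss is a power of y; altogether y^53 =
    X^(53/(12m)) is lost, which eps absorbs for large m. The primes are 2 mod 3 to make -3 a
    non-residue, so that q inert in Q(sqrt(-d)) splits in Q(sqrt(3d)); the norm is q^3 because cubic
    symbols do not see cubes. The obstacle is to show without class field theory that symbols
    separate the classes. If they did not, a certain irreducible cubic T^3 - 3bT - 2c would have a
    root modulo almost every prime and two modulo those splitting in Q(sqrt(3d)). Counting norms
    from Z[T] in a box, weighted by log p / p, leaves only O(1) for the second roots, whereas the
    norm form u^2 - 3d v^2 shows that the splitting primes have infinite weight. *)

Lemma pchar_exp_sum (F : comNzRingType) (q n : nat) (I : Type) (r : seq I)
    (P : pred I) (f : I -> F) : q \in [pchar F] ->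
  (\sum_(i <- r | P i) f i) ^+ (q ^ n) = \sum_(i <- r | P i) f i ^+ (q ^ n).
Proof.
move=> Fq; apply: (big_morph (fun x => x ^+ (q ^ n))).
  move=> x y; apply: exprDn_pchar.
  by rewrite pnatX pnatE ?(pcharf_prime Fq) ?Fq ?orbT.
by rewrite expr0n expn_eq0 -leqn0 leqNgt (prime_gt0 (pcharf_prime Fq)).
Qed.

(** [X^q - X] has at most q roots, and the images of 0, ..., q - 1 already fill them. Square roots
    and roots of cubics found in an algebraic closure are brought down to residues in this way. *)
Lemma pchar_frob_fixed (F : idomainType) (q : nat) (z : F) : q \in [pchar F] ->
  z ^+ q = z -> exists n : nat, z = n%:R.
Proof.
move=> Fq zq; have qp := pcharf_prime Fq.
pose rs := [seq (i : nat)%:R : F | i <- iota 0 q].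
case: (boolP (z \in rs)) => [/mapP[i _ ->]|zrs]; first by exists i.
have szP : size ('X^q - 'X : {poly F}) = q.+1.
  by rewrite size_polyDl size_polyXn // size_polyN size_polyX ltnS prime_gt1.
have P0 : 'X^q - 'X != 0 :> {poly F} by rewrite -size_poly_eq0 szP.
have /(max_poly_roots P0) : all (root ('X^q - 'X)) (z :: rs).
  apply/allP => x; rewrite inE => /orP[/eqP->|/mapP[i _ ->]].
    by rewrite /root !hornerE zq subrr.
  have := pFrobenius_aut_nat Fq i; rewrite pFrobenius_autE => E.
  by rewrite /root !hornerE E subrr.
suff U : uniq (z :: rs).
  by move=> /(_ U); rewrite szP /= size_map size_iota ltnn.
rewrite /= zrs /= map_inj_in_uniq ?iota_uniq // => i j.
rewrite !mem_iota /= !add0n => iq jq /eqP.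
wlog le_ij : i j iq jq / (i <= j)%N.
  move=> W; case/orP: (leq_total i j) => h; first exact: W.
  by rewrite eq_sym => /W ->.
rewrite -(subnK le_ij) natrD eq_sym -subr_eq0 addrK -(dvdn_pcharf Fq).
case: (posnP (j - i)) => [-> //|d0] /(dvdn_leq d0); lia.
Qed.

Lemma prim_root_neq1 (F : idomainType) (p : nat) (z : F) : (1 < p)%N ->
  p.-primitive_root z -> z != 1.
Proof.
move=> p1 zp; apply/eqP => z1; move: zp p1; rewrite z1 => zp.
have := prim_order_dvd zp 1%N; rewrite expr1n eqxx dvdn1 => /eqP->.
by rewrite ltnn.
Qed.

Lemma closed_prim_root (F : closedFieldType) (p : nat) : prime p ->
  p%:R != 0 :> F -> exists z : F, p.-primitive_root z.
Proof.
move=> pp p0.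
have /closed_rootP [z] : size (\poly_(i < p) (1 : F)) != 1%N.
  by rewrite size_poly_eq ?oner_eq0 //; case: p pp {p0} => [|[]].
rewrite /root horner_poly => /eqP z0.
have zp : z ^+ p = 1.
  apply/eqP; rewrite -subr_eq0 subrX1.
  have -> : \sum_(i < p) z ^+ i = \sum_(i < p) 1 * z ^+ i.
    by apply: eq_bigr => i _; rewrite mul1r.
  by rewrite z0 mulr0.
case: (prim_order_exists (prime_gt0 pp) zp) => m zm mp.
exists z; case/primeP: (pp) => _ /(_ _ mp) /orP[] /eqP m1; last by rewrite -m1.
exfalso; subst m; move: z0; rewrite -[z]expr1 (prim_expr_order zm).
under eq_bigr => i _ do rewrite expr1n mulr1.
by rewrite sumr_const card_ord => /eqP; rewrite (negPf p0).
Qed.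

Section GaussSums.
Variables (p : nat) (F : fieldType) (z : F).
Hypotheses (pp : prime p) (zp : p.-primitive_root z).
Implicit Types (X Y : 'F_p -> F) (a x : 'F_p).

Definition addchar (x : 'F_p) : F := z ^+ x.

Lemma addchar_nat (n : nat) : addchar n%:R = z ^+ n.
Proof. by rewrite /addchar val_Fp_nat // (prim_expr_mod zp). Qed.

Lemma addcharD x y : addchar (x + y) = addchar x * addchar y.
Proof.
rewrite -[x]natr_Zp -[y]natr_Zp -natrD.
by rewrite -[(x + y)%N]/(x + y)%N !addchar_nat exprD.
Qed.

Lemma addchar0 : addchar 0 = 1.
Proof. by rewrite -(mulr0n 1) addchar_nat expr0. Qed.

Lemma addchar_sum0 : \sum_x addchar x = 0.
Proof.
apply: (mulfI (x := z - 1)).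
  by rewrite subr_eq0 (prim_root_neq1 (prime_gt1 pp) zp).
rewrite mulr0 mulrBl mul1r; apply/eqP; rewrite subr_eq0; apply/eqP.
rewrite mulr_sumr [RHS](reindex_inj (addrI (1%R : 'F_p))) /=.
apply: eq_bigr => x _; rewrite addcharD; congr (_ * _).
Qed.

Definition mulchar X := [/\ X 0 = 0, X 1 = 1 & {morph X : x y / x * y}].

Definition gauss X := \sum_x X x * addchar x.
Definition jacobi X Y := \sum_x X x * Y (1 - x).

Lemma mulchar_neq0 X x : mulchar X -> x != 0 -> X x != 0.
Proof.
move=> [X0 X1 XM] x0; apply/eqP => E.
have := XM x x^-1; rewrite divff // X1 E mul0r => /eqP.
by rewrite oner_eq0.
Qed.

Lemma mulcharV X x : mulchar X -> X x^-1 = (X x)^-1.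
Proof.
move=> XX; have [X0 X1 XM] := XX; have [->|x0] := eqVneq x 0.
  by rewrite invr0 X0 invr0.
apply: (mulfI (mulchar_neq0 XX x0)).
by rewrite -XM !divff // mulchar_neq0.
Qed.

Lemma mulchar_inv X : mulchar X -> mulchar (fun x => (X x)^-1).
Proof.
by move=> [X0 X1 XM]; split=> [||x y]; rewrite ?X0 ?X1 ?invr0 ?invr1 // XM invfM.
Qed.

Lemma mulchar_nat X n : mulchar X -> X (n%:R ^+ 2) = X n%:R ^+ 2.
Proof. by move=> [_ _ XM]; rewrite expr2 XM. Qed.

Lemma mulchar_sum0 X t : mulchar X -> t != 0 -> X t != 1 -> \sum_x X x = 0.
Proof.
move=> [X0 X1 XM] t0 Xt; apply: (mulfI (x := X t - 1)); first by rewrite subr_eq0.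
rewrite mulr0 mulrBl mul1r; apply/eqP; rewrite subr_eq0; apply/eqP.
rewrite mulr_sumr [RHS](reindex_inj (mulfI t0)) /=.
by apply: eq_bigr => x _; rewrite XM.
Qed.

Lemma gauss_twist X a : mulchar X -> a != 0 ->
  \sum_x X x * addchar (a * x) = (X a)^-1 * gauss X.
Proof.
move=> XX a0; have [X0 X1 XM] := XX.
rewrite /gauss [in RHS](reindex_inj (mulfI a0)) mulr_sumr /=.
apply: eq_bigr => x _; rewrite XM !mulrA mulVf ?mul1r //.
exact: mulchar_neq0.
Qed.

(** Terms are grouped by s = x + y. The group s = 0 gives the first summand; for s != 0 the
    substitution x -> s x extracts X(s) Y(s) and leaves the Jacobi sum. *)
Lemma gauss_mul X Y : mulchar X -> mulchar Y ->
  gauss X * gauss Y =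
  Y (- 1) * \sum_x X x * Y x + jacobi X Y * gauss (fun x => X x * Y x).
Proof.
move=> [X0 X1 XM] [Y0 Y1 YM].
have -> : gauss X * gauss Y = \sum_s addchar s * \sum_x X x * Y (s - x).
  rewrite /gauss mulr_suml.
  under [RHS]eq_bigr => s _ do rewrite mulr_sumr.
  rewrite exchange_big /=; apply: eq_bigr => x _.
  rewrite mulr_sumr (reindex_inj (addIr (- x))) /=.
  apply: eq_bigr => s _.
  have -> : addchar s = addchar (s - x) * addchar x by rewrite -addcharD subrK.
  by ring.
rewrite (bigD1 0) //= addchar0 mul1r; congr (_ + _).
  rewrite mulr_sumr; apply: eq_bigr => x _.
  by rewrite sub0r -(mulN1r x) YM mulrCA.
rewrite /gauss [in RHS](bigD1 0) //= X0 !mul0r add0r mulr_sumr.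
apply: eq_bigr => s s0; rewrite mulr_suml (reindex_inj (mulfI s0)) /= mulr_sumr.
apply: eq_bigr => x _.
have -> : s - s * x = s * (1 - x) by rewrite mulrBr mulr1.
by rewrite XM YM; ring.
Qed.

Lemma card_units_sum : \sum_(x : 'F_p | x != 0) (1 : F) = p%:R - 1.
Proof.
rewrite sumr_const; have := cardC1 (0 : 'F_p); rewrite card_Fp //.
rewrite (_ : #|[pred x : 'F_p | x != 0]| = #|predC1 (0 : 'F_p)|); last exact: eq_card.
by move=> ->; case: p pp => // p' _; rewrite -natr1 addrK.
Qed.

Lemma gauss_inv X t : mulchar X -> t != 0 -> X t != 1 ->
  gauss X * gauss (fun x => (X x)^-1) = X (- 1) * p%:R.
Proof.
move=> XX t0 Xt; have [X0 X1 XM] := XX.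
rewrite gauss_mul ?mulchar_inv //; last exact: mulchar_inv.
have XN : (X (- 1))^-1 = X (- 1) by rewrite -mulcharV // invrN invr1.
have S1 : \sum_x X x * (X x)^-1 = p%:R - 1.
  rewrite -card_units_sum [LHS](bigID (fun x => x != 0)) /=.
  rewrite [X in _ + X]big1 ?addr0; last by move=> x /negPn/eqP->; rewrite X0 mul0r.
  by apply: eq_bigr => x x0; rewrite divff // mulchar_neq0.
have S2 : gauss (fun x => X x * (X x)^-1) = - 1.
  apply/eqP; rewrite -subr_eq0 opprK -addchar0 addrC; apply/eqP.
  rewrite -addchar_sum0 [RHS](bigD1 0) //=; congr (_ + _).
  rewrite /gauss (bigD1 0) //= X0 !mul0r add0r; apply: eq_bigr => x x0.
  by rewrite divff ?mul1r // mulchar_neq0.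
have S3 : jacobi X (fun x => (X x)^-1) = - X (- 1).
  apply/eqP; rewrite -subr_eq0 opprK; apply/eqP.
  rewrite -(mulchar_sum0 XX t0 Xt) [RHS](bigD1 (- 1)) //= addrC; congr (_ + _).
  rewrite /jacobi (bigD1 1) //= subrr X0 invr0 mulr0 add0r.
  (* The substitution x = t / (1 + t) turns X(x) / X(1 - x) into X(t), with t running over
     everything but -1. *)
  rewrite (reindex_onto (fun t : 'F_p => t / (1 + t)) (fun x => x / (1 - x))) /=; last first.
    move=> x h; have h1 : 1 - x != 0 by rewrite subr_eq0 eq_sym.
    by field; rewrite h1 subrK oner_eq0.
  have N1 (x : 'F_p) : (1 + x == 0) = (x == - 1) by rewrite addrC -[1 in LHS]opprK subr_eq0.
  apply: eq_big => x.
    have [->|h] := eqVneq x (- 1).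
      rewrite subrr invr0 mulr0 mul0r [0 == - 1]eq_sym.
      have -> : (- 1 == 0 :> 'F_p) = false by rewrite oppr_eq0 oner_eq0.
      by rewrite andbF.
    have h1 : 1 + x != 0 by rewrite N1.
    have -> : x / (1 + x) / (1 - x / (1 + x)) = x.
      by field; rewrite h1 addrK oner_eq0.
    rewrite eqxx andbT; apply/eqP => /(congr1 (fun y => y * (1 + x))).
    rewrite divfK // mul1r => /eqP.
    by rewrite -subr_eq0 opprD addrCA subrr addr0 oppr_eq0 oner_eq0.
  move=> /andP[h /eqP h2]; have h1 : 1 + x != 0.
    rewrite N1; apply/eqP => h3; move: h2.
    rewrite h3 subrr invr0 mulr0 mul0r => /eqP.
    by rewrite eq_sym oppr_eq0 oner_eq0.
  have -> : 1 - x / (1 + x) = (1 + x)^-1 by field.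
  by rewrite mulcharV // invrK -XM divfK.
by rewrite S1 S2 S3 XN; ring.
Qed.

(** In characteristic q the power q^n is additive and replaces z^x by z^(q^n x), so the Gauss sum is
    only twisted. Quadratic reciprocity is the case n = 1, cubic reciprocity the case n = 2. *)
Lemma gauss_frob X q n : q \in [pchar F] -> q%:R != 0 :> 'F_p -> mulchar X ->
  (forall x, X x ^+ (q ^ n) = X x) ->
  gauss X ^+ (q ^ n) = (X (q%:R ^+ n))^-1 * gauss X.
Proof.
move=> Fq q0 XX XE; rewrite -gauss_twist ?expf_neq0 //.
rewrite pchar_exp_sum //; apply: eq_bigr => x _.
rewrite exprMn XE; congr (_ * _); rewrite /addchar -exprM -[LHS]addchar_nat.
by rewrite natrM natrX natr_Zp mulrC.
Qed.

End GaussSums.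

(** * The algebraic closure of a prime field, quadratic reciprocity *)

(** Reciprocity at q is read off from Gauss sums living in characteristic q, where Frobenius
    computes their powers; hence a closure of F_q rather than a cyclotomic field. *)
Definition Fbar (q : nat) : closedFieldType :=
  projT1 (countable_algebraic_closure 'F_q).

Lemma pchar_Fbar q : prime q -> q \in [pchar Fbar q].
Proof.
move=> qp; rewrite /Fbar; case: countable_algebraic_closure => K [f _] /=.
by rewrite (fmorph_pchar f) pchar_Fp.
Qed.

Lemma intr_pchar (F : idomainType) (q : nat) (n : int) : q \in [pchar F] ->
  (n%:~R == 0 :> F) = (q%:Z %| n)%Z.
Proof.
move=> Fq; rewrite dvdzE absz_nat (dvdn_pcharf Fq).
by case: (intP n) => [|m|m]; rewrite ?abszN // rmorphN oppr_eq0.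
Qed.

Lemma intr_frob (F : idomainType) (q : nat) (n : int) : q \in [pchar F] ->
  n%:~R ^+ q = n%:~R :> F.
Proof.
by move=> Fq; rewrite -pFrobenius_autE rmorph_int.
Qed.

Lemma small_int_inj (F : idomainType) (q : nat) (a b : int) :
  q \in [pchar F] -> (2 < q)%N -> a \in [:: 0; 1; - 1] -> b \in [:: 0; 1; - 1] ->
  a%:~R = b%:~R :> F -> a = b.
Proof.
move=> Fq q2 ha hb /eqP; rewrite -subr_eq0 -rmorphB (intr_pchar _ Fq) dvdzE absz_nat.
move=> h; apply/eqP; rewrite -subr_eq0 -absz_eq0; apply: contraLR h => h.
apply/negP => /dvdn_leq; rewrite lt0n h => /(_ isT).
by move: ha hb; rewrite !inE => /or3P[]/eqP-> /or3P[]/eqP->; rewrite /=; lia.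
Qed.

Section Legendre.
Variable (p : nat).
Hypotheses (pp : prime p) (p2 : (2 < p)%N).

(** The Legendre symbol through Euler's criterion, with integer values so that one symbol can be
    cast into any field. *)
Definition leg (x : 'F_p) : int :=
  if x == 0 then 0 else if x ^+ p.-1./2 == 1 then 1 else - 1.

Lemma half_prime : (p.-1./2 * 2 = p.-1)%N.
Proof.
have : odd p by case: (even_prime pp) => // p2'; move: p2; rewrite p2'.
lia.
Qed.

Lemma Fp_exp_card (x : 'F_p) : x != 0 -> x ^+ p.-1 = 1.
Proof.
move=> x0; apply: (mulfI x0); rewrite -exprS mulr1 prednK ?prime_gt0 //.
by have := expf_card x; rewrite card_Fp.
Qed.

Lemma leg_exp (x : 'F_p) : x ^+ p.-1./2 = (leg x)%:~R.
Proof.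
rewrite /leg; have [->|x0] := eqVneq x 0.
  by rewrite expr0n; have := half_prime; case: (p.-1./2) => //=; lia.
have [->//|h] := eqVneq (x ^+ p.-1./2) 1.
have /eqP : (x ^+ p.-1./2) ^+ 2 = 1 by rewrite -exprM half_prime Fp_exp_card.
by rewrite sqrf_eq1 (negPf h) => /eqP.
Qed.

Lemma leg_val x : leg x \in [:: 0; 1; - 1].
Proof. by rewrite /leg; case: ifP => _ //; case: ifP. Qed.

Lemma leg_eq0 x : (leg x == 0) = (x == 0).
Proof. by rewrite /leg; case: ifP => // _; case: ifP. Qed.

Lemma legM x y : leg (x * y) = leg x * leg y.
Proof.
apply: (small_int_inj (pchar_Fp pp) p2); rewrite ?leg_val //.
  by have := leg_val x; have := leg_val y; rewrite !inE => /or3P[]/eqP-> /or3P[]/eqP->.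
by rewrite rmorphM /= -!leg_exp exprMn.
Qed.

Lemma leg1 : leg 1 = 1.
Proof. by rewrite /leg oner_eq0 expr1n eqxx. Qed.

Lemma leg_mulchar (F : fieldType) : mulchar (fun x => (leg x)%:~R : F).
Proof.
split=> [||x y]; first by rewrite /leg eqxx.
  by rewrite leg1.
by rewrite legM rmorphM.
Qed.

Lemma Fp_exp_neq1 k : (0 < k < p.-1)%N -> exists2 t : 'F_p, t != 0 & t ^+ k != 1.
Proof.
move=> /andP[k0 kp].
case: (pickP (fun t : 'F_p => (t != 0) && (t ^+ k != 1))) => [t /andP[]|H]; first by exists t.
have P0 : 'X^k - 1 != 0 :> {poly 'F_p} by rewrite -size_poly_eq0 size_XnsubC.
have := @max_poly_roots _ _ (enum [pred t : 'F_p | t != 0]) P0.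
rewrite -cardE enum_uniq size_XnsubC // ltnS.
rewrite (eq_card (_ : _ =i predC1 (0 : 'F_p))) // cardC1 card_Fp // => /(_ _ isT) => W.
suff /W : all (root ('X^k - 1)) (enum [pred t : 'F_p | t != 0]) by rewrite leqNgt kp.
apply/allP => t; rewrite mem_enum inE => t0.
by have := H t; rewrite t0 /= => /negbFE/eqP E; rewrite /root !hornerE E subrr.
Qed.

Lemma leg_nonres : exists2 t : 'F_p, t != 0 & leg t = - 1.
Proof.
have [|t t0 h] := @Fp_exp_neq1 p.-1./2; first by have := half_prime; lia.
by exists t => //; rewrite /leg (negPf t0) (negPf h).
Qed.

(** By Euler's criterion a square root of a in the closure is fixed by Frobenius, hence is a
    residue. *)
Lemma leg_sqrt (a : int) : leg a%:~R = 1 -> exists r : nat, (p%:Z %| r%:Z ^+ 2 - a)%Z.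
Proof.
move=> la; have Fp := pchar_Fbar pp.
have /closed_rootP [x] : size ('X^2 - (a%:~R)%:P : {poly Fbar p}) != 1%N by rewrite size_XnsubC.
rewrite /root !hornerE subr_eq0 => /eqP xa.
have [r xr] : exists r : nat, x = r%:R.
  apply: (pchar_frob_fixed Fp).
  have pE : p = (1 + 2 * p.-1./2)%N by have := half_prime; have := prime_gt0 pp; lia.
  rewrite [x ^+ p](_ : _ = x ^+ (1 + 2 * p.-1./2)); last by rewrite -pE.
  rewrite exprD exprM xa expr1.
  have : a%:~R ^+ p.-1./2 = 1 :> Fbar p.
    have := leg_exp a%:~R; rewrite la => /eqP.
    rewrite -rmorphXn -subr_eq0 -rmorphB /= (intr_pchar _ (pchar_Fp pp)).
    by rewrite -(intr_pchar _ Fp) rmorphB rmorphXn /= subr_eq0 => /eqP.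
  by move=> ->; rewrite mulr1.
exists r; rewrite -(intr_pchar _ Fp) rmorphB rmorphXn /= -xa xr.
by rewrite subrr.
Qed.

Lemma leg_of_sqrt (a r : int) : ~~ (p%:Z %| a)%Z -> (p%:Z %| r ^+ 2 - a)%Z ->
  leg a%:~R = 1.
Proof.
have Fp := pchar_Fp pp; rewrite -!(intr_pchar _ Fp) => a0.
rewrite rmorphB rmorphXn /= subr_eq0 => /eqP ra; rewrite -ra expr2 legM.
have : leg r%:~R != 0 by rewrite leg_eq0; apply: contraNneq a0 => r0; rewrite -ra r0 expr0n.
by have := leg_val r%:~R; rewrite !inE => /or3P[]/eqP->.
Qed.
End Legendre.

(** The Gauss sum G of the Legendre character modulo p has G^2 = (-1/p) p. In characteristic q,
    G^(q-1) is the symbol of G^2 by Euler's criterion and (q/p) by Frobenius. The sign stays in the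
    form of a symbol, which spares residues modulo 4. *)
Lemma quadratic_reciprocity (p q : nat) : prime p -> prime q -> (2 < p)%N -> (2 < q)%N ->
  p != q -> leg (p%:R : 'F_q) = leg ((leg (- 1 : 'F_p))%:~R : 'F_q) * leg (q%:R : 'F_p).
Proof.
move=> pp qp p2 q2 pq; have Fq := pchar_Fbar qp.
have pF : p%:R != 0 :> Fbar q by rewrite -(dvdn_pcharf Fq) dvdn_prime2 // eq_sym.
have [z zp] := closed_prim_root pp pF.
pose X (x : 'F_p) : Fbar q := (leg x)%:~R.
have XX : mulchar X := leg_mulchar pp p2 _.
have XV : (fun x => (X x)^-1) =1 X.
  by move=> x; rewrite /X; have := leg_val x; rewrite !inE => /or3P[]/eqP->; rewrite ?invr0 ?invr1 // invrN invr1.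
have [t t0 lt] := leg_nonres pp p2.
have Xt : X t != 1.
  apply/eqP => E; have := small_int_inj (b := 1) Fq q2 (leg_val t) isT E.
  by rewrite lt.
have GG : gauss z X ^+ 2 = X (- 1) * p%:R.
  rewrite expr2 -(gauss_inv pp zp XX t0 Xt); congr (_ * _).
  by apply: eq_bigr => x _; rewrite XV.
have N0 : leg (- 1 : 'F_p) != 0 by rewrite leg_eq0 oppr_eq0 oner_eq0.
have X1 : X (- 1) != 0.
  apply/eqP => E; have /eqP := small_int_inj (b := 0) Fq q2 (leg_val _) isT E.
  by rewrite (negPf N0).
have G0 : gauss z X != 0 by rewrite -sqrf_eq0 GG mulf_neq0.
have q0 : q%:R != 0 :> 'F_p by rewrite -(dvdn_pcharf (pchar_Fp pp)) dvdn_prime2.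
have GF : gauss z X ^+ q = X q%:R * gauss z X.
  have := gauss_frob pp zp (n := 1) Fq q0 XX; rewrite expn1 expr1 XV; apply.
  by move=> x; rewrite intr_frob.
have GE : gauss z X ^+ q.-1 = X q%:R.
  by apply: (mulIf G0); rewrite -exprSr prednK ?prime_gt0.
apply/eqP; rewrite -subr_eq0; apply/eqP.
have E : leg ((leg (- 1 : 'F_p))%:~R * p%:R : 'F_q) = leg (q%:R : 'F_p).
  apply: (small_int_inj Fq q2); rewrite ?leg_val //.
  rewrite -[RHS]/(X q%:R) -GE -(half_prime qp q2) mulnC exprM GG.
  have := leg_exp qp q2 ((leg (- 1 : 'F_p))%:~R * p%:R).
  rewrite -[p%:R]/(p%:Z%:~R) -rmorphM /= -rmorphXn => /eqP.
  rewrite -subr_eq0 -rmorphB /= (intr_pchar _ (pchar_Fp qp)) -(intr_pchar _ Fq).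
  by rewrite rmorphB rmorphXn rmorphM /= subr_eq0 => /eqP <-.
rewrite -E (legM qp q2) mulrA -(legM qp q2).
have -> : (leg (- 1 : 'F_p))%:~R * (leg (- 1 : 'F_p))%:~R = 1 :> 'F_q.
  by have := leg_val (- 1 : 'F_p); rewrite !inE (negPf N0) /= => /orP[]/eqP->; rewrite ?mulr1 // mulrNN mulr1.
by rewrite leg1 // mul1r subrr.
Qed.

(** * Cubic characters and Jacobi sums *)

Lemma prim_root_neq0 (F : idomainType) (n : nat) (w : F) : (0 < n)%N ->
  n.-primitive_root w -> w != 0.
Proof.
move=> n0 wp; apply/eqP => w0; have /eqP := prim_expr_order wp.
by rewrite w0 expr0n gtn_eqF // eq_sym oner_eq0.
Qed.

Lemma prim3_root (F : fieldType) (w : F) : w ^+ 2 + w + 1 = 0 -> 3%:R != 0 :> F ->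
  3.-primitive_root w.
Proof.
move=> w0 h3; have w3 : w ^+ 3 = 1.
  apply/eqP; rewrite -subr_eq0.
  have -> : w ^+ 3 - 1 = (w - 1) * (w ^+ 2 + w + 1) by ring.
  by rewrite w0 mulr0.
case: (prim_order_exists (ltn0Sn 2) w3) => m wm; rewrite dvdn_divisors // !inE.
case/orP => /eqP m1; last by move: wm; rewrite m1.
exfalso; subst m; move: w0; rewrite -[w]expr1 (prim_expr_order wm) expr1n => /eqP.
by rewrite -(_ : 3%:R = 1 + 1 + 1 :> F) ?(negPf h3) //; ring.
Qed.

Lemma prim3_eq0 (F : fieldType) (w : F) : 3.-primitive_root w -> w ^+ 2 + w + 1 = 0.
Proof.
move=> wp; apply: (mulfI (x := w - 1)); first by rewrite subr_eq0 (prim_root_neq1 _ wp).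
rewrite mulr0 (_ : _ * _ = w ^+ 3 - 1); last by ring.
by rewrite (prim_expr_order wp) subrr.
Qed.

Notation cpow w e := (addchar (p := 3) w e).

Lemma cpowD (F : fieldType) (w : F) (a b : 'F_3) : 3.-primitive_root w ->
  cpow w (a + b) = cpow w a * cpow w b.
Proof. by move=> wp; apply: addcharD. Qed.

Lemma cpow_neq0 (F : fieldType) (w : F) (a : 'F_3) : 3.-primitive_root w -> cpow w a != 0.
Proof. by move=> wp; rewrite /addchar expf_neq0 // (prim_root_neq0 _ wp). Qed.

Lemma cpow_inj (F : fieldType) (w : F) (a b : 'F_3) : 3.-primitive_root w ->
  cpow w a = cpow w b -> a = b.
Proof.
move=> wp /eqP; rewrite /addchar (eq_prim_root_expr wp) => /eqP E; apply: val_inj.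
by move: E; rewrite !modn_small ?(ltn_ord a) ?(ltn_ord b).
Qed.

Lemma cube_root_of_unity (F : fieldType) (w x : F) : 3.-primitive_root w ->
  x ^+ 3 = 1 -> [\/ x = 1, x = w | x = w ^+ 2].
Proof.
move=> wp x3; have w0 := prim3_eq0 wp.
have E : w ^+ 2 = - w - 1 by apply/eqP; rewrite -subr_eq0 -[X in _ == X]w0; apply/eqP; ring.
have /eqP : (x - 1) * ((x - w) * (x - w ^+ 2)) = 0 by ring: x3 E.
by rewrite !mulf_eq0 !subr_eq0 => /or3P[]/eqP->; constructor.
Qed.

Section CubicChar.
Variables (p : nat) (w : 'F_p).
Hypotheses (pp : prime p) (w0 : w ^+ 2 + w + 1 = 0) (p3 : p != 3%N).
Let k := (p.-1 %/ 3)%N.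

Lemma cubic_root_prim : 3.-primitive_root w.
Proof. by apply: prim3_root => //; rewrite -(dvdn_pcharf (pchar_Fp pp)) dvdn_prime2. Qed.

Lemma cubic_root_mod : (p.-1 = k * 3)%N.
Proof.
rewrite /k divnK //; rewrite (prim_order_dvd cubic_root_prim).
apply/eqP; apply: Fp_exp_card => //.
by rewrite (prim_root_neq0 _ cubic_root_prim).
Qed.

Lemma cubic_k_gt0 : (0 < k)%N.
Proof.
rewrite lt0n; apply/eqP => k0; have := cubic_root_mod; rewrite k0 mul0n => p1.
have p2 : p = 2%N by have := prime_gt1 pp; lia.
have := prim3_eq0 cubic_root_prim.
have : w != 0 by rewrite (prim_root_neq0 _ cubic_root_prim).
have : w != 1 by rewrite (prim_root_neq1 _ cubic_root_prim).
have : w ^+ p = w by have := expf_card w; rewrite card_Fp.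
rewrite [w ^+ p](_ : _ = w ^+ 2); last by rewrite [in w ^+ 2](_ : 2%N = p).
move=> /eqP; rewrite expr2 -subr_eq0 -{3}[w]mulr1 -mulrBr mulf_eq0 subr_eq0.
by move=> /orP[]->.
Qed.

(** The cubic residue character in additive form: x^((p-1)/3) = w^(ind x). Choosing w amounts to
    choosing a prime over p in Z[omega]. The value at 0 is meaningless. *)
Definition ind (x : 'F_p) : 'F_3 :=
  if x ^+ k == 1 then 0 else if x ^+ k == w then 1 else 2%:R.

Lemma ind_exp x : x != 0 -> x ^+ k = cpow w (ind x).
Proof.
move=> x0; have x3 : (x ^+ k) ^+ 3 = 1 by rewrite -exprM -cubic_root_mod Fp_exp_card.
rewrite /ind; case: eqP => [->|n1]; first by rewrite /addchar expr0.
case: eqP => [->|nw]; first by rewrite /addchar.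
by case: (cube_root_of_unity cubic_root_prim x3) => //->.
Qed.

Lemma indM x y : x != 0 -> y != 0 -> ind (x * y) = ind x + ind y.
Proof.
move=> x0 y0; apply: (cpow_inj cubic_root_prim).
by rewrite (cpowD _ _ cubic_root_prim) -!ind_exp ?mulf_neq0 // exprMn.
Qed.

Lemma ind1 : ind 1 = 0. Proof. by rewrite /ind expr1n eqxx. Qed.

Lemma ind_cube x : x != 0 -> ind (x ^+ 3) = 0.
Proof.
by move=> x0; rewrite /ind -exprM mulnC exprM -!exprM -cubic_root_mod Fp_exp_card // eqxx.
Qed.

Lemma indV x : x != 0 -> ind x^-1 = - ind x.
Proof.
by move=> x0; apply/eqP; rewrite -subr_eq0 opprK -indM ?invr_eq0 // mulVf // ind1.
Qed.

Lemma indN1 : ind (- 1) = 0.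
Proof.
rewrite (_ : - 1 = (- 1) ^+ 3); last by ring.
by rewrite ind_cube // oppr_eq0 oner_eq0.
Qed.

Definition lift3 (e : 'F_3) : int := if e == 0 then 0 else if e == 1 then 1 else - 1.

(** Coordinates of the Jacobi sum J of chi(x) chi(1 - x) in the basis 1, omega: the powers 1, omega,
    omega^2 = -1 - omega have coordinates (1, 0), (0, 1), (-1, -1). *)
Definition jacA : int := \sum_(x : 'F_p | (x != 0) && (x != 1))
  (let e := ind x + ind (1 - x) in if e == 0 then 1 else if e == 1 then 0 else - 1).
Definition jacB : int := \sum_(x : 'F_p | (x != 0) && (x != 1)) lift3 (ind x + ind (1 - x)).

(** [lift3] is odd, and additive modulo 3. Since x -> 1/x negates [ind], the separate sums over
    [ind x] and [ind (1 - x)] vanish. This is the primary condition on the Jacobi sum. *)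
Lemma jacB_dvd3 : (3 %| jacB)%Z.
Proof.
have L3 (a b : 'F_3) : (3 %| lift3 (a + b) - lift3 a - lift3 b)%Z.
  by case: a => [[|[|[|a]]] ha] //; case: b => [[|[|[|b]]] hb].
have LN (a : 'F_3) : lift3 (- a) = - lift3 a by case: a => [[|[|[|]]] ?].
set P := fun x : 'F_p => (x != 0) && (x != 1).
have S0 : \sum_(x | P x) lift3 (ind x) = 0.
  have : \sum_(x | P x) lift3 (ind x) = - \sum_(x | P x) lift3 (ind x).
    rewrite -sumrN (reindex_inj invr_inj) /=; apply: eq_big => x.
      by rewrite /P invr_eq0 invr_eq1.
    by move=> /andP[]; rewrite invr_eq0 => x0 _; rewrite indV // LN.
  lia.
have S1 : \sum_(x | P x) lift3 (ind (1 - x)) = 0.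
  rewrite -[RHS]S0 (reindex_inj (inv_inj (subKr 1))) /=; apply: eq_big => x.
    rewrite /P subr_eq0 eq_sym andbC; congr (_ && _).
    by rewrite -[1 - x == 1]subr_eq0 addrAC subrr add0r oppr_eq0.
  by move=> _; rewrite subKr.
have -> : jacB = \sum_(x | P x) (lift3 (ind x + ind (1 - x)) - lift3 (ind x) - lift3 (ind (1 - x))).
  by rewrite !sumrB S0 S1 !subr0.
by apply: rpred_sum => x _; apply: L3.
Qed.

Section Eval.
Variables (F : fieldType) (o : F).
Hypothesis op : 3.-primitive_root o.

Definition cchar (x : 'F_p) : F := if x == 0 then 0 else cpow o (ind x).

Lemma cchar_mulchar : mulchar cchar.
Proof.
split=> [||x y]; [by rewrite /cchar eqxx|by rewrite /cchar oner_eq0 ind1 /addchar expr0|].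
rewrite /cchar mulf_eq0; case: (eqVneq x 0) => [_|x0]; first by rewrite mul0r.
case: (eqVneq y 0) => [_|y0]; first by rewrite mulr0.
by rewrite indM // cpowD.
Qed.

Lemma cchar_nontriv : exists2 t, t != 0 & cchar t != 1.
Proof.
have [|t t0 tk] := @Fp_exp_neq1 p pp k; first by have := cubic_root_mod; have := cubic_k_gt0; lia.
exists t => //; rewrite /cchar (negPf t0); apply/eqP => h; move: tk.
rewrite ind_exp // (cpow_inj (b := 0) op h) /addchar expr0 eqxx //.
Qed.

Lemma jacobi_eval : jacobi cchar cchar = jacA%:~R + jacB%:~R * o.
Proof.
have o0 := prim3_eq0 op.
have E (e : 'F_3) : cpow o e =
   (if e == 0 then 1 else if e == 1 then 0 else - 1 : int)%:~R + (lift3 e)%:~R * o.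
  have O2 : o ^+ 2 = - 1 - o by apply/eqP; rewrite -subr_eq0 -[X in _ == X]o0; apply/eqP; ring.
  case: e => [[|[|[|]]] h] //; rewrite /addchar /lift3 /=.
  - by rewrite expr0; ring.
  - by rewrite expr1; ring.
  - by rewrite O2; ring.
rewrite /jacobi /jacA /jacB !rmorph_sum mulr_suml -big_split /=.
rewrite (bigID (fun x => (x != 0) && (x != 1))) /= [X in _ + X]big1 ?addr0; last first.
  move=> x; rewrite negb_and !negbK => /orP[]/eqP->; rewrite /cchar ?eqxx ?mul0r //.
  by rewrite subrr eqxx mulr0.
apply: eq_bigr => x /andP[x0 x1].
by rewrite /cchar (negPf x0) subr_eq0 eq_sym (negPf x1) -cpowD // E.
Qed.

Lemma cchar_sq : (fun x => cchar x * cchar x) =1 (fun x => (cchar x)^-1).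
Proof.
move=> x; rewrite /cchar; case: eqP => _; first by rewrite mul0r invr0.
apply: (mulfI (cpow_neq0 (ind x) op)); rewrite divff ?cpow_neq0 //.
rewrite -!cpowD // (_ : _ + _ = 0) ?/addchar ?expr0 //.
by case: (ind x) => [[|[|[|]]] h] //; apply: val_inj.
Qed.

(** As chi^2 is the inverse of chi, G(chi)^2 is J times G(1/chi); one more factor G(chi) gives p J,
    because chi(-1) = 1. *)
Lemma gauss_cube (z : F) : p.-primitive_root z ->
  [/\ gauss z cchar ^+ 3 = p%:R * (jacA%:~R + jacB%:~R * o) &
      gauss z cchar * gauss z (fun x => (cchar x)^-1) = p%:R].
Proof.
move=> zp; have XX := cchar_mulchar; have [t t0 Xt] := cchar_nontriv.
have GI : gauss z cchar * gauss z (fun x => (cchar x)^-1) = p%:R.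
  rewrite (gauss_inv pp zp XX t0 Xt) /cchar oppr_eq0 oner_eq0 indN1.
  by rewrite /addchar expr0 mul1r.
split=> //; rewrite exprS expr2 (gauss_mul pp zp XX XX).
have -> : gauss z (fun x => cchar x * cchar x) = gauss z (fun x => (cchar x)^-1).
  by apply: eq_bigr => x _; rewrite cchar_sq.
have -> : \sum_x cchar x * cchar x = 0.
  rewrite -[RHS](mulchar_sum0 (X := fun x => (cchar x)^-1) (mulchar_inv XX) t0).
    by apply: eq_bigr => x _; rewrite cchar_sq.
  by rewrite invr_eq1.
by rewrite mulr0 add0r mulrCA mulrA -GI jacobi_eval; ring.
Qed.
End Eval.
End CubicChar.

(** * Cubic residue symbols of Eisenstein integers *)

Section AdditiveExtension.
Variables (V : zmodType) (f : nat -> V).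

(* the completely additive extension of f from the primes *)
Definition addext (t : nat) : V :=
  \sum_(0 <= q < t.+1 | prime q) f q *+ logn q t.

Lemma addext_widen t N : (t < N)%N ->
  addext t = \sum_(0 <= q < N | prime q) f q *+ logn q t.
Proof.
move=> tN; rewrite /addext (big_nat_widen _ _ _ _ _ tN) [RHS]big_mkcond [LHS]big_mkcond /=.
apply: eq_bigr => q _; case: (prime q) => //=; case: ltnP => // h.
by rewrite ltn_log0 // mulr0n.
Qed.

Lemma addextM s t : (0 < s)%N -> (0 < t)%N -> addext (s * t) = addext s + addext t.
Proof.
move=> s0 t0; rewrite (@addext_widen s (s * t).+1) ?(@addext_widen t (s * t).+1).
- by rewrite -big_split /=; apply: eq_bigr => q _; rewrite lognM // mulrnDr.
- by rewrite ltnS leq_pmull.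
- by rewrite ltnS leq_pmulr.
Qed.

Lemma addext1 : addext 1 = 0.
Proof. by rewrite /addext big1 // => q _; rewrite logn1. Qed.

Lemma addext_prime q : prime q -> addext q = f q.
Proof.
move=> qp; rewrite /addext big_mkcond (bigD1_seq q) ?iota_uniq ?mem_index_iota ?ltnS ?leqnn //=.
rewrite qp logn_prime // eqxx mulr1n big1 ?addr0 // => r rq.
by case: ifP => // rp; rewrite logn_prime // (negPf rq) mulr0n.
Qed.

(** Induction splitting off a prime factor. Additivity of [h] is asked only on divisors of t, since
    residue symbols are additive only away from bad primes. *)
Lemma addext_total (h : nat -> V) t : (0 < t)%N -> h 1%N = 0 ->
  (forall q s, prime q -> (q * s %| t)%N -> h (q * s)%N = f q + h s) ->
  addext t = h t.
Proof.
move: {2}t (leqnn t) => n; elim: n t => [[]//|n IH] t tn t0 h1 hM.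
have [t1|t1] := leqP t 1; first by rewrite (_ : t = 1%N) ?addext1 ?h1 //; lia.
have qp := pdiv_prime t1; have /dvdnP[s st] := pdiv_dvd t.
move: (pdiv t) qp st => q qp; rewrite mulnC => st; subst t.
have s0 : (0 < s)%N by move: t0; rewrite muln_gt0 => /andP[].
rewrite (addextM (prime_gt0 qp) s0) (addext_prime qp) hM //; congr (_ + _).
apply: IH => //; first by have := prime_gt1 qp; nia.
by move=> p r pp pr; apply: hM => //; rewrite dvdn_mull.
Qed.
End AdditiveExtension.

Lemma omega_exists (q : nat) : exists w : Fbar q, root ('X^2 + 'X + 1) w.
Proof.
apply/closed_rootP; rewrite -addrA size_polyDl size_polyXn //.
by rewrite size_polyDl ?size_polyX // size_poly1.
Qed.

Definition omega (q : nat) : Fbar q := xchoose (omega_exists q).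

Lemma omega_prim q : prime q -> q != 3%N -> 3.-primitive_root (omega q).
Proof.
move=> qp q3; apply: prim3_root.
  by have := xchooseP (omega_exists q); rewrite /root !hornerE => /eqP.
by rewrite -(dvdn_pcharf (pchar_Fbar qp)) dvdn_prime2.
Qed.

Definition enorm (A B : int) : int := A ^+ 2 - A * B + B ^+ 2.
Definition eeval (F : fieldType) (w : F) (A B : int) : F := A%:~R + B%:~R * w.

Lemma eevalM (F : fieldType) (w : F) A B A' B' : 3.-primitive_root w ->
  eeval w (A * A' - B * B') (A * B' + B * A' - B * B') = eeval w A B * eeval w A' B'.
Proof.
move=> /prim3_eq0 w0; rewrite /eeval !(rmorphB, rmorphD, rmorphM) /=.
have E : w ^+ 2 = - w - 1 by apply/eqP; rewrite -subr_eq0 -[X in _ == X]w0; apply/eqP; ring.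
by ring: E.
Qed.

Lemma eeval_norm (F : fieldType) (w : F) A B : 3.-primitive_root w ->
  eeval w A B * eeval (w ^+ 2) A B = (enorm A B)%:~R.
Proof.
move=> /prim3_eq0 w0; rewrite /eeval /enorm !(rmorphB, rmorphD, rmorphM, rmorphXn) /=.
have E : w ^+ 2 = - w - 1 by apply/eqP; rewrite -subr_eq0 -[X in _ == X]w0; apply/eqP; ring.
by ring: E.
Qed.

Lemma prim3_sq (F : fieldType) (w : F) : 3.-primitive_root w -> 3.-primitive_root (w ^+ 2).
Proof. by move=> wp; rewrite prim_root_exp_coprime. Qed.

Lemma enorm_ge0 A B : 0 <= enorm A B.
Proof. rewrite /enorm; nia. Qed.

Definition symexp q := ((q ^ 2).-1 %/ 3)%N.

(** The exponent e with (alpha / conj alpha)^((q^2-1)/3) = omega^e for alpha = A + B omega in the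
    closure of F_q. The exponent q^2 - 1 treats q = 1 and q = 2 modulo 3 alike, and the quotient by
    the conjugate makes rational factors invisible. *)
Definition sym (q : nat) (A B : int) : 'F_3 :=
  let w := omega q in let u := eeval w A B ^+ symexp q in
  let v := eeval (w ^+ 2) A B ^+ symexp q in
  if u == v then 0 else if u == w * v then 1 else 2%:R.

Section Sym.
Variable q : nat.
Hypotheses (qp : prime q) (q3 : q != 3%N).
Let w := omega q.
Let m := symexp q.
Let wp : 3.-primitive_root w := omega_prim qp q3.
Let Fq := pchar_Fbar qp.

Lemma sqr_mod3 : (q ^ 2 = 1 %[mod 3])%N.
Proof.
have : ~~ (3 %| q)%N by rewrite dvdn_prime2 // eq_sym.
rewrite -modnXm; move: (ltn_pmod q (isT : 0 < 3)%N); rewrite /dvdn.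
by case: (q %% 3)%N => [|[|[|]]].
Qed.

Lemma symexpE : ((q ^ 2).-1 = m * 3)%N.
Proof.
rewrite /m /symexp divnK //; have := sqr_mod3.
have : (0 < q ^ 2)%N by rewrite expn_gt0 prime_gt0.
move=> h /eqP; rewrite eqn_mod_dvd // subn1 //.
Qed.

Lemma sqr_pred : ((q ^ 2).-1.+1 = q ^ 2)%N.
Proof. by rewrite prednK // expn_gt0 prime_gt0. Qed.

Lemma eeval_frob A B : eeval w A B ^+ (q ^ 2) = eeval w A B.
Proof.
have IF (n : int) : n%:~R ^+ (q ^ 2) = n%:~R :> Fbar q.
  by rewrite expnS expn1 exprM !intr_frob.
rewrite /eeval exprDn_pchar; last by rewrite pnatX pnatE // Fq.
rewrite exprMn !IF; congr (_ + _ * _).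
by rewrite -(prim_expr_mod wp) sqr_mod3 modn_small // expr1.
Qed.

Lemma eeval_frob2 A B : eeval (w ^+ 2) A B ^+ (q ^ 2) = eeval (w ^+ 2) A B.
Proof.
have -> : eeval (w ^+ 2) A B = eeval w (A - B) (- B); last exact: eeval_frob.
rewrite /eeval rmorphB rmorphN /=.
have -> : w ^+ 2 = - w - 1.
  by apply/eqP; rewrite -subr_eq0 -[X in _ == X](prim3_eq0 wp); apply/eqP; ring.
ring.
Qed.

Lemma eeval_neq0 A B : ~~ (q%:Z %| enorm A B)%Z ->
  eeval w A B != 0 /\ eeval (w ^+ 2) A B != 0.
Proof.
by rewrite -(intr_pchar _ Fq) -(eeval_norm _ _ wp) mulf_eq0 negb_or => /andP[].
Qed.

Lemma sym_spec A B : ~~ (q%:Z %| enorm A B)%Z ->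
  eeval w A B ^+ m = cpow w (sym q A B) * eeval (w ^+ 2) A B ^+ m.
Proof.
move=> /eeval_neq0 [u0 v0]; set r := eeval w A B / eeval (w ^+ 2) A B.
have v0m : eeval (w ^+ 2) A B ^+ m != 0 by rewrite expf_neq0.
have rE : (r ^+ m) ^+ 3 = 1.
  rewrite -exprM -symexpE; apply: (mulIf (_ : r != 0)); first by rewrite mulf_neq0 ?invr_eq0.
  by rewrite -exprSr sqr_pred mul1r /r expr_div_n eeval_frob eeval_frob2.
have uE : eeval w A B ^+ m = r ^+ m * eeval (w ^+ 2) A B ^+ m.
  by rewrite /r expr_div_n divfK.
rewrite /sym -/w -/m uE; move: (r ^+ m) (eeval (w ^+ 2) A B ^+ m) v0m rE => x v vn rE.
have -> : (x * v == v) = (x == 1) by rewrite -{2}[v]mul1r (inj_eq (mulIf vn)).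
rewrite (inj_eq (mulIf vn)); congr (_ * _).
case: eqP => [->|n1]; first by rewrite /addchar expr0.
case: eqP => [->|nw]; first by rewrite /addchar.
by case: (cube_root_of_unity wp rE) => // ->.
Qed.

Lemma sym_uniq A B e : ~~ (q%:Z %| enorm A B)%Z ->
  eeval w A B ^+ m = cpow w e * eeval (w ^+ 2) A B ^+ m -> sym q A B = e.
Proof.
move=> qN E; have [_ v0] := eeval_neq0 qN.
have v0m : eeval (w ^+ 2) A B ^+ m != 0 by rewrite expf_neq0.
by apply: (cpow_inj wp); apply: (mulIf v0m); rewrite -sym_spec.
Qed.

Lemma sym_congr A B A' B' : (q%:Z %| A - A')%Z -> (q%:Z %| B - B')%Z ->
  sym q A B = sym q A' B'.
Proof.
rewrite -!(intr_pchar _ Fq) !rmorphB /= !subr_eq0 => /eqP EA /eqP EB.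
by rewrite /sym /eeval EA EB.
Qed.

Lemma enormM A B A' B' :
  enorm (A * A' - B * B') (A * B' + B * A' - B * B') = enorm A B * enorm A' B'.
Proof. rewrite /enorm; ring. Qed.

Lemma prime_dvdzM (a b : int) : (q%:Z %| a * b)%Z = (q%:Z %| a)%Z || (q%:Z %| b)%Z.
Proof. by rewrite !dvdzE abszM Euclid_dvdM. Qed.

Lemma symM A B A' B' : ~~ (q%:Z %| enorm A B)%Z -> ~~ (q%:Z %| enorm A' B')%Z ->
  sym q (A * A' - B * B') (A * B' + B * A' - B * B') = sym q A B + sym q A' B'.
Proof.
move=> h h'; apply: sym_uniq; first by rewrite enormM prime_dvdzM negb_or h.
rewrite (eevalM _ _ _ _ wp) (eevalM _ _ _ _ (prim3_sq wp)) !exprMn !sym_spec // cpowD //; ring.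
Qed.

Lemma sym_scale c A B : ~~ (q%:Z %| c)%Z -> ~~ (q%:Z %| enorm A B)%Z ->
  sym q (c * A) (c * B) = sym q A B.
Proof.
move=> h h'; apply: sym_uniq.
  have -> : enorm (c * A) (c * B) = c * (c * enorm A B) by rewrite /enorm; ring.
  by rewrite !prime_dvdzM !negb_or h.
have E (o : Fbar q) : eeval o (c * A) (c * B) = c%:~R * eeval o A B.
  by rewrite /eeval !rmorphM /=; ring.
rewrite !E !exprMn sym_spec //; ring.
Qed.

Lemma sym_rat c : ~~ (q%:Z %| c)%Z -> sym q c 0 = 0.
Proof.
move=> h; apply: sym_uniq; last by rewrite /eeval !mul0r /addchar expr0 mul1r.
have -> : enorm c 0 = c * c by rewrite /enorm; ring.
  by rewrite prime_dvdzM negb_or h.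
Qed.

Lemma sym_conj A B : ~~ (q%:Z %| enorm A B)%Z -> sym q (A - B) (- B) = - sym q A B.
Proof.
move=> h; apply: sym_uniq.
  by rewrite (_ : enorm _ _ = enorm A B) // /enorm; ring.
have C (o : Fbar q) : 3.-primitive_root o -> eeval o (A - B) (- B) = eeval (o ^+ 2) A B.
  move=> op; rewrite /eeval rmorphB rmorphN /=.
  have -> : o ^+ 2 = - o - 1.
    by apply/eqP; rewrite -subr_eq0 -[X in _ == X](prim3_eq0 op); apply/eqP; ring.
  ring.
rewrite !C ?prim3_sq // -exprM (_ : w ^+ (2 * 2) = w); last first.
  by rewrite -(prim_expr_mod wp).
rewrite [in RHS]sym_spec // mulrA -cpowD // addNr /addchar expr0 mul1r //.
Qed.

(** The argument is c sqrt(-3), whose conjugate is its negative, so the symbol equals its own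
    opposite in F_3. *)
Lemma sym_pure c : ~~ (q%:Z %| c)%Z -> sym q c (2 * c) = 0.
Proof.
move=> h; have q3' : ~~ (q%:Z %| 3)%Z by rewrite dvdzE dvdn_prime2.
have hN : ~~ (q%:Z %| enorm c (2 * c))%Z.
  have -> : enorm c (2 * c) = 3 * (c * c) by rewrite /enorm; ring.
  by rewrite !prime_dvdzM !negb_or h q3'.
have E := sym_conj hN.
have : sym q c (2 * c) = - sym q c (2 * c).
  have E1 : c - 2 * c = - 1 * c by ring.
  have E2 : - (2 * c) = - 1 * (2 * c) by ring.
  rewrite -E E1 E2.
  by rewrite sym_scale // dvdzE /= dvdn1 gtn_eqF ?prime_gt1.
move/eqP; case: (sym q c (2 * c)) => [[|[|[|n]]] i] //= _; exact: val_inj.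
Qed.
End Sym.

Lemma coprimez_prime (a b : int) :
  (forall p, prime p -> (p%:Z %| a)%Z -> (p%:Z %| b)%Z -> False) -> coprimez a b.
Proof.
move=> h; rewrite coprimezE; apply/negPn/negP; rewrite /coprime => g1.
have [p pp pg] : exists2 p, prime p & (p %| gcdn `|a| `|b|)%N.
  have [g0|g0] := posnP (gcdn `|a| `|b|); first by exists 2; rewrite ?g0.
  by exists (pdiv (gcdn `|a| `|b|)); rewrite ?pdiv_dvd // pdiv_prime //; lia.
by move: pg; rewrite dvdn_gcd => /andP[pa pb]; apply: (h p pp); rewrite dvdzE.
Qed.

Lemma coprimez_primeP (a b : int) p : coprimez a b -> prime p ->
  (p%:Z %| a)%Z -> (p%:Z %| b)%Z -> False.
Proof.
move=> /eqP cab pp pa pb; have : (p%:Z %| gcdz a b)%Z by rewrite dvdz_gcd pa.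
by rewrite cab dvdzE /= dvdn1 gtn_eqF ?prime_gt1.
Qed.

Lemma prime_dvdzX p (a : int) n : prime p -> (p%:Z %| a ^+ n)%Z -> (p%:Z %| a)%Z.
Proof. by move=> pp; rewrite !dvdzE abszX Euclid_dvdX // => /andP[]. Qed.

Lemma prime_dvdz1 p : prime p -> (p%:Z %| 1)%Z = false.
Proof. by move=> pp; rewrite dvdzE dvdn1 gtn_eqF ?prime_gt1. Qed.

Lemma prime_dvdz2 p : prime p -> (p%:Z %| 2)%Z = (p == 2%N).
Proof. by move=> pp; rewrite dvdzE; apply: (dvdn_prime2 pp (isT : prime 2)). Qed.

Lemma prime_dvdz3 p : prime p -> (p%:Z %| 3)%Z = (p == 3%N).
Proof. by move=> pp; rewrite dvdzE; apply: (dvdn_prime2 pp (isT : prime 3)). Qed.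

Lemma prime_dvdz4 p : prime p -> (p%:Z %| 4)%Z = (p == 2%N).
Proof.
move=> pp; rewrite dvdzE -[`|4|%N]/(2 * 2)%N Euclid_dvdM // orbb; exact: (dvdn_prime2 pp (isT : prime 2)).
Qed.

Lemma dvdz_addl_eq (m a b : int) : (m %| b)%Z -> (m %| a + b)%Z = (m %| a)%Z.
Proof. by move=> h; rewrite rpredDr. Qed.

Lemma dvdz_exp2 (m a : int) : (m %| a)%Z -> (m %| a ^+ 2)%Z.
Proof. by rewrite expr2; apply: dvdz_mulr. Qed.

Lemma dvdz_exp3 (m a : int) : (m %| a)%Z -> (m %| a ^+ 3)%Z.
Proof. by rewrite exprS; apply: dvdz_mulr. Qed.

Lemma Fp_power_sum p i : prime p -> (i < p.-1)%N -> \sum_(x : 'F_p) x ^+ i = 0.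
Proof.
move=> pp ip; have [->|i0] := posnP i.
  under eq_bigr => x _ do rewrite expr0.
  by rewrite sumr_const card_Fp // (pchar_Fp_0 pp).
have [|t t0 ti] := @Fp_exp_neq1 p pp i; first by rewrite i0.
apply: (mulchar_sum0 (X := fun x : 'F_p => x ^+ i) _ t0) => //.
by split=> [||x y]; rewrite ?expr1n ?exprMn // expr0n gtn_eqF.
Qed.

Section JacobiSymbol.
Variables (p : nat) (w : 'F_p).
Hypotheses (pp : prime p) (w0 : w ^+ 2 + w + 1 = 0) (p3 : p != 3%N).
Let wp := cubic_root_prim pp w0 p3.
Notation JA := (jacA w). Notation JB := (jacB w).

(** In F_p the character is x^k with 3 k = p - 1, and x^k (1 - x)^k has degree 2 k < p - 1, so all
    its power sums vanish. This tells which prime over p the Jacobi sum generates. *)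
Lemma jac_root : JA%:~R + JB%:~R * w = 0 :> 'F_p.
Proof.
rewrite -(jacobi_eval w wp) /jacobi.
set k := (p.-1 %/ 3)%N; have kE : (p.-1 = k * 3)%N := cubic_root_mod pp w0 p3.
have k0 : (0 < k)%N := cubic_k_gt0 pp w0 p3.
have C x : cchar w w x = x ^+ k.
  rewrite /cchar; case: eqP => [->|/eqP x0]; first by rewrite expr0n gtn_eqF.
  by rewrite (ind_exp pp w0 p3).
transitivity (\sum_(x : 'F_p) \sum_(i < k.+1) x ^+ (k + i) * ((-1) ^+ i *+ 'C(k, i))).
  apply: eq_bigr => x _; rewrite !C exprBn mulr_sumr; apply: eq_bigr => i _.
  rewrite expr1n mulr1 exprD; ring.
rewrite exchange_big big1 //= => i _; rewrite -mulr_suml Fp_power_sum ?mul0r //.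
have := ltn_ord i; lia.
Qed.

(** The Gauss sums for o and o^2 multiply to p and have cubes p J and p conj J, so p^3 = p^2
    N(J). *)
Lemma jac_norm : enorm JA JB = p.
Proof.
have p0 : p%:R != 0 :> algC by rewrite pnatr_eq0 -lt0n prime_gt0.
have [z zp] := closed_prim_root pp p0.
have h3 : 3%:R != 0 :> algC by rewrite pnatr_eq0.
have [o op] := closed_prim_root (isT : prime 3) h3.
have op2 := prim3_sq op.
have [G1 GI] := gauss_cube pp w0 p3 op zp.
have [G2 _] := gauss_cube pp w0 p3 op2 zp.
have E : gauss z (fun x => (cchar w o x)^-1) = gauss z (cchar w (o ^+ 2)).
  apply: eq_bigr => x _; congr (_ * _); rewrite -(cchar_sq w op) /cchar.
  by case: eqP => _; rewrite ?mul0r // /addchar -exprD -exprM; congr (_ ^+ _); lia.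
rewrite E in GI.
have H : (p%:R : algC) ^+ 3 = p%:R ^+ 2 * (enorm JA JB)%:~R.
  rewrite -{1}GI exprMn G1 G2 -(eeval_norm _ _ op) /eeval; ring.
have : (p%:R : algC) = (enorm JA JB)%:~R.
  by apply: (mulfI (_ : p%:R ^+ 2 != 0)); rewrite ?expf_neq0 // -exprSr.
by rewrite -[p%:R]/(p%:Z%:~R) => /intr_inj.
Qed.

(** Cubic reciprocity. The power q^2 - 1 of the Gauss sum is (p J)^((q^2-1)/3) since G^3 = p J, and
    chi(q) by Frobenius. Taking this at omega and at omega^2 and dividing removes p and gives the
    exponent ind q - 2 ind q = 2 ind q. *)
Lemma sym_jacobi q : prime q -> q != 3%N -> q != p ->
  sym q JA JB = ind w q%:R + ind w q%:R.
Proof.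
move=> qp q3 qp'; have Fq := pchar_Fbar qp.
have p0 : p%:R != 0 :> Fbar q by rewrite -(dvdn_pcharf Fq) dvdn_prime2.
have q0 : q%:R != 0 :> 'F_p by rewrite -(dvdn_pcharf (pchar_Fp pp)) dvdn_prime2 // eq_sym.
have [z zp] := closed_prim_root pp p0.
have Key (o : Fbar q) : 3.-primitive_root o ->
    (p%:R * (JA%:~R + JB%:~R * o)) ^+ symexp q = cpow o (ind w q%:R).
  move=> op; have [G1 GI] := gauss_cube pp w0 p3 op zp.
  have G0 : gauss z (cchar w o) != 0.
    by apply: contraNneq p0 => G0; rewrite -GI G0 mul0r.
  have XX := cchar_mulchar pp w0 p3 op.
  have C3 x : x != 0 -> cchar w o x ^+ 3 = 1.
    by move=> x0; rewrite /cchar (negPf x0) -exprM mulnC exprM (prim_expr_order op) expr1n.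
  have GF : gauss z (cchar w o) ^+ (q ^ 2) = (cchar w o (q%:R ^+ 2))^-1 * gauss z (cchar w o).
    apply: gauss_frob => // x; rewrite /cchar; case: eqP => _.
      by rewrite expr0n expn_eq0 andbT gtn_eqF ?prime_gt0.
    rewrite /addchar -exprM mulnC exprM -(prim_expr_mod op) (sqr_mod3 qp q3).
    by rewrite modn_small // expr1.
  have GE : gauss z (cchar w o) ^+ (q ^ 2).-1 = cchar w o q%:R.
    apply: (mulIf G0); rewrite -exprSr (sqr_pred qp) GF; congr (_ * _).
    have c0 : cchar w o q%:R != 0 by rewrite (mulchar_neq0 XX).
    rewrite (mulchar_nat _ XX); apply: (mulfI (_ : cchar w o q%:R ^+ 2 != 0)).
      by rewrite expf_neq0.
    by rewrite divff ?expf_neq0 // -exprSr C3.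
  by rewrite -G1 -exprM mulnC -(symexpE qp q3) GE /cchar (negPf q0).
have op := omega_prim qp q3.
have NN : ~~ (q%:Z %| enorm JA JB)%Z by rewrite jac_norm dvdzE dvdn_prime2.
apply: (sym_uniq qp q3) => //.
have P0 : p%:R ^+ symexp q != 0 :> Fbar q by rewrite expf_neq0.
apply: (mulfI P0); rewrite mulrCA -!exprMn (Key _ op) (Key _ (prim3_sq op)).
have -> : cpow (omega q ^+ 2) (ind w q%:R) = cpow (omega q) (ind w q%:R + ind w q%:R).
  by rewrite (cpowD _ _ op) /addchar -exprM -exprD; congr (_ ^+ _); lia.
rewrite -(cpowD _ _ op); congr (addchar _ _).
by case: (ind w q%:R) => [[|[|[|]]] i] //; apply: val_inj.
Qed.
End JacobiSymbol.

(* The pairs (p, v) stand for the primes over p at which the Eisenstein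
   integer A + B w vanishes, v being the image of w mod p. *)
Lemma eis_factor (A B : int) : coprimez A B -> (3 %| B)%Z ->
  exists L : seq (nat * nat),
   (forall l, l \in L -> [/\ prime l.1, l.1 != 3%N, (l.1%:Z %| enorm A B)%Z &
        (l.2%:R ^+ 2 + l.2%:R + 1 : 'F_(l.1)) = 0]) /\
   (forall q, prime q -> q != 3%N -> ~~ (q%:Z %| enorm A B)%Z ->
     sym q A B = \sum_(l <- L) (ind (l.2%:R : 'F_(l.1)) q%:R + ind (l.2%:R : 'F_(l.1)) q%:R)).
Proof.
have P3 (a b : int) : (3 %| a * b)%Z = (3 %| a)%Z || (3 %| b)%Z.
  exact: (@prime_dvdzM 3 isT a b).
move: {2}`|enorm A B|%N (leqnn `|enorm A B|%N) => n.
elim: n A B => [|n IH] A B hn cAB B3.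
  exfalso; have N0 : enorm A B = 0 by lia.
  have [A0 B0] : A = 0 /\ B = 0 by move: N0; rewrite /enorm; nia.
  by move: cAB; rewrite A0 B0.
have A3 : ~~ (3 %| A)%Z.
  apply/negP => A3; have : (3 %| gcdz A B)%Z by rewrite dvdz_gcd A3.
  by move/eqP: cAB => ->.
have N3 : ~~ (3 %| enorm A B)%Z.
  have -> : enorm A B = A * A + B * (B - A) by rewrite /enorm; ring.
  by rewrite (dvdz_addl_eq _ (dvdz_mulr _ B3)) P3 negb_or A3.
(* The units: with B = 3 c, the identity 4 N = (2 A - B)^2 + 27 c^2 and N <= 1 force B = 0. *)
have [N1|N1] := leqP `|enorm A B|%N 1.
  exists [::]; split=> // q qp q3 qN; rewrite big_nil.
  have B0 : B = 0.
    have /dvdzP[c Bc] := B3; have N4 : 4 * enorm A B = (2 * A - B) ^+ 2 + 27 * c ^+ 2.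
      by rewrite /enorm Bc; ring.
    have c0 : c = 0.
      apply/eqP; rewrite -sqrf_eq0; have := sqr_ge0 (2 * A - B); have := sqr_ge0 c.
      move: N4; move: (c ^+ 2) ((2 * A - B) ^+ 2) (enorm A B) N1 => x y z; lia.
    by rewrite Bc c0 mul0r.
  rewrite B0 sym_rat //; apply: contra qN => qA.
  have -> : enorm A B = A * A by rewrite /enorm B0; ring.
  by rewrite dvdz_mulr.
have pp := pdiv_prime N1; set p := pdiv _ in pp.
have pN : (p%:Z %| enorm A B)%Z by rewrite dvdzE /= pdiv_dvd.
have p3 : p != 3%N.
  by apply/eqP => E; move: pN; rewrite E => pN'; move/negP: N3; apply; exact: pN'.
have Fp := pchar_Fp pp.
have B0 : B%:~R != 0 :> 'F_p.
  rewrite (intr_pchar _ Fp); apply/negP => pB.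
  have pA : (p%:Z %| A)%Z.
    move: pN; have -> : enorm A B = A * A + B * (B - A) by rewrite /enorm; ring.
    by rewrite (dvdz_addl_eq _ (dvdz_mulr _ pB)) prime_dvdzM // orbb.
  have : (p%:Z %| gcdz A B)%Z by rewrite dvdz_gcd pA.
  by move/eqP: cAB => ->; rewrite dvdzE /= dvdn1 gtn_eqF ?prime_gt1.
pose w : 'F_p := - A%:~R / B%:~R.
have w0 : w ^+ 2 + w + 1 = 0.
  have /eqP NF : (enorm A B)%:~R == 0 :> 'F_p by rewrite (intr_pchar _ Fp).
  have : (enorm A B)%:~R / (B%:~R ^+ 2) = 0 :> 'F_p by rewrite NF mul0r.
  move=> <-; rewrite /enorm !(rmorphB, rmorphD, rmorphM, rmorphXn) /= /w; field => //.
have J0 := jac_root pp w0 p3; have JN := jac_norm pp w0 p3.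
have J3 := jacB_dvd3 pp w0 p3.
move: (sym_jacobi pp w0 p3) J0 JN J3.
move: (jacA w) (jacB w) => C D symJ J0 JN J3.
have AE : A%:~R = - (B%:~R * w) :> 'F_p by rewrite /w; field.
have CE : C%:~R = - (D%:~R * w) :> 'F_p by apply/eqP; rewrite -addr_eq0 J0.
(* A1 + B1 omega is the quotient of A + B omega by the Jacobi sum C + D omega: multiply by the
   conjugate and divide by the norm p. The division is exact because both elements vanish at w
   modulo p. *)
have /dvdzP[A1 EA] : (p%:Z %| A * C - A * D + B * D)%Z.
  rewrite -(intr_pchar _ Fp) !(rmorphB, rmorphD, rmorphM) /= AE CE.
  have -> : - (B%:~R * w) * - (D%:~R * w) - - (B%:~R * w) * D%:~R + B%:~R * D%:~R =
     B%:~R * D%:~R * (w ^+ 2 + w + 1) :> 'F_p by ring.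
  by rewrite w0 mulr0.
have /dvdzP[B1 EB] : (p%:Z %| B * C - A * D)%Z.
  rewrite -(intr_pchar _ Fp) !(rmorphB, rmorphD, rmorphM) /= AE CE.
  by apply/eqP; ring.
have p0 : p%:Z != 0 by have := prime_gt0 pp; lia.
have EA2 : A = A1 * C - B1 * D.
  apply: (mulIf p0); rewrite mulrBl mulrAC [B1 * D * _]mulrAC -EA -EB -JN /enorm; ring.
have EB2 : B = A1 * D + B1 * C - B1 * D.
  apply: (mulIf p0).
  have -> : (A1 * D + B1 * C - B1 * D) * p%:Z = A1 * p%:Z * D + B1 * p%:Z * (C - D) by ring.
  rewrite -EA -EB -JN /enorm; ring.
have NE : enorm A B = enorm A1 B1 * p%:Z by rewrite -JN EA2 EB2 enormM.
have cAB1 : coprimez A1 B1.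
  apply: coprimez_prime => q qp qA qB; apply: (coprimez_primeP cAB qp); rewrite ?EA2 ?EB2.
    by apply: rpredB; apply: dvdz_mulr.
  by apply: rpredB; rewrite ?rpredD ?dvdz_mulr.
have B13 : (3 %| B1)%Z.
  have : (3 %| B1 * p%:Z)%Z by rewrite -EB; apply: rpredB; [apply: dvdz_mulr|apply: dvdz_mull].
  rewrite P3 => /orP[] //.
  by rewrite dvdzE dvdn_prime2 // eq_sym (negPf p3).
have [|L [LP LS]] := IH A1 B1 _ cAB1 B13.
  have := prime_gt1 pp; have N0 := enorm_ge0 A1 B1.
  have : enorm A1 B1 != 0 by apply: contraTneq N1 => N10; rewrite NE N10 mul0r.
  move: hn; rewrite NE abszM absz_nat; nia.
exists ((p, w : nat) :: L); split.
  have wE : (w : nat)%:R = w :> 'F_p by exact: natr_Zp.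
  move=> l; rewrite inE => /orP[/eqP->|/LP[? ? d ?]]; first by rewrite [(p, _).1]/= [(p, _).2]/= wE.
  by split=> //; rewrite NE dvdz_mulr.
move=> q qp q3; rewrite NE (prime_dvdzM qp) negb_or => /andP[qN1 qp'].
have qp2 : q != p by move: qp'; rewrite dvdzE dvdn_prime2.
have wE : (w : nat)%:R = w :> 'F_p by exact: natr_Zp.
rewrite big_cons [(p, _).1]/= [(p, _).2]/= wE addrC -LS // -symJ // {1}EA2 EB2 symM // JN //.
Qed.

(** * Cubic reciprocity along norms from the reflected field *)

Lemma ind_abs p (w : 'F_p) (x : int) : prime p -> w ^+ 2 + w + 1 = 0 -> p != 3%N ->
  ind w x%:~R = ind w `|x|%:R.
Proof.
move=> pp w0 p3; case: (intP x) => [|n|n] //; rewrite abszN absz_nat.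
have [E|n0] := eqVneq (n.+1%:R : 'F_p) 0.
  by rewrite rmorphN /= -[n.+1%:Z%:~R]/(n.+1%:R) E oppr0.
rewrite rmorphN /= -[n.+1%:Z%:~R]/(n.+1%:R) -mulN1r indM ?oppr_eq0 ?oner_eq0 //.
by rewrite indN1 // add0r.
Qed.

(* the residue symbol of C + D sqrt(-3) *)
Definition rsym (q : nat) (C D : int) : 'F_3 := sym q (C + D) (2 * D).

(** The element y + z sqrt(-d), or its half, with norm a^3, as a 3-torsion class produces it. As 27
    does not divide z, a factor 3 survives in v after removal of the common factors of z and v when
    27 divides v; this makes z u + y v sqrt(-3) primary. *)
Definition normalized (d : nat) (y z a : int) : Prop :=
  [/\ coprimez y z, ~~ (3 %| y)%Z, ~~ (27 %| z)%Z &
    y ^+ 2 + d%:Z * z ^+ 2 = a ^+ 3 \/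
    [/\ y ^+ 2 + d%:Z * z ^+ 2 = 4 * a ^+ 3, ~~ (2 %| y)%Z & ~~ (2 %| z)%Z]].

(** C + D sqrt(-3) is (C + D) + 2 D omega. For coprime C, D the two coordinates share at most a
    factor 2, namely when C and D are both odd. *)
Lemma eis_reduce (C D : int) : coprimez C D ->
  exists g A B : int, [/\ C + D = g * A, 2 * D = g * B, coprimez A B &
    g = 1 \/ [/\ g = 2, ~~ (2 %| C)%Z & ~~ (2 %| D)%Z]].
Proof.
move=> cCD; have D2 (p : nat) : prime p -> (p%:Z %| 2 * D)%Z -> p = 2%N \/ (p%:Z %| D)%Z.
  move=> pp; rewrite prime_dvdzM // => /orP[|]; last by right.
  by rewrite prime_dvdz2 // => /eqP; left.
case: (boolP ((2 %| C)%Z || (2 %| D)%Z)) => [h|].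
  exists 1, (C + D), (2 * D); rewrite !mul1r; split=> //; last by left.
  apply: coprimez_prime => p pp pA /(D2 p pp)[p2|pD].
    subst p; case/orP: h => h.
      have h2 : (2 %| D)%Z by move: pA; rewrite addrC (dvdz_addl_eq _ h).
      exact: (coprimez_primeP (p := 2) cCD).
    have h2 : (2 %| C)%Z by move: pA; rewrite (dvdz_addl_eq _ h).
    exact: (coprimez_primeP (p := 2) cCD).
  by apply: (coprimez_primeP (p := p) cCD) => //; move: pA; rewrite (dvdz_addl_eq _ pD).
rewrite negb_or => /andP[hC hD].
have /dvdzP[A EA] : (2 %| C + D)%Z by lia.
exists 2, A, D; split=> //; [by rewrite EA mulrC| |by right].
apply: coprimez_prime => p pp pA pD; apply: (coprimez_primeP (p := p) cCD) => //.
have : (p%:Z %| C + D)%Z by rewrite EA dvdz_mulr.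
by rewrite (dvdz_addl_eq _ pD).
Qed.

Lemma enorm_even (A B : int) : (2 %| enorm A B)%Z -> (2 %| A)%Z /\ (2 %| B)%Z.
Proof.
have P2 (a b : int) : (2 %| a * b)%Z = (2 %| a)%Z || (2 %| b)%Z := @prime_dvdzM 2 isT a b.
have -> : enorm A B = B * B + A * (A - B) by rewrite /enorm; ring.
case: (boolP (2 %| A)%Z) => [h|h].
  by rewrite (dvdz_addl_eq _ (dvdz_mulr _ h)) P2 orbb.
case: (boolP (2 %| B)%Z) => [hB|hB].
  rewrite addrC (dvdz_addl_eq _ (dvdz_mulr _ hB)) P2 (negPf h) /=; lia.
have hAB : (2 %| A - B)%Z by lia.
by rewrite (dvdz_addl_eq _ (dvdz_mull _ hAB)) P2 (negPf hB).
Qed.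

(** Reciprocity turns the symbols along n into cubic characters of n at the Eisenstein primes
    dividing C + D sqrt(-3). At these primes n agrees with a^3 up to squares and the factor eps = 1
    or 4; the cube disappears and the remaining factors have trivial symbol. *)
Lemma cubic_reciprocity (d : nat) (y z a u v : int) :
  normalized d y z a -> coprimez u v -> (54 %| v)%Z ->
  coprimez (u ^+ 2 - 3 * d%:Z * v ^+ 2) a ->
  addext (fun p => rsym p (z * u) (y * v)) `|(u ^+ 2 - 3 * d%:Z * v ^+ 2)%R|%N = 0.
Proof.
move=> [cyz y3 z27 Heq] cuv v54; set n := u ^+ 2 - _ => cna.
have [eps [Eeps Heps]] : exists eps : int, y ^+ 2 + d%:Z * z ^+ 2 = eps * a ^+ 3 /\
    (eps = 1 \/ [/\ eps = 4, ~~ (2 %| y)%Z & ~~ (2 %| z)%Z]).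
  case: Heq => [E|[E h1 h2]]; first by exists 1; rewrite mul1r; split => //; left.
  by exists 4; split => //; right.
have v2 : (2 %| v)%Z by apply: dvdz_trans v54.
have v3 : (3 %| v)%Z by apply: dvdz_trans v54.
have v27 : (27 %| v)%Z by apply: dvdz_trans v54.
have u2 : ~~ (2 %| u)%Z by apply/negP => h; apply: (coprimez_primeP (p := 2) cuv).
have u3 : ~~ (3 %| u)%Z by apply/negP => h; apply: (coprimez_primeP (p := 3) cuv).
have [v0|v0] := eqVneq v 0.
  have : `|u|%N = 1%N by move/eqP: cuv; rewrite v0 gcdz0; lia.
  move=> u1; have -> : `|n|%N = 1%N by rewrite /n v0 expr0n mulr0 subr0 abszX u1.
  exact: addext1.
have u0 : u != 0 by apply: contraNneq u2 => ->; rewrite dvdz0.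
(* Only the pairs z, v and u, y can share primes that matter here; removing these leaves coprime C,
   D, and the removed factor g1 g2 is rational, hence invisible to symbols. *)
pose g1 := gcdz z v; pose g2 := gcdz u y.
have g10 : g1 != 0 by rewrite gcdz_eq0 negb_and v0 orbT.
have g20 : g2 != 0 by rewrite gcdz_eq0 negb_and u0.
have /dvdzP[z' Ez] : (g1 %| z)%Z := dvdz_gcdl z v.
have /dvdzP[v' Ev] : (g1 %| v)%Z := dvdz_gcdr z v.
have /dvdzP[u' Eu] : (g2 %| u)%Z := dvdz_gcdl u y.
have /dvdzP[y' Ey] : (g2 %| y)%Z := dvdz_gcdr u y.
have czv : coprimez z' v'.
  apply/eqP/(mulfI g10); rewrite mulr1 [in RHS]/g1 [in RHS]Ez [in RHS]Ev.
  by rewrite -![_ * g1]mulrC -mulz_gcdr // /g1 gcdz_ge0.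
have cuy : coprimez u' y'.
  apply/eqP/(mulfI g20); rewrite mulr1 [in RHS]/g2 [in RHS]Eu [in RHS]Ey.
  by rewrite -![_ * g2]mulrC -mulz_gcdr // /g2 gcdz_ge0.
have dl (p : nat) (x g : int) : (p%:Z %| x)%Z -> (p%:Z %| x * g)%Z by move=> h; rewrite dvdz_mulr.
pose C := z' * u'; pose D := y' * v'.
have cCD : coprimez C D.
  apply: coprimez_prime => p pp; rewrite /C /D !prime_dvdzM // => /orP[] h1 /orP[] h2.
  - by apply: (coprimez_primeP (p := p) cyz pp); rewrite ?Ey ?Ez dl.
  - exact: (coprimez_primeP (p := p) czv).
  - exact: (coprimez_primeP (p := p) cuy).
  - by apply: (coprimez_primeP (p := p) cuv pp); rewrite ?Eu ?Ev dl.
have D3 : (3 %| D)%Z.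
  rewrite /D; have : (3 %| v')%Z.
    apply/negPn/negP => h; case/negP: z27; rewrite Ez.
    have c27 : coprimez 27 v'.
      by rewrite /coprimez (_ : 27 = 3 ^+ 3) // -/(coprimez _ _) coprimezXl // coprimezE prime_coprime.
    have : (27 %| v' * g1)%Z by rewrite -Ev.
    by rewrite Gauss_dvdzr // => h27; rewrite dvdz_mull.
  by move=> h; rewrite dvdz_mull.
have [g [A [B [EA EB cAB gP]]]] := eis_reduce cCD.
have g0 : g != 0 by case: gP => [->|[->]].
have gprime (p : nat) : prime p -> (p%:Z %| C)%Z || (p%:Z %| D)%Z -> ~~ (p%:Z %| g)%Z.
  move=> pp h; case: gP => [->|[-> h1 h2]]; first by rewrite prime_dvdz1.
  rewrite prime_dvdz2 //; apply/negP => /eqP p2; subst p.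
  by case/orP: h => h; [case/negP: h1|case/negP: h2].
have gdvd (p : nat) : prime p -> (p%:Z %| g)%Z -> p = 2%N.
  move=> pp; case: gP => [->|[-> _ _]]; first by rewrite prime_dvdz1.
  by rewrite prime_dvdz2 // => /eqP.
have B3 : (3 %| B)%Z.
  have : (3 %| g * B)%Z by rewrite -EB dvdz_mull.
  by rewrite Gauss_dvdzr //; case: gP => [->|[-> _ _]].
have Neq : g ^+ 2 * enorm A B = C ^+ 2 + 3 * D ^+ 2.
  transitivity (enorm (g * A) (g * B)); first by rewrite /enorm; ring.
  by rewrite -EA -EB /enorm; ring.
have [L [LP LS]] := eis_factor cAB B3.
have N2 : ~~ (2 %| enorm A B)%Z.
  apply/negP => /enorm_even[]; exact: (coprimez_primeP (p := 2) cAB).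
have p_neq2 (p : nat) : (p%:Z %| enorm A B)%Z -> p != 2%N.
  by move=> pE; apply/negP => /eqP p2; move: pE; rewrite p2 => h; move/negP: N2; apply.
have pN (p : nat) : prime p -> p != 3%N -> (p%:Z %| enorm A B)%Z ->
   [/\ ~~ (p%:Z %| C)%Z, ~~ (p%:Z %| D)%Z, ~~ (p%:Z %| n)%Z & ~~ (p%:Z %| a)%Z].
  move=> pp p3 pE; have pCD : (p%:Z %| C ^+ 2 + 3 * D ^+ 2)%Z by rewrite -Neq dvdz_mull.
  have p3' : ~~ (p%:Z %| 3)%Z by rewrite prime_dvdz3.
  have pC : ~~ (p%:Z %| C)%Z.
    apply/negP => h; apply: (coprimez_primeP cCD pp h).
    move: pCD; rewrite addrC (dvdz_addl_eq _ (dvdz_exp2 h)).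
    by rewrite prime_dvdzM // (negPf p3') /= => /(prime_dvdzX pp).
  have pD : ~~ (p%:Z %| D)%Z.
    apply/negP => h; case/negP: pC; move: pCD.
    by rewrite (dvdz_addl_eq _ (dvdz_mull _ (dvdz_exp2 h))) => /(prime_dvdzX pp).
  (* Modulo p one has C^2 = -3 D^2, which turns the form n into the other form: y'^2 n = u'^2 eps
     a^3. *)
  have key : (p%:Z %| y' ^+ 2 * n - u' ^+ 2 * (eps * a ^+ 3))%Z.
    rewrite -Eeps; have -> : y' ^+ 2 * n - u' ^+ 2 * (y ^+ 2 + d%:Z * z ^+ 2) =
       - (d%:Z * g1 ^+ 2) * (C ^+ 2 + 3 * D ^+ 2) by rewrite /n Ez Ev Eu Ey /C /D; ring.
    by rewrite dvdz_mull.
  have py' : ~~ (p%:Z %| y')%Z by apply: contra pD => h; rewrite /D dvdz_mulr.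
  have pu' : ~~ (p%:Z %| u')%Z by apply: contra pC => h; rewrite /C dvdz_mull.
  have pe : ~~ (p%:Z %| eps)%Z.
    case: Heps => [->|[-> _ _]]; first by rewrite prime_dvdz1.
    by rewrite prime_dvdz4 //; apply: (p_neq2 _ pE).
  have na : (p%:Z %| n)%Z = (p%:Z %| a)%Z.
    apply/idP/idP => h.
      have : (p%:Z %| u' ^+ 2 * (eps * a ^+ 3))%Z.
        by rewrite -[X in (_ %| X)%Z](subKr (y' ^+ 2 * n)); apply: rpredB => //; apply: dvdz_mull.
      rewrite prime_dvdzM // => /orP[/(prime_dvdzX pp)|]; first by rewrite (negPf pu').
      by rewrite prime_dvdzM // (negPf pe) => /(prime_dvdzX pp).
    have : (p%:Z %| y' ^+ 2 * n)%Z.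
      rewrite -[X in (_ %| X)%Z](subrK (u' ^+ 2 * (eps * a ^+ 3))); apply: rpredD => //.
      by do 2!apply: dvdz_mull; apply: dvdz_exp3.
    by rewrite prime_dvdzM // => /orP[/(prime_dvdzX pp)|//]; rewrite (negPf py').
  have pn : ~~ (p%:Z %| n)%Z.
    by apply/negP => h; apply: (coprimez_primeP cna pp h); rewrite -na.
  by split=> //; rewrite -na.
(* By [eis_factor] this is the symbol of C + D sqrt(-3) when t is a good prime; as a function of t
   it is visibly additive. *)
pose S (t : nat) : 'F_3 := \sum_(l <- L) (ind (l.2%:R : 'F_(l.1)) t%:R + ind (l.2%:R : 'F_(l.1)) t%:R).
pose good (t : int) := forall l, l \in L -> ~~ (l.1%:Z %| t)%Z.
have goodF l (t : nat) : l \in L -> ~~ (l.1%:Z %| t%:Z)%Z -> t%:R != 0 :> 'F_(l.1).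
  by move=> /LP[pp _ _ _]; rewrite dvdzE -(dvdn_pcharf (pchar_Fp pp)).
have SM (s t : nat) : good s -> good t -> S (s * t)%N = S s + S t.
  move=> gs gt; rewrite /S -big_split /= !big_seq; apply: eq_bigr => l lL.
  have [pp p3 _ w0] := LP _ lL.
  rewrite natrM indM ?goodF //; [ring|exact: gs|exact: gt].
have good_dvd (s t : int) : (s %| t)%Z -> good t -> good s.
  by move=> st gt l /gt; apply: contra => /dvdz_trans; apply.
have S1 : S 1%N = 0 by rewrite /S big1_seq // => l _; rewrite ind1 addr0.
have Sadd (t : int) (f : nat -> 'F_3) : t != 0 -> good t ->
   (forall q, prime q -> (q%:Z %| t)%Z -> f q = S q) -> addext f `|t|%N = S `|t|%N.
  move=> t0 gt fS; apply: addext_total => //; first by rewrite absz_gt0.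
  move=> q s qp qs; have qst : ((q * s)%N%:Z %| t)%Z by rewrite dvdzE.
  rewrite SM; first by rewrite fS //; apply: dvdz_trans qst; rewrite dvdzE /= dvdn_mulr.
    by apply: good_dvd gt; apply: dvdz_trans qst; rewrite dvdzE /= dvdn_mulr.
  by apply: good_dvd gt; apply: dvdz_trans qst; rewrite dvdzE /= dvdn_mull.
have gP' (t : int) : (forall p : nat, prime p -> p != 3%N -> (p%:Z %| enorm A B)%Z -> ~~ (p%:Z %| t)%Z) -> good t.
  by move=> h l /LP[pp p3 pE _]; apply: h.
have gn : good n by apply: gP' => p pp p3 /(pN p pp p3)[].
have ga : good a by apply: gP' => p pp p3 /(pN p pp p3)[].
have gu : good u'.
  by apply: gP' => p pp p3 /(pN p pp p3)[h _ _ _]; apply: contra h => h; rewrite /C dvdz_mull.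
have gy : good y'.
  by apply: gP' => p pp p3 /(pN p pp p3)[_ h _ _]; apply: contra h => h; rewrite /D dvdz_mulr.
have ge : good 2.
  by apply: gP' => p pp p3 pE; rewrite prime_dvdz2 //; apply: (p_neq2 _ pE).
have n0 : n != 0.
  apply/eqP => n0; have : (2 %| u)%Z.
    apply: (@prime_dvdzX 2 u 2 isT); have -> : u ^+ 2 = v * (3 * d%:Z * v).
      by apply/eqP; rewrite -subr_eq0 -n0; apply/eqP; rewrite /n; ring.
    exact: dvdz_mulr.
  by rewrite (negPf u2).
have symS (q : nat) : prime q -> q != 3%N -> ~~ (q%:Z %| enorm A B)%Z -> ~~ (q%:Z %| g)%Z ->
   rsym q C D = S q.
  move=> qp q3 qE qg; rewrite /S -LS // /rsym EA EB sym_scale //.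
(* Modulo such a q, C + D sqrt(-3) is rational or a rational multiple of sqrt(-3). *)
have sym_zero (q : nat) : prime q -> q != 3%N -> (q%:Z %| C)%Z || (q%:Z %| D)%Z -> S q = 0.
  move=> qp q3 h.
  have q3' : ~~ (q%:Z %| 3)%Z by rewrite prime_dvdz3.
  have qE : ~~ (q%:Z %| enorm A B)%Z.
    by apply/negP => /(pN q qp q3)[h1 h2 _ _]; move: h; rewrite (negPf h1) (negPf h2).
  rewrite -symS ?gprime //; case/orP: h => h.
    have qD : ~~ (q%:Z %| D)%Z by apply/negP; apply: (coprimez_primeP cCD qp h).
    rewrite -(sym_pure qp q3 qD); apply: (sym_congr qp).
      by rewrite addrK.
    by rewrite subrr dvdz0.
  have qC : ~~ (q%:Z %| C)%Z by apply/negP => hC; apply: (coprimez_primeP cCD qp hC h).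
  rewrite -(sym_rat qp q3 qC); apply: (sym_congr qp).
    by rewrite addrAC subrr add0r.
  by rewrite subr0 dvdz_mull.
have Su : S `|u'|%N = 0.
  rewrite -(Sadd u' (fun _ => 0)) //; first by rewrite /addext big1 // => *; rewrite mul0rn.
    by apply: contraNneq u0 => h; rewrite Eu h mul0r.
  move=> q qp qu; rewrite sym_zero //; last by rewrite /C dvdz_mull.
  by apply/eqP => q3; subst q; case/negP: u3; rewrite Eu dvdz_mulr.
have Sy : S `|y'|%N = 0.
  rewrite -(Sadd y' (fun _ => 0)) //; first by rewrite /addext big1 // => *; rewrite mul0rn.
    by apply: contraNneq y3 => h; rewrite Ey h mul0r dvdz0.
  move=> q qp qu; rewrite sym_zero //; last by rewrite /D dvdz_mulr ?orbT.
  by apply/eqP => q3; subst q; case/negP: y3; rewrite Ey dvdz_mulr.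
(* When eps = 4, z is odd and v is even, so v' and D are even and the symbol at 2 is trivial. *)
have Se : S `|eps|%N = 0.
  case: Heps => [->|[-> h1 h2]]; first exact: S1.
  rewrite (_ : `|4|%N = (2 * 2)%N) // SM // sym_zero ?addr0 //.
  have : (2 %| v')%Z.
    apply/negPn/negP => h; case/negP: h2; rewrite Ez.
    have : (2 %| v' * g1)%Z by rewrite -Ev.
    by rewrite (prime_dvdzM (q := 2)) // (negPf h) /= => h'; rewrite dvdz_mull.
  by move=> h; rewrite /D (dvdz_mull _ h) orbT.
(* The congruence y'^2 n = u'^2 eps a^3 read through [ind] at each prime of L. *)
have Sn : S `|n|%N = 0.
  have E : S `|n|%N + (S `|y'|%N + S `|y'|%N) = S `|eps|%N + (S `|u'|%N + S `|u'|%N).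
    rewrite /S -!big_split /= !big_seq; apply: eq_bigr => l lL.
    have [pp p3 pE w0] := LP _ lL; have Fp := pchar_Fp pp.
    have F0 (t : int) : good t -> t%:~R != 0 :> 'F_(l.1) by move=> /(_ _ lL); rewrite (intr_pchar _ Fp).
    have Ee : eps%:~R != 0 :> 'F_(l.1).
      case: Heps => [->|[-> _ _]]; first by rewrite oner_eq0.
      by rewrite (_ : 4 = 2 * 2) // rmorphM mulf_neq0 //= F0.
    rewrite -!ind_abs //.
    have : ind (l.2%:R : 'F_(l.1)) (y'%:~R ^+ 2 * n%:~R) = ind (l.2%:R : 'F_(l.1)) (u'%:~R ^+ 2 * (eps%:~R * a%:~R ^+ 3)).
      congr ind; rewrite -!(rmorphXn, rmorphM) /=; apply/eqP; rewrite -subr_eq0 -rmorphB /=.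
      rewrite (intr_pchar _ Fp) -Eeps.
      have -> : y' ^+ 2 * n - u' ^+ 2 * (y ^+ 2 + d%:Z * z ^+ 2) =
         - (d%:Z * g1 ^+ 2) * (g ^+ 2 * enorm A B) by rewrite Neq /n Ez Ev Eu Ey /C /D; ring.
      by rewrite !dvdz_mull.
    have [Y0 N0 U0 A0] := And4 (F0 _ gy) (F0 _ gn) (F0 _ gu) (F0 _ ga).
    have sq (x : 'F_(l.1)) : x != 0 -> ind (l.2%:R : 'F_(l.1)) (x ^+ 2) = ind (l.2%:R : 'F_(l.1)) x + ind (l.2%:R : 'F_(l.1)) x.
      by move=> x0; rewrite expr2 indM.
    rewrite (indM pp w0 p3 (expf_neq0 2 Y0) N0) (indM pp w0 p3 (expf_neq0 2 U0) (mulf_neq0 Ee (expf_neq0 3 A0))).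
    rewrite (indM pp w0 p3 Ee (expf_neq0 3 A0)) (ind_cube pp w0 p3 A0) !sq // addr0.
    by move=> E; rewrite (canRL (addKr _) E); ring.
  by move: E; rewrite Su Sy Se !addr0.
rewrite -[RHS]Sn -(Sadd n (fun p => rsym p (z * u) (y * v))) // => q qp qn.
have q3 : q != 3%N.
  apply: contraNneq u3 => q3; subst q; apply: (prime_dvdzX (n := 2) (isT : prime 3)).
  rewrite -[u ^+ 2](subrK (3 * d%:Z * v ^+ 2)) -/n; apply: rpredD => //.
  by rewrite -mulrA dvdz_mulr.
have q2 : q != 2%N.
  apply: contraNneq u2 => q2; subst q; apply: (prime_dvdzX (n := 2) (isT : prime 2)).
  rewrite -[u ^+ 2](subrK (3 * d%:Z * v ^+ 2)) -/n; apply: rpredD => //.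
  by apply: dvdz_mull; apply: (dvdz_exp2 v2).
have qE : ~~ (q%:Z %| enorm A B)%Z by apply/negP => /(pN q qp q3)[_ _ /negP].
have qg : ~~ (q%:Z %| g)%Z by apply/negP => /(gdvd q qp)/eqP; rewrite (negPf q2).
have qv : ~~ (q%:Z %| v)%Z.
  apply/negP => qv; apply: (coprimez_primeP cuv qp _ qv); apply: (prime_dvdzX (n := 2) qp).
  rewrite -[u ^+ 2](subrK (3 * d%:Z * v ^+ 2)) -/n; apply: rpredD => //.
  by apply: dvdz_mull; apply: (dvdz_exp2 qv).
have qg1 : ~~ (q%:Z %| g1)%Z by apply: contra qv => h; rewrite Ev dvdz_mull.
(* A common prime of u, y and n would divide d, and then eps a^3, against the coprimality of n and
   a. *)
have qg2 : ~~ (q%:Z %| g2)%Z.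
  apply/negP => h; have qu : (q%:Z %| u)%Z by rewrite Eu dvdz_mull.
  have qy : (q%:Z %| y)%Z by rewrite Ey dvdz_mull.
  have qd : (q%:Z %| d%:Z)%Z.
    have : (q%:Z %| 3 * d%:Z * v ^+ 2)%Z.
      rewrite -[X in (_ %| X)%Z](subKr (u ^+ 2)) -/n; apply: rpredB => //.
      by apply: dvdz_exp2.
    rewrite prime_dvdzM // => /orP[|/(prime_dvdzX qp)]; last by rewrite (negPf qv).
    rewrite prime_dvdzM // => /orP[|//].
      by rewrite prime_dvdz3 // (negPf q3).
  have : (q%:Z %| eps * a ^+ 3)%Z.
    by rewrite -Eeps; apply: rpredD; [apply: dvdz_exp2|apply: dvdz_mulr].
  rewrite prime_dvdzM // => /orP[|/(prime_dvdzX qp)]; last exact: (coprimez_primeP cna qp qn).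
  case: Heps => [->|[-> _ _]]; first by rewrite prime_dvdz1.
  by rewrite prime_dvdz4 // (negPf q2).
rewrite -symS // /rsym.
have -> : z * u + y * v = (g1 * g2 * g) * A.
  by rewrite -mulrA -EA Ez Ev Eu Ey /C /D; ring.
have -> : 2 * (y * v) = (g1 * g2 * g) * B.
  by rewrite -mulrA -EB Ev Ey /D; ring.
rewrite EA EB !sym_scale // !prime_dvdzM // !negb_or qg1 qg2 //.
Qed.

(** * Reduced bases of the lattices u = R v mod n *)

(** Pigeonhole in a box of sides U and V with (U + 1)(V + 1) > n, V being the largest integer with S
    V^2 <= n. *)
Lemma thue (n S : nat) (R : int) : (0 < n)%N -> (0 < S)%N ->
  exists u v : int, [/\ (u != 0) || (v != 0), (n%:Z %| u - R * v)%Z,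
    u ^+ 2 <= n%:Z * S%:Z & S%:Z * v ^+ 2 <= n%:Z].
Proof.
move=> n0 S0.
have ex : exists V, (V ^ 2 * S <= n)%N by exists 0%N.
have ub V : (V ^ 2 * S <= n)%N -> (V <= n)%N by rewrite !expnS expn0; nia.
have [V VP Vmax] := ex_maxnP ex ub.
have V1 : (n < V.+1 ^ 2 * S)%N by rewrite ltnNge; apply/negP => /Vmax; rewrite ltnn.
pose U := (n %/ V.+1)%N.
have UV : (n < U.+1 * V.+1)%N by rewrite /U; have := divn_eq n V.+1; have := ltn_pmod n (isT : 0 < V.+1)%N; lia.
have Ule : (U * V.+1 <= n)%N by rewrite /U leq_trunc_div.
have mlt (x : int) : (`|(x %% n%:Z)%Z|%N < n)%N.
  have := modz_ge0 x (_ : n%:Z != 0); have := ltz_pmod x (_ : 0 < n%:Z); lia.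
pose f (x : 'I_U.+1 * 'I_V.+1) : 'I_n := Ordinal (mlt ((x.1 : nat)%:Z - R * (x.2 : nat)%:Z)).
have : ~~ injectiveb f.
  apply/negP => /injectiveP /leq_card; rewrite card_prod !card_ord leqNgt UV //.
rewrite /injectiveb => /injectivePn [[i j] [[i' j'] ne E]].
pose u := (i : nat)%:Z - (i' : nat)%:Z; pose v := (j : nat)%:Z - (j' : nat)%:Z.
have uU : `|u| <= U%:Z by have := ltn_ord i; have := ltn_ord i'; rewrite /u; lia.
have vV : `|v| <= V%:Z by have := ltn_ord j; have := ltn_ord j'; rewrite /v; lia.
exists u, v; split.
- rewrite -negb_and; apply/negP => /andP[u0 v0]; case/eqP: ne; congr pair; apply: val_inj => /=; move: u0 v0; rewrite /u /v; lia.
- have := congr1 val E; rewrite /= => E'.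
  have /eqP : ((i : nat)%:Z - R * (j : nat)%:Z = (i' : nat)%:Z - R * (j' : nat)%:Z %[mod n%:Z])%Z.
    by have := modz_ge0 ((i : nat)%:Z - R * (j : nat)%:Z) (_ : n%:Z != 0);
       have := modz_ge0 ((i' : nat)%:Z - R * (j' : nat)%:Z) (_ : n%:Z != 0); lia.
  rewrite eqz_mod_dvd; congr (_ %| _)%Z; rewrite /u /v; ring.
- have h1 : u ^+ 2 <= U%:Z ^+ 2 by rewrite -[u ^+ 2]real_normK ?num_real //; apply: lerXn2r; rewrite ?nnegrE.
  have h2 : (U ^ 2 <= n * S)%N.
    rewrite -(@leq_pmul2r (V.+1 ^ 2)) ?expn_gt0 // -expnMn.
    apply: (@leq_trans (n ^ 2)); first by rewrite leq_exp2r.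
    by rewrite -mulnA [(S * _)%N]mulnC expnS expn1 leq_pmul2l // ltnW.
  by apply: le_trans h1 _; rewrite -PoszM -rmorphXn /=; lia.
- have h1 : v ^+ 2 <= V%:Z ^+ 2 by rewrite -[v ^+ 2]real_normK ?num_real //; apply: lerXn2r; rewrite ?nnegrE.
  apply: (@le_trans _ _ (S%:Z * V%:Z ^+ 2)); first by rewrite ler_pM2l.
  by rewrite -rmorphXn /= -PoszM mulnC; lia.
Qed.

(** e = (u, v) and e' = (u', v') form a basis of the lattice u = R v mod n, with e short. In it (U^2
    - D V^2) / n becomes c x^2 + 2 k x y + ((k^2 - D) / c) y^2, so (c, k) encodes a binary form of
    fixed discriminant from which n has disappeared. *)
Record lattice_data (D S n : nat) (R u v u' v' c k : int) : Prop := LatticeData {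
  ld_mem : (n%:Z %| u - R * v)%Z;
  ld_mem' : (n%:Z %| u' - R * v')%Z;
  ld_det : u * v' - u' * v = n%:Z;
  ld_c : c * n%:Z = u ^+ 2 - D%:Z * v ^+ 2;
  ld_c0 : c != 0;
  ld_cS : `|c| <= S%:Z;
  ld_k : k * n%:Z = u * u' - D%:Z * v * v';
  ld_kc : 0 <= k < `|c|;
  ld_root : (c %| k ^+ 2 - D%:Z)%Z;
  ld_u : u ^+ 2 <= n%:Z * S%:Z;
  ld_v : D%:Z * v ^+ 2 <= n%:Z * S%:Z }.

(** A Thue vector is made primitive in the lattice, completed to a basis by Bezout, and the second
    vector is shifted by a multiple of the first to bring k into [0, |c|). Since D is not a square,
    c != 0. *)
Lemma lattice_data_exists (D S n : nat) (R : int) :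
  (forall x : int, x ^+ 2 != D%:Z) -> (D <= S ^ 2)%N -> (0 < n)%N ->
  (n%:Z %| R ^+ 2 - D%:Z)%Z -> exists u v u' v' c k, lattice_data D S n R u v u' v' c k.
Proof.
move=> Dns DS n0 nR.
have D0 : (0 < D)%N by rewrite lt0n; apply: contra (Dns 0) => /eqP->.
have S0 : (0 < S)%N by case: S DS => //; rewrite leqNgt D0.
have [u0 [v0 [uv0 mem0 bu0 bv0]]] := thue R n0 S0.
have /dvdzP[s0 Es0] := mem0.
pose g := gcdz s0 v0.
have g0 : g != 0.
  rewrite gcdz_eq0; apply: contraL uv0 => /andP[/eqP s00 /eqP v00].
  by rewrite v00 eqxx orbF negbK; move: Es0; rewrite s00 v00; lia.
have g1 : 1 <= g by have : 0 <= g by []; lia.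
have /dvdzP[s Es] : (g %| s0)%Z := dvdz_gcdl s0 v0.
have /dvdzP[v Ev] : (g %| v0)%Z := dvdz_gcdr s0 v0.
have csv : gcdz s v = 1.
  apply: (mulfI g0); rewrite mulr1 [in RHS]/g [in RHS]Es [in RHS]Ev.
  by rewrite -![_ * g]mulrC -mulz_gcdr //.
have [b [a bez]] := Bezoutz s v; rewrite csv in bez.
pose u := R * v + n%:Z * s.
have Eu : u0 = g * u by move: Es0; rewrite Ev Es /u; lia.
have sq_le (x : int) : x ^+ 2 <= (g * x) ^+ 2.
  rewrite exprMn ler_peMl ?sqr_ge0 //; nia.
have bu : u ^+ 2 <= n%:Z * S%:Z by apply: le_trans (sq_le u) _; rewrite -Eu.
have bv : S%:Z * v ^+ 2 <= n%:Z.
  by apply: le_trans bv0; rewrite ler_pM2l // Ev [v * g]mulrC.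
have N0 : u ^+ 2 - D%:Z * v ^+ 2 != 0.
  apply/eqP => /eqP; rewrite subr_eq0 => /eqP E.
  have v_neq0 : v != 0.
    apply/eqP => v00; have : u = 0 by apply/eqP; rewrite -sqrf_eq0 E v00; apply/eqP; ring.
    by move=> u00; move: uv0; rewrite Eu Ev v00 u00 mulr0 mul0r eqxx.
  have vu : (v %| u)%Z.
    have : (v ^+ 2 %| u ^+ 2)%Z by rewrite E dvdz_mull.
    by rewrite !dvdzE !abszX dvdn_pexp2r.
  have /dvdzP[x xu] := vu; case/negP: (Dns x).
  rewrite -(inj_eq (mulIf (_ : v ^+ 2 != 0))) ?sqrf_eq0 // -exprMn -xu E //.
have /dvdzP[c Ec] : (n%:Z %| u ^+ 2 - D%:Z * v ^+ 2)%Z.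
  have -> : u ^+ 2 - D%:Z * v ^+ 2 = v ^+ 2 * (R ^+ 2 - D%:Z) + (n%:Z * s) * (R * v + R * v + n%:Z * s) by rewrite /u; ring.
  by apply: rpredD; [apply: dvdz_mull|apply/dvdz_mulr/dvdz_mulr].
have c0 : c != 0 by apply: contraNneq N0 => c00; rewrite Ec c00 mul0r.
pose v1 := b; pose u1 := R * b - n%:Z * a.
have det1 : u * v1 - u1 * v = n%:Z by rewrite /u /u1 /v1 -[RHS]mulr1 -bez; ring.
have /dvdzP[k1 Ek1] : (n%:Z %| u * u1 - D%:Z * v * v1)%Z.
  have -> : u * u1 - D%:Z * v * v1 = v * v1 * (R ^+ 2 - D%:Z) + n%:Z * (R * s * b - a * u) by rewrite /u /u1 /v1; ring.
  by apply: rpredD; [apply: dvdz_mull|apply: dvdz_mulr].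
pose t := (k1 %/ c)%Z; pose k := (k1 %% c)%Z.
have Ek : k = k1 - t * c by [].
pose u' := u1 - t * u; pose v' := v1 - t * v.
have det : u * v' - u' * v = n%:Z by rewrite -det1 /u' /v'; ring.
have Ekk : k * n%:Z = u * u' - D%:Z * v * v'.
  have -> : k * n%:Z = k1 * n%:Z - t * (c * n%:Z) by rewrite Ek; ring.
  by rewrite -Ek1 -Ec /u' /v'; ring.
have nz : n%:Z != 0 by lia.
have bv' : D%:Z * v ^+ 2 <= n%:Z * S%:Z.
  have DS' : D%:Z <= S%:Z * S%:Z by rewrite -PoszM lez_nat mulnn.
  apply: (@le_trans _ _ (S%:Z * S%:Z * v ^+ 2)); first by rewrite ler_wpM2r ?sqr_ge0.
  by rewrite -mulrA mulrC ler_wpM2r.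
have kc : 0 <= k < `|c| by rewrite modz_ge0 // ltz_mod.
exists u, v, u', v', c, k; split=> //.
- by rewrite /u addrAC subrr add0r dvdz_mulr.
- have -> : u' - R * v' = n%:Z * (- a - t * s) by rewrite /u' /v' /u1 /v1 /u; ring.
  by rewrite dvdz_mulr.
- have : `|c| * n%:Z <= S%:Z * n%:Z.
    rewrite -{1}[n%:Z]ger0_norm // -normrM -Ec.
    have := sqr_ge0 u; have : 0 <= D%:Z * v ^+ 2 by rewrite mulr_ge0 ?sqr_ge0.
    rewrite [S%:Z * _]mulrC; move: bu bv'; move: (u ^+ 2) (D%:Z * v ^+ 2) => x1 x2; clear; lia.
  by rewrite ler_pM2r // ltz_nat.
- apply/dvdzP; exists ((u' ^+ 2 - D%:Z * v' ^+ 2) %/ n%:Z)%Z.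
  have /dvdzP[m Em] : (n%:Z %| u' ^+ 2 - D%:Z * v' ^+ 2)%Z.
    have -> : u' ^+ 2 - D%:Z * v' ^+ 2 = v' ^+ 2 * (R ^+ 2 - D%:Z) + n%:Z * (- a - t * s) * (u' + R * v').
      by rewrite /u' /v' /u1 /v1 /u; ring.
    by apply: rpredD; [apply: dvdz_mull|apply/dvdz_mulr/dvdz_mulr].
  rewrite Em mulzK //; apply: (mulIf (_ : n%:Z ^+ 2 != 0)); first by rewrite sqrf_eq0.
  have -> : (k ^+ 2 - D%:Z) * n%:Z ^+ 2 = (k * n%:Z) ^+ 2 - D%:Z * n%:Z ^+ 2 by ring.
  have -> : m * c * n%:Z ^+ 2 = (m * n%:Z) * (c * n%:Z) by ring.
  by rewrite -Em -Ec Ekk -det; ring.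
Qed.

Section Pair.
Variables (D S n1 n2 : nat) (R u1 v1 u1' v1' u2 v2 u2' v2' c k : int).
Hypotheses (h1 : lattice_data D S n1 R u1 v1 u1' v1' c k)
           (h2 : lattice_data D S n2 R u2 v2 u2' v2' c k).
Hypotheses (n10 : (0 < n1)%N) (n20 : (0 < n2)%N).

(* (U, V) stands for e1 conj(e2) / c *)
Let U := v2' * u1 - v2 * u1'.
Let V := v2' * v1 - v2 * v1'.

Lemma pair_mem1 : (n1%:Z %| U - R * V)%Z.
Proof.
have -> : U - R * V = v2' * (u1 - R * v1) - v2 * (u1' - R * v1') by rewrite /U /V; ring.
by apply: rpredB; apply: dvdz_mull; [exact: ld_mem h1|exact: ld_mem' h1].
Qed.

Lemma ld_u' n u v u' v' : (0 < n)%N -> lattice_data D S n R u v u' v' c k ->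
  c * u' = u * k + D%:Z * v /\ c * v' = u + k * v.
Proof.
move=> n0 h; have nz : n%:Z != 0 by lia.
split; apply: (mulIf nz).
  have -> : c * u' * n%:Z = u' * (c * n%:Z) by ring.
  have -> : (u * k + D%:Z * v) * n%:Z = u * (k * n%:Z) + D%:Z * v * n%:Z by ring.
  by rewrite (ld_c h) (ld_k h) -(ld_det h); ring.
have -> : c * v' * n%:Z = v' * (c * n%:Z) by ring.
have -> : (u + k * v) * n%:Z = (k * n%:Z) * v + u * n%:Z by ring.
by rewrite (ld_c h) (ld_k h) -(ld_det h); ring.
Qed.

Lemma pair_cU : c * U = u1 * u2 - D%:Z * v1 * v2.
Proof.
have [E1 E2] := ld_u' n10 h1; have [E3 E4] := ld_u' n20 h2.
have -> : c * U = (c * v2') * u1 - v2 * (c * u1') by rewrite /U; ring.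
by rewrite E1 E4; ring.
Qed.

Lemma pair_cV : c * V = u2 * v1 - v2 * u1.
Proof.
have [E1 E2] := ld_u' n10 h1; have [E3 E4] := ld_u' n20 h2.
have -> : c * V = (c * v2') * v1 - v2 * (c * v1') by rewrite /V; ring.
by rewrite E2 E4; ring.
Qed.

Lemma pair_norm : U ^+ 2 - D%:Z * V ^+ 2 = n1%:Z * n2%:Z.
Proof.
apply: (mulfI (_ : c ^+ 2 != 0)); first by rewrite sqrf_eq0 (ld_c0 h1).
have -> : c ^+ 2 * (U ^+ 2 - D%:Z * V ^+ 2) = (c * U) ^+ 2 - D%:Z * (c * V) ^+ 2 by ring.
have -> : c ^+ 2 * (n1%:Z * n2%:Z) = (c * n1%:Z) * (c * n2%:Z) by ring.
by rewrite pair_cU pair_cV (ld_c h1) (ld_c h2); ring.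
Qed.

Hypothesis same_sign : 0 <= (u1 * v1) * (u2 * v2).

(** With p = u2^2 D v1^2 and q = u1^2 D v2^2, equal signs make D (c V)^2 the square of sqrt(p) -
    sqrt(q), which is at most |p - q|; and p - q = c (n2 D v1^2 - n1 D v2^2) is bounded by the size
    of the short vectors. Without the sign condition the sum of the roots would occur. *)
Lemma pair_size : D%:Z * V ^+ 2 <= S%:Z * (n1%:Z * n2%:Z).
Proof.
have aux (x y z : int) : (x <= z) || (y <= z) -> x + y - (z + z) <= `|x - y|.
  by clear; case/orP; lia.
pose W1 := D%:Z * v1 ^+ 2; pose W2 := D%:Z * v2 ^+ 2.
pose t := D%:Z * ((u1 * v1) * (u2 * v2)).
have W10 : 0 <= W1 by rewrite mulr_ge0 ?sqr_ge0.
have W20 : 0 <= W2 by rewrite mulr_ge0 ?sqr_ge0.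
have t0 : 0 <= t by rewrite mulr_ge0.
set p := u2 ^+ 2 * W1; set q := W2 * u1 ^+ 2.
have p0 : 0 <= p by rewrite mulr_ge0 ?sqr_ge0.
have q0 : 0 <= q by rewrite mulr_ge0 ?sqr_ge0.
have tt : t ^+ 2 = p * q by rewrite /t /p /q /W1 /W2; ring.
have E : D%:Z * (c * V) ^+ 2 = p + q - (t + t).
  by rewrite pair_cV /t /p /q /W1 /W2; ring.
have pq : p - q = c * (n2%:Z * W1 - n1%:Z * W2).
  have e1 : u1 ^+ 2 = c * n1%:Z + W1 by rewrite (ld_c h1) subrK.
  have e2 : u2 ^+ 2 = c * n2%:Z + W2 by rewrite (ld_c h2) subrK.
  by rewrite /p /q e1 e2; ring.
have bpq : `|p - q| <= `|c| * (n1%:Z * n2%:Z * S%:Z).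
  rewrite pq normrM ler_wpM2l //.
  have a1 : n2%:Z * W1 <= n1%:Z * n2%:Z * S%:Z.
    by rewrite [n1%:Z * _]mulrC -mulrA ler_wpM2l // (ld_v h1).
  have a2 : n1%:Z * W2 <= n1%:Z * n2%:Z * S%:Z.
    by rewrite -mulrA ler_wpM2l // (ld_v h2).
  have a3 : 0 <= n2%:Z * W1 by rewrite mulr_ge0.
  have a4 : 0 <= n1%:Z * W2 by rewrite mulr_ge0.
  clear -a1 a2 a3 a4; lia.
have tmin : (p <= t) || (q <= t).
  rewrite -[p <= t]negbK -[q <= t]negbK -negb_and -!ltNge; apply/negP => /andP[tp tq].
  have : t ^+ 2 < p * q by rewrite expr2; apply: ltr_pM.
  by rewrite tt ltxx.
have le1 : p + q - (t + t) <= `|p - q| by apply: aux.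
have c0 : 0 < `|c| by rewrite normr_gt0 (ld_c0 h1).
have : `|c| * (D%:Z * V ^+ 2) <= n1%:Z * n2%:Z * S%:Z.
  rewrite -(ler_pM2l c0); apply: le_trans bpq; apply: le_trans le1; rewrite -E.
  by rewrite exprMn -[c ^+ 2]real_normK ?num_real // le_eqVlt; apply/orP; left; apply/eqP; ring.
rewrite mulrC [n1%:Z * _ * _]mulrC; apply: le_trans.
by apply: ler_peMr; [rewrite mulr_ge0 ?sqr_ge0|rewrite -gtz0_ge1].
Qed.
End Pair.

Lemma pair_mem2 (D S n1 n2 : nat) (R u1 v1 u1' v1' u2 v2 u2' v2' c k : int) :
  lattice_data D S n1 R u1 v1 u1' v1' c k -> lattice_data D S n2 R u2 v2 u2' v2' c k ->
  (0 < n1)%N -> (0 < n2)%N ->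
  (n2%:Z %| (v2' * u1 - v2 * u1') + R * (v2' * v1 - v2 * v1'))%Z.
Proof.
move=> h1 h2 n10 n20; have := pair_mem1 v1 v1' h2.
have -> : v1' * u2 - v1 * u2' = v2' * u1 - v2 * u1'.
  have E1 := pair_cU h2 h1 n20 n10; have E2 := pair_cU h1 h2 n10 n20.
  by apply: (mulfI (ld_c0 h1)); rewrite E1 E2; ring.
have -> : v1' * v2 - v1 * v2' = - (v2' * v1 - v2 * v1') by ring.
by rewrite mulrN opprK.
Qed.

Lemma pfactor_cancel (p b g x : nat) : prime p -> (0 < g)%N -> (p ^ b %| g * x)%N ->
  (p ^ (b - logn p g) %| x)%N.
Proof.
move=> pp g0; have [->|x0] := posnP x; first by rewrite dvdn0.
by rewrite !pfactor_dvdn ?muln_gt0 ?g0 // lognM //; lia.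
Qed.

Lemma rsym_congr q (C D C' D' : int) : prime q -> (q%:Z %| C - C')%Z -> (q%:Z %| D - D')%Z ->
  rsym q C D = rsym q C' D'.
Proof.
move=> qp hC hD; apply: (sym_congr qp).
  by rewrite opprD addrACA; apply: rpredD.
by rewrite -mulrBr; apply: dvdz_mull.
Qed.

Lemma rsym_scale q (c C D : int) : prime q -> q != 3%N -> ~~ (q%:Z %| c)%Z ->
  ~~ (q%:Z %| C ^+ 2 + 3 * D ^+ 2)%Z -> rsym q (c * C) (c * D) = rsym q C D.
Proof.
move=> qp q3 qc qN; rewrite /rsym -mulrDr mulrCA sym_scale //.
by rewrite (_ : enorm _ _ = C ^+ 2 + 3 * D ^+ 2) // /enorm; ring.
Qed.

Lemma rsymN q (C D : int) : prime q -> q != 3%N ->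
  ~~ (q%:Z %| C ^+ 2 + 3 * D ^+ 2)%Z -> rsym q (- C) D = - rsym q C D.
Proof.
move=> qp q3 qN.
have NE : enorm (C + D) (2 * D) = C ^+ 2 + 3 * D ^+ 2 by rewrite /enorm; ring.
rewrite /rsym -sym_conj ?NE // -[in RHS](sym_scale (c := - 1) qp q3) ?NE.
- by congr sym; ring.
- by rewrite dvdzE /= dvdn1 gtn_eqF ?prime_gt1.
- by rewrite (_ : enorm _ _ = C ^+ 2 + 3 * D ^+ 2) // /enorm; ring.
Qed.

(* The ideal classes of the lattices of norms n1 and n2 agree modulo 54, so the
   residue symbols of a primary Eisenstein integer along n1 and n2 agree. *)
Lemma pair_reciprocity (d n1 n2 : nat) (R U V y z a : int) :
  normalized d y z a -> (0 < n1)%N -> (0 < n2)%N ->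
  (forall p, prime p -> (p %| n1 * n2)%N ->
     [/\ ~~ (p %| 6 * d)%N & ~~ (p%:Z %| a)%Z]) ->
  ((n1 * n2)%N%:Z %| R ^+ 2 - (3 * d)%N%:Z)%Z ->
  (n1%:Z %| U - R * V)%Z -> (n2%:Z %| U + R * V)%Z ->
  U ^+ 2 - (3 * d)%N%:Z * V ^+ 2 = (n1 * n2)%N%:Z -> (54 %| V)%Z ->
  addext (fun p => rsym p (z * R) y) n1 = addext (fun p => rsym p (z * R) y) n2.
Proof.
move=> norm n10 n20 hp hR mem1 mem2 hN V54.
set D := (3 * d)%N in hR hN *.
have N0 : (0 < n1 * n2)%N by rewrite muln_gt0 n10.
(* The reciprocity law is applied to the coprime part (U', V') and its norm n; valuations satisfy 2
   v(g) + v(n) = v(n1) + v(n2). *)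
pose g := gcdz U V.
have g0 : g != 0.
  apply/eqP => g0; move: hN; have [-> ->] : U = 0 /\ V = 0.
    by move/eqP: g0; rewrite gcdz_eq0 => /andP[/eqP-> /eqP->].
  by rewrite expr0n mulr0 subr0 => /eqP; rewrite eq_sym; move: N0; lia.
have /dvdzP[U' EU] : (g %| U)%Z := dvdz_gcdl U V.
have /dvdzP[V' EV] : (g %| V)%Z := dvdz_gcdr U V.
have cUV : coprimez U' V'.
  apply/eqP/(mulfI g0); rewrite mulr1 [in RHS]/g [in RHS]EU [in RHS]EV.
  by rewrite -![_ * g]mulrC -mulz_gcdr.
pose n := U' ^+ 2 - D%:Z * V' ^+ 2.
have gn : g ^+ 2 * n = (n1 * n2)%N%:Z by rewrite -hN EU EV /n; ring.
have n_gt0 : 0 < n.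
  have h : 0 < g ^+ 2 by rewrite lt0r sqrf_eq0 g0 sqr_ge0.
  by rewrite -(pmulr_rgt0 _ h) gn ltz_nat.
have gnN : (`|g| ^ 2 * `|n| = n1 * n2)%N by rewrite -abszX -abszM gn.
have ag0 : (0 < `|g|)%N by rewrite absz_gt0.
have an0 : (0 < `|n|)%N by rewrite absz_gt0 gt_eqF.
have hpn p : prime p -> (p%:Z %| n)%Z -> (p %| n1 * n2)%N.
  by move=> pp; rewrite dvdzE /= -gnN => h; rewrite dvdn_mull.
have hpg p : prime p -> (p%:Z %| g)%Z -> (p %| n1 * n2)%N.
  by move=> pp; rewrite dvdzE /= -gnN => h; rewrite dvdn_mulr // expnS dvdn_mulr.
have n6 p : prime p -> (p %| n1 * n2)%N -> [/\ p != 2%N, p != 3%N & ~~ (p %| d)%N].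
  move=> pp /(hp p pp)[h _]; split; apply: contra h.
  - by move/eqP->; rewrite dvdn_mulr.
  - by move/eqP->; rewrite dvdn_mulr.
  - by move=> h; rewrite dvdn_mull.
have V54' : (54 %| V')%Z.
  have cg : coprimez 54 g.
    apply: coprimez_prime => p pp p54 pg; have [p2 p3 _] := n6 p pp (hpg p pp pg).
    have : (p %| 2 * (3 * (3 * 3)))%N by move: p54; rewrite dvdzE.
    rewrite !Euclid_dvdM // !(dvdn_prime2 pp) // (negPf p2) (negPf p3) //.
  by rewrite -(Gauss_dvdzl _ cg) -EV.
have cna : coprimez (U' ^+ 2 - 3 * d%:Z * V' ^+ 2) a.
  apply: coprimez_prime => p pp; rewrite -[3 * d%:Z]/((3 * d)%N%:Z) -/D -/n => pn pa.
  by have [_ /negP] := hp p pp (hpn p pp pn).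
have := cubic_reciprocity norm cUV V54' cna.
rewrite -[3 * d%:Z]/((3 * d)%N%:Z) -/D -/n.
set f' := fun p => rsym p (z * U') (y * V'); set f := fun p => rsym p (z * R) y.
move=> rec; apply/eqP; rewrite -subr_eq0; apply/eqP; rewrite -[RHS]rec.
pose N := (n1 + n2 + `|n|).+1%N.
have [w1 w2 w3] : [/\ (n1 < N)%N, (n2 < N)%N & (`|n| < N)%N].
  by rewrite /N; move: `|n|%N; clear => m; split; lia.
rewrite (addext_widen _ w1) (addext_widen _ w2) (addext_widen _ w3).
rewrite -sumrB; apply: eq_bigr => p pp.
have [normE y3 z27 Heq] := norm.
have val : (2 * logn p `|g| + logn p `|n| = logn p n1 + logn p n2)%N.
  by rewrite -(lognM _ n10 n20) -gnN lognM ?expn_gt0 ?ag0 // lognX.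
have [pN|pN] := boolP (p %| n1 * n2)%N; last first.
  have nd m : (m %| n1 * n2)%N -> logn p m = 0%N.
    move=> mN; apply/eqP; rewrite -leqn0 leqNgt logn_gt0 mem_primes negb_and.
    by apply/orP; right; rewrite negb_and; apply/orP; right; apply: contra pN => /dvdn_trans; apply.
  rewrite !nd ?mulr0n ?subrr //; [|by rewrite dvdn_mull|by rewrite dvdn_mulr].
  by rewrite -gnN dvdn_mull.
have [p2 p3 pd] := n6 p pp pN; have [_ pa] := hp p pp pN.
have pD : ~~ (p%:Z %| D%:Z)%Z.
  by rewrite dvdzE /= Euclid_dvdM // negb_or pd (dvdn_prime2 pp) // p3.
have pR : ~~ (p%:Z %| R)%Z.
  apply: contra pD => pR; have -> : D%:Z = R ^+ 2 - (R ^+ 2 - D%:Z) by ring.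
  apply: rpredB; first exact: dvdz_exp2.
  by apply: dvdz_trans hR; rewrite dvdzE.
have dRm m : (p ^ m %| n1 * n2)%N -> ((p ^ m)%N%:Z %| R ^+ 2 - D%:Z)%Z.
  by move=> h; apply: dvdz_trans hR; rewrite dvdzE.
have pm1 : (p ^ (logn p n1) %| `|g| * `|(U' - R * V')%R|)%N.
  rewrite -abszM (_ : g * _ = U - R * V); last by rewrite EU EV; ring.
  by apply: dvdn_trans (pfactor_dvdnn p n1) _; rewrite -[(_ %| _)%N]/(n1%:Z %| _)%Z.
have pm2 : (p ^ (logn p n2) %| `|g| * `|(U' + R * V')%R|)%N.
  rewrite -abszM (_ : g * _ = U + R * V); last by rewrite EU EV; ring.
  by apply: dvdn_trans (pfactor_dvdnn p n2) _; rewrite -[(_ %| _)%N]/(n2%:Z %| _)%Z.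
have qm1 := pfactor_cancel pp ag0 pm1.
have qm2 := pfactor_cancel pp ag0 pm2.
have nE : n = (U' - R * V') * (U' + R * V') + V' ^+ 2 * (R ^+ 2 - D%:Z) by rewrite /n; ring.
have nE' : (U' - R * V') * (U' + R * V') = n - V' ^+ 2 * (R ^+ 2 - D%:Z) by rewrite /n; ring.
have lN : logn p (n1 * n2) = (logn p n1 + logn p n2)%N by rewrite lognM.
have div_n m : (m <= logn p n1 + logn p n2)%N ->
   (p ^ m %| `|(U' - R * V')%R|)%N || (p ^ m %| `|(U' + R * V')%R|)%N -> (m <= logn p `|n|)%N.
  move=> mN h; rewrite -pfactor_dvdn //; rewrite -[(_ %| _)%N]/((p ^ m)%N%:Z %| n)%Z nE.
  apply: rpredD; last by apply: dvdz_mull; apply: dRm; rewrite pfactor_dvdn // lN.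
  by case/orP: h => h; [apply: dvdz_mulr|apply: dvdz_mull]; rewrite dvdzE.
have b1 : (logn p n1 - logn p `|g| <= logn p `|n|)%N.
  by apply: div_n; [apply: leq_trans (leq_subr _ _) (leq_addr _ _)|rewrite qm1].
have b2 : (logn p n2 - logn p `|g| <= logn p `|n|)%N.
  by apply: div_n; [apply: leq_trans (leq_subr _ _) (leq_addl _ _)|rewrite qm2 orbT].
have pyz : ~~ (p%:Z %| (z * R) ^+ 2 + 3 * y ^+ 2)%Z.
  have -> : (z * R) ^+ 2 + 3 * y ^+ 2 = z ^+ 2 * (R ^+ 2 - D%:Z) + 3 * (y ^+ 2 + d%:Z * z ^+ 2).
    by rewrite /D PoszM; ring.
  rewrite addrC dvdz_addl_eq; last by apply: dvdz_mull; have := dRm 1%N; rewrite expn1; apply.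
  rewrite prime_dvdzM // prime_dvdz3 // (negPf p3) /=.
  case: Heq => [->|[-> _ _]]; first by apply: contra pa => /(prime_dvdzX pp).
  by rewrite prime_dvdzM // prime_dvdz4 // (negPf p2) /=; apply: contra pa => /(prime_dvdzX pp).
have [pn|pn] := boolP (p%:Z %| n)%Z; last first.
  have n0' : logn p `|n| = 0%N by apply/eqP; rewrite -leqn0 leqNgt logn_gt0 mem_primes pp an0.
  have -> : logn p n1 = logn p n2 by clear -val b1 b2 n0'; lia.
  by rewrite n0' mulr0n subrr.
have pV' : ~~ (p%:Z %| V')%Z.
  apply/negP => h; apply: (coprimez_primeP cUV pp _ h); apply: (prime_dvdzX (n := 2) pp).
  rewrite -[U' ^+ 2](subrK (D%:Z * V' ^+ 2)); apply: rpredD => //.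
  by apply: dvdz_mull; apply: dvdz_exp2.
have pp12 : (p%:Z %| (U' - R * V') * (U' + R * V'))%Z.
  rewrite nE'; apply: rpredB => //; apply: dvdz_mull.
  by have := dRm 1%N; rewrite expn1; apply.
(* At a prime p of n exactly one of U' - R V' and U' + R V' is divisible by p. It fixes the sign in
   v(n) = +-(v(n1) - v(n2)) and, through U' = +-R V', the same sign in front of the symbol, so the
   two signs cancel. *)
have nboth : (p%:Z %| U' - R * V')%Z -> (p%:Z %| U' + R * V')%Z -> False.
  move=> e1 e2; have : (p%:Z %| 2 * (R * V'))%Z.
    have -> : 2 * (R * V') = (U' + R * V') - (U' - R * V') by ring.
    exact: rpredB.
  by rewrite !prime_dvdzM // prime_dvdz2 // (negPf p2) (negPf pR) (negPf pV').
have pn1 : (0 < logn p `|n|)%N by rewrite logn_gt0 mem_primes pp an0.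
have exp0 (m : nat) (x : int) : (p ^ m %| `|x|)%N -> ~~ (p%:Z %| x)%Z -> m = 0%N.
  case: m => // m h /negP[]; rewrite dvdzE /=; apply: dvdn_trans h.
  by rewrite expnS dvdn_mulr.
rewrite /f' /f; move: pp12; rewrite prime_dvdzM // => /orP[e1|e2].
  have e2 : ~~ (p%:Z %| U' + R * V')%Z by apply/negP => e2; apply: nboth.
  have z2 := exp0 _ _ qm2 e2.
  have l1 : (logn p n1 = logn p `|n| + logn p n2)%N by clear -val b1 b2 z2; lia.
  have -> : rsym p (z * U') (y * V') = rsym p (z * R) y.
    rewrite -(rsym_scale pp p3 pV' pyz); apply: rsym_congr => //.
      have -> : z * U' - V' * (z * R) = z * (U' - R * V') by ring.
      exact: dvdz_mull.
    by rewrite mulrC subrr dvdz0.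
  by rewrite l1 mulrnDr addrK.
have e1 : ~~ (p%:Z %| U' - R * V')%Z by apply/negP => e1; apply: nboth.
have z1 := exp0 _ _ qm1 e1.
have l2 : (logn p n2 = logn p `|n| + logn p n1)%N by clear -val b1 b2 z1; lia.
have -> : rsym p (z * U') (y * V') = - rsym p (z * R) y.
  rewrite -(rsymN pp p3 pyz).
  have pyz' : ~~ (p%:Z %| (- (z * R)) ^+ 2 + 3 * y ^+ 2)%Z by rewrite sqrrN.
  rewrite -(rsym_scale pp p3 pV' pyz'); apply: rsym_congr => //.
    have -> : z * U' - V' * - (z * R) = z * (U' + R * V') by ring.
    exact: dvdz_mull.
  by rewrite mulrC subrr dvdz0.
by rewrite l2 mulrnDr mulNrn opprD addrCA subrr addr0.
Qed.

(** * The reflection bound *)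

Definition nroots (N : int) (c : nat) : nat :=
  count (fun k : nat => (c%:Z %| k%:Z ^+ 2 - N)%Z) (iota 0 c).

Lemma PoszX (m n : nat) : (m ^ n)%N%:Z = m%:Z ^+ n.
Proof. by elim: n => // n IH; rewrite expnS PoszM IH exprS. Qed.

Lemma addextX (V : zmodType) (f : nat -> V) t n : (0 < t)%N ->
  addext f (t ^ n) = addext f t *+ n.
Proof.
move=> t0; elim: n => [|n IH]; first by rewrite expn0 addext1.
by rewrite expnS addextM ?expn_gt0 ?t0 // IH mulrS.
Qed.

Lemma addext_prod (V : zmodType) (f : nat -> V) (I : finType) (g : I -> nat) :
  (forall i, 0 < g i)%N -> addext f (\prod_i g i) = \sum_i addext f (g i).
Proof.
move=> g0; have : (0 < \prod_i g i)%N /\ addext f (\prod_i g i) = \sum_i addext f (g i).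
  apply: (big_ind2 (fun (x : nat) (y : V) => (0 < x)%N /\ addext f x = y)) => //.
    by rewrite addext1.
  move=> x1 y1 x2 y2 [h1 E1] [h2 E2]; rewrite muln_gt0 h1 h2; split=> //.
  by rewrite addextM // E1 E2.
by case.
Qed.

Lemma prime_dvd_prod (I : finType) (g : I -> nat) r : prime r ->
  (r %| \prod_i g i)%N -> exists i, (r %| g i)%N.
Proof.
move=> rp h; have : [exists i, (r %| g i)%N].
  move: h; apply: contraLR; rewrite negb_exists => /forallP h.
  rewrite -prime_coprime //; apply: (big_ind (fun x => coprime r x)).
  - exact: coprimen1.
  - by move=> x y hx hy; rewrite coprimeMr hx.
  - by move=> i _; rewrite prime_coprime.
by case/existsP => i; exists i.
Qed.

(** The symbol matrix has distinct columns, so its rank r satisfies n <= 3^r. Every vector of F_3^r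
    is realised by a product [B v] of powers of the [p k] with exponents at most 2, and a factor q^3
    does not change symbols. This gives 3^r times [size Q] ideals; their reduced forms, refined by
    signs and residues modulo 54, turn out to be distinct. *)
Lemma reflection_bound (d n S T : nat) (y z a : 'I_n -> int) (p : 'I_T -> nat)
    (Q : seq nat) (R : int) :
  (forall x : int, x ^+ 2 != (3 * d)%N%:Z) -> (3 * d <= S ^ 2)%N ->
  (forall l, normalized d (y l) (z l) (a l)) ->
  (forall k, prime (p k)) -> uniq Q -> (forall q, q \in Q -> prime q) ->
  (forall r, (r \in Q) || (r \in codom p) ->
      ~~ (r %| 6 * d)%N /\ forall l, ~~ (r%:Z %| a l)%Z) ->
  (((\prod_k p k ^ 2 * \prod_(q <- Q) q ^ 3) ^ 2)%N%:Z %| R ^+ 2 - (3 * d)%N%:Z)%Z ->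
  (forall l l', l != l' -> exists k, rsym (p k) (z l * R) (y l) != rsym (p k) (z l' * R) (y l')) ->
  (forall q, q \in Q -> S * q ^ 6 < 3 * d)%N ->
  (n * size Q <= 4 * 54 ^ 2 * \sum_(1 <= c < S.+1) nroots (3 * d)%N c)%N.
Proof.
move=> Dns DS hnorm pP uQ QP hr hR hsep hsize.
set D := (3 * d)%N in Dns DS hr hR hsize *.
set W := (_ * _)%N in hR.
pose M : 'M['F_3]_(T, n) := \matrix_(k, l) rsym (p k) (z l * R) (y l).
pose r := \rank M.
have [C [Rb [MCR Cfull Rfree]]] : exists (C : 'M['F_3]_(T, r)) (Rb : 'M['F_3]_(r, n)),
    [/\ M = C *m Rb, row_full C & row_free Rb].
  by exists (col_base M), (row_base M); rewrite mulmx_base col_base_full row_base_free.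
have n_le : (n <= 3 ^ r)%N.
  have inj : injective (fun l : 'I_n => col l Rb).
    move=> l l' E; apply/eqP/negPn/negP => /hsep[k /eqP[]].
    have RE j : Rb j l = Rb j l' by move/colP/(_ j): E; rewrite !mxE.
    have : M k l = M k l' by rewrite MCR !mxE; apply: eq_bigr => j _; rewrite RE.
    by rewrite !mxE.
  have := leq_card _ inj; rewrite card_ord card_mx card_Fp //= muln1; exact.
(* [chi v] lists exponents of the primes [p k] for which the symbols of the resulting ideal, as a
   function of l, are v times the row basis. *)
pose chi (v : 'rV['F_3]_r) : 'rV['F_3]_T := v *m pinvmx C.
have chiC v : chi v *m C = v by rewrite /chi mulmxKpV // submx_full.
have chiM v : chi v *m M = v *m Rb by rewrite MCR mulmxA chiC.
have chi3 v k : (chi v 0%R k < 3)%N by exact: ltn_ord (chi v 0%R k).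
pose B v := (\prod_k p k ^ (chi v 0%R k))%N.
pose X := ('rV['F_3]_r * 'I_(size Q))%type.
pose q (x : X) := nth 0%N Q x.2.
pose N (x : X) := (B x.1 * q x ^ 3)%N.
have qQ x : q x \in Q by rewrite mem_nth.
have qp x : prime (q x) := QP _ (qQ x).
have B0 v : (0 < B v)%N.
  by apply: (big_ind (fun x => 0 < x)%N) => // [x1 x2 h1 h2|k _]; rewrite ?muln_gt0 ?h1 // expn_gt0 prime_gt0.
have N0 x : (0 < N x)%N by rewrite muln_gt0 B0 expn_gt0 prime_gt0.
have NW x : (N x %| W)%N.
  apply: dvdn_mul.
    rewrite /B; apply: (big_ind2 (fun x y => x %| y)%N) => // [x1 x2 y1 y2|k _]; first exact: dvdn_mul.
    by apply: dvdn_exp2l; rewrite -ltnS chi3.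
  by rewrite (big_rem (q x)) //= dvdn_mulr.
have NE (x : X) : (N x)%:Z = (B x.1)%:Z * (q x)%:Z ^+ 3 by rewrite /N PoszM PoszX.
have NR x x' : ((N x * N x')%N%:Z %| R ^+ 2 - D%:Z)%Z.
  by apply: dvdz_trans hR; rewrite dvdzE /= -mulnn dvdn_mul.
have NR1 x : ((N x)%:Z %| R ^+ 2 - D%:Z)%Z.
  by apply: dvdz_trans (NR x x); rewrite dvdzE /= dvdn_mulr.
have primeB v r' : prime r' -> (r' %| B v)%N -> r' \in codom p.
  move=> rp /(prime_dvd_prod rp) [k]; rewrite Euclid_dvdX // dvdn_prime2 // => /andP[/eqP-> _].
  exact: codom_f.
have primeN x r' : prime r' -> (r' %| N x)%N -> (r' \in Q) || (r' \in codom p).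
  move=> rp; rewrite Euclid_dvdM // => /orP[/primeB->//|]; first by rewrite orbT.
  by rewrite Euclid_dvdX // dvdn_prime2 // => /andP[/eqP-> _]; rewrite qQ.
have /fin_all_exists [e eP] : forall x : X, exists t : int * int * int * int * int * int,
    let: (u, v, u', v', c, k) := t in lattice_data D S (N x) R u v u' v' c k.
  move=> x; have [u [v [u' [v' [c [k h]]]]]] := lattice_data_exists Dns DS (N0 x) (NR1 x).
  by exists (u, v, u', v', c, k).
(* The code of a lattice: the signs of c and of u v (4 choices), v and v' modulo 54 (54^2 choices),
   and the form (|c|, k). For two lattices with equal codes the residues make V divisible by 54, and
   the signs make it small. *)
pose F (x : X) := let: (u, v, u', v', c, k) := e x in
  ((c < 0, 0 <= u * v), (`|(v %% 54)%Z|%N, `|(v' %% 54)%Z|%N), (`|c|%N, `|k|%N)).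
pose bb := [:: true; false].
pose roots := [seq (c, k) | c <- iota 1 S, k <- [seq k <- iota 0 c | (c%:Z %| k%:Z ^+ 2 - D%:Z)%Z]].
pose L1 := [seq (x, y) | x <- bb, y <- bb].
pose L2 := [seq (x, y) | x <- iota 0 54, y <- iota 0 54].
pose LL := [seq (x, y) | x <- [seq (x, y) | x <- L1, y <- L2], y <- roots].
have szL : size LL = (4 * 54 ^ 2 * \sum_(1 <= c < S.+1) nroots D%:Z c)%N.
  rewrite /LL !size_allpairs size_allpairs_dep /=; congr (_ * _)%N.
  rewrite sumnE big_map /index_iota subn1 /=; apply: eq_bigr => c _.
  by rewrite size_filter.
have FL x : F x \in LL.
  rewrite /F; move: (eP x); move: (e x) => [[[[[u v] u'] v'] c] k] h.
  have [h1 h2] := andP (ld_kc h); have c0 := ld_c0 h; have cS := ld_cS h.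
  have inbb (b : bool) : b \in bb by case: b.
  have m54 (m : int) : `|(m %% 54)%Z|%N \in iota 0 54.
    by rewrite mem_iota; clear; lia.
  apply: allpairs_f; first by apply: allpairs_f; apply: allpairs_f.
  apply: allpairs_f_dep; first by rewrite mem_iota; clear -c0 cS; lia.
  rewrite mem_filter mem_iota; apply/andP; split; last by clear -h1 h2; lia.
  by have := ld_root h; rewrite !dvdzE absz_nat gez0_abs.
have Finj : injective F.
  move=> x1 x2; rewrite /F; move: (eP x1) (eP x2).
  move: (e x1) (e x2) => [[[[[u1 v1] u1'] v1'] c1] k1] [[[[[u2 v2] u2'] v2'] c2] k2] h1 h2.
  case=> Ec0 Es Ev Ev' Ec Ek.
  have cc : c2 = c1 by clear -Ec0 Ec; lia.
  have kk : k2 = k1.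
    by have [a1 _] := andP (ld_kc h1); have [a2 _] := andP (ld_kc h2); clear -a1 a2 Ek; lia.
  subst c2 k2.
  have ss : 0 <= (u1 * v1) * (u2 * v2).
    move: Es; case: (boolP (0 <= u1 * v1)) => e1 /esym e2; first by rewrite mulr_ge0.
    by move/negbT: e2; rewrite -!ltNge in e1 * => e2; rewrite ltW // nmulr_rgt0.
  set V := v2' * v1 - v2 * v1'; set U := v2' * u1 - v2 * u1'.
  have V54 : (54 %| V)%Z.
    have w1 : (54 %| v1 - v2)%Z by clear -Ev; lia.
    have w2 : (54 %| v2' - v1')%Z by clear -Ev'; lia.
    have -> : V = v2' * (v1 - v2) + v2 * (v2' - v1') by rewrite /V; ring.
    by apply: rpredD; apply: dvdz_mull.
  have m1 : ((N x1)%:Z %| U - R * V)%Z := pair_mem1 v2 v2' h1.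
  have m2 : ((N x2)%:Z %| U + R * V)%Z := pair_mem2 h1 h2 (N0 x1) (N0 x2).
  have nrm : U ^+ 2 - D%:Z * V ^+ 2 = (N x1 * N x2)%N%:Z := pair_norm h1 h2 (N0 x1) (N0 x2).
  have sz : D%:Z * V ^+ 2 <= S%:Z * ((N x1)%:Z * (N x2)%:Z) := pair_size h1 h2 (N0 x1) (N0 x2) ss.
  have hP r' : prime r' -> (r' %| N x1 * N x2)%N -> (r' \in Q) || (r' \in codom p).
    by move=> rp; rewrite Euclid_dvdM // => /orP[]/(primeN _ _ rp).
  have ext x l : addext (fun r' => rsym r' (z l * R) (y l)) (N x) = (x.1 *m Rb) 0 l.
    rewrite -chiM mxE /N addextM ?B0 ?expn_gt0 ?prime_gt0 // addextX ?prime_gt0 //.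
    have -> (t : 'F_3) : t *+ 3 = 0 by rewrite -mulr_natr (pchar_Fp_0 (isT : prime 3)) mulr0.
    rewrite addr0 addext_prod; last by move=> k; rewrite expn_gt0 prime_gt0.
    apply: eq_bigr => k _; rewrite addextX ?prime_gt0 // addext_prime // [M _ _]mxE.
    by move: (chi x.1 0 k) => e0; rewrite -[e0 in RHS]natr_Zp mulr_natl.
  have v12 : x1.1 = x2.1.
    apply: (row_free_inj Rfree); apply/rowP => l; rewrite -!ext.
    apply: (pair_reciprocity (hnorm l) (N0 x1) (N0 x2) _ (NR x1 x2) m1 m2 nrm V54).
    move=> r' rp /(hP r' rp)/hr[h3 h4]; by split.
  (* B divides U - R V and U + R V, hence 2 R V, and it is prime to 2 R. *)
  have BV : ((B x1.1)%:Z %| V)%Z.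
    have b1 : ((B x1.1)%:Z %| U - R * V)%Z by apply: dvdz_trans m1; rewrite dvdzE /= dvdn_mulr.
    have b2 : ((B x1.1)%:Z %| U + R * V)%Z.
      by apply: dvdz_trans m2; rewrite dvdzE /= v12 dvdn_mulr.
    have cB : coprimez (B x1.1)%:Z (2 * R).
      apply: coprimez_prime => r' rp; rewrite dvdzE /= => rB.
      have hin : (r' \in Q) || (r' \in codom p) by rewrite (primeB _ _ rp rB) orbT.
      have [h3 _] := hr r' hin; rewrite prime_dvdzM // prime_dvdz2 // => /orP[/eqP r2|rR].
        by move: h3; rewrite r2 dvdn_mulr.
      have : (r'%:Z %| D%:Z)%Z.
        have -> : D%:Z = R ^+ 2 - (R ^+ 2 - D%:Z) by ring.
        apply: rpredB; first exact: dvdz_exp2.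
        by apply: dvdz_trans (NR1 x1); rewrite dvdzE /= dvdn_mulr.
      rewrite dvdzE /= => rD; move/negP: h3; apply.
      by apply: dvdn_trans rD _; rewrite /D -[6%N]/(2 * 3)%N -mulnA dvdn_mull.
    rewrite -(Gauss_dvdzr _ cB).
    have -> : 2 * R * V = (U + R * V) - (U - R * V) by ring.
    exact: rpredB.
  have /dvdzP[V' EV] := BV.
  (* Otherwise D B^2 <= D V^2 <= S B^2 q1^3 q2^3, whereas S q^6 < D for both primes. *)
  have V'0 : V' = 0.
    apply/eqP; rewrite -sqrf_eq0; apply/negPn/negP => V'0.
    have V'1 : 1 <= V' ^+ 2 by rewrite -gtz0_ge1 lt0r V'0 sqr_ge0.
    have Bz : 0 < (B x1.1)%:Z by rewrite ltz_nat.
    have : D%:Z * V' ^+ 2 <= S%:Z * ((q x1)%:Z ^+ 3 * (q x2)%:Z ^+ 3).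
      rewrite -(ler_pM2l Bz) -(ler_pM2l Bz).
      have -> : (B x1.1)%:Z * ((B x1.1)%:Z * (D%:Z * V' ^+ 2)) = D%:Z * V ^+ 2 by rewrite EV; ring.
      apply: le_trans sz _; rewrite (NE x1) (NE x2) -v12.
      by rewrite le_eqVlt; apply/orP; left; apply/eqP; ring.
    have : S%:Z * ((q x1)%:Z ^+ 3 * (q x2)%:Z ^+ 3) < D%:Z.
      rewrite -!PoszX -!PoszM ltz_nat.
      have := hsize _ (qQ x1); have := hsize _ (qQ x2).
      case/orP: (leq_total (q x1) (q x2)) => le12 s2 s1.
        apply: leq_ltn_trans s2; rewrite leq_mul2l -[6%N]/(3 + 3)%N expnD leq_mul2r.
        by rewrite leq_exp2r // le12 !orbT.
      apply: leq_ltn_trans s1; rewrite leq_mul2l -[6%N]/(3 + 3)%N expnD leq_mul2l.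
      by rewrite leq_exp2r // le12 !orbT.
    have : D%:Z <= D%:Z * V' ^+ 2 by rewrite ler_peMr.
    move: (S%:Z * _) (D%:Z * _) => i j; clear; lia.
  (* With V = 0 the product of the norms is the square U^2, while for q1 != q2 its valuation at q1
     is odd. *)
  have q12 : q x1 = q x2.
    apply/eqP/negPn/negP => ne.
    have V0 : V = 0 by rewrite EV V'0 mul0r.
    have U2 : (`|U| ^ 2 = N x1 * N x2)%N.
      by move/(congr1 absz): nrm; rewrite V0 expr0n mulr0 subr0 abszX.
    have U0 : (0 < `|U|)%N.
      rewrite lt0n; apply/eqP => U0; move: U2; rewrite U0 => /esym/eqP.
      by rewrite muln_eq0 !gtn_eqF.
    have l0 : logn (q x1) (q x2) = 0%N by rewrite logn_prime // (negPf ne).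
    have := congr1 (logn (q x1)) U2.
    have LN x : logn (q x1) (N x) = (logn (q x1) (B x.1) + 3 * logn (q x1) (q x))%N.
      by rewrite /N lognM ?B0 ?expn_gt0 ?prime_gt0 // lognX.
    rewrite lognX lognM // !LN l0 -v12 (logn_prime (q x1) (qp x1)) eqxx; clear; lia.
  rewrite (surjective_pairing x1) (surjective_pairing x2) v12; congr (_, _).
  apply: val_inj; apply/eqP; rewrite -(nth_uniq 0%N (ltn_ord _) (ltn_ord _) uQ).
  exact/eqP.
rewrite -szL; apply: (@leq_trans #|{: X}|).
  by rewrite card_prod card_ord card_mx card_Fp //= mul1n leq_mul2r n_le orbT.
rewrite cardE -(size_map F); apply: uniq_leq_size.
  by rewrite (map_inj_uniq Finj) enum_uniq.
by move=> t /mapP[x _ ->].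
Qed.

(** * Roots of T^3 - 3bT - 2c modulo primes *)

Lemma frobD (F : comNzRingType) p (x y : F) : p \in [pchar F] ->
  (x + y) ^+ p = x ^+ p + y ^+ p.
Proof.
by move=> Fp; apply: exprDn_pchar; rewrite pnatE ?(pcharf_prime Fp).
Qed.

(** Cardano's formula: x and b / x are cube roots of c + u and c - u, and their sum is a root of T^3
    - 3 b T - 2 c. *)
Lemma cardano (F : fieldType) (x b c u : F) : x != 0 -> x ^+ 3 = c + u ->
  c ^+ 2 - u ^+ 2 = b ^+ 3 -> (x + b / x) ^+ 3 - 3%:R * b * (x + b / x) - 2%:R * c = 0.
Proof.
move=> x0 x3 cu; have E : (b / x) ^+ 3 = c - u.
  have n0 : c + u != 0 by rewrite -x3 expf_neq0.
  apply: (mulIf n0); rewrite -{1}x3 expr_div_n divfK ?expf_neq0 // -cu; ring.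
have -> : (x + b / x) ^+ 3 - 3%:R * b * (x + b / x) - 2%:R * c =
   x ^+ 3 + (b / x) ^+ 3 - 2%:R * c + 3%:R * (x + b / x) * (x * (b / x) - b) by ring.
by rewrite E x3 mulrCA divff // mulr1; ring.
Qed.

Lemma div_div_cancel (F : fieldType) (b y : F) : b != 0 -> y != 0 ->
  b * b * b / b = b / (y / b) * y.
Proof. by move=> b0 y0; field; rewrite b0 y0. Qed.

Lemma div_twist (F : fieldType) (b x e : F) : b != 0 -> x != 0 -> e != 0 ->
  e * x = e ^+ 2 * (b / (e * (b / x))).
Proof. by move=> b0 x0 e0; field; rewrite b0 x0 e0. Qed.

Lemma conj_root_twist (F : fieldType) (b x o : F) : b != 0 -> x != 0 -> o ^+ 3 = 1 ->
  o ^+ 2 * (b / x) + b / (o ^+ 2 * (b / x)) = o * x + b / (o * x).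
Proof.
move=> b0 x0 o3; have o0 : o != 0.
  by apply/eqP => o00; move/eqP: o3; rewrite o00 expr0n eq_sym oner_eq0.
have -> : o ^+ 2 = o^-1 by apply: (mulfI o0); rewrite divff // -exprS o3.
by field; rewrite b0 x0 o0.
Qed.

Definition cubic_at (b c t : int) : int := t ^+ 3 - 3 * b * t - 2 * c.

Lemma cubic_at_Fbar p (b c : int) (t : Fbar p) : prime p ->
  t ^+ p = t -> t ^+ 3 - 3%:R * b%:~R * t - 2%:R * c%:~R = 0 ->
  exists n : nat, t = n%:R /\ (p%:Z %| cubic_at b c n)%Z.
Proof.
move=> pp tp t0; have Fp := pchar_Fbar pp.
have [n tn] := pchar_frob_fixed Fp tp; exists n; split=> //.
rewrite -(intr_pchar _ Fp) /cubic_at !rmorphB rmorphXn !rmorphM /=.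
by rewrite -[n%:Z%:~R]/(n%:R) -tn; apply/eqP.
Qed.

Section Cardano.
Variables (p d : nat) (b c f : int).
Hypotheses (pp : prime p) (p2 : (2 < p)%N) (p3 : p != 3%N).
Hypotheses (cfb : c ^+ 2 + d%:Z * f ^+ 2 = b ^+ 3) (pb : ~~ (p%:Z %| b)%Z).
Let F := Fbar p.
Let Fp : p \in [pchar F] := pchar_Fbar pp.
Let o : F := omega p.
Let op : 3.-primitive_root o := omega_prim pp p3.
Let th : F := o + o + 1.

Lemma th_sq : th ^+ 2 = - 3%:R.
Proof.
have o0 := prim3_eq0 op; have E : o ^+ 2 = - o - 1.
  by apply/eqP; rewrite -subr_eq0 -[X in _ == X]o0; apply/eqP; ring.
by rewrite /th; ring: E.
Qed.

Lemma th_neq0 : th != 0.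
Proof.
rewrite -sqrf_eq0 th_sq oppr_eq0 -(dvdn_pcharf Fp) dvdn_prime2 //.
Qed.

Lemma intr_b_neq0 : b%:~R != 0 :> F. Proof. by rewrite (intr_pchar _ Fp). Qed.

Lemma omega_frob : o ^+ p = if (p %% 3 == 1)%N then o else o ^+ 2.
Proof.
have : ~~ (3 %| p)%N by rewrite dvdn_prime2 // eq_sym.
rewrite -(prim_expr_mod op) /dvdn; move: (ltn_pmod p (isT : 0 < 3)%N).
by case: (p %% 3)%N => [|[|[|]]].
Qed.

Lemma th_frob : th ^+ p = if (p %% 3 == 1)%N then th else - th.
Proof.
have o0 := prim3_eq0 op.
rewrite /th !frobD // expr1n omega_frob; case: ifP => // _.
have E : o ^+ 2 = - o - 1.
  by apply/eqP; rewrite -subr_eq0 -[X in _ == X]o0; apply/eqP; ring.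
by ring: E.
Qed.

Lemma mod3_prime : (p %% 3 == 1)%N = false -> (p %% 3 = 2)%N.
Proof.
have : ~~ (3 %| p)%N by rewrite dvdn_prime2 // eq_sym.
rewrite /dvdn; move: (ltn_pmod p (isT : 0 < 3)%N).
by case: (p %% 3)%N => [|[|[|]]].
Qed.

Variables (s : F).
Hypothesis (ss : s ^+ 2 = - d%:R).
Let al : F := c%:~R + f%:~R * s.
Let al' : F := c%:~R - f%:~R * s.

Lemma al_norm : al * al' = b%:~R ^+ 3.
Proof.
have := congr1 (fun x : int => x%:~R : F) cfb.
rewrite rmorphD rmorphM !rmorphXn /= => <-.
have -> : al * al' = c%:~R ^+ 2 - f%:~R ^+ 2 * s ^+ 2 by rewrite /al /al'; ring.
by rewrite ss -[d%:Z%:~R]/(d%:R); ring.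
Qed.

Lemma al_neq0 : al != 0.
Proof.
have : al * al' != 0 by rewrite al_norm expf_neq0 // intr_b_neq0.
by rewrite mulf_eq0 negb_or => /andP[].
Qed.

Lemma al_cu : c%:~R ^+ 2 - (f%:~R * s) ^+ 2 = b%:~R ^+ 3 :> F.
Proof. by rewrite -al_norm /al /al'; ring. Qed.

Lemma intr_frobX (x : int) : x%:~R ^+ p = x%:~R :> F. Proof. exact: intr_frob. Qed.

Lemma frobN (x : F) : (- x) ^+ p = - x ^+ p.
Proof.
apply/eqP; rewrite -subr_eq0 opprK addrC -frobD // subrr expr0n.
by rewrite gtn_eqF ?prime_gt0.
Qed.

Lemma al_frob1 : s ^+ p = s -> al ^+ p = al.
Proof. by move=> sp; rewrite /al frobD // exprMn !intr_frobX sp. Qed.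

Lemma al_frob2 : s ^+ p = - s -> al ^+ p = al'.
Proof. by move=> sp; rewrite /al frobD // exprMn !intr_frobX sp mulrN. Qed.

(** Here 3 d is a non-residue. A cube root x of alpha with x + b / x fixed by Frobenius is explicit:
    a power of alpha if p = 2 mod 3, where cubing is bijective on F_p, and alpha^((p+2)/3) / b if p
    = 1 mod 3, where alpha^(p+1) = b^3. *)
Lemma cubic_root_nonres : (s * th) ^+ p = - (s * th) ->
  exists n : nat, (p%:Z %| cubic_at b c n)%Z.
Proof.
move=> xp; have a0 := al_neq0; have b0 := intr_b_neq0.
suff [x [x0 x3 xp']] : exists x : F, [/\ x != 0, x ^+ 3 = al & (x ^+ p = x) \/ (x ^+ p = b%:~R / x)].
  have [|//|n [_ h]] := @cubic_at_Fbar p b c (x + b%:~R / x) pp; last by exists n.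
    rewrite frobD // exprMn exprVn intr_frobX; case: xp' => ->; first by [].
    by rewrite invf_div mulrCA divff // mulr1 addrC.
  exact: cardano x0 x3 al_cu.
have sp : s ^+ p = if (p %% 3 == 1)%N then - s else s.
  apply: (mulIf th_neq0); move: xp; rewrite exprMn th_frob; case: ifP => _.
    by move=> ->; ring.
  by move=> h; apply: oppr_inj; rewrite -mulrN.
case: ifP sp => p1 sp.
  have a' := al_frob2 sp; pose k := (p %/ 3)%N.
  have pE : (p + 1 + 1 = 3 * k.+1)%N by move/eqP: p1; rewrite /k; clear; lia.
  have ap : al ^+ (p + 1) = b%:~R ^+ 3 by rewrite exprD expr1 a' mulrC al_norm.
  exists (al ^+ k.+1 / b%:~R); split.
  - by rewrite mulf_neq0 ?invr_eq0 ?expf_neq0.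
  - rewrite expr_div_n -exprM mulnC -pE exprD ap expr1.
    by rewrite [_ * al]mulrC mulfK // expf_neq0.
  - right; have Y0 : al ^+ k.+1 != 0 by rewrite expf_neq0.
    have YP : (al ^+ k.+1) ^+ p * al ^+ k.+1 = b%:~R * b%:~R * b%:~R.
      rewrite -exprSr -(addn1 p) -exprM mulnC exprM ap -exprM -pE !exprD !expr1.
      by rewrite intr_frobX.
    rewrite expr_div_n intr_frobX; apply: (mulIf Y0); rewrite mulrAC YP.
    exact: div_div_cancel.
have a' := al_frob1 sp; pose k := (p %/ 3)%N.
have pE : (p = 3 * k + 2)%N by have := mod3_prime p1; rewrite /k; clear; lia.
have a1 : al ^+ (3 * k + 1) = 1.
  by apply: (mulIf a0); rewrite mul1r -exprSr -addn1 -addnA -[in RHS]a'; congr (_ ^+ _); rewrite [RHS]pE.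
exists (al ^+ (2 * k + 1)); split.
- by rewrite expf_neq0.
- rewrite -exprM (_ : (2 * k + 1) * 3 = (3 * k + 1) * 2 + 1)%N; last by clear; lia.
  by rewrite exprD exprM a1 expr1n mul1r expr1.
- by left; rewrite -exprM mulnC exprM a'.
Qed.

(** The equality of powers puts a cube root x of alpha into F_(p^2). Frobenius then sends x to x or
    to b / x, so both x and omega x yield roots fixed by Frobenius; these differ unless alpha equals
    its conjugate. *)
Lemma cubic_roots_res : s ^+ (p ^ 2) = s -> al ^+ symexp p = al' ^+ symexp p ->
  (s * th) ^+ p = s * th -> f%:~R * s != 0 ->
  exists n1 n2 : nat, [/\ (p%:Z %| cubic_at b c n1)%Z, (p%:Z %| cubic_at b c n2)%Z &
     ~~ (p%:Z %| n1%:Z - n2%:Z)%Z].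
Proof.
move=> sp2 sym0 xp fs0; have a0 := al_neq0; have b0 := intr_b_neq0.
have /closed_rootP[x] : size ('X^3 - al%:P : {poly F}) != 1%N by rewrite size_XnsubC.
rewrite /root !hornerE subr_eq0 => /eqP x3.
have x0 : x != 0 by apply: contraNneq a0 => x0; rewrite -x3 x0 expr0n.
have a'E : al' = (b%:~R / x) ^+ 3.
  by apply: (mulfI a0); rewrite al_norm expr_div_n x3 mulrC divfK.
have mE := symexpE pp p3; have qE := sqr_pred pp.
have bp2 : b%:~R ^+ (p ^ 2) = b%:~R :> F by rewrite expnS expn1 exprM !intr_frobX.
(* This power has square 1 by [sym0] and cube 1 because alpha lies in F_(p^2). *)
have X1 : x ^+ (p ^ 2).-1 = 1.
  have bp1 : b%:~R ^+ (p ^ 2).-1 = 1 :> F.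
    by apply: (mulIf b0); rewrite -exprSr qE bp2 mul1r.
  have e2 : (x ^+ (p ^ 2).-1) ^+ 2 = 1.
    have e : x ^+ (p ^ 2).-1 = 1 / x ^+ (p ^ 2).-1.
      by move: sym0; rewrite -x3 a'E -!exprM mulnC -mE expr_div_n bp1.
    by rewrite expr2 {1}e mul1r mulVf // expf_neq0.
  have e3 : (x ^+ (p ^ 2).-1) ^+ 3 = 1.
    rewrite -exprM mulnC exprM x3; apply: (mulIf a0); rewrite -exprSr qE mul1r.
    have ip2 (n : int) : n%:~R ^+ (p ^ 2) = n%:~R :> F by rewrite expnS expn1 exprM !intr_frobX.
    rewrite /al exprDn_pchar; last by rewrite pnatX pnatE // Fp.
    by rewrite exprMn !ip2 sp2.
  by move: e3; rewrite exprS e2 mulr1.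
have xp2 : x ^+ (p ^ 2) = x by rewrite -qE exprSr X1 mul1r.
have o3 := prim_expr_order op.
have eP (e : F) : e ^+ 3 = 1 -> e ^+ p = if (p %% 3 == 1)%N then e else e ^+ 2.
  move=> e3; have -> : e ^+ p = e ^+ (p %% 3).
    by rewrite {1}(divn_eq p 3) exprD mulnC exprM e3 expr1n mul1r.
  by case: ifP => [/eqP->|/mod3_prime->] //; rewrite expr1.
have key : (x ^+ p = if (p %% 3 == 1)%N then x else b%:~R / x).
  have sp : s ^+ p = if (p %% 3 == 1)%N then s else - s.
    apply: (mulIf th_neq0); move: xp; rewrite exprMn th_frob; case: ifP => _; first by [].
    by move=> h; apply: oppr_inj; rewrite -mulrN h; ring.
  case: ifP sp => p1 sp.
    have a' := al_frob1 sp.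
    have [e xE] : exists e, x ^+ p = e * x by exists (x ^+ p / x); rewrite divfK.
    have e3 : e ^+ 3 = 1.
      apply: (mulIf a0); rewrite mul1r -[in RHS]a' -{1}x3 -exprMn -xE -x3.
      by rewrite -!exprM mulnC.
    have ep := eP e e3; rewrite p1 in ep.
    have : e ^+ 2 = 1.
      apply: (mulIf x0); rewrite mul1r -[RHS]xp2 expnS expn1 exprM xE exprMn ep xE; ring.
    by move=> e2; move: e3; rewrite exprS e2 mulr1 => e1; rewrite xE e1 mul1r.
  have a' := al_frob2 sp.
  have y0 : b%:~R / x != 0 by rewrite mulf_neq0 ?invr_eq0.
  have [e xE] : exists e, x ^+ p = e * (b%:~R / x) by exists (x ^+ p / (b%:~R / x)); rewrite divfK.
  have e3 : e ^+ 3 = 1.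
    apply: (mulIf (_ : al' != 0)); first by rewrite a'E expf_neq0.
    by rewrite mul1r -[in RHS]a' a'E -exprMn -xE -x3 -!exprM mulnC.
  have e0 : e != 0 by apply/eqP => e00; move/eqP: e3; rewrite e00 expr0n eq_sym oner_eq0.
  have ep := eP e e3; rewrite p1 in ep.
  have : e = 1.
    apply: (mulIf x0); rewrite mul1r -[RHS]xp2 expnS expn1 exprM xE exprMn ep.
    rewrite expr_div_n intr_frobX xE; exact: div_twist.
  by move=> e1; rewrite xE e1 mul1r.
have bx0 : b%:~R / x != 0 by rewrite mulf_neq0 ?invr_eq0.
have [||n1 [E1 h1]] := @cubic_at_Fbar p b c (x + b%:~R / x) pp.
- rewrite frobD // exprMn exprVn intr_frobX key; case: ifP => // _.
  by rewrite invf_div mulrCA divff // mulr1 addrC.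
- exact: cardano x0 x3 al_cu.
have ox0 : o * x != 0 by rewrite mulf_neq0 // (prim_root_neq0 _ op).
have ox3 : (o * x) ^+ 3 = al by rewrite exprMn o3 mul1r.
have o0 : o != 0 by rewrite (prim_root_neq0 _ op).
have oV : o^-1 = o ^+ 2 by apply: (mulfI o0); rewrite divff // -exprS o3.
have [||n2 [E2 h2]] := @cubic_at_Fbar p b c (o * x + b%:~R / (o * x)) pp.
- rewrite frobD // !exprMn exprVn exprMn intr_frobX omega_frob key; case: ifP => // _.
  exact: conj_root_twist.
- exact: cardano ox0 ox3 al_cu.
exists n1, n2; split=> //.
rewrite -(intr_pchar _ Fp) rmorphB /= -[n1%:Z%:~R]/(n1%:R) -[n2%:Z%:~R]/(n2%:R) -E1 -E2.
apply/eqP => E.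
have : (1 - o) * (x - o ^+ 2 * (b%:~R / x)) = 0.
  rewrite -[RHS]E invfM oV.
  have -> : (1 - o) * (x - o ^+ 2 * (b%:~R / x)) = x + o ^+ 3 * (b%:~R / x) - (o * x + b%:~R * (o ^+ 2 / x)) by ring.
  by rewrite o3 mul1r.
move/eqP; rewrite mulf_eq0 !subr_eq0 => /orP[/eqP o1|/eqP x1].
  by have := prim_root_neq1 (isT : (1 < 3)%N) op; rewrite -o1 eqxx.
case/negP: fs0; have : al = al'.
  rewrite a'E -x3 {1}x1 exprMn -exprM mulnC exprM o3 expr1n mul1r //.
rewrite /al /al' => /addrI /eqP; rewrite -subr_eq0 opprK -mulr2n -mulr_natl mulf_eq0.
by rewrite -(dvdn_pcharf Fp) (dvdn_prime2 pp) // gtn_eqF.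
Qed.
End Cardano.

From mathcomp Require Import reals sequences exp.
(** * Mertens' theorems, also modulo 3 *)

Lemma prime_prod_dvd (s : seq nat) m : uniq s -> {in s, forall p, prime p && (p %| m)%N} ->
  (\prod_(p <- s) p %| m)%N.
Proof.
elim: s => [|p s IH] /=; first by rewrite big_nil dvd1n.
move=> /andP[ps us] h; rewrite big_cons Gauss_dvd.
  have /andP[_ ->] := h p (mem_head _ _); apply: IH => // q qs.
  by apply: h; rewrite inE qs orbT.
rewrite big_seq; apply: (big_ind (fun x => coprime p x)).
- exact: coprimen1.
- by move=> x y hx hy; rewrite coprimeMr hx.
- move=> q qs; have /andP[pp _] := h p (mem_head _ _).
  have /andP[qp _] : prime q && (q %| m)%N by apply: h; rewrite inE qs orbT.
  by rewrite prime_coprime // dvdn_prime2 //; apply: contraNneq ps => ->.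
Qed.

Lemma bin_le_exp2 n k : ('C(n, k) <= 2 ^ n)%N.
Proof.
elim: n k => [|n IH] [|k] //; first by rewrite bin0 expn_gt0.
by rewrite binS expnS mul2n -addnn leq_add.
Qed.

(** Halving: the primes in (k, 2k] divide the binomial coefficient of 2k over k, at most 4^k. The
    generous base 16 absorbs a factor n when n is odd. *)
Lemma primorial_le n : (\prod_(0 <= p < n.+1 | prime p) p <= 16 ^ n)%N.
Proof.
elim/ltn_ind: n => n IH; have [n1|n1] := leqP n 1.
  by case: n n1 {IH} => [|[|]] // _; rewrite unlock.
pose k := n./2; have kE : n = (odd n + k.*2)%N by rewrite odd_double_half.
have kn : (k < n)%N by rewrite /k; lia.
have k0 : (0 < k)%N by rewrite /k; lia.
have step : (\prod_(0 <= p < (k.*2).+1 | prime p) p <= 16 ^ k * 4 ^ k)%N.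
  rewrite (@big_cat_nat _ _ _ k.+1) //=; last by lia.
  apply: leq_mul; first exact: IH.
  apply: (@leq_trans 'C(k.*2, k)); last by rewrite (leq_trans (bin_le_exp2 _ _)) // -mul2n expnM.
  apply: dvdn_leq; first by rewrite bin_gt0; lia.
  rewrite -big_filter; apply: prime_prod_dvd; first by rewrite filter_uniq // iota_uniq.
  move=> p; rewrite mem_filter mem_index_iota => /andP[pp /andP[kp pk]]; rewrite pp /=.
  have : (p %| 'C(k.*2, k) * (k`! * (k.*2 - k)`!))%N.
    by rewrite bin_fact ?dvdn_fact ?prime_gt0 //; lia.
  have nf m : (m < p)%N -> (p %| m`!)%N = false.
    by elim: m => [|m IHm] mp; rewrite ?Euclid_dvd1 // factS Euclid_dvdM // IHm ?orbF ?(ltnW mp) // gtnNdvd.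
  by rewrite !Euclid_dvdM // !nf ?orbF //; lia.
have k16 : (16 ^ k * 4 ^ k * 4 ^ k = 16 ^ k.*2)%N.
  by rewrite -mulnA -expnMn -expnD addnn.
case: (boolP (odd n)) kE => _ /= kE.
  have nE : n = k.*2.+1 by rewrite kE.
  rewrite big_mkcond big_nat_recr //= -big_mkcond /= {1}nE.
  have small : (n <= 16 * 4 ^ k)%N.
    have : (k < 4 ^ k)%N by apply: ltn_expl.
    by rewrite nE; lia.
  rewrite [X in (_ <= 16 ^ X)%N]nE expnS -k16.
  have [A0 B0] : (0 < 16 ^ k * 4 ^ k /\ 0 < 4 ^ k)%N by rewrite muln_gt0 !expn_gt0.
  rewrite mulnCA; case: ifP => _; first by apply: leq_mul.
  by rewrite muln1 (leq_trans step) // leq_pmulr // muln_gt0.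
rewrite {1}kE add0n (leq_trans step) // kE add0n -k16 leq_pmulr // expn_gt0 //.
Qed.

Lemma sum_multiples (V : nmodType) (g : nat -> V) d n : (0 < d)%N ->
  \sum_(1 <= k < n.+1 | (d %| k)%N) g k = \sum_(1 <= j < (n %/ d).+1) g (d * j)%N.
Proof.
move=> d0; elim: n => [|n IH]; first by rewrite div0n !big_nil.
rewrite big_mkcond big_nat_recr //= -big_mkcond /= IH divnS //.
case: (boolP (d %| n.+1)%N) => [dn|dn]; last by rewrite addr0.
rewrite add1n [RHS]big_nat_recr //=; congr (_ + g _).
have -> : (n %/ d).+1 = (n.+1 %/ d)%N by rewrite divnS // dn.
by rewrite mulnC divnK.
Qed.

Lemma count_le_logn n p k : (0 < k <= n)%N -> prime p ->
  logn p k = (\sum_(1 <= i < n.+1) (p ^ i %| k))%N.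
Proof.
move=> /andP[k0 kn] pp.
under eq_bigr => i _ do rewrite pfactor_dvdn //.
have : (logn p k <= n)%N by apply: leq_trans kn; rewrite ltnW // ltn_logl.
elim: n {kn} => [|n IH]; first by rewrite big_nil leqn0 => /eqP.
rewrite leq_eqVlt big_nat_recr //= => /orP[/eqP E|]; last first.
  by rewrite ltnS => h; rewrite -IH // leqNgt ltnS h addn0.
rewrite E ltnSn addn1; congr _.+1.
rewrite (eq_big_nat _ _ (F2 := fun => 1%N)); first by rewrite sum_nat_const_nat subn1 muln1.
by move=> i /andP[_ h]; rewrite ltnW.
Qed.

Section Mertens.
Variable R : realType.
Implicit Types (f g : nat -> R).

Definition lnn (n : nat) : R := ln n%:R.

Lemma lnn_ge0 n : 0 <= lnn n.
Proof.
case: n => [|n]; first by rewrite /lnn ln0.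
by rewrite /lnn ln_ge0 // ler1n.
Qed.

Lemma lnnM m n : (0 < m)%N -> (0 < n)%N -> lnn (m * n) = lnn m + lnn n.
Proof. by move=> m0 n0; rewrite /lnn natrM lnM // posrE ltr0n. Qed.

Lemma lnn1 : lnn 1 = 0. Proof. by rewrite /lnn ln1. Qed.

Lemma ler_lnn m n : (0 < m)%N -> (m <= n)%N -> lnn m <= lnn n.
Proof.
by move=> m0 mn; rewrite /lnn ler_ln ?posrE ?ltr0n ?ler_nat // (leq_trans m0).
Qed.

Lemma lnnS_sub n : (0 < n)%N -> lnn n.+1 - lnn n <= n%:R^-1.
Proof.
move=> n0; have n0' : 0 < n%:R :> R by rewrite ltr0n.
have -> : lnn n.+1 = lnn n + ln (1 + n%:R^-1).
  rewrite /lnn -lnM ?posrE ?addr_gt0 ?invr_gt0 //.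
  by rewrite mulrDr mulr1 divff ?gt_eqF // -natr1.
rewrite addrAC subrr add0r; apply: le_ln1Dx.
by apply: lt_trans (_ : 0 < _); rewrite ?ltrN10 // invr_gt0.
Qed.

Lemma lnn_sum_primes n k : (0 < k <= n)%N ->
  lnn k = \sum_(0 <= p < n.+1 | prime p) \sum_(1 <= i < n.+1 | (p ^ i %| k)%N) lnn p.
Proof.
move=> kn; have /andP[k0 kn'] := kn.
have <- : addext lnn k = lnn k.
  apply: addext_total => //; first exact: lnn1.
  move=> q s qp qs; have s0 := dvdn_gt0 k0 (dvdn_trans (dvdn_mull q (dvdnn s)) qs).
  by rewrite lnnM // prime_gt0.
rewrite (addext_widen _ (_ : k < n.+1)%N) //; apply: eq_bigr => p pp.
rewrite (count_le_logn kn pp) -sumrMnr [RHS]big_mkcond /=.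
by apply: eq_bigr => i _; case: (p ^ i %| k)%N.
Qed.

(** Chebyshev's identity with a weight: g = 1 leads to Mertens' theorem, and g(k) = chi3(k) / k to
    its version modulo 3. *)
Lemma sum_lnn_primes g n :
  \sum_(1 <= k < n.+1) g k * lnn k =
  \sum_(0 <= p < n.+1 | prime p) \sum_(1 <= i < n.+1)
     lnn p * \sum_(1 <= j < (n %/ p ^ i).+1) g (p ^ i * j)%N.
Proof.
transitivity (\sum_(1 <= k < n.+1) \sum_(0 <= p < n.+1 | prime p)
   \sum_(1 <= i < n.+1) (if (p ^ i %| k)%N then g k * lnn p else 0)).
  apply: eq_big_nat => k /andP[k0 kn]; rewrite (@lnn_sum_primes n) ?k0 // mulr_sumr.
  by apply: eq_bigr => p _; rewrite mulr_sumr big_mkcond.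
rewrite exchange_big /=; apply: eq_bigr => p pp.
rewrite exchange_big /=; apply: eq_bigr => i _.
rewrite -big_mkcond /= sum_multiples ?expn_gt0 ?prime_gt0 // mulr_sumr.
by apply: eq_bigr => j _; rewrite mulrC.
Qed.

Definition theta n : R := \sum_(0 <= p < n.+1 | prime p) lnn p.
Definition mertens n : R := \sum_(0 <= p < n.+1 | prime p) lnn p / p%:R.

Lemma theta_le n : theta n <= n%:R * lnn 16.
Proof.
have E m : theta m = lnn (\prod_(0 <= p < m.+1 | prime p) p) /\ (0 < \prod_(0 <= p < m.+1 | prime p) p)%N.
  rewrite /theta; apply: (big_rec2 (fun (x : R) (y : nat) => x = lnn y /\ (0 < y)%N)).
    by rewrite lnn1.
  move=> p x y pp [-> y0]; rewrite muln_gt0 y0 prime_gt0 //; split=> //.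
  by rewrite lnnM // prime_gt0.
have [-> P0] := E n; apply: (le_trans (ler_lnn P0 (primorial_le n))).
by rewrite /lnn natrX lnXn // mulr_natl.
Qed.

Lemma sum_lnn_le n : \sum_(1 <= k < n.+1) lnn k <= n%:R * lnn n.
Proof.
apply: (@le_trans _ _ (\sum_(1 <= k < n.+1) lnn n)).
  by apply: ler_sum_nat => k /andP[k0 kn]; apply: ler_lnn.
by rewrite sumr_const_nat subn1 /= mulr_natl.
Qed.

Lemma sum_lnn_ge n : n%:R * lnn n - n%:R <= \sum_(1 <= k < n.+1) lnn k.
Proof.
elim: n => [|n IH]; first by rewrite mul0r subrr big_nil.
rewrite big_nat_recr //=; have [->|n0] := posnP n.
  by rewrite big_nil lnn1 mulr0 add0r addr0 oppr_le0.
have h := lnnS_sub n0; have n0' : 0 < n%:R :> R by rewrite ltr0n.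
have : n%:R * (lnn n.+1 - lnn n) <= 1.
  by rewrite mulrC -ler_pdivlMr // mul1r.
by move: IH; rewrite -natr1; lra.
Qed.

Lemma sum_lnn_sq n : \sum_(2 <= k < n.+1) lnn k / (k%:R * (k%:R - 1)) <= 2%:R.
Proof.
have [n1|n1] := leqP n 1; first by rewrite big_geq // ltnS.
(* A discrete primitive: h k - h (k+1) dominates ln(k+1) / (k (k+1)), and h 1 = 2. *)
pose h k : R := (lnn k + 2%:R) / k%:R.
apply: (@le_trans _ _ (\sum_(1 <= k < n) (h k - h k.+1))).
  rewrite big_add1 /=; apply: ler_sum_nat => k /andP[k0 _].
  have k0' : 0 < k%:R :> R by rewrite ltr0n.
  have k1 : 1 <= k%:R :> R by rewrite ler1n.
  have hl := lnnS_sub k0; have l0 := lnn_ge0 k.+1.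
  have Ek : k.+1%:R = k%:R + 1 :> R by rewrite natr1.
  rewrite /h Ek addrK.
  set x := k%:R in k0' k1 hl *; set L := lnn k.+1 in hl l0 *; set L' := lnn k in hl *.
  have x1 : x + 1 != 0 by lra.
  have x0 : x != 0 by lra.
  have e1 : (L' + 2%:R) / x - (L + 2%:R) / (x + 1) - L / ((x + 1) * x) =
     ((x + 1) * (L' - L + x^-1) + (1 - x^-1)) / (x * (x + 1)).
    by field; rewrite ?x0 ?x1.
  have e2 : 0 <= ((x + 1) * (L' - L + x^-1) + (1 - x^-1)) / (x * (x + 1)).
    apply: divr_ge0; last by nra.
    apply: addr_ge0; first by apply: mulr_ge0; lra.
    by rewrite subr_ge0 invf_le1.
  by lra.
rewrite (eq_bigr (fun k => - h k.+1 - (- h k))); last by move=> k _; rewrite opprK addrC.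
rewrite (telescope_sumr (fun k => - h k)); last by rewrite ltnW.
rewrite /= opprK addrC /h lnn1 add0r divr1 gerBl divr_ge0 // addr_ge0 // lnn_ge0 //.
Qed.

Lemma geometric_le p n : (1 < p)%N ->
  \sum_(1 <= i < n.+1) (p%:R ^+ i)^-1 <= (p%:R - 1 : R)^-1.
Proof.
move=> p1; have p1' : 1 < p%:R :> R by rewrite ltr1n.
suff -> : \sum_(1 <= i < n.+1) (p%:R ^+ i)^-1 = (1 - (p%:R ^+ n)^-1) / (p%:R - 1 : R).
  rewrite ler_pdivrMr ?subr_gt0 // mulVf ?gt_eqF ?subr_gt0 //.
  by rewrite gerBl invr_ge0 exprn_ge0 // ler0n.
elim: n => [|n IH]; first by rewrite big_nil expr0 invr1 subrr mul0r.
have pn0 : p%:R ^+ n != 0 :> R by rewrite expf_neq0 // gt_eqF // (lt_trans ltr01).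
have p0 : p%:R != 0 :> R by rewrite gt_eqF // (lt_trans ltr01).
have pp0 : p%:R - 1 != 0 :> R by rewrite subr_eq0 gt_eqF.
by rewrite big_nat_recr //= IH exprS; field; rewrite p0 pn0 pp0.
Qed.

Lemma divn_le_div m k : (0 < k)%N -> ((m %/ k)%:R : R) <= m%:R / k%:R.
Proof.
move=> k0; rewrite ler_pdivlMr ?ltr0n // -natrM ler_nat; exact: leq_trunc_div.
Qed.

Lemma divn_ge_div m k : (0 < k)%N -> m%:R / k%:R - 1 <= (m %/ k)%:R :> R.
Proof.
move=> k0; rewrite lerBlDr ler_pdivrMr ?ltr0n // natr1 -natrM ler_nat.
exact/ltnW/ltn_ceil.
Qed.

Lemma tail_split p : (1 < p)%N -> (p%:R - 1 : R)^-1 = p%:R^-1 + (p%:R * (p%:R - 1))^-1.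
Proof.
move=> p1; have p1' : 1 < p%:R :> R by rewrite ltr1n.
have pp0 : p%:R - 1 != 0 :> R by rewrite subr_eq0 gt_eqF.
have p0 : p%:R != 0 :> R by rewrite gt_eqF // (lt_trans ltr01).
by field; rewrite p0 pp0.
Qed.

Lemma sum_primes_tail n :
  \sum_(0 <= p < n.+1 | prime p) lnn p / (p%:R * (p%:R - 1)) <= 2%:R.
Proof.
have [n1|n1] := leqP n 1.
  by case: n n1 => [|[|]] // _; rewrite unlock /= ler0n.
apply: le_trans (sum_lnn_sq n).
rewrite (@big_cat_nat _ _ _ 2) //=; last by rewrite (leq_trans n1).
rewrite big_ltn_cond //= big_ltn_cond //= big_geq // !add0r.
rewrite big_mkcond /=; apply: ler_sum_nat => k /andP[k2 _]; case: ifP => // _.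
rewrite divr_ge0 ?lnn_ge0 // mulr_ge0 ?ler0n // subr_ge0 ler1n ltnW //.
Qed.

(** ln n! >= n ln n - n is compared with n times the sum of ln p / (p - 1); replacing 1 / (p - 1) by
    1 / p costs at most 2. *)
Lemma mertens_lower n : (0 < n)%N -> lnn n - 3%:R <= mertens n.
Proof.
move=> n0; have n0' : 0 < n%:R :> R by rewrite ltr0n.
have H : \sum_(1 <= k < n.+1) lnn k <= n%:R * (mertens n + 2%:R).
  have -> : \sum_(1 <= k < n.+1) lnn k = \sum_(1 <= k < n.+1) 1 * lnn k.
    by apply: eq_bigr => k _; rewrite mul1r.
  rewrite (sum_lnn_primes (fun=> 1)).
  apply: (@le_trans _ _ (\sum_(0 <= p < n.+1 | prime p)
     n%:R * (lnn p / p%:R + lnn p / (p%:R * (p%:R - 1))))); last first.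
    rewrite -mulr_sumr ler_pM2l // big_split /= lerD2l; exact: sum_primes_tail.
  apply: ler_sum => p pp; have p1 := prime_gt1 pp; have p0 := prime_gt0 pp.
  apply: (@le_trans _ _ (\sum_(1 <= i < n.+1) (n%:R * lnn p) * (p%:R ^+ i)^-1)).
    apply: ler_sum => i _; rewrite sumr_const_nat subn1 /= [n%:R * _]mulrC -mulrA.
    apply: ler_wpM2l; first exact: lnn_ge0.
    by rewrite -natrX divn_le_div // expn_gt0 p0.
  rewrite -mulr_sumr -mulrDr mulrA; apply: ler_wpM2l.
    by rewrite mulr_ge0 // lnn_ge0.
  by rewrite -tail_split // geometric_le.
have := le_trans (sum_lnn_ge n) H.
rewrite -{2}[n%:R]mulr1 -mulrBr ler_pM2l //; lra.
Qed.

Lemma mertens_upper n : (0 < n)%N -> mertens n <= lnn n + lnn 16.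
Proof.
move=> n0; have n0' : 0 < n%:R :> R by rewrite ltr0n.
have H : n%:R * mertens n - theta n <= \sum_(1 <= k < n.+1) lnn k.
  have -> : \sum_(1 <= k < n.+1) lnn k = \sum_(1 <= k < n.+1) 1 * lnn k.
    by apply: eq_bigr => k _; rewrite mul1r.
  rewrite (sum_lnn_primes (fun=> 1)) /mertens /theta mulr_sumr -sumrB.
  apply: ler_sum => p pp; have p0 := prime_gt0 pp.
  rewrite big_ltn //= expn1 sumr_const_nat subn1 /=.
  rewrite -[leLHS]addr0; apply: lerD; last first.
    apply: sumr_ge0 => i _; rewrite mulr_ge0 ?lnn_ge0 // sumr_const_nat mulrn_wge0 //.
  have -> : n%:R * (lnn p / p%:R) - lnn p = lnn p * (n%:R / p%:R - 1) by ring.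
  by apply: ler_wpM2l; [exact: lnn_ge0|exact: divn_ge_div].
have := le_trans H (sum_lnn_le n); have := theta_le n => h1 h2.
have : n%:R * mertens n <= n%:R * (lnn n + lnn 16) by rewrite mulrDr; lra.
by rewrite ler_pM2l.
Qed.

Definition chi3 (k : nat) : R := if (k %% 3 == 1)%N then 1 else if (k %% 3 == 2)%N then - 1 else 0.

Lemma chi3M j k : chi3 (j * k) = chi3 j * chi3 k.
Proof.
rewrite /chi3 -modnMm; move: (ltn_pmod j (isT : 0 < 3)%N) (ltn_pmod k (isT : 0 < 3)%N).
by case: (j %% 3)%N => [|[|[|]]] // _; case: (k %% 3)%N => [|[|[|]]] // _ /=;
  rewrite ?mulr0 ?mul0r ?mulr1 ?mul1r ?mulrNN ?mulr1.
Qed.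

Lemma chi3_norm k : `|chi3 k| <= 1.
Proof. by rewrite /chi3; do 2?case: ifP => _; rewrite ?normrN ?normr1 ?normr0. Qed.

(** The character runs through +, -, 0, so a decreasing f gives an alternating sum. The start N is
    arbitrary to allow induction, and its residue decides the sign. *)
Lemma chi3_alternating f m N : (forall k, (N <= k)%N -> 0 <= f k.+1 <= f k) -> 0 <= f N ->
  let S := \sum_(N <= k < N + m) chi3 k * f k in
  if (N %% 3 == 2)%N then - f N <= S <= 0 else 0 <= S <= f N.
Proof.
elim: m N => [|m IH] N fdec f0 /=.
  by rewrite addn0 big_geq //; case: ifP => _; rewrite lexx ?oppr_le0 f0.
have /andP[fN0 fN] := fdec N (leqnn N).
have := IH N.+1 (fun k h => fdec k (ltnW h)) fN0.
rewrite addnS -addSn big_ltn; last by rewrite addSn ltnS leq_addr.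
have hm : (N.+1 %% 3 = (N %% 3).+1 %% 3)%N by rewrite -[in RHS]addn1 modnDml addn1.
move: (\sum_(N.+1 <= i < _) _) => S; rewrite hm /chi3; cbv zeta.
move: (ltn_pmod N (isT : 0 < 3)%N); case: (N %% 3)%N => [|[|[|]]] //= _; lra.
Qed.

Lemma chi3_alt_norm f m N : (forall k, (N <= k)%N -> 0 <= f k.+1 <= f k) -> 0 <= f N ->
  `|\sum_(N <= k < N + m) chi3 k * f k| <= f N.
Proof.
move=> fdec f0; have := chi3_alternating m fdec f0; rewrite ler_norml /=.
case: ifP => _ /andP[h1 h2]; apply/andP; split=> //; first exact: le_trans h2 f0.
by apply: le_trans h1; rewrite oppr_le0.
Qed.

Lemma invn_dec N : (0 < N)%N -> forall k, (N <= k)%N -> 0 <= (k.+1%:R^-1 : R) <= k%:R^-1.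
Proof.
move=> N0 k Nk; have k0 : (0 < k)%N by apply: leq_trans Nk.
by rewrite invr_ge0 ler0n /= lef_pV2 ?posrE ?ltr0n // ler_nat.
Qed.

Definition harm3 n : R := \sum_(1 <= k < n.+1) chi3 k / k%:R.

Lemma harm3_bounds n : 0 <= harm3 n <= 1.
Proof.
have := chi3_alternating (f := fun k => k%:R^-1) n (invn_dec (isT : 0 < 1)%N).
by rewrite invr_ge0 ler0n invr1 add1n => /(_ isT).
Qed.

Lemma harm3_ge n : (0 < n)%N -> 2%:R^-1 <= harm3 n.
Proof.
case: n => [|[|n]] // _.
  by rewrite /harm3 big_nat1 /chi3 /= divr1; lra.
rewrite /harm3 big_ltn // big_ltn //= {1 2}/chi3 /= divr1.
have := chi3_alternating (f := fun k => k%:R^-1) n (invn_dec (isT : 0 < 3)%N).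
rewrite invr_ge0 ler0n -[(3 + n)%N]/(n.+3) => /(_ isT) /= /andP[h _].
by move: h; move: (\sum_(3 <= k < n.+3) _) => S h; lra.
Qed.

Lemma harm3_sub N n : (N <= n)%N -> `|harm3 N - harm3 n| <= N.+1%:R^-1.
Proof.
move=> Nn; rewrite /harm3 [X in _ - X](@big_cat_nat _ _ _ N.+1) //=.
rewrite opprD addrA subrr add0r normrN -(subnKC (_ : N.+1 <= n.+1)%N) //.
by apply: (chi3_alt_norm (f := fun k => k%:R^-1)); [exact: invn_dec|rewrite invr_ge0 ler0n].
Qed.

Lemma ln2_ge : 2%:R^-1 <= lnn 2.
Proof.
have := @le_ln1Dx R (- 2%:R^-1); rewrite (_ : 1 + - _ = 2%:R^-1); last by lra.
by rewrite lnV ?posrE // => h; rewrite /lnn -lerN2; apply: h; lra.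
Qed.

Lemma lnn_div_dec k : (4 <= k)%N -> 0 <= lnn k.+1 / k.+1%:R <= lnn k / k%:R.
Proof.
move=> k4; have k0 : (0 < k)%N by apply: leq_trans k4.
have k0' : 0 < k%:R :> R by rewrite ltr0n.
rewrite divr_ge0 ?lnn_ge0 //= ler_pdivrMr ?ltr0n // mulrAC ler_pdivlMr //.
have h := lnnS_sub k0.
have l1 : 1 <= lnn k.
  apply: le_trans (ler_lnn _ k4) => //.
  by rewrite (_ : 4 = 2 * 2)%N // lnnM //; have := ln2_ge; lra.
have h2 : k%:R * (lnn k.+1 - lnn k) <= 1 by rewrite mulrC -ler_pdivlMr // mul1r.
by rewrite -natr1; lra.
Qed.

Lemma lnn_le n : lnn n <= n%:R.
Proof.
case: n => [|n]; first by rewrite /lnn ln0.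
by apply/ltW/ln_sublinear; rewrite ltr0n.
Qed.

Lemma chi3_lnn_bound n : `|\sum_(1 <= k < n.+1) chi3 k / k%:R * lnn k| <= 2%:R.
Proof.
have E k : chi3 k / k%:R * lnn k = chi3 k * (lnn k / k%:R) by ring.
rewrite (eq_bigr _ (fun k _ => E k)).
have b2 : `|chi3 2 * (lnn 2 / 2%:R)| <= 1.
  rewrite normrM; apply: (@le_trans _ _ (1 * 1)); last by rewrite mulr1.
  apply: ler_pM => //; first exact: chi3_norm.
  rewrite ger0_norm ?divr_ge0 ?lnn_ge0 // ler_pdivrMr // mul1r; exact: lnn_le.
have z1 : chi3 1 * (lnn 1 / 1%:R) = 0 by rewrite lnn1 mul0r mulr0.
have z3 : chi3 3 * (lnn 3 / 3%:R) = 0 by rewrite /chi3 /= mul0r.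
have [n4|n4] := leqP n 3.
  case: n n4 => [|[|[|[|]]]] // _; rewrite ?big_nil ?normr0 //.
  - by rewrite big_nat1 z1 normr0.
  - by rewrite big_ltn // big_nat1 z1 add0r; lra.
  - by rewrite big_ltn // big_ltn // big_nat1 z1 z3 addr0 add0r; lra.
have [h1 h2 h3] : [/\ (1 < n.+1)%N, (2 < n.+1)%N & (3 < n.+1)%N] by split; lia.
rewrite (big_ltn h1) (big_ltn h2) (big_ltn h3) z1 z3 !add0r.
have := chi3_alt_norm (f := fun k => lnn k / k%:R) (n.+1 - 4) lnn_div_dec.
rewrite divr_ge0 ?lnn_ge0 // subnKC // => /(_ isT) h.
have : lnn 4 / 4%:R <= 1 by rewrite ler_pdivrMr // mul1r; exact: lnn_le.
move=> h4; apply: le_trans (ler_normD _ _) _; lra.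
Qed.

Definition mertens3 n : R := \sum_(0 <= p < n.+1 | prime p) chi3 p * (lnn p / p%:R).

(** The sum of chi3(k) ln k / k is bounded, and by Chebyshev's identity it is [harm3 n] times
    [mertens3 n] up to bounded errors. It remains to divide by [harm3 n] >= 1/2, a finite form of
    L(1, chi3) != 0. *)
Lemma mertens3_bound n : (0 < n)%N -> `|mertens3 n| <= 8%:R + 2%:R * lnn 16.
Proof.
move=> n0; have n0' : 0 < n%:R :> R by rewrite ltr0n.
pose rest p := \sum_(2 <= i < n.+1) lnn p * (chi3 (p ^ i) / p%:R ^+ i * harm3 (n %/ p ^ i)).
have main : \sum_(1 <= k < n.+1) chi3 k / k%:R * lnn k =
   harm3 n * mertens3 n
   + \sum_(0 <= p < n.+1 | prime p) chi3 p * (lnn p / p%:R) * (harm3 (n %/ p) - harm3 n)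
   + \sum_(0 <= p < n.+1 | prime p) rest p.
  rewrite (sum_lnn_primes (fun k => chi3 k / k%:R)) /mertens3 mulr_sumr -!big_split /=.
  apply: eq_bigr => p pp; rewrite /rest.
  have inner i : \sum_(1 <= j < (n %/ p ^ i).+1) chi3 (p ^ i * j) / (p ^ i * j)%:R =
     chi3 (p ^ i) / p%:R ^+ i * harm3 (n %/ p ^ i).
    rewrite /harm3 mulr_sumr; apply: eq_bigr => j _.
    by rewrite chi3M natrM natrX invfM; ring.
  under eq_bigr => i _ do rewrite inner.
  by rewrite big_ltn // expn1 expr1; congr (_ + _); ring.
have b1 : `|\sum_(0 <= p < n.+1 | prime p) chi3 p * (lnn p / p%:R) * (harm3 (n %/ p) - harm3 n)| <= lnn 16.
  apply: (@le_trans _ _ (theta n / n%:R)); last first.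
    by rewrite ler_pdivrMr // mulrC theta_le.
  apply: le_trans (ler_norm_sum _ _ _) _; rewrite /theta mulr_suml; apply: ler_sum => p pp.
  have p0 := prime_gt0 pp; have p0' : 0 < p%:R :> R by rewrite ltr0n.
  have l0 := lnn_ge0 p.
  rewrite !normrM (ger0_norm l0) normfV (ger0_norm (ltW p0')).
  have h := harm3_sub (leq_div n p).
  have h2 : ((n %/ p).+1%:R : R)^-1 <= p%:R / n%:R.
    rewrite -[p%:R / _]invf_div lef_pV2 ?posrE ?divr_gt0 ?ltr0n //.
    by rewrite ler_pdivrMr // -natrM ler_nat ltnW // ltn_ceil.
  apply: (@le_trans _ _ (1 * (lnn p / p%:R) * (p%:R / n%:R))).
    apply: ler_pM => //; first by rewrite mulr_ge0 // divr_ge0 // ltW.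
      by apply: ler_wpM2r; [rewrite divr_ge0 // ltW|exact: chi3_norm].
    exact: le_trans h h2.
  by rewrite mul1r mulrA divfK // gt_eqF.
have b2 : `|\sum_(0 <= p < n.+1 | prime p) rest p| <= 2%:R.
  apply: le_trans (ler_norm_sum _ _ _) _; apply: le_trans (sum_primes_tail n).
  apply: ler_sum => p pp; have p1 := prime_gt1 pp; have p0' : 0 < p%:R :> R by rewrite ltr0n prime_gt0.
  have l0 := lnn_ge0 p; rewrite /rest -mulr_sumr normrM (ger0_norm l0).
  apply: ler_wpM2l => //; apply: le_trans (ler_norm_sum _ _ _) _.
  apply: (@le_trans _ _ (\sum_(2 <= i < n.+1) (p%:R ^+ i)^-1)).
    apply: ler_sum => i _; rewrite !normrM normfV (ger0_norm (exprn_ge0 i (ltW p0'))).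
    have /andP[a0 a1] := harm3_bounds (n %/ p ^ i); rewrite (ger0_norm a0).
    have pi0 : 0 <= (p%:R ^+ i : R)^-1 by rewrite invr_ge0 exprn_ge0 // ltW.
    apply: (@le_trans _ _ (1 * (p%:R ^+ i)^-1 * 1)); last by rewrite mulr1 mul1r.
    apply: ler_pM => //; first by rewrite mulr_ge0.
    by apply: ler_wpM2r => //; exact: chi3_norm.
  have := geometric_le n p1; rewrite big_ltn // expr1 tail_split //; lra.
have h1 := harm3_ge n0; have h2 := chi3_lnn_bound n.
have e : harm3 n * mertens3 n = \sum_(1 <= k < n.+1) chi3 k / k%:R * lnn k
   - \sum_(0 <= p < n.+1 | prime p) chi3 p * (lnn p / p%:R) * (harm3 (n %/ p) - harm3 n)
   - \sum_(0 <= p < n.+1 | prime p) rest p by rewrite main; ring.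
have : `|harm3 n * mertens3 n| <= 4%:R + lnn 16.
  rewrite e; apply: le_trans (ler_normB _ _) _.
  have := ler_normB (\sum_(1 <= k < n.+1) chi3 k / k%:R * lnn k)
    (\sum_(0 <= p < n.+1 | prime p) chi3 p * (lnn p / p%:R) * (harm3 (n %/ p) - harm3 n)).
  lra.
rewrite normrM ger0_norm; last by apply: le_trans h1; rewrite invr_ge0.
have m0 := normr_ge0 (mertens3 n).
have : 2%:R^-1 * `|mertens3 n| <= harm3 n * `|mertens3 n| by apply: ler_wpM2r.
lra.
Qed.

Lemma sum_mod3_0 n : 0 <= \sum_(0 <= p < n.+1 | prime p && (p %% 3 == 0)%N) lnn p / p%:R <= 1.
Proof.
rewrite sumr_ge0 /=; last by move=> p _; rewrite divr_ge0 ?lnn_ge0.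
have P3 p : prime p && (p %% 3 == 0)%N = (p == 3%N).
  apply/andP/eqP => [[pp]|->//].
  by rewrite -/(dvdn 3 p) (dvdn_prime2 (isT : prime 3) pp) => /eqP.
rewrite (eq_bigl _ _ P3) big_nat1_eq; case: ifP => // _.
by rewrite ler_pdivrMr // mul1r lnn_le.
Qed.

Definition mertens32 n : R := \sum_(0 <= p < n.+1 | prime p && (p %% 3 == 2)%N) lnn p / p%:R.

Lemma mertens32E n : 2%:R * mertens32 n = mertens n - mertens3 n
  - \sum_(0 <= p < n.+1 | prime p && (p %% 3 == 0)%N) lnn p / p%:R.
Proof.
rewrite /mertens32 /mertens /mertens3 mulr_sumr !big_mkcondr -!sumrB /=.
apply: eq_bigr => p _; rewrite /chi3; move: (ltn_pmod p (isT : 0 < 3)%N).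
by case: (p %% 3)%N => [|[|[|]]] //= _; ring.
Qed.

(** The primes 2 mod 3 in (Y / T, Y] carry weight at least 1 in the sum of ln p / p, and each
    carries at most T ln Y / Y. *)
Lemma primes_2mod3_count : exists T : nat, (0 < T)%N /\ forall Y, (T <= Y)%N ->
  (Y <= T * (trunc_log 2 Y).+1 * count (fun p => prime p && (p %% 3 == 2)) (iota 0 Y.+1))%N.
Proof.
(* Twice the weight gained is at least ln T - 3 - 16 - 2 (8 + 32) - 1 = ln T - 100, with ln 16
   bounded by 16; it has to reach 2. *)
pose T := Num.bound (sequences.expR 102%:R : R).
have hT : 102%:R <= lnn T.
  have h : sequences.expR 102%:R < T%:R :> R by apply: archi_boundP; apply: expR_ge0.
  by rewrite /lnn -[leLHS]expRK ler_ln ?posrE ?expR_gt0 ?ltW // (lt_trans _ h) // expR_gt0.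
have T0 : (0 < T)%N.
  by rewrite lt0n; apply/eqP => T0; move: hT; rewrite T0 /lnn ln0 // lern0.
exists T; split=> // Y TY; clearbody T.
have Y0 : (0 < Y)%N by apply: leq_trans TY.
pose Z := (Y %/ T)%N; have Z0 : (0 < Z)%N by rewrite divn_gt0.
have ZY : (Z <= Y)%N by exact: leq_div.
have lYZ : lnn T + lnn Z <= lnn Y.
  by rewrite -lnnM // ler_lnn ?muln_gt0 ?T0 // mulnC leq_trunc_div.
have l16 : lnn 16 <= 16%:R := lnn_le 16.
have W : 1 <= mertens32 Y - mertens32 Z.
  have := mertens32E Y; have := mertens32E Z.
  have /andP[] := sum_mod3_0 Y; have /andP[] := sum_mod3_0 Z.
  have := mertens_lower Y0; have := mertens_upper Z0.
  have := mertens3_bound Y0; have := mertens3_bound Z0.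
  rewrite !ler_norml => /andP[a1 a2] /andP[a3 a4] a5 a6 a7 a8 a9 a10 a11 a12.
  move: a7 a8 a9 a10 a11 a12; set u := \sum_(_ <= _ < Z.+1 | _) _; set v := \sum_(_ <= _ < Y.+1 | _) _.
  lra.
set N := count _ _.
have lY : lnn Y <= (trunc_log 2 Y).+1%:R.
  have [_ h] := andP (trunc_log_bounds (isT : 1 < 2)%N Y0).
  apply: le_trans (ler_lnn Y0 (ltnW h)) _.
  rewrite /lnn natrX lnXn //; set k := (trunc_log 2 Y).+1.
  suff l21 : ln (2%:R : R) <= 1 by rewrite -(mulr_natl (ln _) k) -[leRHS]mulr1; apply: ler_wpM2l.
  by rewrite -[2]/(1 + 1); apply: le_ln1Dx; lra.
have Y0' : 0 < Y%:R :> R by rewrite ltr0n.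
have cW : mertens32 Y - mertens32 Z <= N%:R * (lnn Y * (T%:R / Y%:R)).
  rewrite /mertens32 (@big_cat_nat _ _ _ Z.+1) //= addrAC subrr add0r.
  apply: (@le_trans _ _ (\sum_(Z.+1 <= p < Y.+1 | prime p && (p %% 3 == 2)%N) lnn Y * (T%:R / Y%:R))).
    rewrite big_nat_cond [leRHS]big_nat_cond; apply: ler_sum => p /andP[/andP[Zp pY] _].
    have p0 : (0 < p)%N by apply: leq_ltn_trans Zp.
    apply: ler_pM; rewrite ?lnn_ge0 ?invr_ge0 ?ler0n ?ler_lnn //.
    rewrite -[T%:R / _]invf_div lef_pV2 ?posrE ?divr_gt0 ?ltr0n // ler_pdivrMr ?ltr0n //.
    by rewrite -natrM ler_nat ltnW // -ltn_divLR.
  rewrite big_const_seq iter_addr addr0 -[leLHS]mulr_natl; apply: ler_wpM2r.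
    by rewrite mulr_ge0 ?lnn_ge0 // divr_ge0.
  rewrite ler_nat /N -(subnKC (_ : Z.+1 <= Y.+1)%N) // iotaD count_cat /index_iota add0n.
  by rewrite addKn leq_addl.
have : Y%:R <= N%:R * (lnn Y * T%:R).
  have := le_trans W cW; rewrite !mulrA ler_pdivlMr // mul1r //.
move=> h; rewrite -(ler_nat R) mulnAC -mulnA !natrM; apply: le_trans h _.
by rewrite [leRHS]mulrCA; apply: ler_wpM2l => //; rewrite [leLHS]mulrC; apply: ler_wpM2l.
Qed.
End Mertens.

(** * Divisor bounds *)

Definition tau (n : nat) : nat := size (divisors n).

Lemma count_congr_le (P : pred nat) l k a : (0 < l)%N ->
  (forall x y, (x < l * k)%N -> (y < l * k)%N -> P x -> P y -> x = y %[mod l]) ->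
  (count P (iota a (l * k - a)) <= k)%N.
Proof.
move=> l0 h; rewrite -size_filter; set s := [seq x <- _ | P x].
have us : uniq s by rewrite filter_uniq ?iota_uniq.
have sP x : x \in s -> P x /\ (x < l * k)%N.
  by rewrite mem_filter mem_iota => /andP[Px /andP[ax xl]]; split=> //; lia.
have inj : {in s &, injective (fun x => (x %/ l)%N)}.
  move=> x y /sP[Px xk] /sP[Py yk] e.
  by rewrite (divn_eq x l) (divn_eq y l) e (h x y).
rewrite -(size_map (fun x => (x %/ l)%N)) -[leqRHS](size_iota 0).
apply: uniq_leq_size; first by rewrite map_inj_in_uniq.
by move=> _ /mapP[x /sP[_ xk] ->]; rewrite mem_iota add0n ltn_divLR // mulnC.
Qed.

Lemma count_fibers (T : eqType) (S : eqType) (f : T -> S) (P : pred T) (s : seq T) (ds : seq S) b :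
  (forall x, x \in s -> P x -> f x \in ds) ->
  (forall y, y \in ds -> (count (fun x => P x && (f x == y)) s <= b)%N) ->
  (count P s <= b * size ds)%N.
Proof.
move=> h; elim: ds P h => [|y ds IH] P h hb.
  rewrite muln0 leqn0 eqn0Ngt -has_count; apply/negP => /hasP[x xs] /(h _ xs).
  by rewrite in_nil.
rewrite mulnS (eq_count (a2 := predU (fun x => P x && (f x == y)) (fun x => P x && (f x != y)))); last first.
  by move=> x /=; case: (P x) => //=; case: (f x == y).
rewrite -(addnK (count (predI (fun x => P x && (f x == y)) (fun x => P x && (f x != y))) s)
   (count _ s)) count_predUI.
apply: leq_trans (leq_subr _ _) _; apply: leq_add; first by apply: hb; rewrite mem_head.
apply: IH => [x xs /andP[Px fx]|z zs].
  by have := h x xs Px; rewrite inE (negPf fx).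
apply: leq_trans (hb z _); last by rewrite inE zs orbT.
by apply: sub_count => x /= /andP[/andP[-> _] ->].
Qed.

(** Fix a root m1 and sort the roots m by g = gcd(c, m - m1), a divisor of c. Then e = c / g divides
    m + m1, so roots with the same g agree modulo lcm(g, e), which leaves c / lcm(g, e) = gcd(g, e)
    of them. The square of this gcd divides c and 4 N. *)
Lemma nroots_le (N : int) (c : nat) : (0 < c)%N ->
  (forall h : nat, (h ^ 2 %| c)%N -> ((h ^ 2)%N%:Z %| 4 * N)%Z -> (h <= 6)%N) ->
  (nroots N c <= 6 * tau c)%N.
Proof.
move=> c0 hN; rewrite /nroots; set P := (X in count X _).
have [/hasP[m1 m1c Pm1]|/negP n] := boolP (has P (iota 0 c)); last first.
  have -> : count P (iota 0 c) = 0%N by apply/eqP; rewrite eqn0Ngt -has_count; apply/negP.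
  by [].
pose f (m : nat) := `|gcdz c (m%:Z - m1%:Z)%R|%N.
apply: (@count_fibers _ _ f) => [m _ _|g gc].
  by rewrite -dvdn_divisors // /f; have := dvdz_gcdl c (m%:Z - m1%:Z).
have {}gc : (g %| c)%N by rewrite dvdn_divisors.
pose e := (c %/ g)%N; have ce : (c = e * g)%N by rewrite divnK.
have [/hasP[m0 _ /andP[Pm0 /eqP fm0]]|/negP n] := boolP (has (fun m => P m && (f m == g)) (iota 0 c)); last first.
  by rewrite [X in (X <= _)%N](_ : _ = 0%N) //; apply/eqP; rewrite eqn0Ngt -has_count; apply/negP.
have key m : P m -> f m = g -> (g%:Z %| m%:Z - m1%:Z)%Z /\ (e%:Z %| m%:Z + m1%:Z)%Z.
  move=> Pm fm; have gE : g%:Z = gcdz c (m%:Z - m1%:Z) by rewrite -fm.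
  have g0 : g%:Z != 0 by rewrite eqz_nat; apply: contraTneq gc => ->; rewrite dvd0n -lt0n.
  have gd : (g%:Z %| m%:Z - m1%:Z)%Z by rewrite gE dvdz_gcdr.
  split=> //; have [w wE] := dvdzP gd.
  have cop : coprimez e w.
    have : gcdz (e%:Z * g%:Z) (w * g%:Z) = g%:Z by rewrite -wE -PoszM -ce -gE.
    rewrite mulrC [w * _]mulrC -mulz_gcdr => /(congr1 absz); rewrite abszM /= => E.
    rewrite /coprimez -[_ == _]/(`|gcdz e w|%N%:Z == 1) eqz_nat.
    have g0' : (0 < g)%N by rewrite lt0n.
    by rewrite -(eqn_pmul2l g0') E muln1.
  have : (e%:Z * g%:Z %| (w * (m%:Z + m1%:Z)) * g%:Z)%Z.
    rewrite -PoszM -ce (_ : _ * _ * _ = (m%:Z ^+ 2 - N) - (m1%:Z ^+ 2 - N)); last by rewrite mulrAC -wE; ring.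
    by apply: rpredB.
  by rewrite dvdz_mul2r ?g0 ?Gauss_dvdzr // (negPf g0).
have [k1 k2] := key _ Pm0 fm0.
pose h := gcdn g e.
have h6 : (h <= 6)%N.
  apply: hN; first by rewrite ce mulnC expnS expn1 dvdn_mul ?dvdn_gcdl ?dvdn_gcdr.
  have d1 : (h%:Z %| 2 * m1%:Z)%Z.
    have -> : 2 * m1%:Z = (m0%:Z + m1%:Z) - (m0%:Z - m1%:Z) by ring.
    by apply: rpredB; [apply: dvdz_trans k2|apply: dvdz_trans k1]; rewrite dvdzE /= ?dvdn_gcdl ?dvdn_gcdr.
  have d2 : ((h ^ 2)%N%:Z %| (2 * m1%:Z) ^+ 2)%Z by rewrite PoszX dvdz_exp2r.
  have d3 : ((h ^ 2)%N%:Z %| 4 * (m1%:Z ^+ 2 - N))%Z.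
    apply: dvdz_mull; apply: dvdz_trans Pm1; rewrite dvdzE /= ce mulnC expnS expn1.
    by rewrite dvdn_mul ?dvdn_gcdl ?dvdn_gcdr.
  have -> : 4 * N = (2 * m1%:Z) ^+ 2 - 4 * (m1%:Z ^+ 2 - N) by ring.
  exact: rpredB.
apply: leq_trans h6; have g0 : (0 < g)%N by rewrite (dvdn_gt0 c0).
have e0 : (0 < e)%N by rewrite lt0n; apply: contraTneq c0 => e0; rewrite ce e0.
have lc : (c = lcmn g e * h)%N by rewrite muln_lcm_gcd ce mulnC.
rewrite [X in iota 0 X](_ : c = lcmn g e * h - 0)%N; last by rewrite subn0.
apply: count_congr_le => [|x y _ _ /andP[Px /eqP fx] /andP[Py /eqP fy]].
  by rewrite lcmn_gt0 g0.
have [a1 a2] := key _ Px fx; have [b1 b2] := key _ Py fy.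
have gd : (g%:Z %| x%:Z - y%:Z)%Z.
  by rewrite (_ : x%:Z - y%:Z = (x%:Z - m1%:Z) - (y%:Z - m1%:Z)); [exact: rpredB|ring].
have ed : (e%:Z %| x%:Z - y%:Z)%Z.
  by rewrite (_ : x%:Z - y%:Z = (x%:Z + m1%:Z) - (y%:Z + m1%:Z)); [exact: rpredB|ring].
have : (lcmn g e %| `|(x%:Z - y%:Z)%R|)%N by rewrite dvdn_lcm; apply/andP.
move=> hd; have {hd} : ((lcmn g e)%:Z %| x%:Z - y%:Z)%Z by [].
by rewrite -eqz_mod_dvd => /eqP; rewrite !modz_nat => -[->].
Qed.

Lemma tau_coprimeX p e m : prime p -> ~~ (p %| m)%N -> (0 < m)%N ->
  (tau (p ^ e * m) <= e.+1 * tau m)%N.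
Proof.
move=> pp pm m0; rewrite /tau -(count_predT (divisors (p ^ e * m))).
have N0 : (0 < p ^ e * m)%N by rewrite muln_gt0 expn_gt0 prime_gt0.
rewrite [leqRHS]mulnC -(size_iota 0 e.+1).
apply: (@count_fibers _ _ (logn p) predT) => [x|k _].
  rewrite -dvdn_divisors // mem_iota /= add0n ltnS => xd _.
  have := dvdn_leq_log p N0 xd; rewrite (lognM _ (_ : 0 < p ^ e)%N m0) ?expn_gt0 ?prime_gt0 // lognX.
  rewrite (logn_prime p pp) eqxx muln1.
  by rewrite (_ : logn p m = 0)%N ?addn0 // lognE pp m0 (negPf pm).
rewrite -size_filter -[leqLHS](size_map (fun x => x %/ p ^ k)%N).
have sP x : x \in [seq y <- divisors (p ^ e * m) | true && (logn p y == k)] ->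
    (p ^ k * (x %/ p ^ k) = x)%N /\ (x %/ p ^ k %| m)%N.
  rewrite mem_filter /= -dvdn_divisors // => /andP[/eqP kx xd].
  have x0 : (0 < x)%N by rewrite (dvdn_gt0 N0).
  have E : (p ^ k * (x %/ p ^ k) = x)%N by rewrite mulnC divnK // -kx pfactor_dvdnn.
  split=> //; have : coprime (x %/ p ^ k) (p ^ e).
    rewrite coprime_sym coprimeXl // prime_coprime // -kx.
    have [r pr xr] := pfactor_coprime pp x0.
    by rewrite {1}xr mulnK ?expn_gt0 ?prime_gt0 // -prime_coprime.
  move=> c; rewrite -(Gauss_dvdr _ c); apply: dvdn_trans xd; rewrite -{2}E; exact: dvdn_mull.
apply: uniq_leq_size; last by move=> _ /mapP[x /sP[_ h] ->]; rewrite -dvdn_divisors.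
rewrite map_inj_in_uniq ?filter_uniq ?divisors_uniq // => x y /sP[xE _] /sP[yE _] E.
by rewrite -xE -yE E.
Qed.

Lemma expn_le_pow2 j e : (e.+1 ^ j <= j ^ j * 2 ^ e)%N.
Proof.
case: j => [|j]; first by rewrite !expn0 mul1n expn_gt0.
have h : (e.+1 <= j.+1 * 2 ^ (e %/ j.+1))%N.
  rewrite {1}(divn_eq e j.+1) -addnS.
  apply: (@leq_trans ((e %/ j.+1).+1 * j.+1)); first by rewrite mulSn addnC leq_add2r ltn_pmod.
  by rewrite mulnC leq_mul2l ltn_expl.
apply: (@leq_trans ((j.+1 * 2 ^ (e %/ j.+1)) ^ j.+1)); first by rewrite leq_exp2r.
by rewrite expnMn leq_mul2l -expnM leq_exp2l // leq_divM orbT.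
Qed.

(** At a prime p >= 2^j the local factor needs no constant: (e + 1)^j <= 2^(e j) <= p^e. Each of the
    fewer than 2^j smaller primes costs a factor j^j. *)
Lemma tau_pow_le j : exists2 C, (0 < C)%N & forall n, (0 < n)%N -> (tau n ^ j <= C * n)%N.
Proof.
pose K := (j ^ j)%N; have K0 : (0 < K)%N by rewrite /K; case: (j) => // k; rewrite expn_gt0.
pose c n := count (fun p => prime p && (p %| n)%N) (iota 0 (2 ^ j)).
have cle n : (c n <= 2 ^ j)%N by rewrite -[leqRHS](size_iota 0); apply: count_size.
suff main n : (0 < n)%N -> (tau n ^ j <= K ^ c n * n)%N.
  exists (K ^ 2 ^ j)%N => [|n n0]; first by rewrite expn_gt0 K0.
  by apply: leq_trans (main n n0) _; rewrite leq_mul2r leq_pexp2l ?orbT ?cle.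
elim/ltn_ind: n => n IH n0; have [n1|n1] := leqP n 1.
  by rewrite (_ : n = 1)%N ?muln1; [rewrite [tau 1](_ : _ = 1)%N // exp1n expn_gt0 K0|lia].
have pp := pdiv_prime n1; set p := pdiv n in pp; have p1 := prime_gt1 pp.
have [m pm nE] := pfactor_coprime pp n0; rewrite prime_coprime // in pm.
set e := logn p n in nE.
have e0 : (0 < e)%N by rewrite logn_gt0 mem_primes pp n0 pdiv_dvd.
have m0 : (0 < m)%N by move: n0; rewrite nE muln_gt0 => /andP[].
have mn : (m < n)%N by rewrite nE -{1}[m]muln1 ltn_pmul2l // -(exp1n e) ltn_exp2r.
have cm : (c m + (p < 2 ^ j) <= c n)%N.
  rewrite /c; have := count_predUI (fun q => prime q && (q %| m)%N) (pred1 p) (iota 0 (2 ^ j)).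
  rewrite [count (predI _ _) _](_ : _ = 0%N); last first.
    apply/eqP; rewrite eqn0Ngt -has_count; apply/negP => /hasP[q _ /= /andP[/andP[_ qm] /eqP qp]].
    by rewrite -qp qm in pm.
  rewrite addn0 count_uniq_mem ?iota_uniq // mem_iota /= add0n => <-.
  apply: sub_count => q /= /orP[/andP[-> qm]|/eqP->]; first by rewrite nE dvdn_mulr.
  by rewrite pp pdiv_dvd.
rewrite {1}nE mulnC; apply: (@leq_trans ((e.+1 * tau m) ^ j)).
  by case: (j) => // k; rewrite leq_exp2r // tau_coprimeX.
rewrite expnMn; have he : (e.+1 ^ j <= K ^ (p < 2 ^ j)%N * p ^ e)%N.
  case: ltnP => [_|pj]; last first.
    rewrite mul1n; apply: (@leq_trans ((2 ^ e) ^ j)); last first.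
      by rewrite -expnM mulnC expnM leq_exp2r.
    by case: (j) => // k; rewrite leq_exp2r // ltn_expl.
  rewrite expn1; apply: leq_trans (expn_le_pow2 j e) _.
  by rewrite leq_mul2l leq_exp2r // p1 orbT.
apply: leq_trans (leq_mul he (IH m mn m0)) _.
rewrite {2}nE mulnACA -expnD [(m * _)%N]mulnC leq_mul2r; apply/orP; right.
by rewrite leq_pexp2l // addnC.
Qed.

(** * Primes dividing norms *)

Section Density.
Variable R : realType.

Definition smooth (s : seq nat) (m : nat) : bool := all (fun p => p \in s) (primes m).

Lemma smooth_dvd s m n : (0 < n)%N -> (m %| n)%N -> smooth s n -> smooth s m.
Proof.
move=> n0 mn /allP h; apply/allP => p; rewrite mem_primes => /and3P[pp m0 pm].
by apply: h; rewrite mem_primes pp n0 (dvdn_trans pm mn).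
Qed.

Definition hsum (s : seq nat) (X : nat) : R :=
  \sum_(1 <= m < X.+1 | smooth s m) m%:R^-1.

Lemma hsum_ge0 s X : 0 <= hsum s X.
Proof. by apply: sumr_ge0 => m _; rewrite invr_ge0. Qed.

Lemma hsum_mono s X Y : (X <= Y)%N -> hsum s X <= hsum s Y.
Proof.
move=> XY; rewrite /hsum [leRHS](@big_cat_nat _ _ _ X.+1) //= lerDl.
by apply: sumr_ge0 => m _; rewrite invr_ge0.
Qed.

(** Splitting by divisibility by p gives H(p :: s, X) = H(s, X) + H(p :: s, X / p) / p, one Euler
    factor at a time. *)
Lemma hsum_cons p s X : prime p -> p \notin s -> (1 - p%:R^-1) * hsum (p :: s) X <= hsum s X.
Proof.
move=> pp ps; have p0 := prime_gt0 pp.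
have step : hsum (p :: s) X = hsum s X + p%:R^-1 * hsum (p :: s) (X %/ p).
  rewrite /hsum (bigID (fun m => p %| m)%N) /= addrC; congr (_ + _).
    rewrite big_nat_cond [RHS]big_nat_cond; apply: eq_bigl => m.
    have [/andP[m0 mX]|//] := boolP (0 < m < X.+1)%N; rewrite /=.
    apply/andP/idP => [[/allP h pm]|/allP h].
      apply/allP => q qm; have := h q qm; rewrite inE => /orP[/eqP qp|//].
      by move: qm; rewrite qp mem_primes (negPf pm) !andbF.
    split; first by apply/allP => q qm; rewrite inE h ?orbT.
    by apply: contra ps => pm; apply: h; rewrite mem_primes pp m0.
  rewrite mulr_sumr (eq_bigl (fun m => (p %| m)%N && smooth (p :: s) m)); last by move=> m; rewrite andbC.
  rewrite big_mkcondr /= (sum_multiples (fun m => if smooth (p :: s) m then m%:R^-1 else 0 : R)) //.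
  rewrite [RHS]big_mkcond /=; rewrite big_nat_cond [RHS]big_nat_cond.
  apply: eq_bigr => m /andP[/andP[m0 mX] _].
  have -> : smooth (p :: s) (p * m) = smooth (p :: s) m.
    apply/idP/idP; first by apply: smooth_dvd; rewrite ?muln_gt0 ?p0 // dvdn_mull.
    move=> /allP h; apply/allP => q; rewrite primesM // primes_prime // => /orP[|/h//].
    by rewrite !inE => ->.
  by case: ifP => // _; rewrite natrM invfM.
rewrite mulrBl mul1r lerBlDr {1}step lerD2l; apply: ler_wpM2l; first by rewrite invr_ge0.
by apply: hsum_mono; apply: leq_div.
Qed.

(** The Euler factor (1 - 1/p)^(-1) is at most 1 + 2/p, hence at most exp(4 ln p / p) as ln p >=
    1/2. A set of primes of bounded weight thus has a convergent sum of reciprocals of smooth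
    numbers. *)
Lemma hsum_le s X : uniq s -> all prime s ->
  hsum s X <= expR (\sum_(p <- s) 4%:R * (lnn R p / p%:R)).
Proof.
elim: s => [|p s IH] /= => [_ _|/andP[ps us] /andP[pp sp]].
  rewrite big_nil expR0 /hsum big_mkcond /=; case: X => [|X]; first by rewrite big_geq.
  rewrite big_ltn //= invr1 big_nat big1 ?addr0 // => m /andP[m1 _].
  case: ifP => // /allP h; have := h (pdiv m); rewrite mem_primes pdiv_prime // pdiv_dvd ltnW //.
  by rewrite in_nil => /(_ isT).
have p1 := prime_gt1 pp; have p0 : 0 < p%:R :> R by rewrite ltr0n prime_gt0.
have q0 : 0 < 1 - p%:R^-1 :> R by rewrite subr_gt0 invf_lt1 // ltr1n.
have h := hsum_cons X pp ps.
rewrite big_cons expRD -(ler_pM2l q0); apply: le_trans h _; apply: le_trans (IH us sp) _.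
rewrite [leRHS]mulrA; apply: ler_peMl; first exact: expR_ge0.
have p2 : 2%:R <= p%:R :> R by rewrite ler_nat.
have l2 : 2%:R^-1 <= lnn R p by apply: le_trans (ln2_ge R) _; rewrite ler_lnn // ltnW.
have e1 := expR_ge1Dx (4%:R * (lnn R p / p%:R)).
have e2 : 1 + 2%:R / p%:R <= expR (4%:R * (lnn R p / p%:R)).
  apply: le_trans e1; rewrite lerD2l mulrA; apply: ler_wpM2r; first by rewrite invr_ge0 ltW.
  by lra.
apply: le_trans (ler_wpM2l (ltW q0) e2).
have : 0 <= p%:R^-1 * (1 - 2%:R / p%:R) :> R.
  by rewrite mulr_ge0 ?invr_ge0 ?(ltW p0) // subr_ge0 ler_pdivrMr // mul1r.
by set z := p%:R^-1; move=> hh; lra.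
Qed.

Lemma hsum_bounded (S : pred nat) (C : R) :
  (forall n, \sum_(0 <= p < n.+1 | prime p && S p) lnn R p / p%:R <= C) ->
  forall X, hsum [seq p <- iota 0 X.+1 | prime p && S p] X <= expR (4%:R * C).
Proof.
move=> h X; apply: le_trans (hsum_le _ _ _) _.
- by rewrite filter_uniq ?iota_uniq.
- by apply/allP => p; rewrite mem_filter => /andP[/andP[]].
rewrite ler_expR -mulr_sumr; apply: ler_wpM2l => //.
by rewrite big_filter; apply: h.
Qed.

(** tau is the convolution of 1 with itself, and a product is smooth only if both factors are. *)
Lemma sum_tau_smooth s X :
  \sum_(1 <= m < X.+1 | smooth s m) (tau m)%:R / m%:R <= hsum s X ^+ 2.
Proof.
have tauE m : (0 < m < X.+1)%N -> (tau m)%:R <= \sum_(1 <= a < X.+1) (a %| m)%N%:R :> R.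
  move=> /andP[m0 mX]; rewrite -natr_sum ler_nat.
  rewrite -big_mkcond sum1_count -size_filter; apply: uniq_leq_size; first exact: divisors_uniq.
  move=> a; rewrite -dvdn_divisors // => am; rewrite mem_filter am mem_index_iota.
  by rewrite (dvdn_gt0 m0 am) (leq_ltn_trans (dvdn_leq m0 am)).
apply: (@le_trans _ _ (\sum_(1 <= m < X.+1) \sum_(1 <= a < X.+1)
    if (a %| m)%N then (smooth s m)%:R / m%:R else 0)).
  rewrite big_mkcond big_nat [leRHS]big_nat; apply: ler_sum => m mX.
  case: ifP => sm; last by apply: sumr_ge0 => a _; case: ifP => // _; rewrite mul0r.
  apply: (@le_trans _ _ ((\sum_(1 <= a < X.+1) (a %| m)%N%:R) / m%:R)).
    by apply: ler_wpM2r; rewrite ?invr_ge0 ?tauE.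
  rewrite mulr_suml; apply: ler_sum => a _; case: (a %| m)%N; by rewrite ?mul1r ?mul0r.
rewrite exchange_big /= expr2 [X in X * _]/hsum mulr_suml [leRHS]big_mkcond /=.
rewrite big_nat [leRHS]big_nat; apply: ler_sum => a /andP[a0 aX].
rewrite -big_mkcond /= (sum_multiples (fun m => (smooth s m)%:R / m%:R : R)) //.
have [sa|sa] := boolP (smooth s a); last first.
  rewrite big_nat big1 // => m /andP[m0 _]; rewrite (_ : smooth s (a * m) = false) ?mul0r //.
  by apply: contraNF sa; apply: smooth_dvd; rewrite ?muln_gt0 ?a0 // dvdn_mulr.
apply: (@le_trans _ _ (a%:R^-1 * hsum s (X %/ a))); last first.
  by apply: ler_wpM2l; rewrite ?invr_ge0 // hsum_mono // leq_div.
rewrite /hsum mulr_sumr [leRHS]big_mkcond [leLHS]big_nat [leRHS]big_nat; apply: ler_sum => m /andP[m0 _].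
have [sm|sm] := boolP (smooth s m).
  by rewrite natrM invfM; apply: ler_piMl; rewrite ?mulr_ge0 ?invr_ge0 ?ler0n // lern1; case: smooth.
rewrite (_ : smooth s (a * m) = false) ?mul0r //.
by apply: contraNF sm; apply: smooth_dvd; rewrite ?muln_gt0 ?a0 // dvdn_mull.
Qed.

Lemma sum_fibers_le (T K : eqType) (f : T -> K) (L : seq T) (ks : seq K) (b F : K -> R) :
  uniq ks -> (forall x, x \in L -> f x \in ks) -> (forall y, 0 <= F y) ->
  (forall y, y \in ks -> (count (fun x => f x == y) L)%:R <= b y) ->
  \sum_(x <- L) F (f x) <= \sum_(y <- ks) b y * F y.
Proof.
move=> uk h F0 hb; apply: (@le_trans _ _ (\sum_(x <- L) \sum_(y <- ks | f x == y) F y)).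
  rewrite !big_seq; apply: ler_sum => x xL; rewrite big_mkcond (bigD1_seq (f x)) ?h //= eqxx.
  by rewrite lerDl sumr_ge0 // => y _; case: ifP.
rewrite (exchange_big_dep xpredT) //= !big_seq; apply: ler_sum => y yk.
by rewrite big_const_seq iter_addr addr0 -mulr_natl; apply: ler_wpM2r; rewrite ?hb.
Qed.

Lemma sum_inv_sq n : \sum_(1 <= g < n.+1) (g%:R ^+ 2)^-1 <= 2%:R :> R.
Proof.
suff h : \sum_(1 <= g < n.+2) (g%:R ^+ 2)^-1 <= 2%:R - n.+1%:R^-1 :> R.
  case: n h => [|n] h; first by rewrite big_geq.
  apply: le_trans (_ : _ <= \sum_(1 <= g < n.+3) (g%:R ^+ 2)^-1) _.
    by rewrite [leRHS]big_nat_recr //= lerDl invr_ge0 exprn_ge0.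
  by apply: le_trans h _; rewrite gerBl invr_ge0.
elim: n => [|n IH]; first by rewrite big_nat1 expr1n invr1; lra.
rewrite big_nat_recr //=; apply: le_trans (lerD IH (lexx _)) _.
have a0 : 0 < n.+1%:R :> R by rewrite ltr0n.
have e : n.+2%:R = n.+1%:R + 1 :> R by rewrite natr1.
rewrite e; move: (n.+1%:R : R) a0 => a a0.
rewrite -subr_ge0 (_ : _ - _ = (a * (a + 1) ^+ 2)^-1).
  by rewrite invr_ge0 mulr_ge0 ?(ltW a0) // sqr_ge0.
by field; apply/andP; split; apply: lt0r_neq0; lra.
Qed.

Lemma harmonic_ge n : lnn R n.+1 <= \sum_(1 <= k < n.+1) k%:R^-1.
Proof.
elim: n => [|n IH]; first by rewrite big_geq // lnn1.
rewrite big_nat_recr //= -[leLHS](subrK (lnn R n.+1)) addrC.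
by apply: lerD; [exact: lnnS_sub|exact: IH].
Qed.

(** * Values of the norm form u^2 - D v^2 in a cone *)

Section Cone.
Variables (D B : nat).
Hypothesis D0 : (0 < D)%N.
Let N0 := (2 * D * B`!)%N.
Definition cone_form (u v : nat) := (u ^ 2 - D * v ^ 2)%N.
(** For coprime u, v the congruences leave only prime factors p > B of the form, modulo which D is a
    square; 4 D v <= u keeps the value comparable to u^2. *)
Definition cone (u v : nat) := [&& coprime u N0, (N0 %| v)%N, (0 < v)%N & (4 * D * v <= u)%N].

Lemma cone_form_ge u v : cone u v -> (15 * u ^ 2 <= 16 * cone_form u v)%N.
Proof.
move=> /and4P[_ _ v0 h]; rewrite /cone_form.
have : (16 * (D * v ^ 2) <= u ^ 2)%N.
  apply: (@leq_trans ((4 * D * v) ^ 2)%N); last by rewrite leq_exp2r.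
  rewrite !expnMn [X in (_ <= X)%N](_ : _ = 16 * (D * (D * v ^ 2)))%N; last by rewrite [(D ^ 2)%N]expnS expn1; lia.
  by rewrite leq_mul2l /= leq_pmull.
lia.
Qed.

Lemma cone_formE u v : cone u v -> (cone_form u v)%:Z = u%:Z ^+ 2 - D%:Z * v%:Z ^+ 2.
Proof.
move=> c; have h := cone_form_ge c; have /and4P[_ _ v0 h'] := c.
have u0 : (0 < u)%N by apply: leq_trans h'; rewrite !muln_gt0 D0 v0.
rewrite /cone_form -subzn; first by rewrite PoszM !PoszX.
have : (0 < u ^ 2)%N by rewrite expn_gt0 u0.
by move: h; rewrite /cone_form; lia.
Qed.

Lemma cone_form_gt0 u v : cone u v -> (0 < cone_form u v)%N.
Proof.
move=> c; have h := cone_form_ge c; have /and4P[_ _ v0 h'] := c.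
have u0 : (0 < u ^ 2)%N by rewrite expn_gt0 (leq_trans _ h') // !muln_gt0 D0 v0.
lia.
Qed.

Lemma cone_div u v g : (0 < g)%N -> cone (g * u) (g * v) -> cone u v.
Proof.
move=> g0 /and4P[c n v0 h]; move: c; rewrite coprimeMl => /andP[cg cu].
rewrite /cone cu /=; move: n v0 h; rewrite Gauss_dvdr 1?coprime_sym // => ->.
by rewrite muln_gt0 g0 /= mulnCA leq_pmul2l // => -> ->.
Qed.

Lemma cone_form_scale u v g : cone_form (g * u) (g * v) = (g ^ 2 * cone_form u v)%N.
Proof. by rewrite /cone_form !expnMn mulnBr mulnCA. Qed.

Lemma cone_form_coprime u v : cone u v -> coprime (cone_form u v) N0.
Proof.
move=> c; have cf0 := cone_form_gt0 c; have /and4P[cu /dvdnP[k vE] v0 h'] := c.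
rewrite coprime_sym /coprime -(gcdnMDl (D * v * k)) (_ : _ + _ = u ^ 2)%N.
  by rewrite -/(coprime _ _) coprimeXr // coprime_sym.
have -> : (D * v * k * N0 = D * v ^ 2)%N by rewrite -!mulnA -vE expnS expn1.
by rewrite /cone_form addnC subnK //; move: cf0; rewrite /cone_form; lia.
Qed.

Variable S : pred nat.
Hypothesis HS : forall (p : nat) (r : int), prime p -> (B < p)%N -> (p%:Z %| r ^+ 2 - D%:Z)%Z -> S p.

Definition ratio_mod (u v m : nat) := (u * (egcdn v m).1 %% m)%N.

Lemma ratio_modP u v m : (0 < v)%N -> coprime v m -> (m%:Z %| (ratio_mod u v m)%:Z * v%:Z - u%:Z)%Z.
Proof.
move=> v0 /eqP cvm; rewrite /ratio_mod; case: (egcdnP m v0) => km kn E _ /=; rewrite cvm in E.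
rewrite -eqz_mod_dvd -PoszM !modz_nat modnMml -mulnA E mulnDr muln1 mulnA mulnC.
by rewrite eqz_nat [(m * _)%N]mulnC modnMDl.
Qed.

Lemma cone_coprime_form u v : cone u v -> coprime u v -> coprime v (cone_form u v).
Proof.
move=> c cuv; have cf0 := cone_form_gt0 c.
rewrite /coprime -(gcdnMDl (D * v)) (_ : _ + _ = u ^ 2)%N.
  by rewrite -/(coprime _ _) coprimeXr // coprime_sym.
rewrite -mulnA mulnn.
by rewrite /cone_form addnC subnK //; move: cf0; rewrite /cone_form; lia.
Qed.

Lemma ratio_mod_root u v (m := cone_form u v) : cone u v -> coprime u v ->
  (m%:Z %| (ratio_mod u v m)%:Z ^+ 2 - D%:Z)%Z.
Proof.
move=> c cuv; have /and4P[_ _ v0 _] := c; have cvm := cone_coprime_form c cuv.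
have h := ratio_modP u v0 cvm; set r := ratio_mod _ _ _ in h *.
have cvm2 : coprimez m (v%:Z ^+ 2) by rewrite -PoszX /coprimez /= -[_ == _]/(coprime _ _) coprimeXr // coprime_sym.
rewrite -(Gauss_dvdzr _ cvm2).
have -> : v%:Z ^+ 2 * (r%:Z ^+ 2 - D%:Z) = (r%:Z * v%:Z - u%:Z) * (r%:Z * v%:Z + u%:Z) + (u%:Z ^+ 2 - D%:Z * v%:Z ^+ 2) by ring.
by rewrite -cone_formE // -/m; apply: rpredD; [apply: dvdz_mulr|].
Qed.

Lemma cone_form_smooth u v X : cone u v -> coprime u v -> (cone_form u v <= X)%N ->
  smooth [seq p <- iota 0 X.+1 | prime p && S p] (cone_form u v).
Proof.
move=> c cuv mX; have m0 := cone_form_gt0 c; apply/allP => p; rewrite mem_primes => /and3P[pp _ pm].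
rewrite mem_filter pp mem_iota /= add0n ltnS (leq_trans (dvdn_leq m0 pm) mX) andbT.
apply: (HS (r := ratio_mod u v (cone_form u v)) pp).
  rewrite ltnNge; apply/negP => pB; have := cone_form_coprime c; move/(coprime_dvdl pm).
  by rewrite prime_coprime // => /negP; apply; rewrite /N0 dvdn_mull // dvdn_fact // prime_gt0.
by apply: dvdz_trans (ratio_mod_root c cuv).
Qed.

(** u / v modulo m is a square root of D. Equal m and equal roots make m divide u v' - u' v, which
    in the cone is smaller than m; so the ratios agree and coprimality concludes. *)
Lemma cone_inj u v u' v' : cone u v -> coprime u v -> cone u' v' -> coprime u' v' ->
  cone_form u v = cone_form u' v' ->
  ratio_mod u v (cone_form u v) = ratio_mod u' v' (cone_form u' v') -> (u, v) = (u', v').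
Proof.
move=> c cuv c' cuv' E; rewrite -E => R1; set m := cone_form u v in E R1.
have m0 : (0 < m)%N := cone_form_gt0 c.
have /and4P[_ _ v0 h] := c; have /and4P[_ _ v0' h'] := c'.
have d1 := ratio_modP u v0 (cone_coprime_form c cuv).
have d2 := ratio_modP u' v0' (cone_coprime_form c' cuv'); rewrite -E -R1 in d2; rewrite -/m in d1.
have b1 := cone_form_ge c; have b2 := cone_form_ge c'; rewrite -/m in b1; rewrite -E in b2.
have D4 : (4 <= 4 * D)%N by rewrite leq_pmulr.
have h1 : (4 * v <= u)%N by apply: leq_trans h; rewrite leq_mul2r D4 orbT.
have h1' : (4 * v' <= u')%N by apply: leq_trans h'; rewrite leq_mul2r D4 orbT.
have uu : (15 * (u * u') <= 16 * m)%N.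
  have := leq_mul b1 b2 => e; rewrite -(@leq_exp2r _ _ 2) //.
  apply: leq_trans (leq_trans _ e) _; first by rewrite !expnMn -[(15 ^ 2)%N]/(15 * 15)%N mulnACA.
  by rewrite !expnS !expn0 !muln1.
have cr : (m%:Z %| u%:Z * v'%:Z - u'%:Z * v%:Z)%Z.
  rewrite (_ : _ - _ = ((ratio_mod u v m)%:Z * v'%:Z - u'%:Z) * v%:Z - ((ratio_mod u v m)%:Z * v%:Z - u%:Z) * v'%:Z); last by ring.
  by apply: rpredB; apply: dvdz_mulr.
have [k1 k2] : (4 * (u * v') <= u * u' /\ 4 * (u' * v) <= u * u')%N.
  by split; [rewrite mulnCA leq_mul2l h1' orbT|rewrite mulnCA [(u * u')%N]mulnC leq_mul2l h1 orbT].
have eq : (u * v' = u' * v)%N.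
  have : `|(u%:Z * v'%:Z - u'%:Z * v%:Z)%R|%N = 0%N.
    apply/eqP; rewrite -leqn0 leqNgt; apply/negP => gt0.
    have := dvdn_leq gt0 cr; rewrite -!PoszM; move: k1 k2 uu m0.
    by generalize (u * v')%N (u' * v)%N (u * u')%N => *; lia.
  by rewrite -!PoszM; lia.
have uu' : u = u'.
  apply/eqP; rewrite eqn_dvd -(Gauss_dvdl _ cuv) -eq dvdn_mulr //=.
  by rewrite -(Gauss_dvdl _ cuv') eq dvdn_mulr.
congr (_, _); first exact: uu'.
move: eq; rewrite uu' => /eqP; rewrite eqn_pmul2l => [/eqP//|].
by apply: leq_trans h'; rewrite !muln_gt0 D0 v0'.
Qed.

Definition cone_sum (U : nat) : R :=
  \sum_(x <- [seq (u, v) | u <- iota 1 U, v <- iota 1 U] | cone x.1 x.2) (cone_form x.1 x.2)%:R^-1.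

(** After division by g = gcd(u, v), a value m comes from at most 6 tau(m) pairs, by the bound for
    square roots of D modulo m. The constant 12 is 6 times the bound 2 for the sum of 1 / g^2. *)
Lemma cone_sum_le U : cone_sum U <=
  12%:R * hsum [seq p <- iota 0 (U ^ 2).+1 | prime p && S p] (U ^ 2) ^+ 2.
Proof.
set s := [seq p <- _ | _]; set X := (U ^ 2)%N.
pose f (x : nat * nat) := let g := gcdn x.1 x.2 in (g, cone_form (x.1 %/ g) (x.2 %/ g)).
pose F (y : nat * nat) : R := (y.1%:R ^+ 2)^-1 * y.2%:R^-1.
pose L := [seq x <- [seq (u, v) | u <- iota 1 U, v <- iota 1 U] | cone x.1 x.2].
pose ks := [seq (g, m) | g <- iota 1 U, m <- [seq m <- iota 1 X | smooth s m]].
have LP x : x \in L -> [/\ (0 < x.1 <= U)%N, (0 < x.2 <= U)%N, cone x.1 x.2 & let g := gcdn x.1 x.2 in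
   [/\ (0 < g <= U)%N, (g * (x.1 %/ g) = x.1)%N, (g * (x.2 %/ g) = x.2)%N & cone (x.1 %/ g) (x.2 %/ g) /\ coprime (x.1 %/ g) (x.2 %/ g)]].
  rewrite mem_filter => /andP[cx /allpairsP[[u v] /= [uU vU xE]]].
  move: uU vU cx; rewrite xE /= !mem_iota !add1n !ltnS => uU vU cx; split=> //.
  have /andP[u0 uU'] := uU; have g0 : (0 < gcdn u v)%N by rewrite gcdn_gt0 u0.
  have e1 : (gcdn u v * (u %/ gcdn u v) = u)%N by rewrite mulnC divnK // dvdn_gcdl.
  have e2 : (gcdn u v * (v %/ gcdn u v) = v)%N by rewrite mulnC divnK // dvdn_gcdr.
  split=> //; first by rewrite g0 (leq_trans (dvdn_leq u0 (dvdn_gcdl _ _))).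
  split; first by apply: (cone_div g0); rewrite e1 e2.
  by rewrite /coprime -(eqn_pmul2l g0) muln_gcdr e1 e2 muln1.
have -> : cone_sum U = \sum_(x <- L) F (f x).
  rewrite /cone_sum /L big_filter -[LHS]big_filter -[RHS]big_filter big_seq [RHS]big_seq.
  apply: eq_bigr => x /LP[_ _ _ [_ e1 e2 _]].
  rewrite /F /f /=; have := cone_form_scale (x.1 %/ gcdn x.1 x.2) (x.2 %/ gcdn x.1 x.2) (gcdn x.1 x.2).
  by rewrite e1 e2 => ->; rewrite natrM natrX invfM.
apply: (@le_trans _ _ (\sum_(y <- ks) (6 * tau y.2)%:R * F y)).
  apply: sum_fibers_le.
  - by rewrite allpairs_uniq ?filter_uniq ?iota_uniq // => -[? ?] [].
  - move=> x /LP[xU yU cx [gU e1 e2 [cx' cop]]]; apply/allpairsP; exists (f x); split=> //=.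
      by rewrite mem_iota add1n ltnS.
    have mX : (cone_form (x.1 %/ gcdn x.1 x.2) (x.2 %/ gcdn x.1 x.2) <= X)%N.
      apply: leq_trans (leq_subr _ _) _; rewrite leq_exp2r //.
      by apply: leq_trans (leq_div _ _) _; case/andP: xU.
    by rewrite mem_filter cone_form_smooth // mem_iota add1n ltnS (cone_form_gt0 cx') mX.
  - by move=> y; rewrite mulr_ge0 ?invr_ge0 ?exprn_ge0.
  move=> [g m] /allpairsP[[g' m'] /= [_ mX [-> ->]]]; rewrite ler_nat.
  have [/hasP[x0 x0L /eqP fx0]|/negP n] := boolP (has (fun x => f x == (g', m')) L); last first.
    by rewrite [X in (X <= _)%N](_ : _ = 0%N) //; apply/eqP; rewrite eqn0Ngt -has_count; apply/negP.
  have cm : coprime m' N0.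
    by have [_ _ _ [_ _ _ [cx _]]] := LP _ x0L; case: fx0 => _ <-; apply: cone_form_coprime.
  have m0 : (0 < m')%N by move: mX; rewrite mem_filter mem_iota => /and3P[].
  apply: leq_trans (@nroots_le D m' m0 _); last first.
    move=> h hm hD; have : (h ^ 2 %| 2 * N0)%N.
      have /dvdn_trans : (h ^ 2 %| 4 * D)%N by [].
      by apply; rewrite /N0 !mulnA; apply: dvdn_mulr.
    have c2 : coprime (h ^ 2) N0 := coprime_dvdl hm cm.
    have c3 : coprime (h ^ 2) 2 by apply: coprime_dvdr c2; rewrite /N0 -mulnA dvdn_mulr.
    rewrite Gauss_dvdr // => h2; have : (h ^ 2 %| gcdn (h ^ 2) N0)%N by rewrite dvdn_gcd h2 andbT.
    by rewrite (eqP c2) dvdn1 => /eqP; case: (h) => [|[|]] // k; rewrite -mulnn; lia.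
  rewrite /nroots -!size_filter.
  pose r (x : nat * nat) := let g := gcdn x.1 x.2 in ratio_mod (x.1 %/ g) (x.2 %/ g) (f x).2.
  rewrite -(size_map r); apply: uniq_leq_size.
    have uL : uniq L by rewrite filter_uniq // allpairs_uniq ?iota_uniq // => -[? ?] [].
    rewrite map_inj_in_uniq; first by rewrite (filter_uniq _ uL).
    move=> x y; rewrite ![_ \in filter _ L]mem_filter => /andP[/eqP fx xL] /andP[/eqP fy yL] rE.
    have [_ _ _ [_ e1 e2 [c1 c2]]] := LP _ xL; have [_ _ _ [_ e3 e4 [c3 c4]]] := LP _ yL.
    have E := cone_inj c1 c2 c3 c4 _ rE; move: (fx); rewrite -fy => -[gE mE].
    have [a1 a2] := E mE; have x1 : x.1 = y.1 by rewrite -e1 a1 gE e3.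
    have x2 : x.2 = y.2 by rewrite -e2 a2 gE e4.
    by rewrite [x]surjective_pairing [y]surjective_pairing x1 x2.
  move=> k /mapP[x]; rewrite [_ \in filter _ L]mem_filter => /andP[/eqP fx xL] ->.
  have [_ _ _ [_ _ _ [c1 c2]]] := LP _ xL.
  have m'E : cone_form (x.1 %/ gcdn x.1 x.2) (x.2 %/ gcdn x.1 x.2) = m' by case: fx.
  rewrite mem_filter mem_iota /= add0n /r fx /= ltn_pmod // andbT.
  by have := ratio_mod_root c1 c2; rewrite m'E.
rewrite big_allpairs_dep /= /F /=.
apply: (@le_trans _ _ (\sum_(g <- iota 1 U) (g%:R ^+ 2)^-1 * (6%:R * hsum s X ^+ 2))).
  apply: ler_sum => g _; rewrite big_filter.
  have h := sum_tau_smooth s X; rewrite /index_iota subSS subn0 in h.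
  apply: (@le_trans _ _ ((g%:R ^+ 2)^-1 * (6%:R * \sum_(m <- iota 1 X | smooth s m) (tau m)%:R / m%:R))).
    have gen (x y z t : R) : x * y * (z * t) = z * (x * (y * t)) by ring.
    by rewrite !mulr_sumr; apply: ler_sum => m _; rewrite (natrM R 6 (tau m)) (gen 6%:R).
  apply: ler_wpM2l; first by rewrite invr_ge0 exprn_ge0.
  exact: ler_wpM2l.
rewrite -mulr_suml mulrA; apply: ler_wpM2r; first exact: sqr_ge0.
have := sum_inv_sq U; rewrite /index_iota subSS subn0; lra.
Qed.

Lemma ler_sum_sub (T : eqType) (s1 s2 : seq T) (F : T -> R) : uniq s1 -> uniq s2 ->
  {subset s1 <= s2} -> (forall x, 0 <= F x) -> \sum_(x <- s1) F x <= \sum_(x <- s2) F x.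
Proof.
move=> u1 u2 s12 F0; have -> : \sum_(x <- s2) F x = \sum_(x <- s2) 1 * F x.
  by apply: eq_bigr => x _; rewrite mul1r.
apply: (@sum_fibers_le _ _ id) => // y _; rewrite (eq_count (a2 := pred1 y)) //.
by rewrite count_uniq_mem // lern1; case: (_ \in _).
Qed.

(** For u = 1 + N0 k all v = N0 j with j <= u / (4 D N0) are admissible, each contributing at least
    1 / u^2; every large k thus contributes a multiple of 1 / k. *)
Lemma cone_sum_ge : exists2 c : R, 0 < c & forall K, c * (lnn R K.+1 - (8 * D)%:R) <= cone_sum (1 + N0 * K)%N.
Proof.
have N00 : (0 < N0)%N by rewrite !muln_gt0 D0 fact_gt0.
pose a := (4 * D * N0)%N; have a0 : (0 < a)%N by rewrite /a 2!muln_gt0 D0 N00.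
exists ((2 * a)%N%:R * (2 * N0)%N%:R)^-1 => [|K].
  by rewrite invr_gt0; apply: mulr_gt0; rewrite ltr0n muln_gt0 ?a0 ?N00.
pose U (k : nat) := (1 + N0 * k)%N.
pose s1 := [seq (U kj.1, N0 * kj.2)%N | kj <- [seq (k, j) | k <- [seq k <- iota 1 K | (8 * D <= k)%N], j <- iota 1 (U k %/ a)]].
have -> : cone_sum (1 + N0 * K)%N = \sum_(x <- [seq x <- [seq (u, v) | u <- iota 1 (U K), v <- iota 1 (U K)] | cone x.1 x.2]) (cone_form x.1 x.2)%:R^-1.
  by rewrite /cone_sum big_filter.
have LP u v : (0 < u <= U K)%N -> (0 < v <= U K)%N -> cone u v ->
    (u, v) \in [seq x <- [seq (u, v) | u <- iota 1 (U K), v <- iota 1 (U K)] | cone x.1 x.2].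
  move=> hu hv cuv; rewrite mem_filter cuv; apply/allpairsP; exists (u, v).
  by rewrite !mem_iota !add1n !ltnS.
apply: le_trans (ler_sum_sub (s1 := s1) _ _ _ _); first last.
- by move=> x; rewrite invr_ge0.
- move=> x /mapP[[k j] /allpairsPdep[k' [j' [kK jU [-> ->]]]] ->].
  move: kK; rewrite mem_filter mem_iota add1n ltnS => /and3P[k8 k1 kK].
  move: jU; rewrite mem_iota add1n ltnS => /andP[j1 jU].
  have jU' : (j' * a <= U k')%N by rewrite -leq_divRL.
  have cn : (4 * D * (N0 * j') <= U k')%N by rewrite mulnA mulnC.
  have UK : (U k' <= U K)%N by rewrite leq_add2l leq_mul2l kK orbT.
  have Nj : (0 < N0 * j')%N by rewrite muln_gt0 N00.
  apply: LP; rewrite ?UK ?Nj //=.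
    by apply: leq_trans UK; apply: leq_trans cn; rewrite leq_pmull // muln_gt0.
  rewrite /cone cn Nj dvdn_mulr //= /U addnC mulnC coprime_sym /coprime gcdnMDl gcdn1 //.
- by rewrite filter_uniq ?allpairs_uniq ?iota_uniq // => -[? ?] [].
- rewrite map_inj_in_uniq ?allpairs_uniq_dep ?filter_uniq ?iota_uniq //.
  + by move=> *; apply: iota_uniq.
  + by move=> [? ?] [? ?] _ _ [-> ->].
  by move=> [k j] [k' j'] _ _ [] /= /eqP + /eqP; rewrite /U eqn_add2l !eqn_pmul2l // => /eqP-> /eqP->.
rewrite big_map big_allpairs_dep /=.
have H : lnn R K.+1 - (8 * D)%:R <= \sum_(k <- [seq k <- iota 1 K | (8 * D <= k)%N]) k%:R^-1.
  rewrite big_filter; have := harmonic_ge K; rewrite /index_iota subSS subn0.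
  rewrite (bigID (fun k => 8 * D <= k)%N) /=.
  have : \sum_(k <- iota 1 K | ~~ (8 * D <= k)%N) k%:R^-1 <= (8 * D)%:R :> R.
    apply: (@le_trans _ _ (\sum_(k <- iota 1 K | ~~ (8 * D <= k)%N) 1)).
      rewrite big_seq_cond [leRHS]big_seq_cond; apply: ler_sum => k /andP[]; rewrite mem_iota => /andP[k1 _] _.
      by rewrite invf_le1 ?ltr0n // ler1n.
    rewrite big_const_seq iter_addr addr0 ler_nat -size_filter -[leqRHS](size_iota 0).
    apply: uniq_leq_size; first by rewrite filter_uniq ?iota_uniq.
    by move=> k; rewrite mem_filter !mem_iota -ltnNge /= => /andP[].
  lra.
apply: le_trans (ler_wpM2l _ H) _; first by rewrite invr_ge0 mulr_ge0.
rewrite mulr_sumr big_seq [leRHS]big_seq; apply: ler_sum => k; rewrite mem_filter mem_iota => /and3P[k8 k1 _].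
have U0 : 0 < (U k)%:R :> R by rewrite ltr0n.
apply: (@le_trans _ _ (\sum_(j <- iota 1 (U k %/ a)) ((U k)%:R ^+ 2)^-1)); last first.
  rewrite big_seq [leRHS]big_seq; apply: ler_sum => j; rewrite mem_iota add1n ltnS => /andP[j1 jU].
  have jU' : (j * a <= U k)%N by rewrite -leq_divRL.
  have cc : cone (U k) (N0 * j).
    rewrite /cone /U -[(1 + _)%N]addnC [(N0 * k)%N]mulnC.
    rewrite coprime_sym /coprime gcdnMDl gcdn1 /= dvdn_mulr // muln_gt0 N00 j1 /=.
    by rewrite -[(k * N0 + 1)%N]addnC [(k * N0)%N]mulnC mulnA mulnC.
  rewrite lef_pV2 ?posrE ?exprn_gt0 ?ltr0n ?cone_form_gt0 // -natrX ler_nat.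
  exact: leq_subr.
rewrite big_const_seq count_predT size_iota iter_addr addr0 -[leRHS]mulr_natl.
have h1 := divn_ge_div R (U k) a0.
have a0' : 0 < a%:R :> R by rewrite ltr0n.
have n0' : 0 < N0%:R :> R by rewrite ltr0n.
have k0' : 0 < k%:R :> R by rewrite ltr0n.
have U2 : 2%:R * a%:R <= (U k)%:R :> R.
  rewrite -natrM ler_nat /U /a; apply: leq_trans (leq_addl _ _).
  by rewrite mulnA mulnC leq_mul2l mulnA k8 orbT.
have Uk : (U k)%:R <= 2%:R * N0%:R * k%:R :> R.
  by rewrite -!natrM ler_nat /U -mulnA mul2n -addnn leq_add2r muln_gt0 N00.
apply: (@le_trans _ _ ((2%:R * a%:R)^-1 * (U k)%:R^-1)).
  rewrite (natrM R 2 a) (natrM R 2 N0) -!invfM lef_pV2 ?posrE ?mulr_gt0 //.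
  by rewrite -[leRHS]mulrA; apply: ler_wpM2l; rewrite ?mulr_ge0.
rewrite expr2 [X in _ <= _ * X]invfM [leRHS]mulrA; apply: ler_wpM2r; first by rewrite invr_ge0 ltW.
rewrite ler_pdivlMr //; apply: le_trans h1.
rewrite invfM -mulrA mulrC [_^-1 * _]mulrC.
have : 2%:R <= (U k)%:R / a%:R :> R by rewrite ler_pdivlMr.
by set z := (U k)%:R / a%:R; lra.
Qed.

(** Bounded weight would bound the sums over smooth numbers and with them [cone_sum], which grows
    like a logarithm. This is the elementary substitute for the density of split primes. *)
Lemma norm_primes_unbounded C :
  ~ (forall n, \sum_(0 <= p < n.+1 | prime p && S p) lnn R p / p%:R <= C).
Proof.
move=> h; have [c c0 hc] := cone_sum_ge; pose M := 12%:R * (expR (4%:R * C)) ^+ 2.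
have {}hc K : c * (lnn R K.+1 - (8 * D)%:R) <= M.
  apply: le_trans (hc K) _; apply: le_trans (cone_sum_le _) _; apply: ler_wpM2l => //.
  by rewrite lerXn2r ?nnegrE ?hsum_ge0 ?expR_ge0 ?hsum_bounded.
pose L := M / c + (8 * D)%:R + 1.
pose K := Num.bound (expR L); have := hc K; rewrite -ler_pdivlMl // mulrC => h1.
have h2 : expR L < K.+1%:R.
  apply: lt_le_trans (archi_boundP (expR_ge0 L)) _; by rewrite ler_nat.
have : L < lnn R K.+1 by rewrite /lnn -[ltLHS]expRK ltr_ln ?posrE ?expR_gt0 ?ltr0n.
by rewrite /L; lra.
Qed.

End Cone.
End Density.

(** * Roots of a cubic polynomial modulo primes *)
From mathcomp Require Import boolp.

(* The norm of x0 + x1 T + x2 T^2 in Z[T]/(T^3 - P T - Q). *)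
Definition cubic_norm (P Q x0 x1 x2 : int) : int :=
  x0 ^+ 3 + Q * x1 ^+ 3 + Q ^+ 2 * x2 ^+ 3 + 2 * P * x0 ^+ 2 * x2 - P * x0 * x1 ^+ 2
  - 3 * Q * x0 * x1 * x2 + P ^+ 2 * x0 * x2 ^+ 2 - P * Q * x1 * x2 ^+ 2.

Definition depressed (P Q t : int) : int := t ^+ 3 - P * t - Q.

(* The rows of the matrix of multiplication by x; (1, t, t^2) is an eigenvector for a root t. *)
Section CubicNorm.
Variables (P Q x0 x1 x2 : int).
Let ev t := x0 + x1 * t + x2 * t ^+ 2.
Let ev1 t := t * ev t - x2 * depressed P Q t.
Let ev2 t := t ^+ 2 * ev t - (x1 + x2 * t) * depressed P Q t.

Lemma cubic_norm_det1 t : cubic_norm P Q x0 x1 x2 =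
  ev t * ((x0 + P * x2) ^+ 2 - x1 * (Q * x2 + P * x1))
  - ev1 t * (x1 * (x0 + P * x2) - x2 * (Q * x2 + P * x1)) + ev2 t * (x1 ^+ 2 - x2 * (x0 + P * x2)).
Proof. rewrite /cubic_norm /ev2 /ev1 /ev /depressed; ring. Qed.

Lemma cubic_norm_det2 t s : cubic_norm P Q x0 x1 x2 * (s - t) =
  ev t * (ev1 s * (x0 + P * x2) - ev2 s * x1) - ev1 t * (ev s * (x0 + P * x2) - ev2 s * x2)
  + ev2 t * (ev s * x1 - ev1 s * x2).
Proof. rewrite /cubic_norm /ev2 /ev1 /ev /depressed; ring. Qed.

Lemma cubic_norm_dvd (p : int) t : (p %| depressed P Q t)%Z -> (p %| ev t)%Z ->
  (p %| cubic_norm P Q x0 x1 x2)%Z.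
Proof.
move=> gt et; have e1 : (p %| ev1 t)%Z by apply: rpredB; apply: dvdz_mull.
have e2 : (p %| ev2 t)%Z by apply: rpredB; apply: dvdz_mull.
by rewrite (cubic_norm_det1 t); apply: rpredD; [apply: rpredB|]; apply: dvdz_mulr.
Qed.

Lemma cubic_norm_dvd2 (p : nat) t s : prime p -> ~~ (p%:Z %| s - t)%Z ->
  (p%:Z %| depressed P Q t)%Z -> (p%:Z %| depressed P Q s)%Z -> (p%:Z %| ev t)%Z -> (p%:Z %| ev s)%Z ->
  ((p ^ 2)%N%:Z %| cubic_norm P Q x0 x1 x2)%Z.
Proof.
move=> pp st gt gs et es.
have e1 u : (p%:Z %| depressed P Q u)%Z -> (p%:Z %| ev u)%Z -> (p%:Z %| ev1 u)%Z.
  by move=> gu eu; apply: rpredB; apply: dvdz_mull.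
have e2 u : (p%:Z %| depressed P Q u)%Z -> (p%:Z %| ev u)%Z -> (p%:Z %| ev2 u)%Z.
  by move=> gu eu; apply: rpredB; apply: dvdz_mull.
have : ((p ^ 2)%N%:Z %| cubic_norm P Q x0 x1 x2 * (s - t))%Z.
  rewrite (cubic_norm_det2 t s) PoszX expr2; apply: rpredD; [apply: rpredB|]; apply: dvdz_mul;
    rewrite ?e1 ?e2 //; apply: rpredB; apply: dvdz_mulr; rewrite ?e1 ?e2 //.
rewrite Gauss_dvdzl // PoszX coprimezXl // coprimezE prime_coprime //.
Qed.

(** Norm zero means a common factor with T^3 - P T - Q, hence a rational root, which is integral
    since the cubic is monic. *)
Lemma cubic_norm_root : (x0, x1, x2) != (0, 0, 0) -> cubic_norm P Q x0 x1 x2 = 0 ->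
  exists t, depressed P Q t = 0.
Proof.
move=> x_neq0 N0; suff [u [v [v0 uv]]] : exists u v : int, v != 0 /\ u ^+ 3 - P * u * v ^+ 2 - Q * v ^+ 3 = 0.
  pose g := gcdz u v; have g0 : g != 0 by rewrite gcdz_eq0 negb_and v0 orbT.
  have [u' uE] := dvdzP (dvdz_gcdl u v); have [v' vE] := dvdzP (dvdz_gcdr u v); rewrite -/g in uE vE.
  have cop : coprimez v' u'.
    apply/coprimezP; have [a [b ab]] := Bezoutz v u; exists (a, b) => /=.
    apply: (mulIf g0); rewrite mul1r mulrDl -!mulrA -uE -vE ab gcdzC //.
  have E : u' ^+ 3 = v' ^+ 2 * (P * u' + Q * v').
    apply: (mulIf (expf_neq0 3 g0)); apply/eqP; rewrite -subr_eq0 -uv uE vE; apply/eqP; ring.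
  have : (v' %| 1)%Z.
    have : (v' %| u' ^+ 3 * 1)%Z by rewrite mulr1 E expr2 -mulrA dvdz_mulr.
    by rewrite Gauss_dvdzr // coprimezXr.
  rewrite dvdz1 => /eqP v1; have v2 : v' ^+ 2 = 1.
    by rewrite -[LHS](normr_idP (sqr_ge0 _)) normrX -abszE v1.
  exists (u' * v'); rewrite /depressed exprMn E v2 mul1r exprS v2 mulr1.
  by rewrite mulrDl -[Q * v' * v']mulrA -expr2 v2; ring.
(* a T + b is the remainder of x2^2 (T^3 - P T - Q) on division by x2 T^2 + x1 T + x0, with quotient
   x2 T - x1. The root is -b / a if a != 0; if the remainder vanishes, it is x1 / x2. *)
pose a := x1 ^+ 2 - x0 * x2 - P * x2 ^+ 2; pose b := x0 * x1 - Q * x2 ^+ 2.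
have E : b ^+ 3 + Q * a ^+ 3 - P * b * a ^+ 2 = 0.
  have : b ^+ 3 + Q * a ^+ 3 - P * b * a ^+ 2 = - cubic_norm P Q x0 x1 x2 * (- x1 ^+ 3 + Q * x2 ^+ 3 + P * x1 * x2 ^+ 2).
    rewrite /a /b /cubic_norm; ring.
  by rewrite N0 oppr0 mul0r.
have [a0|a0] := eqVneq a 0; last by exists b, (- a); rewrite oppr_eq0; split=> //; rewrite -[RHS]E; ring.
have b0 : b = 0.
  by move: E; rewrite a0 !expr0n /= !mulr0 subr0 addr0 => /eqP; rewrite expf_eq0 /= => /eqP.
have [x20|x20] := eqVneq x2 0.
  have x10 : x1 = 0 by move: a0; rewrite /a x20 expr0n /= !mulr0 !subr0 => /eqP; rewrite expf_eq0 /= => /eqP.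
  have e : cubic_norm P Q x0 x1 x2 = x0 ^+ 3 by rewrite /cubic_norm x10 x20; ring.
  move: N0 x_neq0; rewrite e x10 x20 => /eqP; rewrite expf_eq0 /= => /eqP->.
  by rewrite eqxx.
exists x1, x2; split=> //.
have -> : x1 ^+ 3 - P * x1 * x2 ^+ 2 - Q * x2 ^+ 3 = x1 * a + x2 * b by rewrite /a /b; ring.
by rewrite a0 b0 !mulr0 addr0.
Qed.
End CubicNorm.

Lemma ler_norm8 (V : numDomainType) (a b c d e f g h : V) :
  `|a + b + c + d - e - f + g - h| <= `|a| + `|b| + `|c| + `|d| + `|e| + `|f| + `|g| + `|h|.
Proof.
apply: le_trans (ler_normB _ _) (lerD _ (lexx _)); apply: le_trans (ler_normD _ _) (lerD _ (lexx _)).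
do 2![apply: le_trans (ler_normB _ _) (lerD _ (lexx _))].
by do 2![apply: le_trans (ler_normD _ _) (lerD _ (lexx _))]; exact: ler_normD.
Qed.

Lemma cubic_norm_bound (P Q x0 x1 x2 H : int) : `|x0| <= H -> `|x1| <= H -> `|x2| <= H ->
  `|cubic_norm P Q x0 x1 x2| <= (1 + `|Q| + `|Q ^+ 2| + `|2 * P| + `|P| + `|3 * Q| + `|P ^+ 2| + `|P * Q|) * H ^+ 3.
Proof.
move=> h0 h1 h2; have H0 : 0 <= H := le_trans (normr_ge0 _) h0.
have mono c x y z : `|x| <= H -> `|y| <= H -> `|z| <= H -> `|c * (x * y * z)| <= `|c| * H ^+ 3.
  move=> hx hy hz; rewrite normrM; apply: ler_wpM2l => //.
  by rewrite !normrM !exprS expr0 mulr1 mulrA; do 2?[apply: ler_pM; rewrite ?mulr_ge0 //].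
have e : cubic_norm P Q x0 x1 x2 = 1 * (x0 * x0 * x0) + Q * (x1 * x1 * x1) + Q ^+ 2 * (x2 * x2 * x2)
   + (2 * P) * (x0 * x0 * x2) - P * (x0 * x1 * x1) - (3 * Q) * (x0 * x1 * x2) + P ^+ 2 * (x0 * x2 * x2)
   - (P * Q) * (x1 * x2 * x2) by rewrite /cubic_norm; ring.
rewrite e !(mulrDl _ _ (H ^+ 3)) -[X in X * _ + _]normr1.
apply: le_trans (ler_norm8 _ _ _ _ _ _ _ _) _.
by do 7![apply: lerD; last exact: mono]; exact: mono.
Qed.

(** Cauchy-Schwarz for the sizes of the fibres, with equality when all are equal. *)
Lemma pairs_pigeonhole (X C : finType) (f : X -> C) :
  (#|X| ^ 2 <= #|C| * #|[set w : X * X | f w.1 == f w.2]|)%N.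
Proof.
pose n c : int := #|[set x | f x == c]|%:R.
have s1 : \sum_c n c = #|X|%:R.
  rewrite /n -natr_sum; congr _%:R; rewrite -[RHS]cardsT -sum1_card (partition_big f xpredT) //=.
  by apply: eq_bigr => c _; rewrite -sum1_card; apply: eq_bigl => x; rewrite !inE.
have s2 : \sum_c n c ^+ 2 = #|[set w : X * X | f w.1 == f w.2]|%:R.
  transitivity (\sum_c (#|[set x | f x == c]| ^ 2)%N%:R : int); first by apply: eq_bigr => c _; rewrite natrX.
  rewrite -natr_sum; congr _%:R; rewrite -[RHS]sum1_card (partition_big (fun w => f w.1) xpredT) //=.
  apply: eq_bigr => c _; rewrite -mulnn -cardsX -sum1_card; apply: eq_bigl => -[x y]; rewrite !inE /=.
  by apply/andP/andP => [[/eqP<- /eqP<-]|[/eqP-> /eqP->]].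
have : 0 <= \sum_c (#|C|%:R * n c - #|X|%:R) ^+ 2 by apply: sumr_ge0 => c _; apply: sqr_ge0.
have -> : \sum_c (#|C|%:R * n c - #|X|%:R) ^+ 2 = #|C|%:R * (#|C|%:R * (\sum_c n c ^+ 2) - #|X|%:R ^+ 2).
  transitivity (\sum_c (#|C|%:R ^+ 2 * n c ^+ 2 + (- 2 * #|C|%:R * #|X|%:R) * n c + #|X|%:R ^+ 2)).
    by apply: eq_bigr => c _; ring.
  have e : \sum_(c : C) (#|X|%:R : int) = #|C|%:R * #|X|%:R by rewrite sumr_const mulr_natl.
  rewrite !big_split /= -!mulr_sumr s1 e; ring.
have [c0|c0] := posnP #|C|.
  move=> _; suff -> : #|X| = 0%N by [].
  by apply/eqP; rewrite -leqn0 leqNgt; apply/negP => /card_gt0P[x _]; move: (fintype0 (f x)).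
by rewrite pmulr_rge0 ?ltr0n // s2 subr_ge0 -natrX -natrM ler_nat.
Qed.

(** * Chebyshev's method on a box in a cubic order *)

Section BoxChebyshev.
Variable R : realType.
Variables (P Q : int) (S : pred nat) (B : nat).
Hypothesis no_root : forall t : int, depressed P Q t != 0.
Hypothesis one_root : forall p, prime p -> (B < p)%N -> exists t : nat, (p%:Z %| depressed P Q t)%Z.
Hypothesis two_roots : forall p, prime p -> (B < p)%N -> S p -> exists t s : nat,
  [/\ (p%:Z %| depressed P Q t)%Z, (p%:Z %| depressed P Q s)%Z & ~~ (p%:Z %| t%:Z - s%:Z)%Z].

Definition kerb (p : nat) (x0 x1 x2 : int) (t : nat) : bool :=
  (p%:Z %| x0 + x1 * t%:Z + x2 * t%:Z ^+ 2)%Z.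

Lemma root_list p : exists ts : seq nat, prime p -> (B < p)%N ->
  size ts = (1 + S p)%N /\ forall x0 x1 x2 : int, (x0, x1, x2) != (0, 0, 0) ->
    (count (kerb p x0 x1 x2) ts <=
       logn p `|cubic_norm P Q x0 x1 x2|%N)%N.
Proof.
have N0 x0 x1 x2 : (x0, x1, x2) != (0, 0, 0) -> (0 < `|cubic_norm P Q x0 x1 x2|)%N.
  move=> xn; rewrite absz_gt0; apply/eqP => /(cubic_norm_root xn)[t t0].
  by have := no_root t; rewrite t0.
have [/andP[pp pB]|np] := boolP (prime p && (B < p)%N); last first.
  by exists [::] => pp pB; rewrite pp pB in np.
have [Sp|Sp] := boolP (S p).
  have [t [s [gt gs ts]]] := two_roots pp pB Sp; exists [:: t; s] => _ _; split=> // x0 x1 x2 xn /=.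
  have st : ~~ (p%:Z %| s%:Z - t%:Z)%Z by rewrite -[_ - _]opprB rpredN.
  have d1 u := @cubic_norm_dvd P Q x0 x1 x2 p u; have d2 := @cubic_norm_dvd2 P Q x0 x1 x2 p t s pp st gt gs.
  have [et|et] := boolP (kerb p x0 x1 x2 t); have [es|es] := boolP (kerb p x0 x1 x2 s) => //=.
  - by rewrite -pfactor_dvdn ?N0 //; apply: d2.
  - by rewrite logn_gt0 mem_primes pp N0 //; apply: (d1 t).
  - by rewrite logn_gt0 mem_primes pp N0 //; apply: (d1 s).
have [t gt] := one_root pp pB; exists [:: t] => _ _; split=> // x0 x1 x2 xn /=.
case: (boolP (kerb p x0 x1 x2 t)) => //= et; rewrite addn0 logn_gt0 mem_primes pp N0 //.
exact: cubic_norm_dvd gt et.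
Qed.

Let bd : int := (1 + `|Q| + `|Q ^+ 2| + `|2 * P| + `|P| + `|3 * Q| + `|P ^+ 2| + `|P * Q|).
Let C0 := `|bd|%N.

Lemma C0_gt0 : (0 < C0)%N.
Proof. by rewrite absz_gt0 /bd gt_eqF //; do 7![apply: ltr_wpDr => //]. Qed.

(** h^3 is both the number of elements of the box and the order of magnitude of the norms of
    differences. A nonzero norm has logarithm at most ln(C0 x), while each root modulo p is a zero
    of at least x^2 / p - x differences of distinct elements; average over the pairs. *)
Lemma root_weights n (h := n.+1) (x := (h ^ 3)%N) :
  \sum_(0 <= p < x.+1 | prime p && (B < p)%N) (1 + S p)%:R * (lnn R p / p%:R)
  <= lnn R C0 + lnn R x + 2%:R * lnn R 16.
Proof.
have /choice[ts hts] := root_list.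
pose I := ('I_h * 'I_h * 'I_h)%type.
have cI : #|{: I}| = x by rewrite !card_prod !card_ord /x !expnS expn0 muln1 mulnA.
pose ev (w : I) (t : nat) : nat := (w.1.1 + w.1.2 * t + w.2 * t ^ 2)%N.
pose d0 (w : I * I) : int := w.1.1.1%:Z - w.2.1.1%:Z.
pose d1 (w : I * I) : int := w.1.1.2%:Z - w.2.1.2%:Z.
pose d2 (w : I * I) : int := w.1.2%:Z - w.2.2%:Z.
pose N (w : I * I) := `|cubic_norm P Q (d0 w) (d1 w) (d2 w)|%N.
have x0 : (0 < x)%N by rewrite expn_gt0.
have dn w : w.1 != w.2 -> (d0 w, d1 w, d2 w) != (0, 0, 0).
  case: w => [[[a b] c] [[a' b'] c']] /=; apply: contraNneq => -[/eqP + /eqP + /eqP].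
  by rewrite /d0 /d1 /d2 /= !subr_eq0 !eqz_nat => /eqP/val_inj-> /eqP/val_inj-> /eqP/val_inj->.
have Nb w : (N w <= C0 * x)%N.
  have db (a b : 'I_h) : `|a%:Z - b%:Z| <= h%:Z.
    by have := ltn_ord a; have := ltn_ord b; rewrite -lez_nat; lia.
  have := @cubic_norm_bound P Q _ _ _ h%:Z (db w.1.1.1 w.2.1.1) (db w.1.1.2 w.2.1.2) (db w.1.2 w.2.2).
  rewrite -/bd -lez_nat PoszM /N /C0 !abszE PoszX => hh; apply: le_trans hh _.
  by apply: ler_wpM2r; rewrite ?exprn_ge0 // ler_norm.
pose c p w : nat := count (kerb p (d0 w) (d1 w) (d2 w)) (ts p).
have up w : w.1 != w.2 -> \sum_(0 <= p < x.+1 | prime p && (B < p)%N) (c p w)%:R * lnn R p <= lnn R (C0 * x).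
  move=> wn; have N0 : (0 < N w)%N.
    rewrite absz_gt0; apply/eqP => /(cubic_norm_root (dn w wn))[t t0].
    by have := no_root t; rewrite t0.
  apply: le_trans (ler_lnn R N0 (Nb w)).
  have -> : lnn R (N w) = addext (lnn R) (N w).
    apply/esym; apply: addext_total => //; first exact: lnn1.
    move=> q s qp qs; have s0 := dvdn_gt0 N0 (dvdn_trans (dvdn_mull q (dvdnn s)) qs).
    by rewrite lnnM // prime_gt0.
  rewrite (@addext_widen _ _ _ (maxn x (N w)).+1) ?ltnS ?leq_maxr //.
  rewrite [leRHS](@big_cat_nat _ _ _ x.+1) ?ltnS ?leq_maxl //=.
  apply: (@le_trans _ _ (\sum_(0 <= p < x.+1 | prime p) lnn R p *+ logn p (N w))); last first.
    by rewrite lerDl; apply: sumr_ge0 => p _; rewrite mulrn_wge0 ?lnn_ge0.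
  rewrite [leLHS]big_mkcond [leRHS]big_mkcond; apply: ler_sum => p _.
  case: (boolP (prime p)) => //= pp; case: ltnP => pB; last by rewrite mulrn_wge0 ?lnn_ge0.
  rewrite -[leRHS]mulr_natl; apply: ler_wpM2r; rewrite ?lnn_ge0 // ler_nat.
  by have [_] := hts p pp pB; apply; apply: dn.
have low p : prime p -> (B < p)%N ->
   (1 + S p)%:R * (x%:R ^+ 2 / p%:R - x%:R) <= (\sum_(w : I * I | w.1 != w.2) c p w)%:R :> R.
  move=> pp pB; have [sz _] := hts p pp pB; have p0 := prime_gt0 pp.
  have -> : (\sum_(w : I * I | w.1 != w.2) c p w = \sum_(t <- ts p) #|[set w : I * I | (w.1 != w.2) && kerb p (d0 w) (d1 w) (d2 w) t]|)%N.
    transitivity (\sum_(w : I * I | w.1 != w.2) \sum_(t <- ts p) kerb p (d0 w) (d1 w) (d2 w) t : nat)%N.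
      by apply: eq_bigr => w _; rewrite /c -sum1_count big_mkcond.
    rewrite exchange_big /=; apply: eq_bigr => t _; rewrite -big_mkcondr sum1dep_card.
    by apply: eq_card => w; rewrite !inE.
  rewrite natr_sum -sz; have -> : (size (ts p))%:R * (x%:R ^+ 2 / p%:R - x%:R) = \sum_(t <- ts p) (x%:R ^+ 2 / p%:R - x%:R) :> R.
    by rewrite big_const_seq count_predT iter_addr addr0 mulr_natl.
  apply: ler_sum => t _; rewrite lerBlDr ler_pdivrMr ?ltr0n //.
  rewrite -natrD -natrX -natrM ler_nat mulnC -cI.
  pose f (w : I) : 'I_p := Ordinal (ltn_pmod (ev w t) p0).
  have := pairs_pigeonhole f; rewrite card_ord => hp; apply: leq_trans hp _.
  rewrite leq_mul2l; apply/orP; right.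
  apply: leq_trans (_ : _ <= #|[set w : I * I | (w.1 != w.2) && kerb p (d0 w) (d1 w) (d2 w) t] :|: [set (v, v) | v : I]|)%N _; last first.
    apply: leq_trans (leq_card_setU _ _) _; rewrite leq_add2l; exact: leq_imset_card.
  apply: subset_leq_card; apply/subsetP => -[v w]; rewrite !inE /= => /eqP/(congr1 val) /= e.
  have [<-|vw] /= := eqVneq v w; first by apply/imsetP; exists v.
  apply/orP; left; rewrite /kerb; have -> : d0 (v, w) + d1 (v, w) * t%:Z + d2 (v, w) * t%:Z ^+ 2 = (ev v t)%:Z - (ev w t)%:Z.
    by rewrite /d0 /d1 /d2 /ev /= !PoszD !PoszM; ring.
  by rewrite -eqz_mod_dvd !modz_nat e.
have X0 : 0 < x%:R :> R by rewrite ltr0n.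
have total : \sum_(0 <= p < x.+1 | prime p && (B < p)%N) ((1 + S p)%:R * (x%:R ^+ 2 / p%:R - x%:R)) * lnn R p
   <= x%:R ^+ 2 * (lnn R C0 + lnn R x).
  rewrite -lnnM ?C0_gt0 //.
  apply: (@le_trans _ _ (\sum_(w : I * I | w.1 != w.2) \sum_(0 <= p < x.+1 | prime p && (B < p)%N) (c p w)%:R * lnn R p)).
    rewrite exchange_big /=; apply: ler_sum => p /andP[pp pB]; rewrite -mulr_suml -natr_sum.
    by apply: ler_wpM2r; rewrite ?lnn_ge0 ?low.
  apply: le_trans (ler_sum _ up) _; rewrite sumr_const -[leLHS]mulr_natl; apply: ler_wpM2r; first exact: lnn_ge0.
  by rewrite -natrX ler_nat -cI -mulnn -card_prod max_card.
have th := theta_le R x; rewrite /theta in th.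
rewrite -(ler_pM2l (exprn_gt0 2 X0)).
have e : x%:R ^+ 2 * \sum_(0 <= p < x.+1 | prime p && (B < p)%N) (1 + S p)%:R * (lnn R p / p%:R) =
  \sum_(0 <= p < x.+1 | prime p && (B < p)%N) ((1 + S p)%:R * (x%:R ^+ 2 / p%:R - x%:R)) * lnn R p
  + x%:R * \sum_(0 <= p < x.+1 | prime p && (B < p)%N) (1 + S p)%:R * lnn R p.
  by rewrite !mulr_sumr -big_split /=; apply: eq_bigr => p _; ring.
have b : \sum_(0 <= p < x.+1 | prime p && (B < p)%N) (1 + S p)%:R * lnn R p <= 2%:R * (x%:R * lnn R 16).
  apply: le_trans (ler_wpM2l _ th); rewrite // mulr_sumr [leLHS]big_mkcond [leRHS]big_mkcond /=.
  apply: ler_sum => p _; case: (prime p) => //=; case: ltnP => _; last by rewrite mulr_ge0 ?lnn_ge0.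
  by apply: ler_wpM2r; rewrite ?lnn_ge0 // ler_nat; case: (S p).
rewrite e; apply: le_trans (lerD total (ler_wpM2l (ltW X0) b)) _.
by rewrite le_eqVlt; apply/orP; left; apply/eqP; ring.
Qed.

(** One root for every p > B already uses up ln x in [root_weights], by Mertens' lower bound; only
    O(1) is left for the second roots, which occur on S. Any n is covered by passing to x = (n +
    1)^3. *)
Lemma cubic_primes_bounded : exists C : R, forall n,
  \sum_(0 <= p < n.+1 | prime p && ((B < p)%N && S p)) lnn R p / p%:R <= C.
Proof.
exists (lnn R C0 + 2%:R * lnn R 16 + 3%:R + mertens R B) => n.
have h := root_weights n; set x := (n.+1 ^ 3)%N in h; have x0 : (0 < x)%N by rewrite expn_gt0.
have nx : (n <= x)%N by apply: leq_trans (leqnSn n) _; rewrite -{1}[n.+1]expn1 leq_pexp2l.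
apply: (@le_trans _ _ (\sum_(0 <= p < x.+1 | prime p && ((B < p)%N && S p)) lnn R p / p%:R)).
  rewrite [leRHS](@big_cat_nat _ _ _ n.+1) //= lerDl.
  by apply: sumr_ge0 => p _; rewrite divr_ge0 ?lnn_ge0.
have m1 := mertens_lower R x0.
have m2 : mertens R x <= \sum_(0 <= p < x.+1 | prime p && (B < p)%N) lnn R p / p%:R + mertens R B.
  rewrite /mertens [leLHS](bigID (fun p => B < p)%N) /=; apply: lerD => //.
  have [Bx|Bx] := leqP B x.
    rewrite [leRHS]big_mkcond [leLHS]big_mkcond /= [leLHS](@big_cat_nat _ _ _ B.+1) //= [X in _ + X]big_nat.
    rewrite [X in _ + X]big1 ?addr0; last by move=> p /andP[-> _]; rewrite andbF.
    apply: ler_sum => p _; case: (prime p) => //=; case: ltnP => //= _; by rewrite divr_ge0 ?lnn_ge0.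
  rewrite [leRHS](@big_cat_nat _ _ _ x.+1) //=; last by rewrite ltnS ltnW.
  rewrite -[leLHS]addr0; apply: lerD; last by apply: sumr_ge0 => p _; rewrite divr_ge0 ?lnn_ge0.
  rewrite [leRHS]big_mkcond [leLHS]big_mkcond /=; apply: ler_sum => p _; case: (prime p) => //=.
  by case: ltnP => //= _; rewrite divr_ge0 ?lnn_ge0.
have e : \sum_(0 <= p < x.+1 | prime p && (B < p)%N) (1 + S p)%:R * (lnn R p / p%:R)
  = \sum_(0 <= p < x.+1 | prime p && (B < p)%N) lnn R p / p%:R + \sum_(0 <= p < x.+1 | prime p && ((B < p)%N && S p)) lnn R p / p%:R.
  rewrite [X in _ + X](eq_bigl (fun p => (prime p && (B < p)%N) && S p)); last by move=> p; rewrite andbA.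
  rewrite [X in _ + X]big_mkcondr -big_split /=; apply: eq_bigr => p _.
  by case: (S p); rewrite ?mul1r ?addr0 // mulrDl !mul1r.
by rewrite /= -/x in h; move: h; rewrite e; lra.
Qed.
End BoxChebyshev.

(** * Non-cubes have nontrivial cubic symbols *)

Lemma eval_theta (F : fieldType) (o s c f r : F) : r = s * (o + o + 1) ->
  (f * r + c) + (c + c) * o = (o + o + 1) * (c + f * s).
Proof. by move=> ->; ring. Qed.

Lemma eval_theta_conj (F : fieldType) (o s c f r : F) : r = s * (o + o + 1) -> o ^+ 2 = - o - 1 ->
  (f * r + c) + (c + c) * o ^+ 2 = - ((o + o + 1) * (c - f * s)).
Proof. by move=> -> ->; ring. Qed.

Lemma sqr_frob (F : closedFieldType) p (x : F) (n : int) : p \in [pchar F] -> x ^+ 2 = n%:~R ->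
  x ^+ p = x \/ x ^+ p = - x.
Proof.
move=> Fp x2; have : (x ^+ p) ^+ 2 = x ^+ 2 by rewrite exprAC x2 intr_frob.
by move/eqP; rewrite eqf_sqr => /orP[] /eqP; [left|right].
Qed.

Section Nondegenerate.
Variables (p d : nat) (b c f : int).
Hypotheses (pp : prime p) (p3 : (3 < p)%N) (pd : ~~ (p%:Z %| d%:Z)%Z).
Hypotheses (cfb : c ^+ 2 + d%:Z * f ^+ 2 = b ^+ 3) (pb : ~~ (p%:Z %| b)%Z) (pf : ~~ (p%:Z %| f)%Z).
Hypothesis sym0 : forall r : int, (p%:Z %| r ^+ 2 - (3 * d)%N%:Z)%Z -> rsym p (f * r) c = 0.
Let F := Fbar p.
Let Fp : p \in [pchar F] := pchar_Fbar pp.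
Let p2 : (2 < p)%N := ltnW p3.
Let pn3 : p != 3%N. Proof. by rewrite gtn_eqF. Qed.
Let o : F := omega p.
Let op : 3.-primitive_root o := omega_prim pp pn3.
Let th : F := o + o + 1.

Lemma nat_intr (n : nat) : n%:R = (n%:Z)%:~R :> F. Proof. by []. Qed.

(** s th is a square root r of 3 d in F_p, and f r + c sqrt(-3) equals sqrt(-3) alpha with alpha = c
    + f s. A trivial symbol therefore compares powers of alpha and of its conjugate, as
    [cubic_roots_res] requires. *)
Lemma two_roots_of_fixed (s : F) : s ^+ 2 = - d%:R -> (s * th) ^+ p = s * th ->
  exists n1 n2 : nat, [/\ (p%:Z %| cubic_at b c n1)%Z, (p%:Z %| cubic_at b c n2)%Z &
     ~~ (p%:Z %| n1%:Z - n2%:Z)%Z].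
Proof.
move=> s2 sp; have s2z : s ^+ 2 = (- d%:Z)%:~R by rewrite s2 rmorphN.
have fs0 : f%:~R * s != 0.
  rewrite mulf_neq0 ?(intr_pchar _ Fp) //.
  by apply: contra pd => /eqP s0; rewrite -(intr_pchar _ Fp) -oppr_eq0 -nat_intr -s2 s0 expr0n.
have sp2 : s ^+ (p ^ 2) = s.
  rewrite expnS expn1 exprM; case: (sqr_frob Fp s2z) => e; rewrite !e //.
  by rewrite (frobN pp) e opprK.
apply: (cubic_roots_res pp p2 pn3 cfb pb s2 sp2 _ sp fs0).
have [r rE] := pchar_frob_fixed Fp sp.
have r2 : (p%:Z %| r%:Z ^+ 2 - (3 * d)%N%:Z)%Z.
  rewrite -(intr_pchar _ Fp) rmorphB rmorphXn /= -!nat_intr -rE exprMn s2 (th_sq pp pn3) natrM.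
  by apply/eqP; ring.
have := sym0 r2; rewrite /rsym => h.
have nE : ~~ (p%:Z %| enorm (f * r%:Z + c) (2 * c))%Z.
  have -> : enorm (f * r%:Z + c) (2 * c) = f ^+ 2 * (r%:Z ^+ 2 - (3 * d)%N%:Z) + 3 * b ^+ 3.
    by rewrite -cfb /enorm PoszM; ring.
  have q3' : ~~ (p%:Z %| 3)%Z by rewrite dvdzE dvdn_prime2.
  rewrite addrC (dvdz_addl_eq _ (dvdz_mull _ r2)) (prime_dvdzM pp) negb_or q3' /=.
  by apply: contra pb; apply: prime_dvdzX.
have := sym_spec pp pn3 nE; rewrite h /addchar expr0 mul1r.
rewrite /eeval rmorphD !rmorphM /= -/o.
have rE' : (r%:Z)%:~R = s * (o + o + 1) :> F by rewrite -nat_intr -rE.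
have c2 : 2%:~R * c%:~R = c%:~R + c%:~R :> F by rewrite -[2%:~R]/(1 + 1) mulrDl mul1r.
have o2 : o ^+ 2 = - o - 1.
  by apply/eqP; rewrite -subr_eq0 -[X in _ == X](prim3_eq0 op); apply/eqP; ring.
rewrite c2 (eval_theta _ _ rE') (eval_theta_conj _ _ rE' o2).
have -> (x : F) : (- x) ^+ symexp p = x ^+ symexp p.
  suff ev : ~~ odd (symexp p) by rewrite exprNn -signr_odd (negPf ev) mul1r.
  have := symexpE pp pn3; move/(congr1 odd); rewrite oddM andbT => <-.
  have po : odd p by case: (even_prime pp) p2 => [->|].
  have : odd (p ^ 2) by rewrite oddX po orbT.
  by have := sqr_pred pp => <- /=.
rewrite !exprMn; apply: mulfI; rewrite expf_neq0 //; exact: th_neq0.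
Qed.

Lemma one_root_of_sym0 : exists n : nat, (p%:Z %| cubic_at b c n)%Z.
Proof.
have /closed_rootP[s] : size ('X^2 - (- d%:R)%:P : {poly F}) != 1%N by rewrite size_XnsubC.
rewrite /root !hornerE subr_eq0 => /eqP s2.
have x2 : (s * th) ^+ 2 = ((3 * d)%N%:Z)%:~R by rewrite exprMn s2 (th_sq pp pn3) -nat_intr natrM; ring.
have [e|e] := sqr_frob Fp x2.
  by have [n [_ [h _ _]]] := two_roots_of_fixed s2 e; exists n.
exact: (cubic_root_nonres pp pn3 cfb pb s2 e).
Qed.

Lemma two_roots_of_sym0 (r : int) : (p%:Z %| r ^+ 2 - (3 * d)%N%:Z)%Z ->
  exists n1 n2 : nat, [/\ (p%:Z %| cubic_at b c n1)%Z, (p%:Z %| cubic_at b c n2)%Z &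
     ~~ (p%:Z %| n1%:Z - n2%:Z)%Z].
Proof.
move=> rr; have /closed_rootP[s] : size ('X^2 - (- d%:R)%:P : {poly F}) != 1%N by rewrite size_XnsubC.
rewrite /root !hornerE subr_eq0 => /eqP s2; apply: (two_roots_of_fixed s2).
have : (s * th) ^+ 2 = r%:~R ^+ 2.
  rewrite exprMn s2 (th_sq pp pn3); move: rr; rewrite -(intr_pchar _ Fp) rmorphB rmorphXn /= subr_eq0 => /eqP->.
  by rewrite -nat_intr natrM; ring.
move/eqP; rewrite eqf_sqr => /orP[] /eqP->; first exact: intr_frob.
by rewrite (frobN pp) intr_frob.
Qed.
End Nondegenerate.

(** If all symbols beyond B were trivial, the cubic would have a root modulo every large p and two
    roots whenever 3 d is a square modulo p. Such p would have bounded weight by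
    [cubic_primes_bounded] and unbounded weight by [norm_primes_unbounded]. *)
Lemma nondegenerate (R : realType) (d : nat) (b c f : int) : (0 < d)%N -> f != 0 ->
  c ^+ 2 + d%:Z * f ^+ 2 = b ^+ 3 -> (forall t, cubic_at b c t != 0) ->
  forall B, exists p (r : int), [/\ prime p, (B < p)%N, (p%:Z %| r ^+ 2 - (3 * d)%N%:Z)%Z &
    rsym p (f * r) c != 0].
Proof.
move=> d0 f0 cfb noroot B; apply: contrapT => nex.
have b0 : b != 0.
  apply: contraTneq d0 => b0; rewrite b0 expr0n /= in cfb; rewrite -leqNgt leqn0.
  have := sqr_ge0 c; have := sqr_ge0 f; have f2 : f ^+ 2 != 0 by rewrite expf_neq0.
  by move: cfb f2; move: (c ^+ 2) (f ^+ 2) => u v; clear; nia.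
pose B' := (B + 3 + d + `|b| + `|f|)%N.
have big (p : nat) (z : int) : (B' < p)%N -> (`|z| <= B')%N -> z != 0 -> ~~ (p%:Z %| z)%Z.
  move=> Bp zB z0; rewrite dvdzE; apply: contraTN Bp => pz; rewrite -leqNgt.
  by apply: leq_trans zB; apply: dvdn_leq; rewrite ?absz_gt0.
have ND p : prime p -> (B' < p)%N -> [/\ (3 < p)%N, ~~ (p%:Z %| d%:Z)%Z, ~~ (p%:Z %| b)%Z, ~~ (p%:Z %| f)%Z &
    forall r : int, (p%:Z %| r ^+ 2 - (3 * d)%N%:Z)%Z -> rsym p (f * r) c = 0].
  move=> pp Bp; split; try (apply: big => //; rewrite ?eqz_nat -?lt0n //; rewrite /B'; lia).
    by apply: leq_trans Bp; rewrite /B'; lia.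
  move=> r hr; apply/eqP/negPn/negP => h; apply: nex; exists p, r; split=> //.
  by apply: leq_trans Bp; rewrite /B'; lia.
pose S (p : nat) := has (fun r : nat => (p%:Z %| r%:Z ^+ 2 - (3 * d)%N%:Z)%Z) (iota 0 p).
have dep t : depressed (3 * b) (2 * c) t = cubic_at b c t by [].
have one p : prime p -> (B' < p)%N -> exists t : nat, (p%:Z %| depressed (3 * b) (2 * c) t)%Z.
  by move=> pp /(ND p pp)[h1 h2 h3 h4 h5]; apply: (one_root_of_sym0 pp h1 h2 cfb h3 h4 h5).
have two p : prime p -> (B' < p)%N -> S p -> exists t s : nat,
  [/\ (p%:Z %| depressed (3 * b) (2 * c) t)%Z, (p%:Z %| depressed (3 * b) (2 * c) s)%Z & ~~ (p%:Z %| t%:Z - s%:Z)%Z].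
  move=> pp /(ND p pp)[h1 h2 h3 h4 h5] /hasP[r _ hr].
  exact: (two_roots_of_sym0 pp h1 h2 cfb h3 h4 h5 hr).
have [C hC] := @cubic_primes_bounded R _ _ S B' noroot one two.
have D0 : (0 < 3 * d)%N by rewrite muln_gt0.
apply: (@norm_primes_unbounded R (3 * d)%N B' D0 (fun p => (B' < p)%N && S p) _ C hC).
move=> p r pp Bp hr; rewrite Bp /=; apply/hasP; exists `|(r %% p)%Z|%N.
  by rewrite mem_iota /= add0n -ltz_nat gez0_abs ?modz_ge0 ?ltz_pmod // ?ltz_nat ?prime_gt0 // eqz_nat -lt0n prime_gt0.
have p0 : p%:Z != 0 by rewrite eqz_nat -lt0n prime_gt0.
rewrite gez0_abs ?modz_ge0 // (_ : _ - _ = (r ^+ 2 - (3 * d)%N%:Z) - p%:Z * ((r %/ p)%Z * (r + (r %% p)%Z))).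
  by apply: rpredB => //; apply: dvdz_mulr.
have e := divz_eq r p; move: (r %/ p)%Z (r %% p)%Z e => q t ->; ring.
Qed.

(** * Integers of imaginary quadratic fields *)
From mathcomp Require Import boolp classical_sets.

Definition nm (z : algC) : algC := z * z^*.

Lemma nmM x y : nm (x * y) = nm x * nm y.
Proof. by rewrite /nm rmorphM mulrACA. Qed.
Lemma nmE x : nm x = `|x| ^+ 2. Proof. by rewrite normCK. Qed.
Lemma nm_ge0 x : 0 <= nm x. Proof. by rewrite nmE exprn_ge0. Qed.
Lemma nm_eq0 x : (nm x == 0) = (x == 0). Proof. by rewrite nmE expf_eq0 normr_eq0. Qed.
Lemma nm_gt0 x : (0 < nm x) = (x != 0). Proof. by rewrite lt0r nm_eq0 nm_ge0 andbT. Qed.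
Lemma nmX x n : nm (x ^+ n) = nm x ^+ n. Proof. by rewrite !nmE normrX exprAC. Qed.
Lemma nmV x : nm x^-1 = (nm x)^-1. Proof. by rewrite !nmE normfV exprVn. Qed.
Lemma nm_div x y : nm (x / y) = nm x / nm y. Proof. by rewrite nmM nmV. Qed.
Lemma nm_rat x : x \in Crat -> nm x = x ^+ 2.
Proof. by move=> xr; rewrite /nm (conj_Crat xr) expr2. Qed.
Lemma nm_nat n : nm n%:R = n%:R ^+ 2. Proof. by rewrite nm_rat // rpred_nat. Qed.
Lemma nm_conj x : nm x^* = nm x. Proof. by rewrite /nm conjCK mulrC. Qed.
Lemma Aint_exp_root x n : (0 < n)%N -> x ^+ n \in Aint -> x \in Aint.
Proof.
move=> n0 xn; have s1 : (1 < size ('X^n : {poly algC}))%N by rewrite size_polyXn ltnS.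
apply: (@root_monic_Aint (minCpoly (x ^+ n) \Po 'X^n)).
- by rewrite /root horner_comp hornerXn -/(root _ _) root_minCpoly.
- by rewrite monicE lead_coef_comp // lead_coefXn expr1n mulr1 -monicE minCpoly_monic.
by apply: polyOver_comp; rewrite ?polyOverXn.
Qed.

Lemma intr_form (d : nat) (Y Z : int) :
  (Y ^+ 2 + d%:Z * Z ^+ 2)%:~R = Y%:~R ^+ 2 + d%:R * Z%:~R ^+ 2 :> algC.
Proof. by rewrite intrD rmorphXn intrM rmorphXn. Qed.

Lemma Crat_int (n : int) : n%:~R \in Crat. Proof. exact: rpred_int. Qed.

Section Quad.
Variable d : nat.
Hypotheses (d0 : (0 < d)%N) (sf : squarefree d).

Definition qs : algC := sqrtC (- d%:R).

Lemma qs_sq : qs ^+ 2 = - d%:R. Proof. by rewrite sqrtCK. Qed.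

Lemma qs_neq0 : qs != 0.
Proof.
apply: contraTneq d0 => s0; have := qs_sq; rewrite s0 expr0n /= => /esym/eqP.
by rewrite oppr_eq0 pnatr_eq0 lt0n => ->.
Qed.

Lemma qs_conj : qs^* = - qs.
Proof.
apply: (mulfI qs_neq0); rewrite -normCK mulrN -expr2 qs_sq opprK -normrX qs_sq normrN.
by rewrite ger0_norm // ler0n.
Qed.

Lemma qfP z : quad_field d z <-> exists a b, [/\ a \in Crat, b \in Crat & z = a + b * qs].
Proof.
split=> [[a [b ->]]|[_ [_ [/CratP[a ->] /CratP[b ->] ->]]]]; last by exists a, b.
by exists (ratr a), (ratr b); rewrite !Crat_rat.
Qed.

Lemma qf_rat a : a \in Crat -> quad_field d a.
Proof. by move=> ar; apply/qfP; exists a, 0; rewrite Crat0 mul0r addr0. Qed.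

Lemma qf_qs : quad_field d qs.
Proof. by apply/qfP; exists 0, 1; rewrite Crat0 Crat1 mul1r add0r. Qed.

Lemma qfD x y : quad_field d x -> quad_field d y -> quad_field d (x + y).
Proof.
move=> /qfP[a [b [ar br ->]]] /qfP[a' [b' [ar' br' ->]]]; apply/qfP.
by exists (a + a'), (b + b'); rewrite !rpredD // mulrDl addrACA.
Qed.

Lemma qfM x y : quad_field d x -> quad_field d y -> quad_field d (x * y).
Proof.
move=> /qfP[a [b [ar br ->]]] /qfP[a' [b' [ar' br' ->]]]; apply/qfP.
exists (a * a' - b * b' * d%:R), (a * b' + b * a'); split.
- by rewrite rpredB ?rpredM // rpred_nat.
- by rewrite rpredD ?rpredM.
rewrite -[X in _ - _ * X]opprK -qs_sq; ring.
Qed.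

Lemma qfN x : quad_field d x -> quad_field d (- x).
Proof. by move=> h; rewrite -mulN1r; apply: qfM => //; apply: qf_rat; rewrite rpredN Crat1. Qed.

Lemma qfB x y : quad_field d x -> quad_field d y -> quad_field d (x - y).
Proof. by move=> h h'; apply: qfD => //; apply: qfN. Qed.

Lemma qfX x n : quad_field d x -> quad_field d (x ^+ n).
Proof.
move=> h; elim: n => [|n IH]; first by rewrite expr0; apply: qf_rat Crat1.
by rewrite exprS; apply: qfM.
Qed.

Lemma qf_conjE a b : a \in Crat -> b \in Crat -> (a + b * qs)^* = a - b * qs.
Proof. by move=> ar br; rewrite rmorphD rmorphM /= qs_conj !conj_Crat // mulrN. Qed.

Lemma qf_conj x : quad_field d x -> quad_field d x^*.
Proof.
move=> /qfP[a [b [ar br ->]]]; rewrite qf_conjE //; apply: qfB; first exact: qf_rat.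
by apply: qfM; [exact: qf_rat|exact: qf_qs].
Qed.

Lemma nm_qf a b : a \in Crat -> b \in Crat -> nm (a + b * qs) = a ^+ 2 + d%:R * b ^+ 2.
Proof.
move=> ar br; rewrite /nm qf_conjE // -[d%:R]opprK -qs_sq; ring.
Qed.

Lemma nm_Crat x : quad_field d x -> nm x \in Crat.
Proof.
by move=> /qfP[a [b [ar br ->]]]; rewrite nm_qf // rpredD ?rpredM ?rpredX // rpred_nat.
Qed.

Lemma qfV x : quad_field d x -> quad_field d x^-1.
Proof.
have [->|x0] := eqVneq x 0; first by rewrite invr0.
move=> h; have -> : x^-1 = x^* * (nm x)^-1.
  by rewrite /nm invfM mulrCA divff ?mulr1 // conjC_eq0.
by apply: qfM; [exact: qf_conj|apply: qf_rat; rewrite rpredV nm_Crat].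
Qed.

Lemma qf_div x y : quad_field d x -> quad_field d y -> quad_field d (x / y).
Proof. by move=> h h'; apply: qfM => //; apply: qfV. Qed.

Notation O := (ring_of_integers (quad_field d)).

Lemma O_qf z : O z -> quad_field d z. Proof. by case. Qed.

Lemma O_int (n : int) : O n%:~R.
Proof. by split; [apply: qf_rat; exact: Crat_int|exact: Aint_int]. Qed.
Lemma O_nat (n : nat) : O n%:R. Proof. exact: (O_int n). Qed.

Lemma qs_Aint : qs \in Aint.
Proof.
apply: (@root_monic_Aint ('X^2 + (d%:R)%:P)).
- by rewrite /root !hornerE qs_sq addNr.
- by rewrite monicXnaddC.
by rewrite polyOverXnaddC rpred_nat.
Qed.

Lemma O_qs : O qs. Proof. by split; [exact: qf_qs|exact: qs_Aint]. Qed.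
Lemma OD x y : O x -> O y -> O (x + y).
Proof. by move=> [a b] [a' b']; split; [exact: qfD|exact: rpredD]. Qed.
Lemma OM x y : O x -> O y -> O (x * y).
Proof. by move=> [a b] [a' b']; split; [exact: qfM|exact: rpredM]. Qed.
Lemma ON x : O x -> O (- x).
Proof. by move=> [a b]; split; [exact: qfN|rewrite rpredN]. Qed.
Lemma OB x y : O x -> O y -> O (x - y).
Proof. by move=> h h'; apply: OD => //; apply: ON. Qed.
Lemma O_conj x : O x -> O x^*.
Proof. by move=> [a b]; split; [exact: qf_conj|rewrite Aint_aut]. Qed.

Lemma O_root x n : (0 < n)%N -> quad_field d x -> O (x ^+ n) -> O x.
Proof.
move=> n0 xK [_ xn]; split=> //; exact: Aint_exp_root n0 xn.
Qed.

Lemma O_rat x : x \in Crat -> O x -> exists n : int, x = n%:~R.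
Proof. by move=> xr [_ xA]; apply/intrP; exact: Cint_rat_Aint. Qed.

Lemma O_nm z : O z -> exists n : nat, nm z = n%:R.
Proof.
move=> Oz; have [n nE] := O_rat (nm_Crat (O_qf Oz)) (OM Oz (O_conj Oz)).
have : 0 <= nm z := nm_ge0 z; rewrite nE ler0z => n0; exists `|n|%N.
by rewrite -[LHS]/(n%:~R) -{1}(gez0_abs n0).
Qed.

Lemma rat_sqrt_int (q : algC) (n : int) : q \in Crat -> d%:R * q ^+ 2 = n%:~R -> exists m : int, q = m%:~R.
Proof.
move=> /CratP[x ->] h; exists (numq x); suff d1 : denq x = 1 by rewrite -[x in LHS]divq_num_den d1 divr1 ratr_int.
have E : d%:Z * numq x ^+ 2 = n * denq x ^+ 2.
  apply: (@intr_inj algC); rewrite (intrM _ d%:Z) (intrM _ n) !rmorphXn -h /ratr.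
  by rewrite expr_div_n -mulrA divfK // expf_neq0 // intr_eq0 denq_neq0.
have : (`|denq x| ^ 2 %| d)%N.
  have : (denq x ^+ 2 %| d%:Z * numq x ^+ 2)%Z by rewrite E dvdz_mull.
  rewrite Gauss_dvdzl; first by rewrite dvdzE abszX.
  by apply: coprimezXl; apply: coprimezXr; rewrite coprimezE coprime_sym coprime_num_den.
by move/sf => h1; rewrite -[denq x]gez0_abs ?h1 // ltW // denq_gt0.
Qed.

(** Trace and norm are integral, and d square-free makes the second coordinate of 2 z integral.
    Doubling avoids the distinction of d modulo 4. *)
Lemma O_spec z : O z -> exists Y Z n : int,
  [/\ 2%:R * z = Y%:~R + Z%:~R * qs, nm z = n%:~R & Y ^+ 2 + d%:Z * Z ^+ 2 = 4 * n].
Proof.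
move=> Oz; have /qfP[a [b [ar br zE]]] := O_qf Oz.
have r2 : 2%:R \in Crat by rewrite rpred_nat.
have [Y YE] : exists Y : int, 2%:R * a = Y%:~R.
  apply: O_rat; first by rewrite rpredM.
  have -> : 2%:R * a = z + z^* by rewrite zE qf_conjE //; ring.
  by apply: OD => //; apply: O_conj.
have [n nE] := O_nm Oz.
have [Z ZE] : exists Z : int, 2%:R * b = Z%:~R.
  apply: (@rat_sqrt_int _ (4 * n%:Z - Y ^+ 2)); first by rewrite rpredM.
  rewrite rmorphB rmorphM rmorphXn /= -YE -[n%:Z%:~R]/(n%:R) -nE zE nm_qf //.
  by rewrite -[4%:~R]/(4%:R); ring.
exists Y, Z, n%:Z; split=> //; first by rewrite zE mulrDr mulrA YE ZE.
apply: (@intr_inj algC); rewrite intr_form (intrM _ 4) -YE -ZE -[n%:Z%:~R]/(n%:R) -nE zE nm_qf //.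
by rewrite -[4%:~R]/(4%:R); ring.
Qed.

Lemma O_trace_nm (z : algC) (T N : int) : quad_field d z -> z + z^* = T%:~R -> nm z = N%:~R -> O z.
Proof.
move=> zK Tz Nz; split=> //; apply: (@root_monic_Aint (('X - z%:P) * ('X - (z^*)%:P))).
- by rewrite rootM root_XsubC eqxx.
- by rewrite monicMl ?monicXsubC.
have gen (A : comNzRingType) (X a b : A) : (X - a) * (X - b) = X ^+ 2 - (a + b) * X + a * b by ring.
rewrite gen -polyCD -polyCM Tz -/(nm z) Nz.
apply/polyOverP => i; rewrite coefD coefB coefXn coefCM coefX coefC.
by rewrite rpredD ?rpredB ?rpredM ?rpred_nat ?rpred_int //; case: ifP; rewrite ?rpred0 ?rpred_int.
Qed.

Lemma O_intro (Y Z n : int) (z : algC) : 2%:R * z = Y%:~R + Z%:~R * qs -> Y ^+ 2 + d%:Z * Z ^+ 2 = 4 * n -> O z.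
Proof.
move=> zE h; have n2 : 2%:R != 0 :> algC by rewrite pnatr_eq0.
have hC : Y%:~R ^+ 2 + d%:R * Z%:~R ^+ 2 = 4%:R * n%:~R :> algC.
  by have := congr1 (fun x : int => x%:~R : algC) h; rewrite intr_form intrM.
have zE' : z = (Y%:~R + Z%:~R * qs) / 2%:R by rewrite -zE mulrAC divff // mul1r.
have zc : 2%:R * z^* = Y%:~R - Z%:~R * qs.
  by rewrite -qf_conjE ?Crat_int // -zE rmorphM /= conjC_nat.
apply: (@O_trace_nm z Y n).
- rewrite zE'; apply: qf_div; last by apply: qf_rat; rewrite rpred_nat.
  by apply: qfD; [|apply: qfM qf_qs]; apply: qf_rat; exact: Crat_int.
- by apply: (mulfI n2); rewrite mulrDr zE zc; ring.
apply: (mulfI (mulf_neq0 n2 n2)); have -> : 2%:R * 2%:R * nm z = (2%:R * z) * (2%:R * z^*) by rewrite /nm; ring.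
by rewrite zE zc -natrM -hC -[d%:R]opprK -qs_sq; ring.
Qed.

Lemma O_dvd_p (p : nat) z (Y Z n : int) : prime p -> (2 < p)%N -> 2%:R * z = Y%:~R + Z%:~R * qs ->
  Y ^+ 2 + d%:Z * Z ^+ 2 = 4 * n -> (p%:Z %| Y)%Z -> (p%:Z %| Z)%Z -> O (z / p%:R).
Proof.
move=> pp p2 zE h /dvdzP[Y' YE] /dvdzP[Z' ZE].
have p0 : p%:R != 0 :> algC by rewrite pnatr_eq0 -lt0n prime_gt0.
have h' : p%:Z ^+ 2 * (Y' ^+ 2 + d%:Z * Z' ^+ 2) = 4 * n by rewrite -h YE ZE; ring.
have : (4 %| p%:Z ^+ 2 * (Y' ^+ 2 + d%:Z * Z' ^+ 2))%Z by rewrite h' dvdz_mulr.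
rewrite Gauss_dvdzr => [/dvdzP[m mE]|]; last first.
  have -> : (4 : int) = (2 ^ 2)%N%:Z by []. 
  rewrite -PoszX coprimezE /= coprimeXl // coprimeXr // prime_coprime // dvdn_prime2 //.
  by rewrite eq_sym gtn_eqF.
apply: (O_intro (Y := Y') (Z := Z') (n := m)); last by rewrite mE mulrC.
apply: (mulIf p0); rewrite mulrA divfK // zE YE ZE !intrM -[p%:Z%:~R]/(p%:R); ring.
Qed.

Lemma O_spec_unique (Y Z Y' Z' : int) : Y%:~R + Z%:~R * qs = Y'%:~R + Z'%:~R * qs -> Y = Y' /\ Z = Z'.
Proof.
move=> h; have hc : Y%:~R - Z%:~R * qs = Y'%:~R - Z'%:~R * qs.
  by have := congr1 Num.conj h; rewrite !qf_conjE ?Crat_int.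
have n2 : 2%:R != 0 :> algC by rewrite pnatr_eq0.
split; apply: (@intr_inj algC); apply: (mulfI n2).
  have -> : 2%:R * Y%:~R = (Y%:~R + Z%:~R * qs) + (Y%:~R - Z%:~R * qs) by ring.
  by rewrite h hc; ring.
apply: (mulIf qs_neq0).
have -> : 2%:R * Z%:~R * qs = (Y%:~R + Z%:~R * qs) - (Y%:~R - Z%:~R * qs) by ring.
by rewrite h hc; ring.
Qed.

(** An unramified p dividing w^3 divides w. In coordinates: p divides the norm n and Y^3 - 3 d Y
    Z^2, hence 4 Y^3 and Y, and then d Z^2 and Z. *)
Lemma O_cube_dvd (p : nat) w : prime p -> ~~ (p %| 2 * d)%N -> O w -> O (w ^+ 3 / p%:R) -> O (w / p%:R).
Proof.
move=> pp p2d Ow Ow3; have [Y [Z [n [wE nE h]]]] := O_spec Ow.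
have [Y' [Z' [n' [wE' nE' h']]]] := O_spec Ow3.
have p0 : p%:R != 0 :> algC by rewrite pnatr_eq0 -lt0n prime_gt0.
have [p2 pd] : (2 < p)%N /\ ~~ (p %| d)%N.
  move: p2d; rewrite Euclid_dvdM // negb_or => /andP[h2 ->]; split=> //.
  by rewrite ltn_neqAle prime_gt1 // andbT; apply: contra h2 => /eqP <-.
have E : Y ^+ 3 - 3 * d%:Z * Y * Z ^+ 2 = p%:Z * (4 * Y').
  have e : (Y ^+ 3 - 3 * d%:Z * Y * Z ^+ 2)%:~R + (3 * Y ^+ 2 * Z - d%:Z * Z ^+ 3)%:~R * qs =
     (p%:Z * (4 * Y'))%:~R + (p%:Z * (4 * Z'))%:~R * qs.
    transitivity ((2%:R * w) ^+ 3).
      rewrite wE !(rmorphB, rmorphM, rmorphXn) /= -[3%:~R]/(3%:R) -[d%:Z%:~R]/(d%:R) -[d%:R]opprK -qs_sq; ring.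
    transitivity (p%:R * (4%:R * (2%:R * (w ^+ 3 / p%:R)))); last by rewrite wE' !rmorphM /= -[4%:~R]/(4%:R) -[p%:Z%:~R]/(p%:R); ring.
    have -> : p%:R * (4%:R * (2%:R * (w ^+ 3 / p%:R))) = 4%:R * 2%:R * (w ^+ 3 / p%:R * p%:R) by ring.
    by rewrite divfK //; ring.
  by have [] := O_spec_unique e.
have pn : (p%:Z %| n)%Z.
  have : (p%:Z %| n ^+ 3)%Z.
    have : n ^+ 3 = p%:Z ^+ 2 * n'.
      have e1 : (n ^+ 3)%:~R = n%:~R ^+ 3 :> algC by rewrite rmorphXn.
      have e2 : (p%:Z ^+ 2 * n')%:~R = p%:R ^+ 2 * n'%:~R :> algC by rewrite intrM rmorphXn.
      apply: (@intr_inj algC); rewrite e1 e2 -nE -nE' nm_div nmX nm_nat.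
      by rewrite mulrCA divff ?mulr1 // expf_neq0.
    by move->; rewrite expr2 -mulrA dvdz_mulr.
  exact: prime_dvdzX.
have pYZ : (p%:Z %| Y ^+ 2 + d%:Z * Z ^+ 2)%Z by rewrite h dvdz_mull.
have pY : (p%:Z %| Y)%Z.
  have : (p%:Z %| 4 * Y ^+ 3)%Z.
    have -> : 4 * Y ^+ 3 = (Y ^+ 3 - 3 * d%:Z * Y * Z ^+ 2) + 3 * Y * (Y ^+ 2 + d%:Z * Z ^+ 2) by ring.
    by apply: rpredD; [rewrite E dvdz_mulr|rewrite dvdz_mull].
  rewrite prime_dvdzM // => /orP[|]; last exact: prime_dvdzX.
  rewrite dvdzE -[`|4|%N]/(2 ^ 2)%N Euclid_dvdX // dvdn_prime2 // => /andP[/eqP pe _].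
  by move: pe p2; rewrite absz_nat => ->.
have pZ : (p%:Z %| Z)%Z.
  have : (p%:Z %| d%:Z * Z ^+ 2)%Z.
    by move: pYZ; rewrite addrC dvdz_addl_eq // expr2 dvdz_mulr.
  by rewrite prime_dvdzM // => /orP[|]; [rewrite dvdzE /= (negPf pd)|exact: prime_dvdzX].
exact: O_dvd_p pp p2 wE h pY pZ.
Qed.

End Quad.

(** * Ideals whose cube is principal *)

Lemma prime_free_eq1 (n : nat) : (0 < n)%N -> (forall p, prime p -> ~~ (p %| n)%N) -> n = 1%N.
Proof.
move=> n0 h; apply/eqP; rewrite eqn_leq n0 andbT leqNgt; apply/negP => n1.
by have := h _ (pdiv_prime n1); rewrite pdiv_dvd.
Qed.

Section Ideal.
Variable d : nat.
Hypotheses (d0 : (0 < d)%N) (sf : squarefree d).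
Notation K := (quad_field d).
Notation O := (ring_of_integers K).
Notation s := (qs d).

(** g plays the part of the ideal norm; no index of lattices is defined. *)
Record omodule (J : algC -> Prop) (g : algC) : Prop := Omodule {
  om_K : forall z, J z -> K z;
  om_D : forall x y, J x -> J y -> J (x + y);
  om_M : forall a x, O a -> J x -> J (a * x);
  om_neq0 : exists2 z, J z & z != 0;
  om_g : 0 < g;
  om_nm : forall z, J z -> exists n : nat, nm z = n%:R * g }.

(** [ci_cube] and [ci_gen] stand for the two inclusions of I^3 = x O. [ci_p] makes g the exact
    common divisor of the norms of elements. *)
Record cube_ideal (I : algC -> Prop) (x g : algC) : Prop := CubeIdeal {
  ci_om : omodule I g;
  ci_x : K x;
  ci_x0 : x != 0;
  ci_cube : forall a b c, I a -> I b -> I c -> O (a * b * c / x);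
  ci_gen : exists n (a b c : 'I_n -> algC),
    [/\ forall i, I (a i), forall i, I (b i), forall i, I (c i) & x = \sum_i a i * b i * c i];
  ci_p : forall p, prime p -> exists2 z, I z & exists2 n : nat, nm z = n%:R * g & ~~ (p %| n)%N;
  ci_nmx : nm x = g ^+ 3 }.

Section OModule.
Variables (J : algC -> Prop) (g : algC).
Hypothesis mJ : omodule J g.

Lemma om_Crat : g \in Crat.
Proof.
have [z Jz z0] := om_neq0 mJ; have [n nE] := om_nm mJ Jz.
have n0 : n%:R != 0 :> algC by apply: contra_neq z0 => n0; apply/eqP; rewrite -nm_eq0 nE n0 mul0r.
have -> : g = nm z / n%:R by rewrite nE mulrAC divff // mul1r.
by rewrite rpred_div ?rpred_nat // (nm_Crat d0 (om_K mJ Jz)).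
Qed.

Lemma om_int (n : int) z : J z -> J (n%:~R * z).
Proof. by move=> h; apply: (om_M mJ) => //; apply: O_int. Qed.

Lemma om_N z : J z -> J (- z).
Proof. by move=> h; rewrite -mulN1r -[- 1]/((- 1)%:~R); apply: om_int. Qed.

Lemma om_B x y : J x -> J y -> J (x - y).
Proof. by move=> hx hy; apply: (om_D mJ) => //; apply: om_N. Qed.

Lemma om_0 : J 0.
Proof. by have [z Jz _] := om_neq0 mJ; rewrite -(subrr z); apply: om_B. Qed.

Lemma om_sum n (f : 'I_n -> algC) : (forall i, J (f i)) -> J (\sum_i f i).
Proof. by move=> h; apply: (big_ind J) => //; [exact: om_0|exact: (om_D mJ)]. Qed.

(** The trace is (nm(a + b) - nm a - nm b) / g and the norm is nm a nm b / g^2, both integers. *)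
Lemma om_polar a b : J a -> J b -> O (a * b^* / g).
Proof.
move=> Ja Jb; have g0 := om_g mJ; have gn : g != 0 by rewrite gt_eqF.
have [na nE] := om_nm mJ Ja; have [nb nE'] := om_nm mJ Jb; have [nc nE''] := om_nm mJ (om_D mJ Ja Jb).
have gc : g^* = g := conj_Crat om_Crat.
apply: (O_trace_nm (T := nc%:Z - na%:Z - nb%:Z) (N := na%:Z * nb%:Z)).
- apply: (qf_div d0); last by apply: qf_rat; exact: om_Crat.
  by apply: qfM; [apply: (om_K mJ)|apply: (qf_conj d0); apply: (om_K mJ)].
- apply: (mulIf gn); rewrite rmorphM rmorphM fmorphV /= conjCK gc mulrDl !divfK //.
  rewrite !rmorphB /= -[nc%:Z%:~R]/(nc%:R) -[na%:Z%:~R]/(na%:R) -[nb%:Z%:~R]/(nb%:R) !mulrBl -nE -nE' -nE''.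
  rewrite /nm rmorphD /=; ring.
rewrite nm_div nmM nm_conj nE nE' (nm_rat om_Crat) rmorphM /= -[na%:Z%:~R]/(na%:R) -[nb%:Z%:~R]/(nb%:R).
have e (x y z : algC) : x * z * (y * z) = x * y * z ^+ 2 by ring.
by rewrite e mulfK // expf_neq0.
Qed.
End OModule.

Section CubeIdeal.
Variables (I : algC -> Prop) (x g : algC).
Hypothesis cI : cube_ideal I x g.
Let mI := ci_om cI.

(** I^2 / x is the inverse of I: writing x as a sum of a b c in the numerator of w x / x expresses w
    by elements c of I with coefficients w a b / x. *)
Lemma ci_crit w : (forall j j', I j -> I j' -> O (w * j * j' / x)) -> I w.
Proof.
move=> h; have [n [a [b [c [Ia Ib Ic xE]]]]] := ci_gen cI.
have x0 := ci_x0 cI; have -> : w = \sum_i (w * a i * b i / x) * c i.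
  rewrite -[LHS](mulfK x0) {1}xE mulr_sumr mulr_suml; apply: eq_bigr => i _; ring.
by apply: (om_sum mI) => i; apply: (om_M mI) => //; apply: h.
Qed.

Lemma div_cube3 (w j j' : algC) : (w * j * j' / x) ^+ 3 = (w ^+ 3 / x) * (j * j * j / x) * (j' * j' * j' / x).
Proof. ring. Qed.

(** The cube of w j j' / x is a product of integers of the field, and integrality passes to cube
    roots. Thus I is determined by x, as the w with w^3 in x O. *)
Lemma ci_root w : K w -> O (w ^+ 3 / x) -> I w.
Proof.
move=> Kw Ow; apply: ci_crit => j j' Ij Ij'; apply: (@O_root d _ 3) => //.
  by apply: qf_div => //; [apply: qfM; [apply: qfM|] => //; apply: (om_K mI)|exact: ci_x cI].
rewrite div_cube3; apply: OM; [apply: OM|] => //; exact: (ci_cube cI).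
Qed.

Lemma ci_dvd p w : prime p -> ~~ (p %| 2 * d)%N -> I w -> O (w ^+ 3 / x / p%:R) -> I (w / p%:R).
Proof.
move=> pp p2d Iw Ow; apply: ci_crit => j j' Ij Ij'.
have -> : w / p%:R * j * j' / x = w * j * j' / x / p%:R by ring.
apply: (O_cube_dvd d0 sf pp p2d); first exact: (ci_cube cI).
have -> : (w * j * j' / x) ^+ 3 / p%:R = (w ^+ 3 / x / p%:R) * (j * j * j / x) * (j' * j' * j' / x).
  by rewrite div_cube3; ring.
by apply: OM; [apply: OM|] => //; exact: (ci_cube cI).
Qed.
End CubeIdeal.

(** Membership depends only on w^3 / x, so changing x by mu^3 scales the ideal by mu. *)
Lemma cube_ideal_uniq I x g I' x' g' mu : cube_ideal I x g -> cube_ideal I' x' g' -> K mu ->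
  mu ^+ 3 = x / x' -> forall z, I z <-> I' (z / mu).
Proof.
move=> cI cI' Kmu mu3 z; have x0 := ci_x0 cI; have x0' := ci_x0 cI'.
have mu0 : mu != 0.
  by apply/eqP => m0; move/eqP: mu3; rewrite m0 expr0n /= eq_sym mulf_eq0 invr_eq0 (negPf x0) (negPf x0').
have xE : x = mu ^+ 3 * x' by rewrite mu3 divfK.
split=> h.
  apply: (ci_root cI'); first by apply: qf_div => //; apply: (om_K (ci_om cI)).
  have gen (a b e : algC) : (a / b) ^+ 3 / e = a * a * a / (b ^+ 3 * e).
    by rewrite expr_div_n (invfM (b ^+ 3)); ring.
  rewrite gen -xE.
  exact: (ci_cube cI).
have -> : z = (z / mu) * mu by rewrite divfK.
move: (z / mu) h => w h; apply: (ci_root cI); first by apply: qfM => //; apply: (om_K (ci_om cI')).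
have -> : (w * mu) ^+ 3 / x = w * w * w / x' * (mu ^+ 3 / mu ^+ 3) by rewrite xE exprMn (invfM (mu ^+ 3)); ring.
by rewrite divff ?mulr1 ?expf_neq0 //; exact: (ci_cube cI').
Qed.

(** nm x / g^3 is an integer, by expanding x into products and applying [om_polar] to each factor. A
    prime p dividing it would divide the cube of nm z / g for every z in I, against the maximality
    of the common divisor G. *)
Lemma cube_ideal_exists (I : classical_sets.set algC) (x : algC) : frac_ideal K I -> K x -> x != 0 ->
  ideal_mul (ideal_mul I I) I = scale_set x O -> exists g, cube_ideal I x g.
Proof.
move=> [IK I0 ID IM [z0 Iz0 z00] [c [Oc c0 cI]]] Kx x0 Ix.
have cO z : I z -> O (c * z) by move=> Iz; apply: cI; exists z.
have nc0 : nm c != 0 by rewrite nm_eq0.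
have /choice[f fE] : forall z, exists n : nat, I z -> nm (c * z) = n%:R.
  by move=> z; have [Iz|nI] := pselect (I z); [have [n nE] := O_nm d0 (cO z Iz); exists n|exists 0%N].
pose P G := (0 < G)%N && `[< forall z, I z -> (G %| f z)%N >].
have P1 : exists G, P G by exists 1%N; rewrite /P /=; apply/asboolP => z _; exact: dvd1n.
have f0 : (0 < f z0)%N.
  by have := nm_gt0 (c * z0); rewrite (fE _ Iz0) ltr0n mulf_neq0.
have Pb G : P G -> (G <= f z0)%N by move=> /andP[_ /asboolP/(_ z0 Iz0)]; apply: dvdn_leq.
have [G /andP[G0 /asboolP hG] Gmax] := ex_maxnP P1 Pb.
have G0' : G%:R != 0 :> algC by rewrite pnatr_eq0 -lt0n.
pose g := G%:R / nm c.
have nmE z : I z -> nm z = (f z %/ G)%N%:R * g.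
  by move=> Iz; rewrite /g mulrA -natrM divnK ?hG // -fE // nmM mulrAC divff // mul1r.
have om : omodule I g.
  split=> //; [by exists z0|by rewrite /g divr_gt0 ?ltr0n // lt0r nc0 nm_ge0|].
  by move=> w Iw; exists (f w %/ G)%N; apply: nmE.
have hp p : prime p -> exists2 z, I z & exists2 n : nat, nm z = n%:R * g & ~~ (p %| n)%N.
  move=> pp; apply: contrapT => nh; suff : P (p * G)%N.
    by move/Gmax; rewrite leqNgt -[X in (X < _)%N]mul1n ltn_pmul2r // prime_gt1.
  rewrite /P muln_gt0 prime_gt0 // G0 /=; apply/asboolP => z Iz.
  rewrite -(divnK (hG z Iz)) dvdn_pmul2r //; apply: contrapT => /negP nd; apply: nh; exists z => //.
  by exists (f z %/ G)%N => //; apply: nmE.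
have cube a b e : I a -> I b -> I e -> O (a * b * e / x).
  move=> Ia Ib Ie; have : ideal_mul (ideal_mul I I) I (a * b * e).
    exists 1%N, (fun=> a * b), (fun=> e); split=> //; last by rewrite big_ord1.
    by move=> _; exists 1%N, (fun=> a), (fun=> b); split=> //; rewrite big_ord1.
  by rewrite Ix => -[y Oy <-]; rewrite mulrAC divff // mul1r.
have gen : exists n (a b e : 'I_n -> algC),
    [/\ forall i, I (a i), forall i, I (b i), forall i, I (e i) & x = \sum_i a i * b i * e i].
  have : ideal_mul (ideal_mul I I) I x by rewrite Ix; exists 1; [exact: (O_nat d 1)|rewrite mulr1].
  move=> [n [u [v [hu hv xE]]]].
  have hu' i : exists w : seq (algC * algC), (forall t, t \in w -> I t.1 /\ I t.2) /\ u i = \sum_(t <- w) t.1 * t.2.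
    have [k [a [b [Ia Ib ->]]]] := hu i; exists [seq (a j, b j) | j <- enum 'I_k]; split.
      by move=> t /mapP[j _ ->]; split; [exact: Ia|exact: Ib].
    by rewrite big_map big_enum.
  have /choice[w hw] := hu'.
  pose L := [seq ((t.1, t.2), v i) | i <- enum 'I_n, t <- w i].
  have LI t : t \in L -> [/\ I t.1.1, I t.1.2 & I t.2].
    move=> /allpairsPdep[i [t' [_ tw ->]]] /=; have [h _] := hw i; have [h1 h2] := h _ tw; split=> //.
  have xL : x = \sum_(t <- L) t.1.1 * t.1.2 * t.2.
    rewrite xE big_allpairs_dep /= big_enum /=; apply: eq_bigr => i _; have [_ ->] := hw i.
    by rewrite mulr_suml.
  exists (size L), (fun i => (tnth (in_tuple L) i).1.1), (fun i => (tnth (in_tuple L) i).1.2), (fun i => (tnth (in_tuple L) i).2).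
  by split; try (by move=> i; have [] := LI _ (mem_tnth i (in_tuple L))); rewrite xL big_tnth.
exists g; split=> //.
have gn : g != 0 by rewrite gt_eqF // (om_g om).
have gr := om_Crat om.
have [n [a [b [e [Ia Ib Ie xE]]]]] := gen.
have Onx : O (nm x / g ^+ 3).
  have -> : nm x / g ^+ 3 = \sum_i \sum_j (a i * (a j)^* / g) * (b i * (b j)^* / g) * (e i * (e j)^* / g).
    rewrite /nm {1}xE xE rmorph_sum mulr_suml mulr_suml; apply: eq_bigr => i _.
    rewrite mulr_sumr mulr_suml; apply: eq_bigr => j _; rewrite !rmorphM /= exprS expr2 !invfM; ring.
  apply: (big_ind O) => [||i _]; [exact: (O_nat d 0)|exact: OD|].
  apply: (big_ind O) => [||j _]; [exact: (O_nat d 0)|exact: OD|].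
  by apply: OM; [apply: OM|]; apply: (om_polar om).
have [k kE] := O_rat (rpred_div (nm_Crat d0 Kx) (rpredX 3 gr)) Onx.
have k0 : 0 < k by rewrite -(ltr0z algC) -kE divr_gt0 ?exprn_gt0 ?(om_g om) // nm_gt0.
suff k1 : k = 1 by rewrite -[LHS](divfK (expf_neq0 3 gn)) kE k1 mul1r.
have k1 : `|k|%N = 1%N.
  apply: prime_free_eq1; first by rewrite absz_gt0 gt_eqF.
  move=> p pp; apply/negP => pk; have [z Iz [m mE /negP pm]] := hp p pp; apply: pm.
  have [q qE] := O_nm d0 (cube _ _ _ Iz Iz Iz).
  have : (m ^ 3 = q * `|k|)%N.
    apply/eqP; rewrite -(eqr_nat algC) natrX natrM -qE nm_div !nmM mE.
    rewrite -[`|k|%N%:R]/((`|k|%N%:Z)%:~R) gez0_abs ?ltW // -kE; apply/eqP.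
    have nx0 : nm x != 0 by rewrite nm_eq0.
    rewrite mulrA divfK //; apply: (mulIf (expf_neq0 3 gn)); rewrite divfK ?expf_neq0 //; ring.
  by move=> mk; have := dvdn_mull q pk; rewrite -mk Euclid_dvdX // => /andP[].
by rewrite -[k]gez0_abs ?ltW // k1.
Qed.

End Ideal.

(** * Reduced lattices *)

Lemma reduced_ineq1 (c m e : int) : 0 <= m -> 2 * m <= c -> c ^+ 2 <= m ^+ 2 + e -> 3 * c ^+ 2 <= 4 * e.
Proof. by move=> m0 mc; rewrite !expr2 => h; nia. Qed.

Lemma reduced_ineq2 (c m e : int) : m < c -> c < 2 * m -> c ^+ 2 <= (m - c) ^+ 2 + e -> 3 * c ^+ 2 <= 4 * e.
Proof. by move=> mc cm; rewrite !expr2 => h; nia. Qed.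

Section Reduce.
Variable d : nat.
Hypotheses (d0 : (0 < d)%N).
Notation K := (quad_field d).
Notation O := (ring_of_integers K).
Notation s := (qs d).

Definition tau_of (c m : nat) : algC := (s - m%:R) / c%:R.

Definition reduced (c m : nat) : bool :=
  [&& (0 < c)%N, (3 * c ^ 2 <= 4 * d)%N, (c %| m ^ 2 + d)%N & (m < c)%N].

Lemma qf_uniq a b a' b' : a \in Crat -> b \in Crat -> a' \in Crat -> b' \in Crat ->
  a + b * s = a' + b' * s -> a = a' /\ b = b'.
Proof.
move=> ar br ar' br' h; have hc : a - b * s = a' - b' * s.
  by have := congr1 Num.conj h; rewrite !qf_conjE.
have n2 : 2%:R != 0 :> algC by rewrite pnatr_eq0.
split; apply: (mulfI n2).
  have -> : 2%:R * a = (a + b * s) + (a - b * s) by ring.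
  by rewrite h hc; ring.
apply: (mulIf (qs_neq0 d0)).
have -> : 2%:R * b * s = (a + b * s) - (a - b * s) by ring.
by rewrite h hc; ring.
Qed.

Section Reduction.
Variables (J : algC -> Prop) (g : algC).
Hypothesis mJ : omodule d J g.

(* A minimal vector of J is scaled to 1. *)
Lemma omodule_minimal : exists xi n0, [/\ J xi, xi != 0, (0 < n0)%N, nm xi = n0%:R * g &
  forall z, J z -> z != 0 -> nm xi <= nm z].
Proof.
pose P (n : nat) := `[< exists2 z, J z & z != 0 /\ nm z = n%:R * g >].
have P1 : exists n, P n.
  have [z Jz z0] := om_neq0 mJ; have [n nE] := om_nm mJ Jz.
  by exists n; apply/asboolP; exists z.
have [n /asboolP[xi Jxi [xi0 xiE]] nmin] := ex_minnP P1; exists xi, n; split=> //.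
  rewrite lt0n; apply: contra_neq xi0 => n0; apply/eqP; rewrite -nm_eq0 xiE n0 mul0r //.
move=> z Jz z0; have [m mE] := om_nm mJ Jz; rewrite xiE mE; apply: ler_wpM2r; first exact: ltW (om_g mJ).
by rewrite ler_nat; apply: nmin; apply/asboolP; exists z.
Qed.

(** Scaled by a minimal vector, the lattice is spanned by 1 and an element of least positive
    imaginary part. It contains s, so that element is (s - m) / c up to sign conventions of m;
    minimality against the translate nearest to the imaginary axis gives c^2 <= c^2 / 4 + d. *)
Lemma omodule_reduced : exists xi c m, [/\ K xi, xi != 0, reduced c m &
  forall z, J z <-> exists i j : int, z = xi * (i%:~R + j%:~R * tau_of c m)].
Proof.
have [xi [n0 [Jxi xi0 n00 xiE xmin]]] := omodule_minimal.
have g0 := om_g mJ; have gn : g != 0 by rewrite gt_eqF.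
pose J1 w := J (xi * w).
have J1_1 : J1 1 by rewrite /J1 mulr1.
have J1D x y : J1 x -> J1 y -> J1 (x + y) by move=> hx hy; rewrite /J1 mulrDr; apply: (om_D mJ).
have J1O a x : O a -> J1 x -> J1 (a * x) by move=> ha hx; rewrite /J1 mulrCA; apply: (om_M mJ).
have J1int (i : int) x : J1 x -> J1 (i%:~R * x) by apply: J1O; exact: O_int.
have J1B x y : J1 x -> J1 y -> J1 (x - y).
  by move=> hx hy; apply: J1D => //; rewrite -mulN1r -[- 1]/((- 1)%:~R); apply: J1int.
have J1K w : J1 w -> K w.
  move=> Jw; rewrite -[w](mulKf xi0) mulrC; apply: (qf_div d0); [exact: (om_K mJ)|exact: (om_K mJ)].
have n0n : n0%:R != 0 :> algC by rewrite pnatr_eq0 -lt0n.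
have nm1' w : J1 w -> exists n : nat, n0%:R * nm w = n%:R.
  move=> Jw; have [n nE] := om_nm mJ Jw; exists n; apply: (mulIf gn).
  by rewrite -nE nmM xiE; ring.
have nmge w : J1 w -> w != 0 -> 1 <= nm w.
  move=> Jw w0; have := xmin _ Jw (mulf_neq0 xi0 w0).
  by rewrite nmM -{1}[nm xi]mulr1 ler_pM2l // nm_gt0.
have re_int a b : a \in Crat -> b \in Crat -> J1 (a + b * s) -> exists k : int, 2%:R * n0%:R * a = k%:~R.
  move=> ar br Jw; have [n nE] := nm1' _ Jw; have [n' nE'] := nm1' _ (J1D _ _ Jw J1_1).
  exists (n'%:Z - n%:Z - n0%:Z); rewrite !rmorphB /= -[n'%:Z%:~R]/(n'%:R) -[n%:Z%:~R]/(n%:R) -nE -nE'.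
  have e1 : nm (a + b * s + 1) = (a + 1) ^+ 2 + d%:R * b ^+ 2 by rewrite addrAC nm_qf // rpredD ?rpred1.
  have nz : n0%:Z%:~R = n0%:R :> algC by [].
  by rewrite e1 nm_qf // nz; ring.
have im_int a b : a \in Crat -> b \in Crat -> J1 (a + b * s) -> exists k : int, (2 * d * n0)%N%:R * b = k%:~R.
  move=> ar br Jw; have Js := J1O _ _ (O_qs d) Jw.
  have e : s * (a + b * s) = (- (d%:R * b)) + a * s by rewrite -mulNr -[- d%:R]qs_sq; ring.
  rewrite e in Js; have [|//|k kE] := re_int _ _ _ _ Js; first by rewrite rpredN rpredM ?rpred_nat.
  by exists (- k); rewrite rmorphN /= -kE !natrM; ring.
(* Otherwise the fractional part would be a nonzero element of norm below 1. *)
have rat_J1 a : a \in Crat -> J1 a -> exists k : int, a = k%:~R.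
  move=> /CratP[q ->] Jq; pose k := Num.floor q; exists k.
  have /andP[k1 k2] := floor_itv q; rewrite -/k in k1 k2.
  apply/eqP; rewrite -subr_eq0; apply/negPn/negP => nz.
  have Jk : J1 (ratr q - k%:~R) by apply: J1B => //; rewrite -[k%:~R]mulr1; apply: J1int.
  have := nmge _ Jk nz; rewrite -(ratr_int _ k) -rmorphB nm_rat ?Crat_rat // -rmorphXn -(rmorph1 ratr) ler_rat.
  have q0 : 0 <= q - k%:~R by rewrite subr_ge0.
  have q1 : q - k%:~R < 1 by rewrite ltrBlDl -[1]/(1%:~R) -intrD.
  have gen (t : rat) : 0 <= t -> t < 1 -> 1 <= t ^+ 2 -> False.
    by move=> t0 t1; rewrite expr2; nra.
  exact: gen q0 q1.
pose M := (2 * d * n0)%N; have M0 : (0 < M)%N by rewrite !muln_gt0 d0 n00.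
have Mn : M%:R != 0 :> algC by rewrite pnatr_eq0 -lt0n.
pose P (k : nat) := (0 < k)%N && `[< exists a b, [/\ a \in Crat, b \in Crat, J1 (a + b * s) & M%:R * b = k%:R] >].
have Ps : P M.
  rewrite /P M0; apply/asboolP; exists 0, 1; rewrite Crat0 Crat1 mulr1; split=> //.
  by rewrite add0r mul1r -[s]mulr1; apply: J1O => //; exact: O_qs.
have [k0 /andP[k00 /asboolP[u0 [v0 [u0r v0r Jtau v0E]]]] kmin] := ex_minnP (ex_intro P M Ps).
have k0n : k0%:R != 0 :> algC by rewrite pnatr_eq0 -lt0n.
have v0n : v0 != 0 by apply: contra_neq k0n => v00; rewrite -v0E v00 mulr0.
set t0 := u0 + v0 * s in Jtau.
have span w : J1 w -> exists i j : int, w = i%:~R + j%:~R * t0.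
  move=> Jw; have /qfP[a [b [ar br wE]]] := J1K _ Jw; have Jab := Jw; rewrite wE in Jab.
  have [k kE] := im_int _ _ ar br Jab; rewrite -/M in kE.
  pose j := (k %/ k0)%Z; pose r := (k %% k0)%Z.
  have kjr : k = j * k0%:Z + r by exact: divz_eq.
  have Jr : J1 ((a - j%:~R * u0) + (b - j%:~R * v0) * s).
    have -> : (a - j%:~R * u0) + (b - j%:~R * v0) * s = (a + b * s) - j%:~R * t0 by rewrite /t0; ring.
    by apply: J1B => //; apply: J1int.
  have r1 : a - j%:~R * u0 \in Crat by rewrite rpredB ?rpredM ?Crat_int.
  have r2 : b - j%:~R * v0 \in Crat by rewrite rpredB ?rpredM ?Crat_int.
  have rE : M%:R * (b - j%:~R * v0) = r%:~R.
    by rewrite mulrBr kE mulrCA v0E kjr intrD intrM -[k0%:Z%:~R]/(k0%:R) addrAC subrr add0r.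
  have k0z : k0%:Z != 0 by rewrite eqz_nat -lt0n.
  have rge : 0 <= r by apply: modz_ge0.
  have rlt : r < k0%:Z by apply: ltz_pmod; rewrite ltz_nat.
  have r0 : r = 0.
    apply/eqP/negPn/negP => rn; have : P `|r|%N.
      rewrite /P absz_gt0 rn; apply/asboolP; exists (a - j%:~R * u0), (b - j%:~R * v0); split=> //.
      by rewrite rE -{1}(gez0_abs rge).
    by move/kmin; rewrite leqNgt -ltz_nat gez0_abs // rlt.
  have b0 : b - j%:~R * v0 = 0 by apply: (mulfI Mn); rewrite rE r0 mulr0.
  rewrite b0 mul0r addr0 in Jr; have [i iE] := rat_J1 _ r1 Jr; exists i, j.
  rewrite wE -iE /t0; move/eqP: b0; rewrite subr_eq0 => /eqP->; ring.
have Jsp : J1 s by rewrite -[s]mulr1; apply: J1O => //; exact: O_qs.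
have [m [c sE]] := span _ Jsp.
have [e1 e2] : m%:~R + c%:~R * u0 = 0 /\ c%:~R * v0 = 1.
  apply: qf_uniq; rewrite ?rpredD ?rpredM ?Crat_int ?Crat0 ?Crat1 //.
  by rewrite add0r mul1r {2}sE /t0; ring.
have cM : c * k0%:Z = M%:Z.
  apply: (@intr_inj algC); rewrite intrM -[k0%:Z%:~R]/(k0%:R) -v0E mulrCA e2 mulr1 //.
have c0 : 0 < c.
  have h : 0 < c * k0%:Z by rewrite cM ltz_nat.
  by rewrite -(pmulr_lgt0 c (_ : 0 < k0%:Z)) // ltz_nat.
have cn : c%:~R != 0 :> algC by rewrite intr_eq0 gt_eqF.
have tE : t0 = (s - m%:~R) / c%:~R.
  by apply: (mulIf cn); rewrite divfK // sE; ring.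
have [i [j ijE]] := span _ (J1O _ _ (O_qs d) Jtau).
have md : m ^+ 2 + d%:Z = - i * c.
  have h : s * (s - m%:~R) = c%:~R * i%:~R + j%:~R * (s - m%:~R).
    have := congr1 (fun z => c%:~R * z) ijE; rewrite /= tE mulrCA [c%:~R * (_ / _)]mulrC divfK // => ->.
    by rewrite mulrDr mulrCA [c%:~R * (_ / _)]mulrC divfK.
  have [h1 h2] : - d%:R = c%:~R * i%:~R - j%:~R * m%:~R :> algC /\ - m%:~R = j%:~R :> algC.
    apply: qf_uniq; rewrite ?rpredB ?rpredN ?rpredM ?Crat_int ?rpred_nat //.
    transitivity (s * (s - m%:~R)); first by rewrite -qs_sq; ring.
    by rewrite h; ring.
  apply: (@intr_inj algC); rewrite intrD rmorphXn (intrM _ (- i)) rmorphN /= -[d%:Z%:~R]/(d%:R).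
  move/eqP: h1; rewrite -h2 eq_sym subr_eq => /eqP h1; rewrite mulNr mulrC h1; ring.
have lat_t (k : int) : J1 ((s - (m + c * k)%:~R) / c%:~R).
  have -> : (s - (m + c * k)%:~R) / c%:~R = t0 - k%:~R * 1.
    by rewrite tE intrD intrM; field.
  by apply: J1B => //; apply: J1int.
pose m0 := (m %% c)%Z; have m0E : m0 = m + c * (- (m %/ c)%Z) by rewrite /m0 {2}(divz_eq m c); ring.
have m00 : 0 <= m0 by apply: modz_ge0; rewrite gt_eqF.
have m0c : m0 < c by apply: ltz_pmod.
have nmt (k : int) : c ^+ 2 <= (m + c * k) ^+ 2 + d%:Z.
  have nz : (s - (m + c * k)%:~R) / c%:~R != 0.
    rewrite mulf_neq0 ?invr_eq0 // subr_eq0; apply/eqP => sR.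
    have := qs_conj d0; rewrite sR conj_Crat ?Crat_int // => /eqP.
    by rewrite -addr_eq0 -mulr2n mulrn_eq0 /= -sR (negPf (qs_neq0 d0)).
  have := nmge _ (lat_t k) nz; rewrite nm_div [nm c%:~R]nm_rat ?Crat_int // ler_pdivlMr ?exprn_gt0 ?ltr0z //.
  have -> : s - (m + c * k)%:~R = (- (m + c * k))%:~R + 1 * s by rewrite rmorphN mul1r addrC.
  rewrite [leLHS]mul1r nm_qf ?Crat_int ?Crat1 // expr1n mulr1 rmorphN sqrrN -!rmorphXn -[d%:R]/(d%:Z%:~R) -intrD ler_int //.
have c3 : 3 * c ^+ 2 <= 4 * d%:Z.
  have [h|h] := lerP (2 * m0) c.
    by have := nmt (- (m %/ c)%Z); rewrite -m0E; exact: reduced_ineq1 m00 h.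
  have := nmt (- (m %/ c)%Z - 1); have -> : m + c * (- (m %/ c)%Z - 1) = m0 - c by rewrite m0E; ring.
  exact: reduced_ineq2 m0c h.
exists xi, `|c|%N, `|m0|%N; have cN : `|c|%N%:Z = c by rewrite gez0_abs // ltW.
have mN : `|m0|%N%:Z = m0 by rewrite gez0_abs.
split=> //; first exact: (om_K mJ).
  apply/and4P; split.
  - by rewrite absz_gt0 gt_eqF.
  - by rewrite -lez_nat (PoszM 3) (PoszM 4) PoszX cN.
  - suff : (`|c|%N%:Z %| (`|m0| ^ 2 + d)%N%:Z)%Z by [].
    rewrite PoszD PoszX cN mN m0E.
    have -> : (m + c * - (m %/ c)%Z) ^+ 2 + d%:Z = (m ^+ 2 + d%:Z) + c * ((- (m %/ c)%Z) * (2 * m + c * - (m %/ c)%Z)) by ring.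
    by rewrite md; apply: rpredD; [apply: dvdz_mull|apply: dvdz_mulr].
  - by rewrite -ltz_nat cN mN.
have tau0 : tau_of `|c| `|m0| = t0 + (m %/ c)%Z%:~R.
  rewrite /tau_of -[`|c|%N%:R]/(`|c|%N%:Z%:~R) -[`|m0|%N%:R]/(`|m0|%N%:Z%:~R) cN mN m0E tE intrD intrM rmorphN /=.
  by field.
move=> z; split=> [Jz|[i' [j' ->]]].
  have zE : z = xi * (z / xi) by rewrite mulrC divfK.
  have [|i' [j' hh]] := span (z / xi); first by rewrite /J1 mulrC divfK.
  exists (i' - j' * (m %/ c)%Z), j'; rewrite zE hh tau0 intrB intrM; congr (_ * _); ring.
have Jt : J1 (tau_of `|c| `|m0|) by rewrite tau0; apply: J1D => //; rewrite -[_%:~R]mulr1; apply: J1int.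
by apply: J1D; [rewrite -[_%:~R]mulr1|]; apply: J1int.
Qed.
End Reduction.
End Reduce.

(** * Split primes *)

Section SplitPrimes.
Variable d : nat.
Hypotheses (d0 : (0 < d)%N) (sf : squarefree d).
Notation K := (quad_field d).
Notation O := (ring_of_integers K).
Notation s := (qs d).

Record is_norm (J : algC -> Prop) (g : algC) : Prop := IsNorm {
  in_nm : forall z, J z -> exists n : nat, nm z = n%:R * g;
  in_p : forall p, prime p -> exists2 z, J z & exists2 n : nat, nm z = n%:R * g & ~~ (p %| n)%N }.

(** A prime p in the denominator of nm lam g / g' is excluded by testing on some z in J with nm z /
    g prime to p. *)
Lemma norm_incl J g J' g' lam : is_norm J g -> is_norm J' g' -> g \in Crat -> g' \in Crat ->
  0 < g -> 0 < g' -> K lam ->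
  (forall z, J z -> J' (lam * z)) -> exists k : nat, nm lam * g = k%:R * g'.
Proof.
move=> [hn hp] [hn' hp'] gr gr' g0 g0' Kl h.
have gn' : g' != 0 by rewrite gt_eqF.
have /CratP[q qE] : nm lam * g / g' \in Crat.
  by apply: rpred_div => //; apply: rpredM => //; exact: (nm_Crat d0 Kl).
have q0 : 0 <= q by rewrite -(ler0q algC) -qE; apply: mulr_ge0; [apply: mulr_ge0; [exact: nm_ge0|exact: ltW]|rewrite invr_ge0 ltW].
have d1 : `|denq q|%N = 1%N.
  apply: prime_free_eq1; first by rewrite absz_gt0 denq_neq0.
  move=> p pp; apply/negP => pd; have [z Jz [n nE /negP pn]] := hp p pp; apply: pn.
  have [n' nE'] := hn' _ (h _ Jz).
  have E : q * n%:R = n'%:R.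
    apply: (fmorph_inj (ratr : rat -> algC)); rewrite rmorphM !rmorph_nat /= -qE.
    by apply: (mulIf gn'); rewrite -nE' nmM nE mulrAC divfK //; ring.
  have E' : numq q * n%:Z = n'%:Z * denq q.
    apply: (@intr_inj rat); rewrite !intrM -[n%:Z%:~R]/(n%:R) -[n'%:Z%:~R]/(n'%:R) -E.
    have qn : q * (denq q)%:~R = (numq q)%:~R by rewrite -{1}(divq_num_den q) divfK // intr_eq0 denq_neq0.
    by rewrite mulrAC qn.
  have : (p %| `|numq q| * n)%N by rewrite -[n]/(`|n%:Z|%N) -abszM E' abszM dvdn_mull.
  rewrite Euclid_dvdM // => /orP[pq|//]; have := coprime_num_den q.
  by move/(coprime_dvdl pq)/(coprime_dvdr pd); rewrite /coprime gcdnn => /eqP p1; rewrite p1 in pp.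
exists `|numq q|%N; rewrite -[LHS](divfK gn') qE; congr (_ * _).
have qz : q = (numq q)%:~R by rewrite -[LHS]divq_num_den -[denq q]gez0_abs ?d1 ?divr1 // ltW // denq_gt0.
by rewrite {1}qz ratr_int -{1}[numq q]gez0_abs // numq_ge0.
Qed.

Lemma ci_is_norm I x g : cube_ideal d I x g -> is_norm I g.
Proof. by move=> cI; split; [exact: (om_nm (ci_om cI))|exact: (ci_p cI)]. Qed.

Section SplitPrime.
Variables (I : algC -> Prop) (x g : algC) (b r : nat).
Hypothesis cI : cube_ideal d I x g.
Hypotheses (bp : prime b) (b2 : (2 < b)%N) (bd : ~~ (b %| d)%N).
Hypotheses (br : (b %| r ^ 2 + d)%N) (br2 : ~~ (b ^ 2 %| r ^ 2 + d)%N).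
Let mI := ci_om cI.
Let b0 : b%:R != 0 :> algC. Proof. by rewrite pnatr_eq0 -lt0n prime_gt0. Qed.
Let e := ((r ^ 2 + d) %/ b)%N.
Let eE : (r ^ 2 + d = e * b)%N. Proof. by rewrite divnK. Qed.
Let be : ~~ (b %| e)%N.
Proof. by move: br2; rewrite eE -mulnn dvdn_pmul2r // prime_gt0. Qed.

(** The product of I with the prime ideal (b, s - r) over b, described by divisibility: (s + r)(s -
    r) = -(r^2 + d) is a multiple of b. *)
Definition split_part z := I z /\ I ((s + r%:R) * z / b%:R).

Lemma sr_sq : (s + r%:R) * (s - r%:R) = - (e%:R * b%:R).
Proof.
have h : e%:R * b%:R = r%:R ^+ 2 + d%:R :> algC by rewrite -natrM -eE natrD natrX.
have -> : (s + r%:R) * (s - r%:R) = s ^+ 2 - r%:R ^+ 2 by ring.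
by rewrite h qs_sq; ring.
Qed.

Lemma Osr : O (s + r%:R). Proof. by apply: OD; [exact: O_qs|exact: O_nat]. Qed.
Lemma Osr' : O (s - r%:R). Proof. by apply: OB; [exact: O_qs|exact: O_nat]. Qed.

Lemma split_part_b w : I w -> split_part (b%:R * w).
Proof.
move=> Iw; split; first by apply: (om_M mI) => //; exact: O_nat.
rewrite mulrCA mulrAC divff // mul1r; apply: (om_M mI) => //; exact: Osr.
Qed.

Lemma split_part_s w : I w -> split_part ((s - r%:R) * w).
Proof.
move=> Iw; split; first by apply: (om_M mI) => //; exact: Osr'.
rewrite mulrA sr_sq -mulNr mulrAC mulfK //; apply: (om_M mI) => //.
by apply: ON; exact: O_nat.
Qed.

Lemma split_part_om : omodule d split_part g.
Proof.
split.
- by move=> z [Iz _]; exact: (om_K mI).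
- move=> u v [u1 u2] [v1 v2]; split; first exact: (om_D mI).
  by rewrite mulrDr mulrDl; apply: (om_D mI).
- move=> a u Oa [u1 u2]; split; first exact: (om_M mI).
  by rewrite mulrCA -mulrA; apply: (om_M mI).
- have [z Iz z0] := om_neq0 mI; exists (b%:R * z); first exact: split_part_b.
  by rewrite mulf_neq0.
- exact: (om_g mI).
- by move=> z [Iz _]; exact: (om_nm mI).
Qed.

(** [om_polar] applied to z and (s + r) z / b gives an integer of norm n^2 e / b, where n = nm z / g
    and b is prime to e; so b divides n. The elements b z and (s - r) z show that no further prime
    divides all the norms. *)
Lemma split_part_norm : is_norm split_part (b%:R * g).
Proof.
have gn : g != 0 by rewrite gt_eqF // (om_g mI).
have gr := om_Crat d0 mI.
split=> [z [Iz Iw]|p pp].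
  have [n nE] := om_nm mI Iz; suff /dvdnP[k kE] : (b %| n)%N by exists k; rewrite nE kE natrM mulrA.
  have [t tE] := O_nm d0 (om_polar d0 mI Iz Iw).
  have : (n ^ 2 * e = t * b)%N.
    apply/eqP; rewrite -(eqr_nat algC) natrM natrX natrM -tE.
    have -> : nm (z * ((s + r%:R) * z / b%:R)^* / g) = nm z ^+ 2 * nm (s + r%:R) / (b%:R ^+ 2 * g ^+ 2).
      by rewrite nm_div nmM nm_conj nm_div nmM nm_nat (nm_rat gr); field; rewrite gn b0.
    have -> : nm (s + r%:R) = e%:R * b%:R.
      by rewrite /nm rmorphD /= (qs_conj d0) conjC_nat -[RHS]opprK -sr_sq; ring.
    rewrite nE; apply/eqP; apply: (mulIf (mulf_neq0 (expf_neq0 2 b0) (expf_neq0 2 gn))).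
    by rewrite [RHS]mulrAC divfK ?mulf_neq0 ?expf_neq0 //; ring.
  move=> h; have : (b %| n ^ 2 * e)%N by rewrite h dvdn_mull.
  by rewrite Euclid_dvdM // (negPf be) orbF Euclid_dvdX // => /andP[].
have [z Iz [n nE pn]] := ci_p cI pp; have [pb|pb] := eqVneq p b.
  exists ((s - r%:R) * z); first exact: split_part_s.
  exists (e * n)%N; last by rewrite pb Euclid_dvdM // negb_or be -pb.
  rewrite nmM nE natrM; have -> : nm (s - r%:R) = e%:R * b%:R.
    by rewrite /nm rmorphB /= (qs_conj d0) conjC_nat -[RHS]opprK -sr_sq; ring.
  ring.
exists (b%:R * z); first exact: split_part_b.
exists (b * n)%N; first by rewrite nmM nm_nat nE natrM; ring.
by rewrite Euclid_dvdM // negb_or pn andbT dvdn_prime2.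
Qed.

(** The two memberships put b w, (s + r) w and (s - r) w into I, hence 2 r w, and 2 r is prime to b.
    So the product with the prime ideal determines I. *)
Lemma split_part_recover w : I w <-> split_part (b%:R * w) /\ split_part ((s - r%:R) * w).
Proof.
split=> [Iw|[[h1 h2] [h3 _]]]; first by split; [exact: split_part_b|exact: split_part_s].
have h2' : I ((s + r%:R) * w) by move: h2; rewrite mulrCA mulrAC divff // mul1r.
have h4 : I ((2 * r)%N%:Z%:~R * w).
  have -> : (2 * r)%N%:Z%:~R * w = (s + r%:R) * w - (s - r%:R) * w.
    by rewrite -[(2 * r)%N%:Z%:~R]/((2 * r)%N%:R) natrM; ring.
  exact: (om_B mI).
have cop : coprimez (2 * r)%N b.
  rewrite coprimezE coprime_sym prime_coprime // Euclid_dvdM // negb_or dvdn_prime2 //.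
  rewrite gtn_eqF //=; apply: contra bd => brr.
  by rewrite -(dvdn_addr d (dvdn_exp (isT : 0 < 2)%N brr)).
have /coprimezP[[u v] /= uv] := cop.
have -> : w = u%:~R * ((2 * r)%N%:Z%:~R * w) + v%:~R * (b%:R * w).
  have := congr1 (fun z : int => z%:~R : algC) uv; rewrite intrD !intrM => h.
  by rewrite -{1}[w]mul1r -[1 in LHS]/(1%:~R) -h -[b%:Z%:~R]/(b%:R); ring.
by apply: (om_D mI); apply: (om_int mI).
Qed.
End SplitPrime.

Lemma split_part_inj I x g I' x' g' b r lam : cube_ideal d I x g -> cube_ideal d I' x' g' ->
  prime b -> (2 < b)%N -> ~~ (b %| d)%N -> (b %| r ^ 2 + d)%N -> lam != 0 ->
  (forall z, split_part I b r z <-> split_part I' b r (lam * z)) ->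
  forall z, I z <-> I' (lam * z).
Proof.
move=> cI cI' bp b2 bd br l0 h z.
have R1 : I z <-> split_part I b r (b%:R * z) /\ split_part I b r ((s - r%:R) * z).
  by apply: (split_part_recover cI).
have R2 : I' (lam * z) <-> split_part I' b r (b%:R * (lam * z)) /\ split_part I' b r ((s - r%:R) * (lam * z)).
  by apply: (split_part_recover cI').
by rewrite R1 R2 ![_ * (lam * z)]mulrCA -!h.
Qed.

(** * Equivalent products of two classes with different primes *)

Section Collision.
Variables (I I' : algC -> Prop) (x x' g g' : algC) (b b' r r' : nat) (lam : algC).
Hypotheses (cI : cube_ideal d I x g) (cI' : cube_ideal d I' x' g').
Hypotheses (bp : prime b) (b2 : (2 < b)%N) (bd : ~~ (b %| d)%N).
Hypotheses (br : (b %| r ^ 2 + d)%N) (br2 : ~~ (b ^ 2 %| r ^ 2 + d)%N).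
Hypotheses (bp' : prime b') (b2' : (2 < b')%N) (bd' : ~~ (b' %| d)%N).
Hypotheses (br' : (b' %| r' ^ 2 + d)%N) (br2' : ~~ (b' ^ 2 %| r' ^ 2 + d)%N).
Hypotheses (bb' : b != b') (Kl : K lam) (l0 : lam != 0).
Hypothesis collide : forall z, split_part I b r z <-> split_part I' b' r' (lam * z).
Let mI := ci_om cI.
Let mI' := ci_om cI'.
Let b0 : b%:R != 0 :> algC. Proof. by rewrite pnatr_eq0 -lt0n prime_gt0. Qed.
Let g0 := om_g mI.
Let g0' := om_g mI'.

Lemma nm_lam : nm lam * (b%:R * g) = b'%:R * g'.
Proof.
have gr := om_Crat d0 mI; have gr' := om_Crat d0 mI'.
have n1 : is_norm (split_part I b r) (b%:R * g) by apply: (split_part_norm cI).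
have n2 : is_norm (split_part I' b' r') (b'%:R * g') by apply: (split_part_norm cI').
have pos (c : nat) (y : algC) : prime c -> 0 < y -> 0 < c%:R * y.
  by move=> cp y0; rewrite mulr_gt0 // ltr0n prime_gt0.
have rr (c : nat) (y : algC) : y \in Crat -> c%:R * y \in Crat by move=> yr; rewrite rpredM ?rpred_nat.
have [k kE] := norm_incl n1 n2 (rr b _ gr) (rr b' _ gr') (pos _ _ bp g0) (pos _ _ bp' g0') Kl (fun z => (collide z).1).
have inv z : split_part I' b' r' z -> split_part I b r (lam^-1 * z).
  by move=> h; apply/collide; rewrite mulrA divff // mul1r.
have [k' kE'] := norm_incl n2 n1 (rr b' _ gr') (rr b _ gr) (pos _ _ bp' g0') (pos _ _ bp g0) (qfV d0 Kl) inv.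
have kk : (k' * k = 1)%N.
  apply/eqP; rewrite -(eqr_nat algC) natrM; apply/eqP.
  apply: (mulIf (_ : b%:R * g != 0)); first by rewrite mulf_neq0 // gt_eqF.
  have l0' : nm lam != 0 by rewrite nm_eq0.
  rewrite mul1r mulrAC -kE' -[RHS](mulKf l0') kE nmV; ring.
have -> : nm lam * (b%:R * g) = k%:R * (b'%:R * g') := kE.
by move/eqP: kk; rewrite muln_eq1 => /andP[_ /eqP->]; rewrite mul1r.
Qed.

(** b lam maps I into I'; on cubes this is multiplication by (b lam)^3 from x O into x' O, and theta
    is the corresponding integer. *)
Let theta := (b%:R * lam) ^+ 3 * x / x'.

Lemma lam_incl z : I z -> I' (b%:R * lam * z).
Proof.
move=> Iz; have [h _] := (collide _).1 (split_part_b r cI bp Iz).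
by have -> : b%:R * lam * z = lam * (b%:R * z) by ring.
Qed.

Lemma theta_O : O theta.
Proof.
have [n [a [c [e [Ia Ic Ie xE]]]]] := ci_gen cI.
have -> : theta = \sum_i (b%:R * lam * a i) * (b%:R * lam * c i) * (b%:R * lam * e i) / x'.
  by rewrite /theta {1}xE mulr_sumr mulr_suml; apply: eq_bigr => i _; ring.
apply: (big_ind O) => [||i _]; [exact: (O_nat d 0)|exact: OD|].
by apply: (ci_cube cI'); apply: lam_incl.
Qed.

Lemma theta_nm : nm theta = ((b * b') ^ 3)%N%:R.
Proof.
have gn : g != 0 by rewrite gt_eqF. have gn' : g' != 0 by rewrite gt_eqF.
have nl : nm lam = b'%:R * g' / (b%:R * g) by rewrite -nm_lam mulfK // mulf_neq0.
rewrite /theta nm_div nmM nmX nmM nm_nat (ci_nmx cI) (ci_nmx cI') nl natrX natrM.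
by field; rewrite gn gn' b0.
Qed.

(** If q divided theta, (b lam / q) I would lie in I' by the cube criterion, and comparing norms q^2
    would divide b b', a product of two distinct primes. *)
Lemma theta_prim q : prime q -> (q == b) || (q == b') -> ~ O (theta / q%:R).
Proof.
move=> qp qb Oq; have [q2 qd] : (2 < q)%N /\ ~~ (q %| d)%N by case/orP: qb => /eqP->.
have q0 : q%:R != 0 :> algC by rewrite pnatr_eq0 -lt0n prime_gt0.
have q2d : ~~ (q %| 2 * d)%N by rewrite Euclid_dvdM // negb_or qd dvdn_prime2 // gtn_eqF.
have inc z : I z -> I' (b%:R * lam / q%:R * z).
  move=> Iz; have -> : b%:R * lam / q%:R * z = (b%:R * lam * z) / q%:R by ring.
  apply: (ci_dvd d0 sf cI' qp q2d); first exact: lam_incl.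
  have x0 := ci_x0 cI; have x0' := ci_x0 cI'.
  have -> : (b%:R * lam * z) ^+ 3 / x' / q%:R = (theta / q%:R) * (z * z * z / x).
    by rewrite /theta; field; rewrite x0 x0' q0.
  by apply: OM => //; exact: (ci_cube cI).
have Kq : K (b%:R * lam / q%:R).
  by apply: (qf_div d0); [apply: qfM => //|]; apply: qf_rat; rewrite rpred_nat.
have [k kE] := norm_incl (ci_is_norm cI) (ci_is_norm cI') (om_Crat d0 mI) (om_Crat d0 mI') g0 g0' Kq inc.
have gn : g != 0 by rewrite gt_eqF. have gn' : g' != 0 by rewrite gt_eqF.
have E : (b * b' = k * q ^ 2)%N.
  apply/eqP; rewrite -(eqr_nat algC) natrM (natrM _ k) natrX; apply/eqP; apply: (mulIf gn').
  have nl : nm lam = b'%:R * g' / (b%:R * g) by rewrite -nm_lam mulfK // mulf_neq0.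
  rewrite [RHS]mulrAC -kE nm_div nmM !nm_nat nl; by field; rewrite gn q0 b0.
have : (q ^ 2 %| b * b')%N by rewrite E dvdn_mull.
have bbc : coprime b b' by rewrite prime_coprime // dvdn_prime2.
case/orP: qb => /eqP->; rewrite -mulnn.
  by rewrite dvdn_pmul2l ?prime_gt0 // dvdn_prime2 // (negPf bb').
by rewrite dvdn_pmul2r ?prime_gt0 // dvdn_prime2 // eq_sym (negPf bb').
Qed.

Lemma collision_pair : exists Y Z : int,
  [/\ Y ^+ 2 + d%:Z * Z ^+ 2 = (4 * (b * b') ^ 3)%N%:Z & coprime (b * b') `|Z|].
Proof.
have [Y [Z [n [tE nE h]]]] := O_spec d0 sf theta_O; exists Y, Z.
have n3 : n = ((b * b') ^ 3)%N%:Z by apply: (@intr_inj algC); rewrite -nE theta_nm.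
split; first by rewrite h n3 PoszM.
have one q : prime q -> (2 < q)%N -> (q == b) || (q == b') -> ~~ (q %| `|Z|)%N.
  move=> qp q2 qb; apply/negP => qZ; apply: (theta_prim qp qb).
  apply: (O_dvd_p d0 qp q2 tE h); last by rewrite dvdzE.
  have : (q%:Z %| Y ^+ 2 + d%:Z * Z ^+ 2)%Z.
    rewrite h n3 dvdz_mull // dvdzE /=; rewrite Euclid_dvdX // andbT Euclid_dvdM // !dvdn_prime2 //.
  rewrite dvdz_addl_eq; first exact: prime_dvdzX.
  by apply: dvdz_mull; rewrite expr2; apply: dvdz_mulr; rewrite dvdzE.
by rewrite coprimeMl !prime_coprime // !one ?eqxx ?orbT.
Qed.
End Collision.
End SplitPrimes.

(** * The bound from split primes *)
From mathcomp Require Import finmap cardinality.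

Definition is_square_nat (n : nat) : bool := has (fun w => w ^ 2 == n)%N (iota 0 n.+1).

Lemma is_square_natP n w : (w ^ 2 = n)%N -> is_square_nat n.
Proof.
move=> h; apply/hasP; exists w; last by rewrite h.
by rewrite mem_iota /= add0n ltnS -h; case: (w) => // k; rewrite -mulnn leq_pmulr.
Qed.

Definition cubic_pair (d a z : nat) : bool :=
  [&& odd a, coprime a z, (0 < z)%N, (d * z ^ 2 <= 4 * a ^ 3)%N & is_square_nat (4 * a ^ 3 - d * z ^ 2)].

(** For d > 0 the range of z loses nothing: d z^2 <= 4 a^3 and a <= A give z <= 2 A^2. *)
Definition cubic_pairs (d A : nat) : seq (nat * nat) :=
  [seq az <- [seq (a, z) | a <- iota 1 A, z <- iota 1 (2 * A ^ 2)] | cubic_pair d az.1 az.2].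

Record class_family (d n : nat) (I : 'I_n -> algC -> Prop) (x g : 'I_n -> algC) : Prop := ClassFamily {
  cf_ideal : forall k, cube_ideal d (I k) (x k) (g k);
  cf_inj : forall k l lam, quad_field d lam -> lam != 0 ->
    (forall z, I k z <-> I l (lam * z)) -> k = l }.

Lemma class_family_exists d : (0 < d)%N -> squarefree d ->
  exists I x g, @class_family d (h3 d) I x g.
Proof.
move=> d0 sf; rewrite /h3; set A : classical_sets.set (classical_sets.set (classical_sets.set algC)) := (X in fset_set X).
(* For an infinite set, [fset_set] is empty by default and there is nothing to prove. *)
have mem C : C \in fset_set A -> A C.
  have [fA|nA] := pselect (finite_set A); first by rewrite in_fset_set // => /classical_sets.set_mem.
  by rewrite /fset_set; case: pselect => // _; rewrite in_fset0.
set F := fset_set A in mem *; set n := (X in 'I_X).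
pose C (k : 'I_n) := nth classical_sets.set0 (enum_fset F) k.
have CA k : A (C k) by apply: mem; rewrite -[_ \in F]/(_ \in enum_fset F) mem_nth.
have ex k : exists Ix : classical_sets.set algC * algC, C k = ideal_class (quad_field d) Ix.1 /\
    exists g, cube_ideal d Ix.1 Ix.2 g.
  have [[I fI CI] C3] := CA k.
  have IC : C k I.
    rewrite -CI; exists 1; split; [exact: qf_rat Crat1|exact: oner_neq0|].
    by rewrite /scale_set; apply/funext => z; apply/propext; split=> [Iz|[w Iw <-]]; [exists z => //; rewrite mul1r|rewrite mul1r].
  have : class_mul (class_mul (C k) (C k)) (C k) (ideal_mul (ideal_mul I I) I).
    by exists (ideal_mul I I); [exists I => //; exists I|exists I].
  rewrite C3 => -[x [Kx x0 Ix]]; exists (I, x); split=> //.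
  exact: cube_ideal_exists.
have /choice[f fE] := ex.
have /choice[g gE] := fun k => (fE k).2.
exists (fun k => (f k).1), (fun k => (f k).2), g; split=> // k l lam Kl l0 h.
have e : C k = C l.
  rewrite (fE k).1 (fE l).1; have KV := qfV d0 Kl.
  apply/funext => J; apply/propext; split=> -[y [Ky y0 ->]].
    exists (y / lam); split; [exact: (qf_div d0)|by rewrite mulf_neq0 ?invr_eq0|].
    apply/funext => z; apply/propext; split=> -[w Iw <-].
      by exists (lam * w); [exact/h|rewrite mulrA divfK].
    by exists (w / lam); [apply/h; rewrite mulrC divfK|rewrite mulrA mulrAC].
  exists (y * lam); split; [exact: qfM|by rewrite mulf_neq0|].
  apply/funext => z; apply/propext; split=> -[w Iw <-].
    by exists (w / lam); [apply/h; rewrite mulrC divfK|rewrite -mulrA [lam * _]mulrC divfK].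
  by exists (lam * w); [exact/h|rewrite mulrA].
apply/val_inj/eqP; move/eqP: e; rewrite nth_uniq ?ltn_ord // ?fset_uniq //.
Qed.

Lemma prime_pair_eq (b1 b2 c1 c2 : nat) : prime b1 -> prime c1 -> prime c2 ->
  (b1 * b2 = c1 * c2)%N -> (b1 = c1 /\ b2 = c2) \/ (b1 = c2 /\ b2 = c1).
Proof.
move=> p1 q1 q2 e; have : (b1 %| c1 * c2)%N by rewrite -e dvdn_mulr.
rewrite Euclid_dvdM // !dvdn_prime2 // => /orP[]/eqP h; [left|right]; split=> //.
  by apply/eqP; rewrite -(eqn_pmul2l (prime_gt0 q1)) -e h.
by apply/eqP; rewrite -(eqn_pmul2l (prime_gt0 q2)) -{1}h e mulnC.
Qed.

Section SplitBound.
Variable d : nat.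
Hypotheses (d0 : (0 < d)%N) (sf : squarefree d).
Variables (n : nat) (I : 'I_n -> algC -> Prop) (x g : 'I_n -> algC).
Hypothesis cf : class_family d I x g.
Variables (B : seq nat) (A S : nat).
Hypotheses (uB : uniq B) (hB : forall b, b \in B ->
  [/\ prime b, (2 < b)%N, ~~ (b %| d)%N & exists r : nat, (b %| r ^ 2 + d)%N]).
Hypothesis hA : forall b b', b \in B -> b' \in B -> (b * b' <= A)%N.
Hypothesis hS : forall c, (3 * c ^ 2 <= 4 * d)%N -> (c <= S)%N.

(** If b^2 divides r^2 + d, passing to r + b changes it by 2 r b modulo b^2, and 2 r is prime to
    b. *)
Lemma simple_root b : b \in B -> exists r : nat, (b %| r ^ 2 + d)%N /\ ~~ (b ^ 2 %| r ^ 2 + d)%N.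
Proof.
move=> /hB[bp b2 bd [r br]]; have [h|h] := boolP (b ^ 2 %| r ^ 2 + d)%N; last by exists r.
exists (r + b)%N; have e : ((r + b) ^ 2 + d = (r ^ 2 + d) + b * (2 * r + b))%N by rewrite sqrnD -mulnn; lia.
split; first by rewrite e dvdn_addr // dvdn_mulr.
rewrite e dvdn_addr // -mulnn dvdn_pmul2l ?prime_gt0 // dvdn_addl // Euclid_dvdM // negb_or dvdn_prime2 //.
rewrite gtn_eqF //=; apply: contra bd => brr.
by rewrite -(dvdn_addr d (dvdn_exp (isT : 0 < 2)%N brr)).
Qed.

Definition reduced_forms : seq (nat * nat) :=
  [seq (c, m) | c <- iota 1 S, m <- [seq m <- iota 0 c | (c%:Z %| m%:Z ^+ 2 - (- d%:Z))%Z]].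

Lemma size_reduced_forms : size reduced_forms = (\sum_(1 <= c < S.+1) nroots (- d%:Z) c)%N.
Proof.
rewrite size_allpairs_dep sumnE big_map /index_iota subSS subn0.
by apply: eq_bigr => c _; rewrite size_filter.
Qed.

(** Cauchy-Schwarz for the map from pairs (class, prime) to reduced forms. Collisions with the same
    prime are trivial; the others yield cubic pairs with a = b b', at most 2 E for each first
    class. *)
Lemma split_bound : (n * size B ^ 2 <=
  (\sum_(1 <= c < S.+1) nroots (- d%:Z) c) * (size B + 2 * size (cubic_pairs d A)))%N.
Proof.
rewrite -size_reduced_forms; set M := size B; set E := size (cubic_pairs d A).
have [n0|n0] := posnP n; first by rewrite n0 mul0n.
pose b (i : 'I_M) := nth 0%N B i.
have bB i : b i \in B by exact: mem_nth.
have /choice[r rE] : forall i, exists r : nat, (b i %| r ^ 2 + d)%N /\ ~~ (b i ^ 2 %| r ^ 2 + d)%N.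
  by move=> i; apply: simple_root.
pose X := ('I_n * 'I_M)%type.
pose J (u : X) := split_part d (I u.1) (b u.2) (r u.2).
have ex (u : X) : exists t : algC * (nat * nat), [/\ quad_field d t.1, t.1 != 0, t.2 \in reduced_forms &
    forall z, J u z <-> exists i j : int, z = t.1 * (i%:~R + j%:~R * tau_of d t.2.1 t.2.2)].
  have [bp _ _ _] := hB (bB u.2).
  have [xi [c [m [Kx x0 red h]]]] := omodule_reduced d0 (split_part_om (r u.2) (cf_ideal cf u.1) bp).
  exists (xi, (c, m)); split=> //=; have /and4P[c0 c3 cm mc] := red.
  apply/allpairsPdep; exists c, m; split=> //; first by rewrite mem_iota c0 /= add1n ltnS hS.
  rewrite mem_filter mem_iota /= add0n mc andbT opprK -PoszX -PoszD; exact: cm.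
have /choice[f fE] := ex.
have idx (u : X) : (index (f u).2 reduced_forms < size reduced_forms)%N by rewrite index_mem; case: (fE u).
pose F (u : X) : 'I_(size reduced_forms) := Ordinal (idx u).
have Feq u v : F u = F v -> (f u).2 = (f v).2.
  move=> /(congr1 val) /= e; have [_ _ h _] := fE u; have [_ _ h' _] := fE v.
  by rewrite -[LHS](nth_index (0, 0)%N h) e nth_index.
have coll u v : F u = F v -> exists lam, [/\ quad_field d lam, lam != 0 & forall z, J u z <-> J v (lam * z)].
  move=> /Feq e; have [Ku u0 _ hu] := fE u; have [Kv v0 _ hv] := fE v.
  exists ((f v).1 / (f u).1); split; [exact: (qf_div d0)|by rewrite mulf_neq0 ?invr_eq0|].
  move=> z; rewrite hu hv e; split=> -[i [j zE]]; exists i, j.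
    by rewrite zE mulrA divfK.
  have e1 : (f v).1 / (f u).1 != 0 by rewrite mulf_neq0 ?invr_eq0.
  by apply: (mulfI e1); rewrite zE [RHS]mulrA divfK.
have same_i u v : F u = F v -> u.2 = v.2 -> u = v.
  move=> /coll[lam [Kl l0 h]] e; have [bp b2 bd _] := hB (bB u.2); have [br br2] := rE u.2.
  rewrite [u]surjective_pairing [v]surjective_pairing -e; congr (_, _).
  apply: (cf_inj cf Kl l0); rewrite /J -e in h.
  exact: (split_part_inj (cf_ideal cf u.1) (cf_ideal cf v.1) bp b2 bd br l0 h).
have ez (w : X * X) : exists z : nat, F w.1 = F w.2 -> w.1.2 != w.2.2 -> (b w.1.2 * b w.2.2, z)%N \in cubic_pairs d A.
  have [Fw|nF] := pselect (F w.1 = F w.2); last by exists 0%N.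
  have [ii|ii] := eqVneq w.1.2 w.2.2; first by exists 0%N.
  have [lam [Kl l0 h]] := coll _ _ Fw.
  have [bp b2 bd _] := hB (bB w.1.2); have [br br2] := rE w.1.2.
  have [bp' b2' bd' _] := hB (bB w.2.2); have [br' br2'] := rE w.2.2.
  have bb : b w.1.2 != b w.2.2 by rewrite nth_uniq ?ltn_ord.
  have [Y [Z [YZ cop]]] : exists Y Z : int,
     [/\ Y ^+ 2 + d%:Z * Z ^+ 2 = (4 * (b w.1.2 * b w.2.2) ^ 3)%N%:Z & coprime (b w.1.2 * b w.2.2) `|Z|].
    by apply: (collision_pair d0 sf (cf_ideal cf w.1.1) (cf_ideal cf w.2.1) bp b2 bd br br2 bp' b2' bd' br' br2' bb Kl l0 h).
  exists `|Z|%N => _ _; set a := (b w.1.2 * b w.2.2)%N in YZ cop *.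
  have YZn : (`|Y| ^ 2 + d * `|Z| ^ 2 = 4 * a ^ 3)%N.
    apply/eqP; rewrite -eqz_nat -YZ PoszD PoszM !PoszX !abszE !real_normK ?num_real //.
  have a1 : (1 < a)%N by rewrite /a (leq_trans (prime_gt1 bp)) // leq_pmulr // prime_gt0.
  have Z0 : (0 < `|Z|)%N.
    by rewrite lt0n; apply: contraTneq cop => ->; rewrite /coprime gcdn0 gtn_eqF.
  have aA : (a <= A)%N by exact: hA.
  have oa : odd a.
    have odd_b c : prime c -> (2 < c)%N -> odd c by move=> cp; case: (even_prime cp) => [->|].
    by rewrite oddM !odd_b.
  have le : (d * `|Z| ^ 2 <= 4 * a ^ 3)%N by rewrite -YZn leq_addl.
  rewrite mem_filter; apply/andP; split.
    by rewrite /cubic_pair /= oa cop Z0 le -YZn addnK /=; apply: is_square_natP.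
  apply/allpairsP; exists (a, `|Z|%N); split=> //=; first by rewrite mem_iota (ltnW a1) add1n ltnS.
  rewrite mem_iota Z0 add1n ltnS -(@leq_exp2r _ _ 2) //.
  have h1 : (`|Z| ^ 2 <= 4 * a ^ 3)%N by apply: leq_trans le; rewrite leq_pmull.
  apply: leq_trans h1 _; rewrite expnMn -expnM leq_mul2l /=.
  apply: (@leq_trans (A ^ 3)); first by rewrite leq_exp2r.
  by rewrite leq_pexp2l // (leq_trans _ aA) // ltnW.
have /choice[zf zfE] := ez.
have card_coll : (#|[set w : X * X | F w.1 == F w.2]| <= n * M + n * (2 * E))%N.
  pose D : {set X * X} := [set (u, u) | u : X].
  pose W := [set w : X * X | (F w.1 == F w.2) && (w.1.2 != w.2.2)].
  apply: (@leq_trans #|D :|: W|).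
    apply: subset_leq_card; apply/fintype.subsetP => -[u v]; rewrite !inE /= => Fuv; rewrite Fuv /=.
    have [e|] := eqVneq u.2 v.2; last by rewrite orbT.
    by rewrite orbF (same_i _ _ (eqP Fuv) e); apply/imsetP; exists v.
  apply: leq_trans (leq_card_setU _ _) _; apply: leq_add.
    apply: leq_trans (leq_imset_card _ _) _; by rewrite card_prod !card_ord.
  (* The product b b' determines the primes up to order, the boolean their order, and the first
     class then determines the second. *)
  pose G (w : X * X) := ((w.1.1, (w.1.2 < w.2.2)%N), ((b w.1.2 * b w.2.2)%N, zf w)).
  pose T := [seq (kb, az) | kb <- [seq (k, t) | k <- enum 'I_n, t <- [:: true; false]], az <- cubic_pairs d A].
  have sT : size T = (n * (2 * E))%N by rewrite !size_allpairs size_enum_ord /= mulnA.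
  rewrite -sT cardE -(size_map G); apply: uniq_leq_size; last first.
    move=> y /mapP[w]; rewrite mem_enum inE => /andP[/eqP Fw ii] yE; rewrite yE {y yE}.
    apply/allpairsP; exists ((w.1.1, (w.1.2 < w.2.2)%N), ((b w.1.2 * b w.2.2)%N, zf w)); split=> //=; last exact: zfE.
    by apply/flatten_mapP; exists w.1.1; rewrite ?mem_enum // !inE !xpair_eqE eqxx; case: (_ < _)%N.
  rewrite map_inj_in_uniq ?enum_uniq // => -[[k i] [k' i']] [[l j] [l' j']]; rewrite !mem_enum !inE /=.
  move=> /andP[/eqP F1 ii] /andP[/eqP F2 jj] [kl lt_eq bb _].
  have [p1 _ _ _] := hB (bB i); have [q1 _ _ _] := hB (bB j); have [q2 _ _ _] := hB (bB j').
  have binj i1 i2 : b i1 = b i2 -> i1 = i2.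
    by move=> /eqP; rewrite nth_uniq ?ltn_ord // => /eqP/val_inj.
  have [e1 e2] : i = j /\ i' = j'.
    have [[/binj-> /binj->]|[/binj e1 /binj e2]] := prime_pair_eq p1 q1 q2 bb; first by [].
    move: lt_eq ii; rewrite e1 e2 -val_eqE /=; case: (ltngtP j' j) => //.
  move: F1 F2; rewrite -kl -e1 -e2 => F1 F2; congr (_, _).
  by apply: same_i => //; rewrite -F1 -F2.
have := pairs_pigeonhole F; rewrite card_ord => /leq_trans/(_ (leq_mul (leqnn _) card_coll)).
rewrite card_prod !card_ord -mulnDr [(_ * (n * _))%N]mulnCA expnMn -mulnn -mulnA leq_pmul2l //.
Qed.
End SplitBound.

(** * The bound from inert primes *)

Lemma lin_congr_solve (p : nat) (a b : int) : prime p -> ~~ (p%:Z %| a)%Z ->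
  exists t : int, (p%:Z %| a * t - b)%Z.
Proof.
move=> pp pa; have /coprimezP[[u v] /= uv] : coprimez a p.
  by rewrite coprimez_sym coprimezE /= prime_coprime // -dvdzE.
exists (u * b); have -> : a * (u * b) - b = - (v * b) * p%:Z.
  by rewrite -[b in - b]mul1r -uv; ring.
exact: dvdz_mull.
Qed.

(** M is built up prime by prime: Hensel's lemma when p already divides the part treated, the
    Chinese remainder theorem otherwise. *)
Lemma sqrt_mod (D : int) M : (0 < M)%N ->
  (forall p, prime p -> (p %| M)%N -> [/\ (2 < p)%N, ~~ (p%:Z %| D)%Z & exists t : int, (p%:Z %| t ^+ 2 - D)%Z]) ->
  exists r : int, (M%:Z %| r ^+ 2 - D)%Z.
Proof.
elim/ltn_ind: M => M IH M0 h; have [M1|M1] := leqP M 1.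
  by exists 0; rewrite (_ : M = 1)%N ?dvd1z //; lia.
have pp := pdiv_prime M1; set p := pdiv M in pp; have pM : (p %| M)%N := pdiv_dvd M.
have [p2 pD [t0 t0E]] := h p pp pM.
pose N := (M %/ p)%N; have ME : (M = N * p)%N by rewrite divnK.
have N0 : (0 < N)%N by move: M0; rewrite ME muln_gt0 => /andP[].
have [|//|r rE] := IH N _ N0; first by rewrite ltn_Pdiv // prime_gt1.
  by move=> q qp qN; apply: h; rewrite // ME dvdn_mulr.
have [e eE] := dvdzP rE.
have main (t : int) : (r + N%:Z * t) ^+ 2 - D = N%:Z * (e + 2 * r * t + N%:Z * t ^+ 2).
  have -> : (r + N%:Z * t) ^+ 2 - D = (r ^+ 2 - D) + N%:Z * (2 * r * t + N%:Z * t ^+ 2) by ring.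
  by rewrite eE; ring.
have [pN|pN] := boolP (p %| N)%N.
  have p2r : ~~ (p%:Z %| 2 * r)%Z.
    rewrite prime_dvdzM // prime_dvdz2 // gtn_eqF //=; apply: contra pD => pr.
    have pe : (p%:Z %| r ^+ 2 - D)%Z by apply: dvdz_trans rE; rewrite dvdzE.
    have -> : D = r ^+ 2 - (r ^+ 2 - D) by ring.
    by apply: rpredB => //; apply: dvdz_exp2.
  have [t tE] := lin_congr_solve (- e) pp p2r; rewrite opprK in tE.
  exists (r + N%:Z * t); rewrite main ME PoszM; apply: dvdz_mul => //.
  by apply: rpredD; [rewrite addrC|apply: dvdz_mulr; rewrite dvdzE].
have pNz : ~~ (p%:Z %| N%:Z)%Z by rewrite dvdzE.
have [t tE] := lin_congr_solve (t0 - r) pp pNz.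
exists (r + N%:Z * t); rewrite ME PoszM Gauss_dvdz; last by rewrite coprimezE /= coprime_sym prime_coprime.
apply/andP; split; first by rewrite main dvdz_mulr.
have -> : (r + N%:Z * t) ^+ 2 - D = (t0 ^+ 2 - D) + (N%:Z * t - (t0 - r)) * (r + N%:Z * t + t0) by ring.
by apply: rpredD => //; apply: dvdz_mulr.
Qed.

Lemma rsymM q (C D C' D' : int) : prime q -> q != 3%N ->
  ~~ (q%:Z %| C ^+ 2 + 3 * D ^+ 2)%Z -> ~~ (q%:Z %| C' ^+ 2 + 3 * D' ^+ 2)%Z ->
  rsym q (C * C' - 3 * D * D') (C * D' + D * C') = rsym q C D + rsym q C' D'.
Proof.
move=> qp q3 h h'; have NE (u v : int) : enorm (u + v) (2 * v) = u ^+ 2 + 3 * v ^+ 2 by rewrite /enorm; ring.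
rewrite /rsym -symM ?NE //; congr sym; ring.
Qed.

Lemma cube_coords (D u v Y Z : int) (s : algC) : s ^+ 2 = - D%:~R ->
  (u%:~R + v%:~R * s) ^+ 3 * (Y%:~R + Z%:~R * s) =
  (Y * (u ^+ 3 - 3 * D * u * v ^+ 2) - D * Z * (3 * u ^+ 2 * v - D * v ^+ 3))%:~R +
  (Y * (3 * u ^+ 2 * v - D * v ^+ 3) + Z * (u ^+ 3 - 3 * D * u * v ^+ 2))%:~R * s.
Proof.
move=> s2; have Ds : D%:~R = - s ^+ 2 by rewrite s2 opprK.
by rewrite !(rmorphD, rmorphB, rmorphN, rmorphM) /= Ds; ring.
Qed.

Lemma coprime6_gt0 (a d : nat) : (0 < d)%N -> coprime a (6 * d) -> (0 < a)%N.
Proof.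
move=> d0; rewrite lt0n; apply: contraTneq => ->; rewrite /coprime gcd0n; lia.
Qed.

Section Alpha.
Variable d : nat.
Hypotheses (d0 : (0 < d)%N) (sf : squarefree d).
Notation K := (quad_field d).
Notation O := (ring_of_integers K).
Notation s := (qs d).

Section One.
Variables (I : algC -> Prop) (x g : algC).
Hypothesis cI : cube_ideal d I x g.
Let mI := ci_om cI.

(** For p not dividing N, an element z with norm prime to N and an element w with norm prime to p
    combine to p z + N w, good for both. *)
Lemma ideal_coprime_norm M : (0 < M)%N ->
  exists2 z, I z & exists2 n : nat, nm z = n%:R * g & coprime n M.
Proof.
elim/ltn_ind: M => M IH M0; have [M1|M1] := leqP M 1.
  have [z Iz _] := om_neq0 mI; have [n nE] := om_nm mI Iz; exists z => //; exists n => //.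
  by rewrite (_ : M = 1)%N ?coprimen1 //; lia.
have pp := pdiv_prime M1; set p := pdiv M in pp; have pM : (p %| M)%N := pdiv_dvd M.
pose N := (M %/ p)%N; have ME : (M = N * p)%N by rewrite divnK.
have N0 : (0 < N)%N by move: M0; rewrite ME muln_gt0 => /andP[].
have [|z Iz [n nE cnN]] := IH N _ N0; first by rewrite ltn_Pdiv // prime_gt1.
have [pN|pN] := boolP (p %| N)%N.
  by exists z => //; exists n => //; rewrite ME coprimeMr cnN (coprime_dvdr pN).
have [w Iw [k kE pk]] := ci_p cI pp; have [m mE] := om_nm mI (om_D mI Iz Iw).
have Iv : I (p%:R * z + N%:R * w) by apply: (om_D mI); apply: (om_M mI) => //; exact: O_nat.
have [l lE] := om_nm mI Iv; exists (p%:R * z + N%:R * w) => //; exists l => //.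
have gn : g != 0 by rewrite gt_eqF // (om_g mI).
have E : l%:Z = p%:Z ^+ 2 * n%:Z + p%:Z * N%:Z * (m%:Z - n%:Z - k%:Z) + N%:Z ^+ 2 * k%:Z.
  apply: (@intr_inj algC); apply: (mulIf gn); rewrite -[l%:Z%:~R]/(l%:R) -lE.
  have -> : nm (p%:R * z + N%:R * w) = p%:R ^+ 2 * nm z + p%:R * N%:R * (nm (z + w) - nm z - nm w) + N%:R ^+ 2 * nm w.
    by rewrite /nm !rmorphD !rmorphM /= !conjC_nat; ring.
  rewrite nE kE mE 2!intrD intrM (intrM _ (p%:Z * N%:Z)) (intrM _ (N%:Z ^+ 2)) intrM !rmorphB !rmorphXn /=.
  by rewrite -[p%:Z%:~R]/(p%:R) -[N%:Z%:~R]/(N%:R) -[m%:Z%:~R]/(m%:R) -[n%:Z%:~R]/(n%:R) -[k%:Z%:~R]/(k%:R); ring.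
have cl : coprimez l M.
  apply: coprimez_prime => q qp ql qM; have [qp'|qp'] := eqVneq q p.
    move: ql; rewrite E qp' addrC dvdz_addl_eq.
      rewrite prime_dvdzM // => /orP[/(prime_dvdzX pp)|]; rewrite dvdzE ?(negPf pN) //=.
      by rewrite (negPf pk).
    rewrite expr2 -!mulrA -mulrDr; exact: dvdz_mulr.
  have qpn : (q %| p)%N = false by rewrite dvdn_prime2 // (negPf qp').
  have qN : (q %| N)%N by move: qM; rewrite dvdzE /= ME Euclid_dvdM // qpn orbF.
  move: ql; rewrite E -addrA dvdz_addl_eq; last first.
    by apply: rpredD; [apply: dvdz_mulr; apply: dvdz_mull|apply: dvdz_mulr; rewrite expr2; apply: dvdz_mulr]; rewrite dvdzE.
  rewrite prime_dvdzM // => /orP[/(prime_dvdzX qp)|]; rewrite dvdzE ?qpn //= => qn.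
  by have := coprime_dvdl qn cnN; rewrite prime_coprime // qN.
by [].
Qed.

(** alpha = xi^3 / x is an integer of norm a^3 because I^3 = x O, and Y, Z are the coordinates of 2
    alpha. Another xi changes alpha by a cube only, which gives the freedom to normalise. *)
Definition alpha_data (xi : algC) (a : nat) (Y Z : int) : Prop :=
  [/\ I xi, nm xi = a%:R * g, 2%:R * (xi ^+ 3 / x) = Y%:~R + Z%:~R * s,
    Y ^+ 2 + d%:Z * Z ^+ 2 = (4 * a ^ 3)%N%:Z & coprime a (6 * d)].

Lemma alpha_data_intro xi a : I xi -> nm xi = a%:R * g -> coprime a (6 * d) ->
  exists Y Z, alpha_data xi a Y Z.
Proof.
move=> Ixi xiE ca; have [Y [Z [n [tE nE h]]]] := O_spec d0 sf (ci_cube cI Ixi Ixi Ixi).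
exists Y, Z; split=> //; first by rewrite -tE; ring.
rewrite h PoszM; congr (_ * _); apply: (@intr_inj algC); rewrite -nE nm_div !nmM (ci_nmx cI) xiE.
have gn : g != 0 by rewrite gt_eqF // (om_g mI).
by rewrite -[((a ^ 3)%N%:Z)%:~R]/((a ^ 3)%N%:R) natrX; field.
Qed.

Lemma alpha_mul xi a Y Z (u v : int) (m : nat) : alpha_data xi a Y Z ->
  u ^+ 2 + d%:Z * v ^+ 2 = m%:Z -> coprime m (6 * d) ->
  exists Y' Z', [/\ alpha_data ((u%:~R + v%:~R * s) * xi) (m * a) Y' Z',
    Y' = Y * (u ^+ 3 - 3 * d%:Z * u * v ^+ 2) - d%:Z * Z * (3 * u ^+ 2 * v - d%:Z * v ^+ 3) &
    Z' = Y * (3 * u ^+ 2 * v - d%:Z * v ^+ 3) + Z * (u ^+ 3 - 3 * d%:Z * u * v ^+ 2)].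
Proof.
move=> [Ixi xiE tE h ca] uvE cm; have Ouv : O (u%:~R + v%:~R * s).
  by apply: OD; [exact: O_int|apply: OM; [exact: O_int|exact: O_qs]].
do 2!eexists; split; [|reflexivity|reflexivity]; split.
- exact: (om_M mI).
- rewrite nmM xiE nm_qf ?Crat_int // natrM mulrA; congr (_ * _ * _).
  by rewrite -[m%:R]/(m%:Z%:~R) -uvE intr_form.
- have -> : 2%:R * (((u%:~R + v%:~R * s) * xi) ^+ 3 / x) = (u%:~R + v%:~R * s) ^+ 3 * (2%:R * (xi ^+ 3 / x)) by ring.
  by rewrite tE; apply: cube_coords; rewrite qs_sq.
- transitivity ((u ^+ 2 + d%:Z * v ^+ 2) ^+ 3 * (Y ^+ 2 + d%:Z * Z ^+ 2)); first by ring.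
  rewrite uvE h; have -> : (4 * (m * a) ^ 3)%N%:Z = 4 * (m%:Z * a%:Z) ^+ 3 by rewrite PoszM PoszX PoszM.
  have -> : (4 * a ^ 3)%N%:Z = 4 * a%:Z ^+ 3 by rewrite PoszM PoszX.
  by ring.
- by rewrite coprimeMl cm.
Qed.

Lemma coprime_shift (m n k : nat) : coprime m n -> coprime (m + k * n) n.
Proof. by move=> h; rewrite /coprime addnC gcdnC gcdnMDl gcdnC. Qed.

Lemma alpha_exists : exists xi a Y Z, [/\ alpha_data xi a Y Z, ~~ (3 %| Y)%Z & ~~ (27 %| Z)%Z].
Proof.
have M0 : (0 < 6 * d)%N by rewrite muln_gt0.
have [xi0 Ixi0 [a0 xi0E ca0]] := ideal_coprime_norm M0.
have [Y0 [Z0 A0]] := alpha_data_intro Ixi0 xi0E ca0.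
have P3 (u v : int) : (3 %| u * v)%Z = (3 %| u)%Z || (3 %| v)%Z := @prime_dvdzM 3 isT u v.
have step1 : exists xi a Y Z, alpha_data xi a Y Z /\ ~~ (3 %| Y)%Z.
  have [h3|h3] := boolP (3 %| Y0)%Z; last by exists xi0, a0, Y0, Z0.
  have [_ _ _ hYZ _] := A0.
  have dZ : ~~ (3 %| d%:Z * Z0 ^+ 2)%Z.
    apply: contraL ca0 => hd; have : (3 %| (4 * a0 ^ 3)%N%:Z)%Z.
      by rewrite -hYZ; apply: rpredD => //; apply: dvdz_exp2.
    move=> h3'; have : (3 %| 4 * a0 ^ 3)%N by exact: h3'.
    rewrite (Euclid_dvdM 4 (a0 ^ 3) (isT : prime 3)) /= Euclid_dvdX // => /andP[a3 _].
    apply/negP => c; have := coprime_dvdr (dvdn_mulr d (isT : 3 %| 6)%N) c.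
    by move/(coprime_dvdl a3).
  have [hd hZ] : ~~ (3 %| d%:Z)%Z /\ ~~ (3 %| Z0)%Z.
    by move: dZ; rewrite P3 expr2 P3 !negb_or => /andP[-> /andP[->]].
  have hd' : ~~ (3 %| d)%N by exact: hd.
  (* xi is multiplied by 3 + 2 s, of norm 9 + 4 d. The new Y is 8 d^2 Z modulo 3, nonzero because 3
     divides Y but not a. *)
  have cm : coprime (9 + 4 * d) (6 * d).
    rewrite coprimeMr; apply/andP; split.
      rewrite -[6%N]/(2 * 3)%N coprimeMr; apply/andP; split.
        by rewrite coprimen2 oddD oddM.
      rewrite coprime_sym prime_coprime // dvdn_addr // (Euclid_dvdM 4 d (isT : prime 3)) /=.
      exact: hd'.
    apply: coprime_shift; rewrite -[9%N]/(3 ^ 2)%N; apply: coprimeXl.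
    by rewrite prime_coprime.
  have uv : (3 : int) ^+ 2 + d%:Z * 2 ^+ 2 = (9 + 4 * d)%N%:Z by rewrite PoszD PoszM; ring.
  have [Y [Z [A1 YE ZE]]] := alpha_mul A0 uv cm; do 4!eexists; split; first exact: A1.
  rewrite YE; have -> : Y0 * (3 ^+ 3 - 3 * d%:Z * 3 * 2 ^+ 2) - d%:Z * Z0 * (3 * 3 ^+ 2 * 2 - d%:Z * 2 ^+ 3)
     = d%:Z * d%:Z * Z0 * 8 + 3 * (Y0 * (9 - 12 * d%:Z) - d%:Z * Z0 * 18) by ring.
  rewrite dvdz_addl_eq; last exact: dvdz_mulr.
  by rewrite !P3 !negb_or hd hZ.
have [xi1 [a1 [Y1 [Z1 [A1 h1]]]]] := step1.
have [h27|h27] := boolP (27 %| Z1)%Z; last by exists xi1, a1, Y1, Z1.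
(* xi is multiplied by 1 + 6 s, which keeps Y modulo 3 and makes Z congruent to 18 Y modulo 27. *)
have uv : (1 : int) ^+ 2 + d%:Z * 6 ^+ 2 = (1 + 6 * (6 * d))%N%:Z by rewrite PoszD !PoszM; ring.
have cm : coprime (1 + 6 * (6 * d)) (6 * d) by apply: coprime_shift; rewrite coprime1n.
have [Y [Z [A2 YE ZE]]] := alpha_mul A1 uv cm; do 4!eexists; split; first exact: A2.
  rewrite YE; have -> : Y1 * (1 ^+ 3 - 3 * d%:Z * 1 * 6 ^+ 2) - d%:Z * Z1 * (3 * 1 ^+ 2 * 6 - d%:Z * 6 ^+ 3)
     = Y1 + 3 * (- (Y1 * d%:Z * 36) - d%:Z * Z1 * (6 - 72 * d%:Z)) by ring.
  by rewrite dvdz_addl_eq //; apply: dvdz_mulr.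
rewrite ZE; have -> : Y1 * (3 * 1 ^+ 2 * 6 - d%:Z * 6 ^+ 3) + Z1 * (1 ^+ 3 - 3 * d%:Z * 1 * 6 ^+ 2)
   = 9 * (2 * Y1) + (27 * (- 8 * Y1 * d%:Z) + Z1 * (1 - 108 * d%:Z)) by ring.
rewrite dvdz_addl_eq; last by apply: rpredD; [apply: dvdz_mulr|apply: dvdz_mulr].
have -> : (27 : int) = 9 * 3 by [].
rewrite dvdz_mul2l //= P3 negb_or h1 andbT //.
Qed.

(* Among the admissible xi one of minimal norm has coprime coordinates. *)
Lemma alpha_primitive : exists xi a Y Z, [/\ alpha_data xi a Y Z, ~~ (3 %| Y)%Z, ~~ (27 %| Z)%Z &
  forall p : nat, prime p -> (2 < p)%N -> (p%:Z %| Y)%Z -> (p%:Z %| Z)%Z -> False].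
Proof.
pose P (a : nat) := `[< exists xi Y Z, [/\ alpha_data xi a Y Z, ~~ (3 %| Y)%Z & ~~ (27 %| Z)%Z] >].
have P1 : exists a, P a.
  by have [xi [a [Y [Z h]]]] := alpha_exists; exists a; apply/asboolP; exists xi, Y, Z.
have [a /asboolP[xi [Y [Z [A h3 h27]]]] amin] := ex_minnP P1; exists xi, a, Y, Z; split=> // p pp p2 pY pZ.
have [Ixi xiE tE h ca] := A; have p0 : p%:R != 0 :> algC by rewrite pnatr_eq0 -lt0n prime_gt0.
have pa : (p %| a)%N.
  have : (p%:Z %| (4 * a ^ 3)%N%:Z)%Z.
    by rewrite -h; apply: rpredD; [apply: dvdz_exp2|apply: dvdz_mull; apply: dvdz_exp2].
  have : (p %| (2 ^ 2) * a ^ 3)%N -> (p %| a)%N.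
    by rewrite (Euclid_dvdM (2 ^ 2) _ pp) !(Euclid_dvdX _ _ pp) dvdn_prime2 // gtn_eqF //= => /andP[].
  by apply.
have p6d : ~~ (p %| 6 * d)%N by have := coprime_dvdl pa ca; rewrite prime_coprime.
have p2d : ~~ (p %| 2 * d)%N by apply: contra p6d => h2; rewrite -[6%N]/(3 * 2)%N -mulnA dvdn_mull.
have pn3 : p != 3%N by apply: contra p6d => /eqP->; rewrite dvdn_mulr.
have Iw : I (xi / p%:R).
  apply: (ci_dvd d0 sf cI pp p2d Ixi); apply: (O_dvd_p (n := (a ^ 3)%N) d0 pp p2 tE) => //.
have [b bE] := om_nm mI Iw.
have abE : (a = p ^ 2 * b)%N.
  have gn : g != 0 by rewrite gt_eqF // (om_g mI).
  apply/eqP; rewrite -(eqr_nat algC) natrM natrX; apply/eqP; apply: (mulIf gn).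
  by rewrite -xiE -mulrA -bE nm_div nm_nat mulrCA divff ?mulr1 // expf_neq0.
have cb : coprime b (6 * d) by move: ca; rewrite abE coprimeMl => /andP[].
have [Y' [Z' A']] := alpha_data_intro Iw bE cb; have [_ _ tE' _ _] := A'.
have [YE ZE] : Y = p%:Z ^+ 3 * Y' /\ Z = p%:Z ^+ 3 * Z'.
  have e (z : int) : (p%:Z ^+ 3 * z)%:~R = p%:R ^+ 3 * z%:~R :> algC by rewrite intrM rmorphXn.
  apply: (O_spec_unique d0); rewrite -tE 2!e -mulrA -mulrDr -tE'.
  by field; rewrite p0 (ci_x0 cI).
have : P b.
  apply/asboolP; exists (xi / p%:R), Y', Z'; split=> //.
    by apply: contra h3; rewrite YE; apply: dvdz_mull.
  by apply: contra h27; rewrite ZE; apply: dvdz_mull.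
have a0 := coprime6_gt0 d0 ca.
move/amin; rewrite {1}abE leqNgt ltn_Pmull //; first by rewrite -(exp1n 2) ltn_exp2r // prime_gt1.
by move: a0; rewrite abE muln_gt0 => /andP[].
Qed.
End One.

(* The norm of Z r + Y sqrt(-3) is 12 a^3 modulo p. *)
Lemma eis_norm_ndvd (p : nat) (Y Z r : int) (a : nat) : prime p -> ~~ (p %| 6 * d)%N -> ~~ (p %| a)%N ->
  (p%:Z %| r ^+ 2 - (3 * d)%N%:Z)%Z -> Y ^+ 2 + d%:Z * Z ^+ 2 = (4 * a ^ 3)%N%:Z ->
  ~~ (p%:Z %| (Z * r) ^+ 2 + 3 * Y ^+ 2)%Z.
Proof.
move=> pp p6 pa hr h; have -> : (Z * r) ^+ 2 + 3 * Y ^+ 2 = (3 * (4 * a ^ 3))%N%:Z + Z ^+ 2 * (r ^+ 2 - (3 * d)%N%:Z).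
  by rewrite PoszM -h PoszM; ring.
rewrite dvdz_addl_eq; last exact: dvdz_mull.
have p6' : ~~ (p %| 6)%N by apply: contra p6; apply: dvdn_mulr.
have : ~~ (p %| 6 * (2 * a ^ 3))%N.
  rewrite (Euclid_dvdM _ _ pp) (Euclid_dvdM 2 _ pp) (Euclid_dvdX _ _ pp) !negb_or p6' (negPf pa) andbT /=.
  by apply: contra p6' => /dvdn_trans; apply.
by apply: contra; rewrite dvdzE /= => h12; rewrite (_ : 6 * (2 * a ^ 3) = 3 * (4 * a ^ 3))%N; [exact: h12|ring].
Qed.

(** * Cubic symbols separate two classes *)

Section Two.
Variables (n : nat) (I : 'I_n -> algC -> Prop) (x g : 'I_n -> algC).
Hypothesis cf : class_family d I x g.
Variables (k l : 'I_n) (xi xi' : algC) (a a' : nat) (Y Z Y' Z' : int).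
Hypotheses (A : alpha_data (I k) (x k) (g k) xi a Y Z) (A' : alpha_data (I l) (x l) (g l) xi' a' Y' Z').
Hypothesis kl : k != l.
(** c + f s is 8 alpha alpha'^2, of norm b^3. Were it a cube, alpha / alpha' would be one too, and
    the two classes would coincide. *)
Let c := Y * (Y' ^+ 2 - d%:Z * Z' ^+ 2) - 2 * d%:Z * Z * Y' * Z'.
Let f := 2 * Y * Y' * Z' + Z * (Y' ^+ 2 - d%:Z * Z' ^+ 2).
Let b : int := (4 * a * a' ^ 2)%N%:Z.

Lemma cfb : c ^+ 2 + d%:Z * f ^+ 2 = b ^+ 3.
Proof.
have [_ _ _ h _] := A; have [_ _ _ h' _] := A'.
transitivity ((Y ^+ 2 + d%:Z * Z ^+ 2) * (Y' ^+ 2 + d%:Z * Z' ^+ 2) ^+ 2); first by rewrite /c /f; ring.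
have -> : b = 4 * a%:Z * a'%:Z ^+ 2 by rewrite /b PoszM PoszM PoszX.
rewrite h h'; have E (m : nat) : (4 * m ^ 3)%N%:Z = 4 * m%:Z ^+ 3 by rewrite PoszM PoszX.
by rewrite 2!E; ring.
Qed.

Lemma cf_alpha : c%:~R + f%:~R * s = 8%:R * (xi ^+ 3 / x k) * (xi' ^+ 3 / x l) ^+ 2.
Proof.
have [_ _ t _ _] := A; have [_ _ t' _ _] := A'.
have -> : 8%:R * (xi ^+ 3 / x k) * (xi' ^+ 3 / x l) ^+ 2 = (2%:R * (xi ^+ 3 / x k)) * (2%:R * (xi' ^+ 3 / x l)) ^+ 2 by ring.
have gen (D y z y' z' : int) (t0 : algC) : t0 ^+ 2 = - D%:~R ->
    (y * (y' ^+ 2 - D * z' ^+ 2) - 2 * D * z * y' * z')%:~R + (2 * y * y' * z' + z * (y' ^+ 2 - D * z' ^+ 2))%:~R * t0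
    = (y%:~R + z%:~R * t0) * (y'%:~R + z'%:~R * t0) ^+ 2.
  move=> s2; have Ds : D%:~R = - t0 ^+ 2 by rewrite s2 opprK.
  by rewrite !(rmorphD, rmorphB, rmorphN, rmorphM) /= Ds; ring.
by rewrite t t' /c /f gen // qs_sq.
Qed.

(** From a cube root kappa, mu = 2 xi xi'^2 / (kappa x_l) satisfies mu^3 = x_k / x_l, and
    [cube_ideal_uniq] makes the two ideals proportional. *)
Lemma not_cube kappa : K kappa -> kappa ^+ 3 = c%:~R + f%:~R * s -> False.
Proof.
move=> Kk k3; have cI := cf_ideal cf k; have cI' := cf_ideal cf l.
have [Ixi xiE _ _ ca] := A; have [Ixi' xiE' _ _ ca'] := A'.
have x0 := ci_x0 cI; have x0' := ci_x0 cI'.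
have nz (J : algC -> Prop) gg z (m : nat) : omodule d J gg -> nm z = m%:R * gg -> coprime m (6 * d) -> z != 0.
  by move=> om zE cm; rewrite -nm_eq0 zE mulf_neq0 // gt_eqF ?(om_g om) // ltr0n (coprime6_gt0 d0 cm).
have xi0 := nz _ _ _ _ (ci_om cI) xiE ca; have xi0' := nz _ _ _ _ (ci_om cI') xiE' ca'.
have k0 : kappa != 0.
  apply/eqP => k0; move: k3; rewrite k0 expr0n /= cf_alpha => /esym/eqP; apply/negP.
  by rewrite !mulf_neq0 ?expf_neq0 ?mulf_neq0 ?invr_eq0 ?expf_neq0 ?pnatr_eq0.
pose mu := 2%:R * xi * xi' ^+ 2 / (kappa * x l).
have Kxi : K xi := om_K (ci_om cI) Ixi; have Kxi' : K xi' := om_K (ci_om cI') Ixi'.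
have Kmu : K mu.
  apply: (qf_div d0); last by apply: qfM => //; exact: ci_x cI'.
  apply: qfM; last exact: qfX; apply: qfM => //; apply: qf_rat; exact: rpred_nat.
have mu3 : mu ^+ 3 = x k / x l.
  have -> : mu ^+ 3 = 8%:R * xi ^+ 3 * xi' ^+ 6 / (kappa ^+ 3 * x l ^+ 3) by rewrite /mu; field; rewrite k0 x0'.
  rewrite k3 cf_alpha; field; by rewrite x0 x0' xi0 xi0'.
have mu0 : mu != 0 by rewrite !mulf_neq0 ?invr_eq0 ?mulf_neq0 ?expf_neq0 ?pnatr_eq0.
have h := cube_ideal_uniq d0 cI cI' Kmu mu3.
have e : k = l; last by move: kl; rewrite e eqxx.
apply: (cf_inj cf (qfV d0 Kmu)); first by rewrite invr_eq0.
by move=> z; rewrite h mulrC.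
Qed.

Lemma cf_nondegenerate (R : realType) B : exists p (r : int),
  [/\ prime p, (B < p)%N, (p%:Z %| r ^+ 2 - (3 * d)%N%:Z)%Z & rsym p (f * r) c != 0].
Proof.
have a0 : (0 < a)%N by have [_ _ _ _ ca] := A; exact: coprime6_gt0 ca.
have a0' : (0 < a')%N by have [_ _ _ _ ca] := A'; exact: coprime6_gt0 ca.
have b0 : b != 0 by rewrite eqz_nat -lt0n 2!muln_gt0 a0 expn_gt0 a0'.
have bn : b%:~R != 0 :> algC by rewrite intr_eq0.
have KZ (z : int) : K z%:~R by apply: qf_rat; exact: Crat_int.
have f0 : f != 0.
  apply/eqP => f0; have h := cfb; rewrite f0 expr0n mulr0 addr0 in h.
  (* With f = 0 one has c^2 = b^3, so c is the cube of c / b. *)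
  apply: (@not_cube (c%:~R / b%:~R)); first by apply: (qf_div d0).
  have hn : c%:~R ^+ 2 = b%:~R ^+ 3 :> algC by rewrite -(rmorphXn _ 2) h rmorphXn.
  rewrite f0 mul0r addr0 expr_div_n -hn exprS mulfK //.
  by rewrite hn expf_neq0.
apply: (nondegenerate R d0 f0 cfb) => t; apply/eqP => t0.
have tb : t ^+ 2 - b != 0.
  apply/eqP => tb; have bt : b = t ^+ 2 by apply/eqP; rewrite eq_sym -subr_eq0 tb.
  have ct : c = - t ^+ 3 by move: t0; rewrite /cubic_at bt; lia.
  have := cfb; rewrite ct bt => h; have : d%:Z * f ^+ 2 = 0.
    by apply: (addrI ((- t ^+ 3) ^+ 2)); rewrite h addr0; ring.
  by move/eqP; rewrite mulf_eq0 expf_eq0 /= (negPf f0) orbF eqz_nat gtn_eqF.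
have tbn : t%:~R ^+ 2 - b%:~R != 0 :> algC by rewrite -rmorphXn -rmorphB intr_eq0.
pose w : algC := c%:~R + f%:~R * s.
have w2 : w ^+ 2 = 2%:R * c%:~R * w - b%:~R ^+ 3.
  have hb : c%:~R ^+ 2 + d%:R * f%:~R ^+ 2 = b%:~R ^+ 3 :> algC.
    by rewrite -intr_form cfb rmorphXn.
  by rewrite -hb -[d%:R]opprK -(qs_sq d) /w; ring.
have c2 : 2%:R * c%:~R = t%:~R ^+ 3 - 3%:R * b%:~R * t%:~R :> algC.
  have : 2 * c = t ^+ 3 - 3 * b * t by move: t0; rewrite /cubic_at; lia.
  by move/(congr1 (fun z : int => z%:~R : algC)); rewrite rmorphB rmorphXn !rmorphM.
(* If t = kappa + b / kappa, then kappa^2 = t kappa - b and kappa^3 = (t^2 - b) kappa - t b; solving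
   kappa^3 = w for kappa gives this witness. *)
pose kappa := (w + t%:~R * b%:~R) / (t%:~R ^+ 2 - b%:~R).
have Kw : K w by apply: qfD => //; apply: qfM => //; exact: qf_qs.
apply: (@not_cube kappa).
  by apply: (qf_div d0); [apply: qfD => //; apply: qfM|apply: qfB => //; apply: qfX].
rewrite -/w; move: w2 c2 tbn; rewrite /kappa; clear Kw kappa; move: (t%:~R : algC) (b%:~R : algC) (c%:~R : algC) w.
clear; move=> t b c w w2 c2 tb.
have k2 : ((w + t * b) / (t ^+ 2 - b)) ^+ 2 = t * ((w + t * b) / (t ^+ 2 - b)) - b.
  apply: (mulIf (expf_neq0 2 tb)); rewrite expr_div_n divfK ?expf_neq0 // mulrBl.
  have -> : t * ((w + t * b) / (t ^+ 2 - b)) * (t ^+ 2 - b) ^+ 2 = t * (w + t * b) * (t ^+ 2 - b).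
    by rewrite [(t ^+ 2 - b) ^+ 2]expr2 mulrA -[t * _ * _]mulrA divfK.
  have -> : (w + t * b) ^+ 2 = w ^+ 2 + 2%:R * t * b * w + t ^+ 2 * b ^+ 2 by ring.
  by rewrite w2 c2; ring.
have -> : ((w + t * b) / (t ^+ 2 - b)) ^+ 3 = (t ^+ 2 - b) * ((w + t * b) / (t ^+ 2 - b)) - t * b.
  by rewrite exprS k2 mulrBr mulrCA -expr2 k2; ring.
by rewrite mulrC divfK // addrK.
Qed.

(** (Z r + Y sqrt(-3)) (Z' r + Y' sqrt(-3))^2 is congruent to -3 (f r + c sqrt(-3)) modulo p. If
    both symbols were e, the right side would have symbol 3 e = 0, against [cf_nondegenerate]. The
    other root -r negates both symbols. *)
Lemma rsym_separates (R : realType) B : exists p, [/\ prime p, (B < p)%N,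
  exists r : int, (p%:Z %| r ^+ 2 - (3 * d)%N%:Z)%Z &
  forall r : int, (p%:Z %| r ^+ 2 - (3 * d)%N%:Z)%Z -> rsym p (Z * r) Y != rsym p (Z' * r) Y'].
Proof.
have [p [r [pp pB hr h]]] := cf_nondegenerate R (B + 6 * d + a + a').
have [_ _ _ N1 ca] := A; have [_ _ _ N2 ca'] := A'.
have a0 := coprime6_gt0 d0 ca; have a0' := coprime6_gt0 d0 ca'.
have big m : (0 < m)%N -> (m <= B + 6 * d + a + a')%N -> ~~ (p %| m)%N.
  by move=> m0 mB; apply: contraTN pB => pm; rewrite -leqNgt (leq_trans _ mB) // dvdn_leq.
have p6 : ~~ (p %| 6 * d)%N by apply: big; move: d0 a0 a0'; clear; lia.
have pa : ~~ (p %| a)%N by apply: big; move: d0 a0 a0'; clear; lia.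
have pa' : ~~ (p %| a')%N by apply: big; move: d0 a0 a0'; clear; lia.
have pn3 : p != 3%N by apply: contra p6 => /eqP->; rewrite -[6%N]/(3 * 2)%N -mulnA dvdn_mulr.
exists p; split=> //; [by move: pB; clear; lia|by exists r|move=> r1 hr1].
have E1 := eis_norm_ndvd pp p6 pa hr N1; have E2 := eis_norm_ndvd pp p6 pa' hr N2.
have ne : rsym p (Z * r) Y != rsym p (Z' * r) Y'.
  apply: contra h => /eqP e.
  have E3 : ~~ (p%:Z %| (Z' * r * (Z' * r) - 3 * Y' * Y') ^+ 2 + 3 * (Z' * r * Y' + Y' * (Z' * r)) ^+ 2)%Z.
    have -> : (Z' * r * (Z' * r) - 3 * Y' * Y') ^+ 2 + 3 * (Z' * r * Y' + Y' * (Z' * r)) ^+ 2 = ((Z' * r) ^+ 2 + 3 * Y' ^+ 2) ^+ 2 by ring.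
    by apply: contra E2; apply: prime_dvdzX.
  have cM := rsymM pp pn3 E1 E3; rewrite (rsymM pp pn3 E2 E2) e in cM.
  have z3 : rsym p (Z' * r) Y' + (rsym p (Z' * r) Y' + rsym p (Z' * r) Y') = 0.
    by apply/eqP; case: (rsym p (Z' * r) Y') => [[|[|[|]]]].
  rewrite z3 in cM; have pm3 : ~~ (p%:Z %| (-3)%R)%Z by rewrite dvdzE abszN -dvdzE prime_dvdz3.
  have E4 : ~~ (p%:Z %| (f * r) ^+ 2 + 3 * c ^+ 2)%Z.
    have -> : (f * r) ^+ 2 + 3 * c ^+ 2 = (3 * (4 * a * a' ^ 2) ^ 3)%N%:Z + f ^+ 2 * (r ^+ 2 - (3 * d)%N%:Z).
      by rewrite PoszM PoszX -/b -cfb PoszM; ring.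
    rewrite dvdz_addl_eq; last exact: dvdz_mull.
    have p6' : ~~ (p %| 6)%N by apply: contra p6; apply: dvdn_mulr.
    rewrite dvdzE /= Euclid_dvdM // Euclid_dvdX // Euclid_dvdM // (Euclid_dvdM 4) // !Euclid_dvdX // !negb_or (negPf pa) (negPf pa') /= !andbT.
    have p24 : ~~ (p %| 4)%N.
      apply: contra p6' => h4; have : (p %| 2 ^ 2)%N by exact: h4.
      by rewrite Euclid_dvdX // => /andP[/dvdn_trans h _]; apply: h.
    by rewrite p24 andbT; apply: contra p6' => /dvdn_trans; apply.
  rewrite -(rsym_scale pp pn3 pm3 E4) -{}cM; apply/eqP; apply: (rsym_congr pp).
    have -> : -3 * (f * r) - (Z * r * (Z' * r * (Z' * r) - 3 * Y' * Y') - 3 * Y * (Z' * r * Y' + Y' * (Z' * r)))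
      = (r ^+ 2 - (3 * d)%N%:Z) * (- Z * Z' ^+ 2 * r) by rewrite /f PoszM; ring.
    exact: dvdz_mulr.
  have -> : -3 * c - (Z * r * (Z' * r * Y' + Y' * (Z' * r)) + Y * (Z' * r * (Z' * r) - 3 * Y' * Y'))
      = (r ^+ 2 - (3 * d)%N%:Z) * (- (Y * Z' ^+ 2 + 2 * Z * Z' * Y')) by rewrite /c PoszM; ring.
  exact: dvdz_mulr.
have : (p%:Z %| (r1 - r) * (r1 + r))%Z.
  have -> : (r1 - r) * (r1 + r) = (r1 ^+ 2 - (3 * d)%N%:Z) - (r ^+ 2 - (3 * d)%N%:Z) by ring.
  exact: rpredB.
rewrite prime_dvdzM // => /orP[hm|hp].
  have cg (u v : int) : rsym p (u * r1) v = rsym p (u * r) v.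
    by apply: (rsym_congr pp); rewrite ?subrr ?dvdz0 // -mulrBr; apply: dvdz_mull.
  by rewrite !cg.
have cg (u v : int) : ~~ (p%:Z %| (u * r) ^+ 2 + 3 * v ^+ 2)%Z -> rsym p (u * r1) v = - rsym p (u * r) v.
  move=> hN; rewrite -(rsymN pp pn3 hN); apply: (rsym_congr pp); rewrite ?subrr ?dvdz0 //.
  by rewrite opprK -mulrDr; apply: dvdz_mull.
by rewrite (cg _ _ E1) (cg _ _ E2) eqr_opp.
Qed.
End Two.

(** If Z is even then so is Y, and halving suffices because a is odd; if Z is odd, an even Y would
    make 4 divide d. *)
Lemma alpha_normalized (Y Z : int) (a : nat) : Y ^+ 2 + d%:Z * Z ^+ 2 = (4 * a ^ 3)%N%:Z -> coprime a (6 * d) ->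
  ~~ (3 %| Y)%Z -> ~~ (27 %| Z)%Z ->
  (forall p : nat, prime p -> (2 < p)%N -> (p%:Z %| Y)%Z -> (p%:Z %| Z)%Z -> False) ->
  exists y z e : int, [/\ normalized d y z a%:Z, Y = e * y, Z = e * z & e = 1 \/ e = 2].
Proof.
move=> hYZ ca h3 h27 prim.
have a2 : ~~ (2 %| a)%N.
  by rewrite -prime_coprime // coprime_sym; apply: coprime_dvdr ca; rewrite -[6%N]/(2 * 3)%N -mulnA dvdn_mulr.
have E4 : (4 * a ^ 3)%N%:Z = 4 * a%:Z ^+ 3 by rewrite PoszM PoszX.
rewrite E4 in hYZ.
have P2 (u v : int) : (2 %| u * v)%Z = (2 %| u)%Z || (2 %| v)%Z := @prime_dvdzM 2 isT u v.
have co (y z e : int) : Y = e * y -> Z = e * z -> ~~ ((2 %| y)%Z && (2 %| z)%Z) -> coprimez y z.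
  move=> yE zE nyz; apply: coprimez_prime => p pp py pz.
  have [p2|p2] := leqP p 2; last by apply: (prim p) => //; rewrite ?yE ?zE; exact: dvdz_mull.
  have {}p2 : p = 2%N by have := prime_gt1 pp; lia.
  by move: nyz; rewrite p2 in py pz; rewrite py pz.
have [Z2|Z2] := boolP (2 %| Z)%Z.
  have Y2 : (2 %| Y)%Z.
    have : (2 %| Y * Y)%Z.
      rewrite -expr2 (_ : Y ^+ 2 = 2 * (2 * a%:Z ^+ 3) - d%:Z * (Z * Z)); last by rewrite -expr2; lia.
      by apply: rpredB; [exact: dvdz_mulr|do 2!apply: dvdz_mull].
    by rewrite P2 orbb.
  have [y yE] := dvdzP Y2; have [z zE] := dvdzP Z2; exists y, z, 2.
  have h : y ^+ 2 + d%:Z * z ^+ 2 = a%:Z ^+ 3.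
    apply: (mulfI (isT : (4 : int) != 0)); rewrite -hYZ yE zE; ring.
  split; [|by rewrite mulrC|by rewrite mulrC|by right]; split; last by left.
  - apply: (co _ _ 2); rewrite 1?mulrC //; apply/negP => /andP[y2 z2].
    have : (2 %| (a ^ 3)%N%:Z)%Z.
      by rewrite PoszX -h; apply: rpredD; [apply: dvdz_exp2|apply: dvdz_mull; apply: dvdz_exp2].
    by rewrite dvdzE /= Euclid_dvdX // (negPf a2).
  - by apply: contra h3; rewrite yE => h'; apply: dvdz_mulr.
  - by apply: contra h27; rewrite zE => h'; apply: dvdz_mulr.
have Y2 : ~~ (2 %| Y)%Z.
  apply/negP => Y2; have : (2 ^ 2 %| d)%N; last by move/sf.
  have : (4 %| d%:Z * Z ^+ 2)%Z.
    have -> : d%:Z * Z ^+ 2 = 4 * a%:Z ^+ 3 - Y ^+ 2 by rewrite -hYZ; ring.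
    by apply: rpredB; [exact: dvdz_mulr|have [y ->] := dvdzP Y2; rewrite exprMn; exact: dvdz_mull].
  rewrite mulrC Gauss_dvdzr //; rewrite coprimezE /= abszX.
  by rewrite coprimeXr // -[coprime _ _]/(coprime (2 ^ 2)%N `|Z|) coprimeXl // prime_coprime.
exists Y, Z, 1; split; rewrite ?mul1r //; last by left.
split=> //; last by right.
by apply: (co _ _ 1); rewrite ?mul1r // (negPf Y2).
Qed.

(** If q divided a but not Z, then Y / Z would be a square root of -d modulo q. *)
Lemma inert_ndvd (q : nat) (Y Z : int) (a : nat) : prime q -> ~~ (q %| 6 * d)%N ->
  (forall r : nat, ~~ (q %| r ^ 2 + d)%N) -> Y ^+ 2 + d%:Z * Z ^+ 2 = (4 * a ^ 3)%N%:Z ->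
  (forall p : nat, prime p -> (2 < p)%N -> (p%:Z %| Y)%Z -> (p%:Z %| Z)%Z -> False) -> ~~ (q %| a)%N.
Proof.
move=> qp q6 inert h prim; apply/negP => qa.
have q2 : (2 < q)%N.
  rewrite ltn_neqAle eq_sym prime_gt1 // andbT; apply: contra q6 => /eqP->.
  by rewrite -[6%N]/(2 * 3)%N -mulnA dvdn_mulr.
have qh : (q%:Z %| Y ^+ 2 + d%:Z * Z ^+ 2)%Z.
  by rewrite h dvdzE /= dvdn_mull // (dvdn_exp (k := 3)).
have [qZ|qZ] := boolP (q%:Z %| Z)%Z.
  apply: (prim q) => //; apply: (prime_dvdzX qp (n := 2)).
  have -> : Y ^+ 2 = (Y ^+ 2 + d%:Z * Z ^+ 2) - d%:Z * Z ^+ 2 by ring.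
  by apply: rpredB => //; apply: dvdz_mull; apply: dvdz_exp2.
have [t tE] := lin_congr_solve Y qp qZ.
have : (q%:Z %| Z ^+ 2 * (t ^+ 2 + d%:Z))%Z.
  have -> : Z ^+ 2 * (t ^+ 2 + d%:Z) = (Y ^+ 2 + d%:Z * Z ^+ 2) + (Z * t - Y) * (Z * t + Y) by ring.
  by apply: rpredD => //; apply: dvdz_mulr.
rewrite prime_dvdzM // => /orP[/(prime_dvdzX qp)|qt]; first by rewrite (negPf qZ).
have /negPf qi := inert `|t|%N; move: qt.
have -> : t ^+ 2 + d%:Z = (`|t| ^ 2 + d)%N%:Z by rewrite PoszD PoszX abszE real_normK // num_real.
by rewrite dvdzE qi.
Qed.

Lemma inert_bound (R : realType) (S n : nat) (I : 'I_n -> algC -> Prop) x g (Q : seq nat) :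
  class_family d I x g -> (forall t : int, t ^+ 2 != (3 * d)%N%:Z) -> (3 * d <= S ^ 2)%N ->
  uniq Q ->
  (forall q, q \in Q -> [/\ prime q, ~~ (q %| 6 * d)%N, forall r : nat, ~~ (q %| r ^ 2 + d)%N,
     exists t : int, (q%:Z %| t ^+ 2 - (3 * d)%N%:Z)%Z & (S * q ^ 6 < 3 * d)%N]) ->
  (n * size Q <= 4 * 54 ^ 2 * \sum_(1 <= c < S.+1) nroots (3 * d)%N c)%N.
Proof.
move=> cf Dns DS uQ hQ; have [->|Q0] := posnP (size Q); first by rewrite muln0.
have /choice[W hW] (l : 'I_n) : exists w : algC * nat * int * int,
    [/\ alpha_data (I l) (x l) (g l) w.1.1.1 w.1.1.2 w.1.2 w.2, ~~ (3 %| w.1.2)%Z, ~~ (27 %| w.2)%Z &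
      forall p : nat, prime p -> (2 < p)%N -> (p%:Z %| w.1.2)%Z -> (p%:Z %| w.2)%Z -> False].
  by have [xi [a [Y [Z h]]]] := alpha_primitive (cf_ideal cf l); exists (xi, a, Y, Z).
pose a l := (W l).1.1.2; pose Y l := (W l).1.2; pose Z l := (W l).2.
have hA l : alpha_data (I l) (x l) (g l) (W l).1.1.1 (a l) (Y l) (Z l) by have [] := hW l.
have hN l : Y l ^+ 2 + d%:Z * Z l ^+ 2 = (4 * a l ^ 3)%N%:Z by have [] := hA l.
have hc l : coprime (a l) (6 * d) by have [] := hA l.
have hprim l (p : nat) : prime p -> (2 < p)%N -> (p%:Z %| Y l)%Z -> (p%:Z %| Z l)%Z -> False.
  by have [_ _ _] := hW l; apply.
have /choice[V hV] (l : 'I_n) : exists v : int * int * int,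
    [/\ normalized d v.1.1 v.1.2 (a l)%:Z, Y l = v.2 * v.1.1, Z l = v.2 * v.1.2 & v.2 = 1 \/ v.2 = 2].
  have [_ h3 h27 _] := hW l.
  by have [y [z [e h]]] := alpha_normalized (hN l) (hc l) h3 h27 (hprim l); exists (y, z, e).
have Qa q l : q \in Q -> ~~ (q %| a l)%N.
  by move=> /hQ[qp q6 qi _ _]; exact: (inert_ndvd qp q6 qi (hN l) (@hprim l)).
have /choice[P hP] (w : 'I_n * 'I_n) : exists p : nat, [/\ prime p, ~~ (p %| 6 * d)%N, forall l, ~~ (p %| a l)%N,
    exists t : int, (p%:Z %| t ^+ 2 - (3 * d)%N%:Z)%Z &
    w.1 != w.2 -> forall r : int, (p%:Z %| r ^+ 2 - (3 * d)%N%:Z)%Z ->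
      rsym p (Z w.1 * r) (Y w.1) != rsym p (Z w.2 * r) (Y w.2)].
  (* On the diagonal nothing has to be separated; any prime of Q has the remaining properties. *)
  have [e|ne] := eqVneq w.1 w.2.
    have q0Q : nth 0%N Q 0 \in Q by rewrite mem_nth.
    have [qp q6 _ qt _] := hQ _ q0Q; exists (nth 0%N Q 0); split=> // l; exact: Qa.
  have [p [pp pB hr hs]] := rsym_separates cf (hA w.1) (hA w.2) ne R (6 * d + \sum_l a l).
  have big m : (0 < m)%N -> (m <= 6 * d + \sum_l a l)%N -> ~~ (p %| m)%N.
    by move=> m0 mB; apply: contraTN pB => pm; rewrite -leqNgt (leq_trans _ mB) // dvdn_leq.
  exists p; split=> // [|l]; first by apply: big; [rewrite muln_gt0|exact: leq_addr].
  apply: big; first exact: coprime6_gt0 (hc l).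
  by rewrite (leq_trans _ (leq_addl _ _)) // (bigD1 l) //= leq_addr.
pose T := #|{: 'I_n * 'I_n}|; pose p (k : 'I_T) := P (enum_val k).
pose M := ((\prod_k p k ^ 2 * \prod_(q <- Q) q ^ 3) ^ 2)%N.
have pq r : (r \in Q) || (r \in codom p) -> [/\ prime r, ~~ (r %| 6 * d)%N, forall l, ~~ (r %| a l)%N &
    exists t : int, (r%:Z %| t ^+ 2 - (3 * d)%N%:Z)%Z].
  case/orP => [rQ|/codomP[k ->]]; last by have [] := hP (enum_val k).
  by have [? ? ? ? _] := hQ _ rQ; split=> // l; exact: Qa.
have inM r : prime r -> (r %| M)%N -> (r \in Q) || (r \in codom p).
  move=> rp; rewrite /M (Euclid_dvdX _ _ rp) andbT (Euclid_dvdM _ _ rp) => /orP[].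
    rewrite (big_morph (fun k => (r %| k)%N) (id1 := false) (op1 := orb)); last first.
    - by rewrite dvdn1 gtn_eqF ?prime_gt1.
    - by move=> u v; exact: Euclid_dvdM.
    rewrite big_orE => /existsP[k]; rewrite (Euclid_dvdX _ _ rp) andbT.
    have [pk _ _ _ _] := hP (enum_val k); rewrite dvdn_prime2 // => /eqP->.
    by rewrite codom_f orbT.
  rewrite (big_morph (fun k => (r %| k)%N) (id1 := false) (op1 := orb)); last first.
  - by rewrite dvdn1 gtn_eqF ?prime_gt1.
  - by move=> u v; exact: Euclid_dvdM.
  rewrite big_has => /hasP[q qQ]; rewrite (Euclid_dvdX _ _ rp) andbT.
  by have [qp _ _ _ _] := hQ _ qQ; rewrite dvdn_prime2 // => /eqP->; rewrite qQ.
have M0 : (0 < M)%N.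
  rewrite /M expn_gt0; apply/orP; left; rewrite muln_gt0; apply/andP; split.
    by apply: prodn_gt0 => k; rewrite expn_gt0 prime_gt0 //; have [] := hP (enum_val k).
  rewrite big_seq; apply: prodn_cond_gt0 => q /hQ[qp _ _ _ _]; by rewrite expn_gt0 prime_gt0.
have six r : ~~ (r %| 6 * d)%N -> prime r -> (2 < r)%N /\ r != 3%N.
  move=> r6 rp; split.
    rewrite ltn_neqAle eq_sym prime_gt1 // andbT; apply: contra r6 => /eqP->.
    by rewrite -[6%N]/(2 * 3)%N -mulnA dvdn_mulr.
  by apply: contra r6 => /eqP->; rewrite -[6%N]/(3 * 2)%N -mulnA dvdn_mulr.
have [r0 r0E] : exists r : int, (M%:Z %| r ^+ 2 - (3 * d)%N%:Z)%Z.
  apply: sqrt_mod => // r rp rM; have [_ r6 _ rt] := pq r (inM r rp rM); have [r2 _] := six r r6 rp.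
  split=> //; rewrite dvdzE /=; apply: contra r6 => h.
  by rewrite -[6%N]/(2 * 3)%N -mulnA dvdn_mull.
apply: (@reflection_bound d n S T (fun l => (V l).1.1) (fun l => (V l).1.2) (fun l => (a l)%:Z) p Q r0) => //.
- by move=> l; have [] := hV l.
- by move=> k; have [] := hP (enum_val k).
- by move=> q /hQ[].
- by move=> r /pq[rp r6 ra _]; split=> // l; rewrite dvdzE.
- move=> l l' ll'; exists (enum_rank (l, l')); rewrite /p enum_rankK.
  have [pp p6 pa _ sep] := hP (l, l'); set q := P (l, l') in pp p6 pa sep *.
  have [q2 q3] := six q p6 pp.
  have qr : (q%:Z %| r0 ^+ 2 - (3 * d)%N%:Z)%Z.
    apply: dvdz_trans r0E; rewrite dvdzE /= /M; apply: (@dvdn_exp 2) => //; apply: dvdn_mulr.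
    rewrite (bigD1 (enum_rank (l, l'))) //= /p enum_rankK; apply: dvdn_mulr.
    by apply: (@dvdn_exp 2).
  have tr j : rsym q ((V j).1.2 * r0) (V j).1.1 = rsym q (Z j * r0) (Y j).
    have := eis_norm_ndvd pp p6 (pa j) qr (hN j); have [_ -> -> e12] := hV j; set e := (V j).2 in e12 *.
    have -> : (e * (V j).1.2 * r0) ^+ 2 + 3 * (e * (V j).1.1) ^+ 2
      = ((V j).1.2 * r0 * ((V j).1.2 * r0) + 3 * ((V j).1.1 * (V j).1.1)) * (e * e) by ring.
    move=> nd; rewrite -mulrA rsym_scale //.
      case: e12 => ->; rewrite dvdzE /=; first by rewrite dvdn1 gtn_eqF // prime_gt1.
      by rewrite dvdn_prime2 // gtn_eqF.
    by apply: contra nd; rewrite !expr2 => h; apply: dvdz_mulr.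
  by rewrite !tr; apply: sep.
- by move=> q /hQ[].
Qed.
End Alpha.

(** * Quadratic characters with many equal values *)

Lemma squarefree_prod (d : nat) : (0 < d)%N -> squarefree d -> d = (\prod_(p <- primes d) p)%N.
Proof.
move=> d0 sf; rewrite {1}(prod_prime_decomp d0) /primes /unzip1 big_map.
apply: eq_big_seq => -[p e] /mem_prime_decomp[pp e0 pd] /=.
have [e1|e1] := leqP e 1; first by rewrite (_ : e = 1)%N ?expn1 //; lia.
have /sf p1 : (p ^ 2 %| d)%N by apply: dvdn_trans pd; apply: dvdn_exp2l.
by rewrite p1 in pp.
Qed.

Lemma squarefree_dvdX (d h n : nat) : squarefree d -> (0 < n)%N -> (h ^ 2 %| n ^ 2 * d)%N -> (h %| n)%N.
Proof.
move=> sf n0 hd; have g0 : (0 < gcdn h n)%N by rewrite gcdn_gt0 n0 orbT.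
pose h' := (h %/ gcdn h n)%N; pose n' := (n %/ gcdn h n)%N.
have hE : h = (h' * gcdn h n)%N by rewrite divnK // dvdn_gcdl.
have nE : n = (n' * gcdn h n)%N by rewrite divnK // dvdn_gcdr.
have co : coprime h' n'.
  rewrite /coprime -(eqn_pmul2r g0) muln_gcdl -hE -nE mul1n //.
have : (h' ^ 2 %| d)%N.
  have gg : (0 < gcdn h n ^ 2)%N by rewrite expn_gt0 g0.
  rewrite -(Gauss_dvdr d (_ : coprime (h' ^ 2) (n' ^ 2))); last by rewrite coprimeXl // coprimeXr.
  rewrite -(dvdn_pmul2r gg) -expnMn -hE mulnAC -expnMn -nE //.
by move/sf => h1; rewrite hE h1 mul1n dvdn_gcdr.
Qed.

Lemma leg_sum0 p : prime p -> (2 < p)%N -> \sum_(x : 'F_p) leg x = 0.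
Proof.
move=> pp p2; have [t t0 lt] := leg_nonres pp p2.
have := @mulchar_sum0 _ _ (fun x : 'F_p => (leg x)%:~R : rat) t (leg_mulchar pp p2 rat) t0.
rewrite lt => /(_ isT); rewrite -rmorph_sum /= => /eqP; rewrite intr_eq0 => /eqP //.
Qed.

Lemma leg_norm p (x : 'F_p) : `|leg x| <= 1.
Proof. by have := leg_val x; rewrite !inE => /or3P[]/eqP->. Qed.

Lemma sum_nat_blocks (V : nmodType) (F : nat -> V) (M p : nat) :
  \sum_(0 <= n < p * M) F n = \sum_(0 <= t < p) \sum_(0 <= r < M) F (r + t * M)%N.
Proof.
elim: p => [|p IH]; first by rewrite !big_geq.
rewrite big_nat_recr //= -IH mulSn addnC (@big_cat_nat _ _ _ (p * M)) ?leq_addr //=; congr (_ + _).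
by rewrite -[X in index_iota X]add0n big_addn addKn.
Qed.

Lemma sum_leg_progression p M r : prime p -> (2 < p)%N -> ~~ (p %| M)%N ->
  \sum_(0 <= t < p) leg ((r + t * M)%N%:R : 'F_p) = 0.
Proof.
move=> pp p2 pM; have Fp := pchar_Fp pp.
have M0 : M%:R != 0 :> 'F_p by rewrite -(dvdn_pcharf Fp).
rewrite -[RHS](leg_sum0 pp p2) (reindex_inj (h := fun x : 'F_p => r%:R + x * M%:R)); last first.
  by move=> x y /addrI /(mulIf M0).
rewrite big_mkord /=; have e : (p = (Zp_trunc (pdiv p)).+2)%N by rewrite Fp_cast.
rewrite (reindex_onto (fun x : 'F_p => cast_ord (esym e) x) (cast_ord e)) /=; last first.
  by move=> i _; apply: val_inj.
apply: eq_big => [x|x _]; first by apply/eqP/val_inj.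
by rewrite natrD natrM; congr (leg (_ + _ * _)); rewrite natr_Zp.
Qed.

(** M is prime to p, so over a full period M p the Legendre factor sums to 0 along each progression
    modulo M; an incomplete period remains. *)
Lemma char_sum_bound (phi : nat -> int) (M p N : nat) : (0 < M)%N -> prime p -> (2 < p)%N -> ~~ (p %| M)%N ->
  (forall n t, phi (n + t * M)%N = phi n) -> (forall n, `|phi n| <= 1) ->
  `|\sum_(0 <= n < N) phi n * leg (n%:R : 'F_p)| <= (M * p)%N%:Z.
Proof.
move=> M0 pp p2 pM per bd; have Fp := pchar_Fp pp; have p0 := prime_gt0 pp.
pose F n := phi n * leg (n%:R : 'F_p); rewrite -/(F _).
have Fper n t : F (n + t * (p * M))%N = F n.
  rewrite /F mulnA per; congr (_ * leg _); rewrite natrD -mulnA mulnCA natrM.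
  by rewrite (pcharf0 Fp) mul0r addr0.
have block : \sum_(0 <= n < p * M) F n = 0.
  rewrite sum_nat_blocks exchange_big /=; apply: big1 => r _.
  under eq_bigr => t _ do rewrite /F per.
  by rewrite -big_distrr /= sum_leg_progression // mulr0.
have Mp0 : (0 < p * M)%N by rewrite muln_gt0 p0.
have -> : \sum_(0 <= n < N) F n = \sum_(0 <= n < N %% (p * M)) F n.
  rewrite {1}(divn_eq N (p * M)) (@big_cat_nat _ _ _ (N %/ (p * M) * (p * M))) ?leq_addr //=.
  rewrite sum_nat_blocks big1 ?add0r => [|t _].
    rewrite -[X in index_iota X]add0n big_addn addKn; apply: eq_bigr => n _; exact: Fper.
  by under eq_bigr => r _ do rewrite Fper.
apply: le_trans (ler_norm_sum _ _ _) _.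
apply: (@le_trans _ _ (\sum_(0 <= n < N %% (p * M)) 1)).
  by apply: ler_sum => n _; rewrite /F normrM mulr_ile1 // leg_norm.
rewrite big_const_nat subn0 iter_addr addr0 mulnC -natz ler_nat.
by apply: ltnW; rewrite ltn_mod muln_gt0 M0.
Qed.

(** By reciprocity (-d/q) is psi d q up to a factor depending only on d, once (-1/q) and (2/q) are
    fixed. A symbol of varying modulus q becomes a character of q with modulus dividing d. *)
Definition psi (d n : nat) : int := \prod_(p <- primes d | (2 < p)%N) leg (n%:R : 'F_p).

Lemma prod_leg_norm (s : seq nat) (P : pred nat) n :
  `|\prod_(p <- s | P p) leg (n%:R : 'F_p)| <= 1.
Proof.
by elim/big_rec: _ => // p x _ h; rewrite normrM mulr_ile1 // leg_norm.
Qed.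

Lemma psiM d m n : psi d (m * n) = psi d m * psi d n.
Proof.
rewrite /psi -big_split /= big_seq_cond [RHS]big_seq_cond; apply: eq_bigr => p /andP[].
rewrite mem_primes => /and3P[pp _ _] p2.
by rewrite natrM legM.
Qed.

Lemma psi_prod d (I : finType) (f : I -> nat) : psi d (\prod_i f i)%N = \prod_i psi d (f i).
Proof.
apply: (big_morph (psi d)); first by move=> m n; exact: psiM.
by rewrite /psi big_seq_cond big1 // => p /andP[]; rewrite mem_primes => /and3P[pp _ _] p2; rewrite leg1.
Qed.

Lemma prod_leg_per (s : seq nat) (P : pred nat) M n t : {in s, forall p, prime p /\ (P p -> p %| M)%N} ->
  \prod_(p <- s | P p) leg ((n + t * M)%N%:R : 'F_p) = \prod_(p <- s | P p) leg (n%:R : 'F_p).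
Proof.
move=> h; rewrite big_seq_cond [RHS]big_seq_cond; apply: eq_bigr => p /andP[/h[pp pM] /pM {}pM]; congr leg.
have Fp := pchar_Fp pp; rewrite natrD natrM; have /eqP -> : M%:R == 0 :> 'F_p by rewrite -(dvdn_pcharf Fp).
by rewrite mulr0 addr0.
Qed.

Lemma psi_ortho_aux d d' p N : (0 < d)%N -> (0 < d')%N -> squarefree d ->
  prime p -> (2 < p)%N -> (p %| d)%N -> ~~ (p %| d')%N ->
  `|\sum_(0 <= n < N) psi d n * psi d' n| <= (d * d')%N%:Z.
Proof.
move=> d0 d0' sf pp p2 pd pd'; pose M := ((d %/ p) * d')%N.
have dE : d = (d %/ p * p)%N by rewrite divnK.
have pM : ~~ (p %| M)%N.
  rewrite Euclid_dvdM // negb_or pd' andbT; apply/negP => h.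
  have /sf p1 : (p ^ 2 %| d)%N by rewrite dE expnS expn1 dvdn_mul.
  by rewrite p1 in pp.
have M0 : (0 < M)%N by rewrite muln_gt0 d0' divn_gt0 ?prime_gt0 // dvdn_leq.
pose phi n : int := \prod_(r <- primes d | (2 < r)%N && (r != p)) leg (n%:R : 'F_r) * psi d' n.
have -> : (d * d' = M * p)%N by rewrite /M {1}dE mulnAC.
have <- : \sum_(0 <= n < N) phi n * leg (n%:R : 'F_p) = \sum_(0 <= n < N) psi d n * psi d' n.
  apply: eq_bigr => n _; rewrite /phi mulrAC; congr (_ * _).
  rewrite /psi [RHS]big_mkcond (bigD1_seq p) /= ?primes_uniq ?mem_primes ?pp ?d0 // mulrC p2.
  by congr (_ * _); rewrite -big_mkcondr; apply: eq_bigl => r; rewrite andbC.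
apply: char_sum_bound => // [n t|n]; last by rewrite normrM mulr_ile1 // prod_leg_norm.
rewrite /phi /psi; congr (_ * _); apply: prod_leg_per => r; rewrite mem_primes => /and3P[rp _ rd]; split=> //.
  case/andP => _ rn; rewrite dvdn_mulr //; move: rd; rewrite {1}dE Euclid_dvdM // => /orP[] //.
  by rewrite dvdn_prime2 // (negPf rn).
by move=> _; rewrite dvdn_mull.
Qed.

Lemma squarefree_eq d d' : (0 < d)%N -> (0 < d')%N -> squarefree d -> squarefree d' ->
  (forall p, prime p -> (p %| d)%N = (p %| d')%N) -> d = d'.
Proof.
move=> d0 d0' sf sf' h; rewrite (squarefree_prod d0 sf) (squarefree_prod d0' sf').
congr bigop; apply: (irr_sorted_eq ltn_trans ltnn); rewrite ?sorted_primes //.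
by move=> p; rewrite !mem_primes d0 d0' /=; have [pp|] := boolP (prime p); rewrite //= h.
Qed.

(** Square-free numbers of the same parity differ at an odd prime p; there the product of the
    characters contains a single factor (n/p), which produces the cancellation. *)
Lemma psi_ortho d d' N : (0 < d)%N -> (0 < d')%N -> squarefree d -> squarefree d' -> odd d = odd d' -> d != d' ->
  `|\sum_(0 <= n < N) psi d n * psi d' n| <= (d * d')%N%:Z.
Proof.
move=> d0 d0' sf sf' od ne.
have [p [pp p2 pdd]] : exists p, [/\ prime p, (2 < p)%N & (p %| d)%N != (p %| d')%N].
  apply/not_existsP => H; move/eqP: ne; apply; apply: squarefree_eq => // p pp.
  have [p2|p2] := leqP p 2.
    have -> : p = 2%N by have := prime_gt1 pp; lia.
    by rewrite !dvdn2 od.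
  by apply: contrapT => c; apply: (H p); split=> //; apply/eqP.
have [pd|pd] := boolP (p %| d)%N.
  by apply: (psi_ortho_aux N d0 d0' sf pp) => //; move: pdd; rewrite pd; case: (p %| d')%N.
under eq_bigr => n _ do rewrite mulrC.
by rewrite mulnC; apply: (psi_ortho_aux N d0' d0 sf' pp) => //; move: pdd; rewrite (negPf pd); case: (p %| d')%N.
Qed.

Lemma leg_psi (e1 e2 : int) d : `|e1| <= 1 -> `|e2| <= 1 -> (0 < d)%N -> squarefree d ->
  exists2 e : int, `|e| <= 1 & forall q, prime q -> (2 < q)%N -> leg (- 1 : 'F_q) = e1 ->
    leg (2%:R : 'F_q) = e2 -> leg ((- d%:Z)%:~R : 'F_q) = e * psi d q.
Proof.
move=> h1 h2 d0 sf.
pose w (p : nat) : int := if (2 < p)%N then (if leg (-1 : 'F_p) == 1 then 1 else e1) else e2.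
exists (e1 * \prod_(p <- primes d) w p).
  rewrite normrM mulr_ile1 //; elim/big_rec: _ => // p x _ h; rewrite normrM mulr_ile1 // /w.
  by case: ifP => // _; case: ifP.
move=> q qp q2 E1 E2; have Fq := pchar_Fp qp.
rewrite rmorphN /= -mulN1r legM // E1 -mulrA; congr (_ * _).
rewrite {1}(squarefree_prod d0 sf) /psi [X in _ * X]big_mkcond -big_split /=.
have LM (s : seq nat) : leg (((\prod_(p <- s) p)%N%:Z)%:~R : 'F_q) = \prod_(p <- s) leg (p%:R : 'F_q).
  elim: s => [|p s IH]; first by rewrite !big_nil leg1.
  by rewrite !big_cons -IH -legM // PoszM rmorphM.
rewrite LM; apply: eq_big_seq => p; rewrite mem_primes => /and3P[pp _ _]; rewrite /w.
have [p2|p2] := leqP p 2.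
  by rewrite mulr1 (_ : p = 2)%N // ; have := prime_gt1 pp; lia.
have [->|pq] := eqVneq p q.
  have -> : q%:R = 0 :> 'F_q by rewrite (pcharf0 Fq).
  by rewrite /leg eqxx mulr0.
rewrite quadratic_reciprocity //; congr (_ * _).
have := leg_val (-1 : 'F_p); have : leg (-1 : 'F_p) != 0 by rewrite leg_eq0 oppr_eq0 oner_eq0.
by rewrite !inE => l0 /or3P[]/eqP h; rewrite h in l0 *; rewrite ?leg1 // rmorphN1 E1.
Qed.

Lemma sum_sq_le (I : finType) (x : I -> int) : (\sum_i x i) ^+ 2 <= #|I|%:Z * \sum_i x i ^+ 2.
Proof.
have h : 0 <= \sum_i \sum_j (x i - x j) ^+ 2 by apply: sumr_ge0 => i _; apply: sumr_ge0 => j _; apply: sqr_ge0.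
suff e : \sum_i \sum_j (x i - x j) ^+ 2 = 2 * (#|I|%:Z * \sum_i x i ^+ 2 - (\sum_i x i) ^+ 2).
  by move: h; rewrite e pmulr_rge0 // subr_ge0.
have cst (c : int) : \sum_(j : I) c = #|I|%:Z * c.
  by rewrite big_const iter_addr addr0 -mulr_natl natz.
have e1 i : \sum_j (x i - x j) ^+ 2 = #|I|%:Z * x i ^+ 2 + \sum_j x j ^+ 2 - 2 * x i * \sum_j x j.
  rewrite (eq_bigr (fun j => x i ^+ 2 + x j ^+ 2 - 2 * x i * x j)) => [|j _]; last by ring.
  by rewrite sumrB big_split /= cst -mulr_sumr.
under eq_bigr => i _ do rewrite e1.
by rewrite sumrB big_split /= -mulr_sumr cst -mulr_suml -mulr_sumr; ring.
Qed.

(** * A large sieve by power moments *)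

Section BadCount.
Variables (k Y D : nat) (Q A : seq nat) (e1 e2 : int) (par : bool).
Hypotheses (uQ : uniq Q) (uA : uniq A) (ek : ~~ odd k) (E1 : `|e1| <= 1) (E2 : `|e2| <= 1).
Hypothesis hQ : forall q, q \in Q -> [/\ prime q, (2 < q)%N, (q <= Y)%N, leg (- 1 : 'F_q) = e1 & leg (2%:R : 'F_q) = e2].
Hypothesis hA : forall d, d \in A -> [/\ (0 < d <= D)%N, squarefree d, odd d = par &
  (size Q)%:Z <= 4 * `|\sum_(q <- Q) leg ((- d%:Z)%:~R : 'F_q)|].

Let a := size A.
Let X := {ffun 'I_k -> 'I_(size Q)}.
Let val (f : X) : nat := \prod_i nth 0%N Q (f i).
Let F (n : nat) : int := \sum_(d <- A) psi d n.

(** k is even, so absolute values disappear: for each d in A the k-th power of the character sum is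
    at least (|Q| / 4)^k, and it expands into values of psi d at products of k primes. *)
Lemma bad_power : (a * size Q ^ k)%N%:Z <= (4 ^ k)%N%:Z * \sum_(f : X) F (val f).
Proof.
have -> : \sum_(f : X) F (val f) = \sum_(d <- A) (\sum_(q <- Q) psi d q) ^+ k.
  rewrite exchange_big /=; apply: eq_bigr => d _; rewrite (big_nth 0%N) big_mkord.
  have -> (t : int) : t ^+ k = \prod_(i < k) t by rewrite prodr_const card_ord.
  by rewrite bigA_distr_bigA /=; apply: eq_bigr => f _; rewrite psi_prod.
rewrite mulr_sumr PoszM.
have -> : a%:Z * (size Q ^ k)%N%:Z = \sum_(d <- A) (size Q ^ k)%N%:Z :> int.
  by rewrite big_const_seq count_predT iter_addr addr0 -mulr_natl natz.
rewrite big_seq [leRHS]big_seq; apply: ler_sum => d /hA[/andP[d0 _] sf _ hd].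
have [e he eE] := leg_psi E1 E2 d0 sf.
have h : (size Q)%:Z <= 4 * `|\sum_(q <- Q) psi d q|.
  apply: le_trans hd _; rewrite ler_pM2l //.
  have -> : \sum_(q <- Q) leg ((- d%:Z)%:~R : 'F_q) = e * \sum_(q <- Q) psi d q.
    by rewrite mulr_sumr; apply: eq_big_seq => q /hQ[qp q2 _ h1 h2]; exact: eE.
  by rewrite normrM ler_piMl.
have -> : (\sum_(q <- Q) psi d q) ^+ k = `|\sum_(q <- Q) psi d q| ^+ k.
  by rewrite -normrX ger0_norm // exprn_even_ge0.
by rewrite PoszX (PoszX 4) -exprMn lerXn2r // nnegrE mulr_ge0.
Qed.

(** A k-tuple with product n takes its values among the at most k primes of one such tuple. *)
Lemma bad_fiber n : (#|[pred f : X | val f == n]| <= k ^ k)%N.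
Proof.
have [f0 /eqP f0n|] := pickP [pred f : X | val f == n]; last by move=> e; rewrite eq_card0.
apply: (@leq_trans #|[pred f : X | f \in ffun_on [in codom f0]]|).
  apply: subset_leq_card; apply/fintype.subsetP => f; rewrite !inE => /eqP fn.
  apply/ffun_onP => i; have qQ (j : 'I_(size Q)) : nth 0%N Q j \in Q by rewrite mem_nth.
  have [qp _ _ _ _] := hQ (qQ (f i)).
  have : (nth 0%N Q (f i) %| val f0)%N by rewrite f0n -fn /val (bigD1 i) //= dvdn_mulr.
  rewrite /val (big_morph (fun m => (nth 0%N Q (f i) %| m)%N) (id1 := false) (op1 := orb)); last first.
  - by rewrite dvdn1 gtn_eqF ?prime_gt1.
  - by move=> u v; exact: Euclid_dvdM.
  rewrite big_orE => /existsP[j]; have [qp' _ _ _ _] := hQ (qQ (f0 j)).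
  rewrite dvdn_prime2 // nth_uniq // => /eqP e; rewrite (_ : f i = f0 j); last exact: val_inj.
  exact: codom_f.
rewrite card_ffun_on card_ord.
have mono (c e : nat) : (c <= e)%N -> (c ^ e <= e ^ e)%N by case: e => // e ce; rewrite leq_exp2r.
by apply: mono; rewrite (leq_trans (card_size _)) // size_codom card_ord.
Qed.

Lemma bad_square : (\sum_(f : X) F (val f)) ^+ 2 <=
  ((size Q) ^ k * k ^ k)%N%:Z * \sum_(0 <= n < (Y ^ k).+1) F n ^+ 2.
Proof.
apply: le_trans (sum_sq_le _) _; rewrite card_ffun !card_ord PoszM -mulrA ler_wpM2l //.
have vY (f : X) : (val f < (Y ^ k).+1)%N.
  rewrite ltnS /val -[X in (_ <= _ ^ X)%N](card_ord k) -prod_nat_const; apply: leq_prod => i _.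
  by have [] := hQ (mem_nth 0%N (ltn_ord (f i))).
rewrite (partition_big (fun f => inord (val f) : 'I_(Y ^ k).+1) predT) //= big_mkord mulr_sumr.
apply: ler_sum => n _; rewrite (eq_bigr (fun=> F n ^+ 2)) => [|f /eqP <-]; last by rewrite inordK.
rewrite sumr_const -mulr_natl natz ler_wpM2r ?sqr_ge0 // lez_nat.
apply: leq_trans (bad_fiber n); apply: subset_leq_card; apply/fintype.subsetP => f; rewrite !inE => /eqP <-.
by apply/eqP; rewrite /= inordK.
Qed.

Lemma bad_ortho N : \sum_(0 <= n < N) F n ^+ 2 <= (a * (N + a * D ^ 2))%N%:Z.
Proof.
have -> : \sum_(0 <= n < N) F n ^+ 2 = \sum_(d <- A) \sum_(d' <- A) \sum_(0 <= n < N) psi d n * psi d' n.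
  under [RHS]eq_bigr => d _ do rewrite exchange_big /=.
  rewrite [RHS]exchange_big /=; apply: eq_bigr => n _.
  by rewrite expr2 /F mulr_suml; apply: eq_bigr => d _; rewrite mulr_sumr.
have cst (c : int) : \sum_(d <- A) c = a%:Z * c.
  by rewrite big_const_seq count_predT iter_addr addr0 -mulr_natl natz.
rewrite PoszM -cst big_seq [leRHS]big_seq; apply: ler_sum => d dA.
have [/andP[d0 dD] sf od _] := hA dA.
apply: (@le_trans _ _ (\sum_(d' <- A) ((if d' == d then N%:Z else 0) + (D ^ 2)%N%:Z))).
  rewrite big_seq [leRHS]big_seq; apply: ler_sum => d' dA'; have [/andP[d0' dD'] sf' od' _] := hA dA'.
  have [->|ne] := eqVneq d' d.
    rewrite -[leLHS]addr0 lerD //.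
    apply: (@le_trans _ _ (\sum_(0 <= n < N) 1)); last by rewrite big_const_nat subn0 iter_addr addr0 natz.
    apply: ler_sum => n _; apply: le_trans (ler_norm _) _.
    by rewrite normrM mulr_ile1 // prod_leg_norm.
  rewrite add0r; apply: le_trans (ler_norm _) _; apply: le_trans (psi_ortho N d0 d0' sf sf' _ _) _.
  - by rewrite od od'.
  - by rewrite eq_sym.
  by rewrite lez_nat expnS expn1 leq_mul.
rewrite big_split /= cst -big_mkcond PoszD PoszM lerD2r.
by rewrite big_const_seq count_uniq_mem // dA /= addr0.
Qed.

(** [bad_power] is squared, combined with [bad_square] and [bad_ortho], and a |Q|^k is cancelled.
    Once |Q|^k exceeds twice (16 k)^k D^2, the last term can be absorbed on the left and A has at
    most about (Y^k / |Q|^k) elements. *)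
Lemma bad_count : (a * size Q ^ k <= (16 * k) ^ k * ((Y ^ k).+1 + a * D ^ 2))%N.
Proof.
have [->|P0] := posnP (a * size Q ^ k)%N; first by [].
rewrite -(leq_pmul2l P0).
have a0 : (0 < a)%N by move: P0; rewrite muln_gt0 => /andP[].
have h1 : (a * size Q ^ k)%N%:Z ^+ 2 <= ((4 ^ k)%N%:Z * \sum_(f : X) F (val f)) ^+ 2.
  by rewrite lerXn2r ?nnegrE // (le_trans _ bad_power).
have h2 := ler_wpM2l (sqr_ge0 (4 ^ k)%N%:Z) bad_square.
have h3 := ler_wpM2l (_ : 0 <= ((4 ^ k)%N%:Z ^+ 2 * (size Q ^ k * k ^ k)%N%:Z)) (bad_ortho (Y ^ k).+1).
have := le_trans h1 _; rewrite exprMn => /(_ _ (le_trans h2 _)); rewrite mulrA => /(_ _ (h3 _)).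
move=> /(_ _); rewrite -!PoszX -!PoszM lez_nat => h.
have {}h : ((a * size Q ^ k) ^ 2 <= (4 ^ k) ^ 2 * (size Q ^ k * k ^ k) * (a * ((Y ^ k).+1 + a * D ^ 2)))%N by apply: h.
rewrite -mulnn in h; apply: leq_trans h _; have e16 : ((4 ^ k) ^ 2 = 16 ^ k)%N by rewrite -expnM mulnC expnM.
rewrite e16 expnMn.
apply: eq_leq; ring.
Qed.
End BadCount.

(** * The second moment of the number of cubic pairs *)

Definition nat_sqrt (n : nat) : nat := find (fun w => w ^ 2 == n)%N (iota 0 n.+1).

Lemma nat_sqrtP n : is_square_nat n -> (nat_sqrt n ^ 2 = n)%N.
Proof.
move=> h; have := h; rewrite /is_square_nat has_find size_iota -/(nat_sqrt n) => hs.
by have /eqP := nth_find 0%N h; rewrite -/(nat_sqrt n) nth_iota.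
Qed.

Lemma sum_sq_le_nat (Z : nat) (x : nat -> nat) :
  ((\sum_(1 <= z < Z.+1) x z) ^ 2 <= Z * \sum_(1 <= z < Z.+1) x z ^ 2)%N.
Proof.
have := @sum_sq_le 'I_Z (fun i => (x i.+1)%:Z); rewrite card_ord !big_add1 !big_mkord /=.
have -> : \sum_(i < Z) (x i.+1)%:Z = (\sum_(i < Z) x i.+1)%N%:Z by rewrite (big_morph Posz PoszD (erefl _)).
have -> : \sum_(i < Z) (x i.+1)%:Z ^+ 2 = (\sum_(i < Z) x i.+1 ^ 2)%N%:Z.
  by rewrite (big_morph Posz PoszD (erefl _)); apply: eq_bigr => i _; rewrite PoszX.
by rewrite -PoszX -PoszM lez_nat.
Qed.

Lemma sum_divn_le V Z t : (forall n, (0 < n <= V)%N -> (tau n <= t)%N) ->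
  (\sum_(1 <= z < Z.+1) V %/ z <= V * t)%N.
Proof.
move=> h; have e z : (0 < z)%N -> (V %/ z = \sum_(1 <= n < V.+1 | z %| n) 1)%N.
  by move=> z0; rewrite [RHS](sum_multiples (fun=> 1%N) V z0) sum_nat_const_nat subSS subn0 muln1.
apply: (@leq_trans (\sum_(1 <= z < Z.+1) \sum_(1 <= n < V.+1 | z %| n) 1)%N).
  by rewrite big_nat [leqRHS]big_nat; apply: leq_sum => z /andP[z0 _]; rewrite e.
rewrite (exchange_big_dep predT) //=.
apply: (@leq_trans (\sum_(1 <= n < V.+1) t)%N); last by rewrite sum_nat_const_nat subSS subn0.
rewrite big_nat [leqRHS]big_nat; apply: leq_sum => n /andP[n0 nV].
apply: leq_trans (h n _); last by rewrite n0.
rewrite sum1_count -size_filter; apply: uniq_leq_size; first by rewrite filter_uniq ?iota_uniq.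
by move=> z; rewrite mem_filter -dvdn_divisors // => /andP[].
Qed.

Section Moment.
Variables (Ds : seq nat) (L V A Z t : nat).
Hypothesis uD : uniq Ds.
Hypothesis hD : forall d, d \in Ds -> [/\ squarefree d, (0 < d)%N, (L <= d)%N & (d < V ^ 2)%N].
Hypothesis hZ : forall z, (L * z ^ 2 <= 4 * A ^ 3)%N -> (z <= Z)%N.
Hypothesis tZ : forall z, (0 < z <= Z)%N -> (tau (z ^ 2) <= t)%N.
Hypothesis tA : forall n, (0 < n <= 4 * A ^ 3)%N -> (tau n <= t)%N.
Hypothesis tV : forall n, (0 < n <= V)%N -> (tau n <= t)%N.

Lemma size_cubic_pairs d : d \in Ds ->
  (size (cubic_pairs d A) <= \sum_(1 <= z < Z.+1) \sum_(1 <= a < A.+1) cubic_pair d a z)%N.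
Proof.
move=> /hD[_ _ Ld _].
apply: (@leq_trans (size [seq az <- [seq (a, z) | z <- iota 1 Z, a <- iota 1 A] | cubic_pair d az.1 az.2])).
  apply: uniq_leq_size.
    by rewrite filter_uniq // allpairs_uniq ?iota_uniq // => -[? ?] [? ?] _ _ [-> ->].
  move=> [a z]; rewrite !mem_filter /= => /andP[cp]; rewrite cp /= => /allpairsP[[a' z'] /= [ha hz [aE zE]]].
  rewrite -aE in ha.
  apply/allpairsP; exists (z, a); split=> //=; rewrite mem_iota add1n ltnS.
  case/and5P: cp => _ _ -> le _; apply: hZ; apply: leq_trans (leq_trans le _).
    by rewrite leq_mul2r Ld orbT.
  by move: ha; rewrite mem_iota add1n ltnS => /andP[_ aA]; rewrite leq_mul2l leq_exp2r.
rewrite size_filter -sum1_count [leqLHS]big_mkcond big_allpairs_dep /= /index_iota !subSS !subn0.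
by apply: eq_leq; apply: eq_bigr => z _; apply: eq_bigr => a _; case: cubic_pair.
Qed.

Lemma cubic_pair_sqrt d a z : cubic_pair d a z ->
  (nat_sqrt (4 * a ^ 3 - d * z ^ 2) ^ 2 + d * z ^ 2 = 4 * a ^ 3)%N.
Proof. by case/and5P => _ _ _ le /nat_sqrtP ->; rewrite subnK. Qed.

(** w is a square root of 4 a^3 modulo z^2, and d < V^2 confines it to an interval of length V z
    above the least w0, as (w - w0)^2 <= w^2 - w0^2. So there are about V / z periods, each with at
    most 6 tau(z^2) roots. *)
Lemma count_fixed a z : (0 < z <= Z)%N ->
  (\sum_(d <- Ds) cubic_pair d a z <= 6 * t * (V %/ z).+1)%N.
Proof.
move=> /andP[z0 zZ]; pose s := [seq d <- Ds | cubic_pair d a z].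
have -> : (\sum_(d <- Ds) cubic_pair d a z = size s)%N.
  by rewrite size_filter -sum1_count [RHS]big_mkcond; apply: eq_bigr => d _; case: cubic_pair.
have [->|sn] := eqVneq s [::]; first by [].
pose w d := nat_sqrt (4 * a ^ 3 - d * z ^ 2).
have sP d : d \in s -> [/\ cubic_pair d a z, (d < V ^ 2)%N & (w d ^ 2 + d * z ^ 2 = 4 * a ^ 3)%N].
  by rewrite mem_filter => /andP[cp /hD[_ _ _ dV]]; split=> //; exact: cubic_pair_sqrt.
have [cop oa] : coprime a z /\ odd a.
  have [d ds] : exists d, d \in s by case: (s) sn => // d ? _; exists d; rewrite mem_head.
  by have [/and5P[]] := sP d ds.
have exW : exists k, k \in map w s by case: (s) sn => // d ? _; exists (w d); rewrite mem_head.
have [w0 /mapP[d1 d1s w0E] w0min] := ex_minnP exW.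
have z20 : (0 < z ^ 2)%N by rewrite expn_gt0 z0.
pose k := (V %/ z).+1; pose P u := ((z ^ 2)%N%:Z %| (w0 + u)%N%:Z ^+ 2 - (4 * a ^ 3)%N%:Z)%Z.
have inj : {in s &, injective (fun d => w d - w0)%N}.
  move=> d d' ds ds' e; have [_ _ h] := sP d ds; have [_ _ h'] := sP d' ds'.
  have l1 := w0min _ (map_f w ds); have l2 := w0min _ (map_f w ds').
  have ww : w d = w d' by rewrite -(subnK l1) e subnK.
  by apply/eqP; rewrite -(eqn_pmul2r z20) -(eqn_add2l (w d ^ 2)) h ww h'.
have sub : (size s <= count P (iota 0 (z ^ 2 * k)))%N.
  rewrite -(size_map (fun d => w d - w0)%N) -size_filter; apply: uniq_leq_size.
    by rewrite map_inj_in_uniq // filter_uniq.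
  move=> _ /mapP[d ds ->]; have [_ dV h] := sP d ds; have l1 := w0min _ (map_f w ds).
  have [_ dV1 h1] := sP d1 d1s; rewrite -w0E in h1.
  rewrite mem_filter mem_iota add0n /P subnKC // leq0n /=; apply/andP; split.
    rewrite -h PoszD PoszX opprD addrA subrr sub0r rpredN PoszM; exact: dvdz_mull.
  have sq : ((w d - w0) ^ 2 < (V * z) ^ 2)%N.
    apply: (@leq_ltn_trans (w d ^ 2 - w0 ^ 2)).
      by rewrite leq_subRL ?leq_exp2r // -{2}(subnKC l1) sqrnD -addnA leq_add2l leq_addr.
    have : (d1 * z ^ 2 < V ^ 2 * z ^ 2)%N by rewrite ltn_pmul2r.
    by rewrite expnMn; lia.
  rewrite ltn_sqr in sq; apply: leq_trans sq _.
  by rewrite -mulnn -mulnA mulnC leq_pmul2l // mulnC ltnW // ltn_ceil.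
apply: leq_trans sub _.
have roots : (nroots (4 * a ^ 3)%N%:Z (z ^ 2) <= 6 * t)%N.
  apply: leq_trans (nroots_le z20 _) _; last by rewrite leq_mul2l tZ ?z0 // orbT.
  move=> h hz ha; have {}hz : (h %| z)%N by rewrite -(dvdn_pexp2r _ _ (isT : 0 < 2)%N).
  have {}ha : (h ^ 2 %| 16 * a ^ 3)%N.
    by move: ha; rewrite dvdzE /= => ha; rewrite -[16%N]/(4 * 4)%N -mulnA.
  have co : coprime (h ^ 2) (a ^ 3) by rewrite coprimeXl // coprimeXr // (coprime_dvdl hz) // coprime_sym.
  rewrite Gauss_dvdl // in ha; have : (h ^ 2 <= 4 ^ 2)%N by apply: dvdn_leq.
  by rewrite leq_sqr; lia.
apply: leq_trans (leq_mul (roots) (leqnn k)); rewrite [leqRHS]mulnC /nroots -[X in (_ <= _ * X)%N]size_filter.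
apply: (@count_fibers _ _ (fun u => (w0 + u) %% z ^ 2)%N) => [u _ Pu|r _].
  rewrite mem_filter mem_iota add0n ltn_mod z20 andbT /=.
  pose q := ((w0 + u) %/ z ^ 2)%N; set r := (_ %% _)%N.
  have -> : r%:Z ^+ 2 - (4 * a ^ 3)%N%:Z = ((w0 + u)%N%:Z ^+ 2 - (4 * a ^ 3)%N%:Z) - (z ^ 2)%N%:Z * (q%:Z * ((w0 + u)%N%:Z + r%:Z)).
    have -> : (w0 + u)%N%:Z = q%:Z * (z ^ 2)%N%:Z + r%:Z by rewrite {1}(divn_eq (w0 + u) (z ^ 2)) PoszD PoszM.
    by ring.
  by rewrite leq0n andbT; apply: rpredB => //; exact: dvdz_mulr.
have := @count_congr_le (fun u => P u && ((w0 + u) %% z ^ 2 == r)%N) (z ^ 2) k 0 z20; rewrite subn0; apply.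
move=> u v _ _ /andP[_ /eqP e1] /andP[_ /eqP e2].
by apply/eqP; rewrite -(eqn_modDl w0) e1 e2.
Qed.

(** Here (w - w')(w + w') = 4 a^3 - 4 a'^3. The divisor w - w' gives w and w', hence d z^2, hence d
    and z as d is square-free. *)
Lemma count_offdiag a a' : (a <= A)%N -> (a' < a)%N ->
  (\sum_(1 <= z < Z.+1) \sum_(d <- Ds) cubic_pair d a z * cubic_pair d a' z <= t)%N.
Proof.
move=> aA a'a; pose P := (4 * a ^ 3 - 4 * a' ^ 3)%N.
have lt3 : (4 * a' ^ 3 < 4 * a ^ 3)%N by rewrite ltn_pmul2l // ltn_exp2r.
have P0 : (0 < P)%N by rewrite subn_gt0.
apply: leq_trans (tA (_ : 0 < P <= _)%N); last first.
  by rewrite P0 (leq_trans (leq_subr _ _)) // leq_pmul2l // leq_exp2r.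
pose s := [seq zd <- [seq (z, d) | z <- iota 1 Z, d <- Ds] | cubic_pair zd.2 a zd.1 && cubic_pair zd.2 a' zd.1].
have -> : (\sum_(1 <= z < Z.+1) \sum_(d <- Ds) cubic_pair d a z * cubic_pair d a' z = size s)%N.
  rewrite size_filter -sum1_count [RHS]big_mkcond big_allpairs_dep /= /index_iota subSS subn0.
  by apply: eq_bigr => z _; apply: eq_bigr => d _; case: cubic_pair; case: cubic_pair.
pose w b (zd : nat * nat) := nat_sqrt (4 * b ^ 3 - zd.2 * zd.1 ^ 2).
have sP zd : zd \in s -> [/\ (0 < zd.1)%N, squarefree zd.2, (0 < zd.2)%N,
    (w a zd ^ 2 + zd.2 * zd.1 ^ 2 = 4 * a ^ 3)%N & (w a' zd ^ 2 + zd.2 * zd.1 ^ 2 = 4 * a' ^ 3)%N].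
  case: zd => z d; rewrite mem_filter /= => /andP[/andP[c c'] /allpairsP[[z' d'] /= [hz hd [zE dE]]]].
  rewrite -dE in hd; have [sf d0 _ _] := hD hd; split=> //; [by case/and5P: c|exact: cubic_pair_sqrt..].
have fac zd : zd \in s -> [/\ (w a' zd < w a zd)%N & ((w a zd - w a' zd) * (w a zd + w a' zd) = P)%N].
  by move=> /sP[_ _ _ h h']; rewrite -subn_sqr -ltn_sqr /P; split; lia.
rewrite /tau -(size_map (fun zd => w a zd - w a' zd)%N); apply: uniq_leq_size; last first.
  by move=> _ /mapP[zd /fac[_ h] ->]; rewrite -dvdn_divisors // -h dvdn_mulr.
rewrite map_inj_in_uniq; last first.
  move=> zd zd' hs hs' e; have [lt1 f1] := fac _ hs; have [lt2 f2] := fac _ hs'.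
  have e2 : (w a zd + w a' zd = w a zd' + w a' zd')%N.
    by apply/eqP; rewrite -(eqn_pmul2l (_ : 0 < w a zd - w a' zd)%N) ?subn_gt0 // f1 e f2.
  have e3 : w a zd = w a zd' by move: e e2 lt1 lt2; clear; lia.
  have [z0 sf d0 h _] := sP _ hs; have [z0' sf' d0' h' _] := sP _ hs'.
  have e4 : (zd.2 * zd.1 ^ 2 = zd'.2 * zd'.1 ^ 2)%N by apply/eqP; rewrite -(eqn_add2l (w a zd ^ 2)) h e3 h'.
  have zz : zd.1 = zd'.1.
    apply/eqP; rewrite eqn_dvd; apply/andP; split.
      by apply: (squarefree_dvdX sf') => //; rewrite mulnC -e4 dvdn_mull.
    by apply: (squarefree_dvdX sf) => //; rewrite mulnC e4 dvdn_mull.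
  have dd : zd.2 = zd'.2 by apply/eqP; rewrite -(eqn_pmul2r (_ : 0 < zd.1 ^ 2)%N) ?expn_gt0 ?z0 // e4 zz.
  by case: zd zd' zz dd {hs hs' e lt1 f1 lt2 f2 e2 e3 z0 sf d0 h z0' sf' d0' h' e4} => ? ? [? ?] /= -> ->.
by rewrite filter_uniq // allpairs_uniq ?iota_uniq // => -[? ?] [? ?] _ _ [-> ->].
Qed.

(** Cauchy-Schwarz is applied to the sum over z only, at the price Z; for fixed z the square splits
    into equal and distinct values of a. *)
Lemma moment_le : (\sum_(d <- Ds) size (cubic_pairs d A) ^ 2 <=
  Z * (A * (6 * t * (V * t + Z)) + A ^ 2 * t))%N.
Proof.
pose e d a z : nat := cubic_pair d a z.
apply: (@leq_trans (\sum_(d <- Ds) Z * \sum_(1 <= z < Z.+1) (\sum_(1 <= a < A.+1) e d a z) ^ 2)%N).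
  rewrite big_seq [leqRHS]big_seq; apply: leq_sum => d dD; apply: leq_trans (sum_sq_le_nat _ _).
  by rewrite leq_exp2r // size_cubic_pairs.
rewrite -big_distrr leq_mul2l; apply/orP; right => /=.
have sq d z : ((\sum_(1 <= a < A.+1) e d a z) ^ 2 =
    \sum_(1 <= a < A.+1) e d a z + \sum_(1 <= a < A.+1) \sum_(1 <= a' < A.+1 | a' != a) e d a z * e d a' z)%N.
  rewrite -mulnn big_distrl -big_split /=; apply: eq_big_nat => a ha; rewrite big_distrr /=.
  rewrite (bigD1_seq a) ?iota_uniq ?mem_index_iota //=; congr (_ + _)%N.
  by rewrite /e; case: cubic_pair.
under eq_bigr => d _ do under eq_bigr => z _ do rewrite sq.
under eq_bigr => d _ do rewrite big_split.
rewrite big_split leq_add //=.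
  under eq_bigr => d _ do rewrite exchange_big /=.
  rewrite exchange_big /=; apply: (@leq_trans (\sum_(1 <= a < A.+1) (6 * t * (V * t + Z)))%N); last first.
    by rewrite sum_nat_const_nat subSS subn0.
  apply: leq_sum => a _; rewrite exchange_big /=.
  apply: (@leq_trans (\sum_(1 <= z < Z.+1) 6 * t * (V %/ z).+1)%N).
    by rewrite big_nat [leqRHS]big_nat; apply: leq_sum => z hz; exact: count_fixed.
  rewrite -big_distrr leq_mul2l; apply/orP; right => /=.
  under eq_bigr => z _ do rewrite -addn1.
  by rewrite big_split /= leq_add ?sum_divn_le // sum_nat_const_nat subSS subn0 muln1.
under eq_bigr => d _ do rewrite exchange_big /=.
under eq_bigr => d _ do under eq_bigr => a _ do rewrite exchange_big /=.
rewrite exchange_big /=.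
apply: (@leq_trans (\sum_(1 <= a < A.+1) A * t)%N); last by rewrite sum_nat_const_nat subSS subn0 mulnA mulnn.
rewrite big_nat [leqRHS]big_nat; apply: leq_sum => a /andP[a0 aA].
rewrite exchange_big /=; apply: (@leq_trans (\sum_(1 <= a' < A.+1) t)%N); last by rewrite sum_nat_const_nat subSS subn0.
rewrite big_mkcond big_nat [leqRHS]big_nat; apply: leq_sum => a' /andP[a0' aA'].
case: (ltngtP a' a) => //= c; rewrite exchange_big /=; first exact: count_offdiag.
under eq_bigr => z _ do under eq_bigr => d _ do rewrite mulnC.
exact: count_offdiag.
Qed.
End Moment.

(** * Split and inert primes at different scales *)

Lemma leq_absorb (c y a b : nat) : (c <= y)%N -> (a < b)%N -> (c * y ^ a <= y ^ b)%N.
Proof.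
move=> cy ab; have [y0|y0] := posnP y; first by move: cy; rewrite y0 leqn0 => /eqP->; rewrite mul0n.
by apply: (@leq_trans (y ^ a.+1)); [rewrite expnS leq_mul2r cy orbT|rewrite leq_pexp2l].
Qed.

Lemma tau_small K : exists y0, forall y, (y0 <= y)%N -> forall n, (0 < n <= y ^ K)%N -> (4 * tau n <= y)%N.
Proof.
have [C C0 hC] := tau_pow_le K.+1; exists (4 ^ K.+1 * C)%N => y hy n /andP[n0 nK].
rewrite -(leq_exp2r _ _ (ltn0Sn K)) expnMn; apply: (@leq_trans (4 ^ K.+1 * (C * n))).
  by rewrite leq_mul2l hC // orbT.
by rewrite mulnA [(y ^ _)%N]expnS; apply: leq_mul.
Qed.

Lemma log_small J T : exists y0, forall y, (y0 <= y)%N -> forall j, (j <= J)%N ->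
  (T * (trunc_log 2 (y ^ j)).+1 < y)%N.
Proof.
pose K := (2 * J.+1)%N; exists (K ^ K + T ^ 2 + 1)%N => y hy j jJ; set e := trunc_log 2 _.
have y0 : (0 < y)%N by apply: leq_trans hy; rewrite addn1.
have he : (2 ^ e <= y ^ J)%N.
  by apply: (@leq_trans (y ^ j)); [apply: trunc_logP; rewrite ?expn_gt0 ?y0|rewrite leq_pexp2l].
have e2 : (e.+1 ^ 2 <= y)%N.
  rewrite -(leq_exp2r _ _ (ltn0Sn J)) -expnM -/K; apply: leq_trans (expn_le_pow2 K e) _.
  by rewrite expnS leq_mul //; lia.
have [h|h] := leqP e.+1 T.
  by apply: (@leq_ltn_trans (T * T)); [rewrite leq_mul2l h orbT|rewrite mulnn; lia].
by apply: leq_trans e2; rewrite -mulnn ltn_mul2r.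
Qed.

(** The primes 2 mod 3 up to y^j outnumber 10 y^(j-1). Nine shares go to the possible values of
    (-1/q) and (2/q), so one class is large; the tenth covers the prime 2. *)
Lemma many_primes (R : realType) J : exists y0, forall y, (y0 <= y)%N -> forall j, (0 < j <= J)%N ->
  exists (Q : seq nat) (e1 e2 : int), [/\ uniq Q, `|e1| <= 1, `|e2| <= 1, (y ^ j.-1 <= size Q)%N &
    forall q, q \in Q -> [/\ prime q, (2 < q)%N, (q <= y ^ j)%N, (q %% 3 = 2)%N &
      leg (- 1 : 'F_q) = e1 /\ leg (2%:R : 'F_q) = e2]].
Proof.
have [T [T0 hT]] := primes_2mod3_count R; have [y1 hy1] := log_small J (10 * T).
exists (y1 + T)%N => y hy j /andP[j0 jJ]; have Ty : (T <= y)%N by lia.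
have y0 : (0 < y)%N by lia.
pose P q := prime q && (q %% 3 == 2)%N.
pose cl (c : int * int) q := [&& P q, (2 < q)%N, leg (- 1 : 'F_q) == c.1 & leg (2%:R : 'F_q) == c.2].
pose cs : seq (int * int) := [seq (u, v) | u <- [:: 0; 1; - 1], v <- [:: 0; 1; - 1]].
pose Qc c := [seq q <- iota 0 (y ^ j).+1 | cl c q].
have [/hasP[c cC hc]|/hasPn no] := boolP (has (fun c => y ^ j.-1 <= size (Qc c))%N cs).
  exists (Qc c), c.1, c.2.
  have [h1 h2] : `|c.1| <= 1 /\ `|c.2| <= 1.
    by move: cC => /allpairsP[[u v] /= [hu hv ->]]; move: hu hv; rewrite !inE => /or3P[]/eqP-> /or3P[]/eqP->.
  split=> //; first by rewrite filter_uniq ?iota_uniq.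
  move=> q; rewrite mem_filter mem_iota => /andP[/and4P[/andP[qp /eqP q3] q2 /eqP l1 /eqP l2] /andP[_ qY]].
  by split.
have yj : (y ^ j = y * y ^ j.-1)%N by rewrite -expnS prednK.
have TY : (T <= y ^ j)%N by apply: leq_trans Ty _; rewrite -{1}(expn1 y) leq_pexp2l.
have cnt : (count P (iota 0 (y ^ j).+1) <= 10 * y ^ j.-1)%N.
  have -> : count P (iota 0 (y ^ j).+1) = (count (fun q => P q && (2 < q)%N) (iota 0 (y ^ j).+1)
      + count (fun q => P q && ~~ (2 < q)%N) (iota 0 (y ^ j).+1))%N.
    by rewrite -!sum1_count (bigID (fun q => 2 < q)%N).
  rewrite -[10%N]/(9 + 1)%N mulnDl leq_add //.
    rewrite mulnC; have -> : (9 = size cs)%N by [].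
    apply: (@count_fibers _ _ (fun q => (leg (- 1 : 'F_q), leg (2%:R : 'F_q)))) => [q _ _|c cC].
      by apply/allpairsP; exists (leg (- 1 : 'F_q), leg (2%:R : 'F_q)); split=> //; exact: leg_val.
    have := no c cC; rewrite -ltnNge => /ltnW; rewrite size_filter; apply: leq_trans.
    by apply: sub_count => q /= /andP[/andP[Pq q2] /eqP <-]; rewrite /cl Pq q2 !eqxx.
  rewrite mul1n; apply: (@leq_trans 1); last by rewrite expn_gt0 y0.
  rewrite -size_filter; apply: (@uniq_leq_size _ _ [:: 2%N]); first by rewrite filter_uniq ?iota_uniq.
  move=> q; rewrite mem_filter -leqNgt inE => /andP[/andP[/andP[qp _] q2] _].
  by rewrite inE eqn_leq q2 prime_gt1.
have h1 : (10 * T * (trunc_log 2 (y ^ j)).+1 < y)%N by apply: hy1 => //; lia.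
have := hT _ TY; rewrite leqNgt => /negP[].
apply: (@leq_ltn_trans (10 * T * (trunc_log 2 (y ^ j)).+1 * y ^ j.-1)).
  apply: leq_trans (_ : T * (trunc_log 2 (y ^ j)).+1 * (10 * y ^ j.-1) <= _)%N; first by apply: leq_mul.
  by apply: eq_leq; ring.
by rewrite [X in (_ < X)%N]yj ltn_pmul2r // expn_gt0 y0.
Qed.

Lemma nroots_sum (N : int) S t :
  (forall h, ((h ^ 2)%N%:Z %| 4 * N)%Z -> (h <= 6)%N) ->
  (forall c, (0 < c <= S)%N -> (tau c <= t)%N) ->
  (\sum_(1 <= c < S.+1) nroots N c <= S * (6 * t))%N.
Proof.
move=> hN ht; apply: (@leq_trans (\sum_(1 <= c < S.+1) 6 * t)%N); last by rewrite sum_nat_const_nat subSS subn0.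
rewrite big_nat [leqRHS]big_nat; apply: leq_sum => c /andP[c0 cS].
apply: leq_trans (nroots_le c0 _) _; first by move=> h _; apply: hN.
by rewrite leq_mul2l ht // c0.
Qed.

Lemma leg_split d q : prime q -> (2 < q)%N -> leg ((- d%:Z)%:~R : 'F_q) = 1 ->
  ~~ (q %| d)%N /\ exists r : nat, (q %| r ^ 2 + d)%N.
Proof.
move=> qp q2 l1; have Fq := pchar_Fp qp; split.
  have : leg ((- d%:Z)%:~R : 'F_q) != 0 by rewrite l1.
  by rewrite leg_eq0 (intr_pchar _ Fq) dvdzE abszN.
have [r hr] := leg_sqrt qp q2 l1; exists r.
by move: hr; rewrite opprK dvdzE -PoszX -PoszD.
Qed.

Lemma leg_ram d q : prime q -> leg ((- d%:Z)%:~R : 'F_q) = 0 -> (q %| d)%N.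
Proof.
by move=> qp /eqP; rewrite leg_eq0 (intr_pchar _ (pchar_Fp qp)) dvdzE abszN.
Qed.

(** q = 2 mod 3 makes -3 a non-residue, by reciprocity with 3; so 3 d = (-3)(-d) is a residue when
    -d is not. *)
Lemma leg_inert d q : prime q -> (2 < q)%N -> (q %% 3 = 2)%N -> leg ((- d%:Z)%:~R : 'F_q) = - 1 ->
  [/\ ~~ (q %| 6 * d)%N, forall r : nat, ~~ (q %| r ^ 2 + d)%N &
    exists t : int, (q%:Z %| t ^+ 2 - (3 * d)%N%:Z)%Z].
Proof.
move=> qp q2 q3 l1; have Fq := pchar_Fp qp.
have qd : ~~ (q%:Z %| - d%:Z)%Z.
  have : leg ((- d%:Z)%:~R : 'F_q) != 0 by rewrite l1.
  by rewrite leg_eq0 (intr_pchar _ Fq).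
have qn3 : (3 != q)%N by apply/eqP => e; rewrite -e in q3.
split.
- apply/negP; rewrite Euclid_dvdM // => /orP[|h]; last by move: qd; rewrite dvdzE abszN h.
  rewrite -[6%N]/(2 * 3)%N Euclid_dvdM // (dvdn_prime2 qp (isT : prime 2)) (dvdn_prime2 qp (isT : prime 3)).
  by rewrite gtn_eqF //= eq_sym (negPf qn3).
- move=> r; apply/negP => h; have := @leg_of_sqrt q qp q2 (- d%:Z) r%:Z qd.
  rewrite l1 opprK -PoszX -PoszD dvdzE => /(_ h); by [].
have l3 : leg ((- 3)%:~R : 'F_q) = - 1.
  have e : leg (3%:R : 'F_q) = leg (- 1 : 'F_q) * - 1.
    rewrite (quadratic_reciprocity (isT : prime 3) qp) //.
    have -> : leg (- 1 : 'F_3) = - 1 by [].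
    rewrite rmorphN1; congr (_ * _).
    have -> : q%:R = 2%:R :> 'F_3.
      rewrite {1}(divn_eq q 3) q3 natrD natrM (_ : 3%:R = 0 :> 'F_3) ?mulr0 ?add0r //.
      by apply/eqP.
    by [].
  rewrite (_ : (- 3)%:~R = - 1 * 3%:R :> 'F_q); last by rewrite mulN1r rmorphN.
  rewrite legM // e mulrA.
  have := leg_val (- 1 : 'F_q); have : leg (- 1 : 'F_q) != 0 by rewrite leg_eq0 oppr_eq0 oner_eq0.
  by rewrite !inE => l0 /or3P[]/eqP h; rewrite h in l0 *.
have l9 : leg ((3 * d)%N%:Z%:~R : 'F_q) = 1.
  have -> : (3 * d)%N%:Z%:~R = (- 3)%:~R * (- d%:Z)%:~R :> 'F_q by rewrite -intrM PoszM; congr (_%:~R); ring.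
  by rewrite legM // l3 l1.
by have [r hr] := leg_sqrt qp q2 l9; exists r%:Z.
Qed.

(** * One block of d between y^(12m) and (y+1)^(12m) *)

Section Block.
Variables (R : realType) (m y : nat).
Let V := (y.+1 ^ (6 * m))%N.
Variables (Q : nat -> seq nat) (e1 e2 : nat -> int).
Hypothesis m3 : (3 <= m)%N.
Hypothesis yc : (1000 + 48 * (4 * 54 ^ 2) <= y)%N.
Hypothesis VE : (V <= y ^ (6 * m).+1)%N.
Hypothesis tauE : forall n, (0 < n <= y ^ (24 * m + 2))%N -> (4 * tau n <= y)%N.
Hypothesis uQ : forall j, (0 < j <= 4 * m)%N -> uniq (Q j).
Hypothesis hQ1 : forall j, (0 < j <= 4 * m)%N -> `|e1 j| <= 1 /\ `|e2 j| <= 1.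
Hypothesis sQ : forall j, (0 < j <= 4 * m)%N -> (y ^ j.-1 <= size (Q j))%N.
Hypothesis hQ : forall j q, (0 < j <= 4 * m)%N -> q \in Q j ->
  [/\ prime q, (2 < q)%N, (q <= y ^ j)%N, (q %% 3 = 2)%N &
      leg (- 1 : 'F_q) = e1 j /\ leg (2%:R : 'F_q) = e2 j].

Let y0 : (0 < y)%N. Proof. by move: yc; case: (y). Qed.

Definition block_mem (d : nat) : Prop := [/\ squarefree d, (y ^ (12 * m) <= d)%N & (d < V ^ 2)%N].

Let chi d q := leg ((- d%:Z)%:~R : 'F_q).
Let spl j d := [seq q <- Q j | chi d q == 1].
Let ine j d := [seq q <- Q j | chi d q == - 1].
Let ram j d := [seq q <- Q j | chi d q == 0].

Lemma chi_count j d : (size (spl j d) + size (ine j d) + size (ram j d) = size (Q j))%N.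
Proof.
rewrite !size_filter; elim: (Q j) => //= q s <-.
by have := leg_val ((- d%:Z)%:~R : 'F_q); rewrite -/(chi d q) !inE => /or3P[]/eqP->; rewrite /=; lia.
Qed.

Lemma chi_sum j d : \sum_(q <- Q j) chi d q = (size (spl j d))%:Z - (size (ine j d))%:Z.
Proof.
rewrite !size_filter; elim: (Q j) => [|q s IH]; first by rewrite big_nil.
rewrite big_cons IH /=.
by have := leg_val ((- d%:Z)%:~R : 'F_q); rewrite -/(chi d q) !inE => /or3P[]/eqP->; rewrite /=; lia.
Qed.

Lemma block_le d n : block_mem d -> (d <= n)%N -> (n <= 4 * d)%N -> (n <= y ^ (12 * m + 3))%N.
Proof.
move=> [_ _ dV] _ h; apply: leq_trans h _; apply: (@leq_trans (4 * (y ^ (6 * m).+1) ^ 2)).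
  by rewrite leq_mul2l ltnW ?orbT // (leq_trans dV) // leq_sqr.
rewrite -expnM; apply: leq_absorb; first by move: yc; clear; lia.
by clear; lia.
Qed.

Lemma block_gt0 d : block_mem d -> (0 < d)%N.
Proof. by case=> _ h _; apply: leq_trans h; rewrite expn_gt0 y0. Qed.

(** Primes with symbol 0 are among the divisors of d. *)
Lemma ram_small j d : (0 < j <= 4 * m)%N -> block_mem d -> (4 * size (ram j d) <= y)%N.
Proof.
move=> hj bd; have d0 := block_gt0 bd.
apply: leq_trans (tauE (n := d) _); last first.
  rewrite d0 (leq_trans (block_le bd (leqnn d) (leq_pmull d _))) // leq_pexp2l //.
  by move: m3; clear; lia.
rewrite leq_mul2l /=; apply: uniq_leq_size; first by rewrite filter_uniq // uQ.
move=> q; rewrite mem_filter => /andP[/eqP l0 /(hQ hj)[qp _ _ _ _]].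
by rewrite -dvdn_divisors // (leg_ram qp).
Qed.

Lemma two_V_le : (2 * V <= y ^ (6 * m + 2))%N.
Proof.
apply: (@leq_trans (2 * y ^ (6 * m).+1)); first by rewrite leq_mul2l VE.
by apply: leq_absorb; [move: yc; clear|clear]; lia.
Qed.

Lemma sum_nroots_le d (N : int) : squarefree d ->
  N = - d%:Z \/ N = (3 * d)%N%:Z -> (\sum_(1 <= c < (2 * V).+1) nroots N c <= 3 * y ^ (6 * m + 3))%N.
Proof.
move=> sf hN.
have t1 c : (0 < c <= 2 * V)%N -> (4 * tau c <= y)%N.
  move=> /andP[c0 cV]; apply: tauE; rewrite c0 (leq_trans cV) // (leq_trans two_V_le) // leq_pexp2l //.
  by clear; lia.
apply: leq_trans (@nroots_sum N (2 * V) (y %/ 4) _ _) _.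
- move=> h hh; suff : (h %| 6)%N by move/dvdn_leq; apply.
  apply: (squarefree_dvdX sf) => //; case: hN hh => ->; rewrite dvdzE abszM ?abszN /= => hh.
    by apply: dvdn_trans hh _; rewrite -[(6 ^ 2)%N]/(9 * 4)%N -mulnA dvdn_mull.
  by apply: dvdn_trans hh _; rewrite -[(6 ^ 2)%N]/(3 * (4 * 3))%N mulnA -!mulnA dvdn_mull.
- by move=> c /t1 h; rewrite leq_divRL // mulnC.
apply: (@leq_trans (y ^ (6 * m + 2) * (3 * y))); last by rewrite mulnCA -expnSr -addnS.
apply: leq_mul; first exact: two_V_le.
by have := leq_trunc_div y 4; clear; lia.
Qed.

Lemma split_scale j d : (0 < j <= 4 * m)%N -> block_mem d -> (size (Q j) <= 4 * size (spl j d))%N ->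
  (h3 d * y ^ (2 * j) <= y ^ (6 * m + 6) * (y ^ j + size (cubic_pairs d (y ^ (2 * j)))))%N.
Proof.
move=> hj bd hs; have d0 := block_gt0 bd; have [sf d1 d2] := bd.
have [I [x [g cf]]] := class_family_exists d0 sf.
set E := size _; set M := size (spl j d) in hs.
have SB := @split_bound d d0 sf _ I x g cf (spl j d) (y ^ (2 * j)) (2 * V).
have {}SB : (h3 d * M ^ 2 <= 3 * y ^ (6 * m + 3) * (M + 2 * E))%N.
  apply: leq_trans (SB _ _ _ _) _.
  - by rewrite filter_uniq // uQ.
  - move=> b; rewrite mem_filter => /andP[/eqP l1 /(hQ hj)[bp b2 _ _ _]].
    by have [? ?] := leg_split bp b2 l1.
  - move=> b b'; rewrite !mem_filter => /andP[_ /(hQ hj)[_ _ h _ _]] /andP[_ /(hQ hj)[_ _ h' _ _]].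
    by rewrite mul2n -addnn expnD leq_mul.
  - move=> c hc; rewrite -leq_sqr expnMn; move: hc d2; clear; lia.
  by rewrite leq_mul2r; apply/orP; right; apply: (sum_nroots_le sf); left.
have My : (M <= y ^ j)%N.
  rewrite /M -(size_iota 1 (y ^ j)); apply: uniq_leq_size; first by rewrite filter_uniq // uQ.
  move=> q; rewrite mem_filter => /andP[_ /(hQ hj)[qp _ qy _ _]].
  by rewrite mem_iota prime_gt0 //= add1n ltnS.
have yM : (y ^ j <= y * (4 * M))%N.
  have -> : (y ^ j = y * y ^ j.-1)%N by rewrite -expnS prednK //; case/andP: hj.
  by rewrite leq_mul2l (leq_trans (sQ hj) hs) orbT.
apply: (@leq_trans (h3 d * (y * (4 * M)) ^ 2)).
  by rewrite leq_mul2l mulnC expnM leq_sqr yM orbT.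
have -> : (h3 d * (y * (4 * M)) ^ 2 = (16 * y ^ 2) * (h3 d * M ^ 2))%N by rewrite !expnMn; ring.
apply: (@leq_trans (16 * y ^ 2 * (3 * y ^ (6 * m + 3) * (2 * (y ^ j + E))))).
  rewrite leq_mul2l; apply/orP; right; apply: leq_trans SB _; rewrite leq_mul2l; apply/orP; right.
  by move: My; clear; lia.
have -> : (16 * y ^ 2 * (3 * y ^ (6 * m + 3) * (2 * (y ^ j + E))) = 96 * y ^ (6 * m + 5) * (y ^ j + E))%N.
  by rewrite (_ : 6 * m + 5 = 2 + (6 * m + 3))%N; [rewrite [in RHS]expnD; ring|lia].
by rewrite leq_mul2r leq_absorb ?orbT //; [move: yc|]; clear; lia.
Qed.

(** A pair requires d <= 4 y^(6j), whereas d >= y^(12m). *)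
Lemma no_cubic_pairs j d : (j < 2 * m)%N -> block_mem d -> size (cubic_pairs d (y ^ (2 * j))) = 0%N.
Proof.
move=> jm [_ d1 _]; apply/eqP; rewrite size_eq0 -(negbK (_ == _)) -has_filter -all_predC.
apply/allP => -[a z] /allpairsP[[a' z'] /= [ha hz [-> ->]]]; apply/negP => /and5P[_ _ z0 h _].
have aA : (a' <= y ^ (2 * j))%N by move: ha; rewrite mem_iota add1n ltnS => /andP[].
have : (y ^ (12 * m) <= 4 * y ^ (6 * j))%N.
  apply: leq_trans d1 (leq_trans _ (leq_trans h _)).
    by rewrite leq_pmulr // expn_gt0 z0.
  have -> : (y ^ (6 * j) = (y ^ (2 * j)) ^ 3)%N by rewrite -expnM; congr expn; lia.
  by rewrite leq_mul2l leq_exp2r.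
rewrite leqNgt => /negP; apply.
apply: (@leq_trans (5 * y ^ (6 * j))); first by rewrite ltn_pmul2r // expn_gt0 y0.
by apply: leq_absorb; [move: yc|move: jm]; clear; lia.
Qed.

(** The scale m - 1 is the largest that this bound permits: S q^6 is at most y^(6m+2) y^(6m-6),
    which is below d. *)
Lemma inert_scale d : block_mem d -> (size (Q m.-1) <= 4 * size (ine m.-1 d))%N ->
  (h3 d <= y ^ (5 * m + 6))%N.
Proof.
move=> bd hs; have d0 := block_gt0 bd; have [sf d1 d2] := bd.
have hj : (0 < m.-1 <= 4 * m)%N by move: m3; clear; lia.
have [I [x [g cf]]] := class_family_exists d0 sf.
set M := size (ine m.-1 d) in hs.
have IB : (h3 d * M <= 4 * 54 ^ 2 * (3 * y ^ (6 * m + 3)))%N.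
  apply: leq_trans (@inert_bound d d0 sf R (2 * V) _ I x g (ine m.-1 d) cf _ _ _ _) _.
  - move=> t; apply/eqP => t2; have t3 : (3 %| t)%Z.
      apply: (@prime_dvdzX 3 t 2) => //; rewrite t2 PoszM; exact: dvdz_mulr.
    have [u uE] := dvdzP t3.
    have du : d = (3 * `|u| ^ 2)%N.
      apply/eqP; rewrite -eqz_nat PoszM PoszX abszE real_normK ?num_real //; apply/eqP.
      apply: (mulfI (isT : (3 : int) != 0)); rewrite -[3 * d%:Z]/((3%N)%:Z * d%:Z) -PoszM -t2 uE; ring.
    have u1 : `|u|%N = 1%N by apply: sf; rewrite du dvdn_mull.
    have : (y ^ 1 <= d)%N by apply: leq_trans d1; rewrite leq_pexp2l //; move: m3; clear; lia.
    by rewrite du u1; move: yc; clear; lia.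
  - by move: d2; rewrite expnMn; clear; lia.
  - by rewrite filter_uniq // uQ.
  - move=> q; rewrite mem_filter => /andP[/eqP l1 /(hQ hj)[qp q2 qy q3 _]].
    have [h1 h2 h4] := leg_inert qp q2 q3 l1; split=> //.
    apply: (@leq_ltn_trans (y ^ (6 * m + 2) * (y ^ m.-1) ^ 6)).
      by apply: leq_mul; [exact: two_V_le|rewrite leq_exp2r].
    rewrite -expnM -expnD; apply: (@leq_ltn_trans d); last by move: d0; clear; lia.
    by apply: leq_trans d1; rewrite leq_pexp2l //; move: m3; clear; lia.
  rewrite leq_mul2l; apply/orP; right; apply: (sum_nroots_le sf); by right.
have yM : (y ^ m.-2 <= 4 * M)%N by apply: leq_trans hs; apply: sQ.
have : (h3 d * y ^ m.-2 <= y ^ (5 * m + 6) * y ^ m.-2)%N.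
  apply: (@leq_trans (h3 d * (4 * M))); first by rewrite leq_mul2l yM orbT.
  rewrite mulnCA; apply: (@leq_trans (4 * (4 * 54 ^ 2 * (3 * y ^ (6 * m + 3))))); first by rewrite leq_mul2l IB.
  have -> : (4 * (4 * 54 ^ 2 * (3 * y ^ (6 * m + 3))) = 12 * (4 * 54 ^ 2) * y ^ (6 * m + 3))%N by ring.
  rewrite -expnD; apply: leq_absorb; last by move: m3; clear; lia.
  by move: yc; move: (4 * 54 ^ 2)%N; clear; lia.
by rewrite leq_pmul2r // expn_gt0 y0.
Qed.

(** At the scale m - 1 there are no cubic pairs, and as few primes ramify, at least a quarter are
    inert or at least a quarter split. *)
Lemma h3_pointwise d : block_mem d -> (h3 d <= y ^ (5 * m + 7))%N.
Proof.
move=> bd; have hj : (0 < m.-1 <= 4 * m)%N by move: m3; clear; lia.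
have [hi|hi] := leqP (size (Q m.-1)) (4 * size (ine m.-1 d)).
  by apply: leq_trans (inert_scale bd hi) _; rewrite leq_pexp2l //; clear; lia.
have hs : (size (Q m.-1) <= 4 * size (spl m.-1 d))%N.
  have := ram_small hj bd; have := chi_count m.-1 d.
  have : (y <= size (Q m.-1))%N.
    by apply: leq_trans (sQ hj); rewrite -{1}(expn1 y) leq_pexp2l //; move: m3; clear; lia.
  by move: hi; clear; lia.
have := split_scale hj bd hs; rewrite no_cubic_pairs //; last by move: m3; clear; lia.
rewrite addn0 -expnD => h; have yj : (0 < y ^ (2 * m.-1))%N by rewrite expn_gt0 y0.
rewrite -(leq_pmul2r yj) -expnD; apply: leq_trans h _; rewrite leq_pexp2l //; move: m3; clear; lia.
Qed.

Definition bad j d : bool := ((size (Q j))%:Z <= 4 * `|\sum_(q <- Q j) leg ((- d%:Z)%:~R : 'F_q)|).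

(** A character sum below |Q| / 4 in absolute value, together with few ramified primes, leaves at
    least a quarter of the primes split. *)
Lemma good_scale j d : (1 < j <= 4 * m)%N -> block_mem d -> ~~ bad j d ->
  (h3 d * y ^ (2 * j) <= y ^ (6 * m + 6) * (y ^ j + size (cubic_pairs d (y ^ (2 * j)))))%N.
Proof.
move=> /andP[j1 jm] bd nb; have hj : (0 < j <= 4 * m)%N by rewrite jm (ltnW j1).
apply: split_scale => //; have := ram_small hj bd; have := chi_count j d.
have : (y <= size (Q j))%N.
  by apply: leq_trans (sQ hj); rewrite -{1}(expn1 y) leq_pexp2l //; move: j1; clear; lia.
move: nb; rewrite /bad (chi_sum j d); clear; lia.
Qed.

(* The exponent is kept abstract, so that (16 * k) ^ k is never evaluated. *)
Variable k : nat.
Hypothesis kE : k = 20%N.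
Hypothesis yk : (4 * (16 * k) ^ k <= y)%N.
Hypothesis ym : (2 * m + 2 <= y)%N.
Variable Ds : seq nat.
Hypothesis uD : uniq Ds.
Hypothesis hD : forall d, d \in Ds -> block_mem d.

Lemma absorb_small a n q w u e : (0 < q)%N -> (0 < w)%N -> (a * q <= n * (w.+1 + a * e))%N ->
  (2 * n * e <= q)%N -> (w <= q * u)%N -> (a <= 4 * n * u)%N.
Proof.
move=> q0 w0 h1 h2 h3; rewrite -(leq_pmul2r q0).
have h4 : (a * (2 * n * e) <= a * q)%N by rewrite leq_mul2l h2 orbT.
have h5 : (n * w <= n * (q * u))%N by rewrite leq_mul2l h3 orbT.
have h6 : (n * w.+1 <= n * (2 * w))%N by rewrite leq_mul2l; apply/orP; right; lia.
have h7 : (n * (w.+1 + a * e) = n * w.+1 + n * (a * e))%N by rewrite mulnDr.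
have h8 : (a * (2 * n * e) = 2 * (n * (a * e)))%N by ring.
have h9 : (4 * n * u * q = 4 * (n * (q * u)))%N by ring.
have h10 : (n * (2 * w) = 2 * (n * w))%N by ring.
by rewrite h9; move: h1 h4 h5 h6 h7 h8 h10; clear; lia.
Qed.

(** The sieve needs |Q|^k to exceed y^(24m+5). With |Q| >= y^(j-1) and j >= 2m - 1 this reads k (2m
    - 2) >= 24m + 5, and k = 20 suffices for all m >= 3. What remains is Y^k / |Q|^k <= y^20 times
    constants, for each parity of d. *)
Lemma bad_few j : (2 * m - 1 <= j <= 4 * m)%N -> (count (bad j) Ds <= y ^ 22)%N.
Proof.
move=> /andP[j1 j2]; have hj : (0 < j <= 4 * m)%N by move: j1 j2 m3; clear; lia.
have main par : (count (fun d => bad j d && (odd d == par)) Ds <= y ^ 21)%N.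
  rewrite -size_filter; set A := [seq d <- Ds | _].
  have [E1 E2] := hQ1 hj.
  have BC := @bad_count k (y ^ j) (V ^ 2) (Q j) A (e1 j) (e2 j) par.
  have {}BC : (size A * size (Q j) ^ k <= (16 * k) ^ k * (((y ^ j) ^ k).+1 + size A * (V ^ 2) ^ 2))%N.
    apply: BC => //; [exact: uQ|by rewrite filter_uniq|by rewrite kE|by move=> q /(hQ hj)[? ? ? _ []]|].
    move=> d; rewrite mem_filter => /andP[/andP[bd /eqP od] /hD hd]; have [sf _ dV] := hd.
    by split=> //; rewrite block_gt0 // ltnW.
  have Qy : (y ^ (j.-1 * k) <= size (Q j) ^ k)%N by rewrite expnM leq_exp2r ?kE ?sQ.
  apply: leq_trans (absorb_small (u := (y ^ k)%N) _ _ BC _ _) _.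
  - by apply: leq_trans Qy; rewrite expn_gt0 y0.
  - by rewrite -expnM expn_gt0 y0.
  - apply: leq_trans Qy; apply: (@leq_trans (2 * (16 * k) ^ k * y ^ (24 * m + 4))).
      rewrite leq_mul2l; apply/orP; right; rewrite -expnM.
      apply: (@leq_trans ((y ^ (6 * m).+1) ^ 4)); first by rewrite leq_exp2r.
      by rewrite -expnM leq_pexp2l //; clear; lia.
    apply: leq_absorb; first by move: yk; clear; lia.
    by rewrite kE; move: j1 m3; clear; lia.
  - by rewrite -expnM (_ : j * k = j.-1 * k + k)%N ?expnD ?leq_mul2r ?Qy ?orbT // -mulSnr prednK //; case/andP: hj.
  by apply: leq_absorb => //; rewrite kE.
rewrite (_ : count _ _ = count (fun d => bad j d && (odd d == true)) Ds + count (fun d => bad j d && (odd d == false)) Ds)%N.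
  apply: leq_trans (leq_add (main true) (main false)) _; rewrite addnn -mul2n leq_absorb //.
  by move: yc; clear; lia.
rewrite -!sum1_count (bigID odd) /=; congr (_ + _)%N; apply: eq_bigl => d; first by rewrite eqb_id.
by rewrite eqbF_neg.
Qed.

Let E j d := size (cubic_pairs d (y ^ (2 * j))).

(** Take the least scale j with h3 y^j > 2 y^(6m+6). There the split bound forces E > y^j, so j >=
    2m, and h3 y^(2j) <= 2 y^(6m+6) E; minimality gives h3 y^j <= 2 y^(6m+7). The product of the
    squares of these two bounds is h3^4 y^(6j). If no such j exists, h3 is at most 2 y^(2m+6). *)
Lemma h3_pow4 d : block_mem d -> (forall j, (2 * m - 1 <= j <= 4 * m)%N -> ~~ bad j d) ->
  (h3 d ^ 4 <= y ^ (8 * m + 25) + \sum_(2 * m <= j < (4 * m).+1) y ^ (24 * m - 6 * j + 27) * E j d ^ 2)%N.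
Proof.
move=> bd gd; pose P j := [&& (2 * m - 1 <= j)%N, (j <= 4 * m)%N & (2 * y ^ (6 * m + 6) < h3 d * y ^ j)%N].
have gs j : (2 * m - 1 <= j <= 4 * m)%N -> (h3 d * y ^ (2 * j) <= y ^ (6 * m + 6) * (y ^ j + E j d))%N.
  by move=> hj; apply: good_scale => //; [move: hj m3; clear; lia|exact: gd].
have [/hasP[j1 _ Pj1]|/hasPn no] := boolP (has P (iota 0 (4 * m).+1)); last first.
  apply: leq_trans (leq_addr _ _).
  have : ~~ P (4 * m)%N by apply: no; rewrite mem_iota add0n ltnS leqnn.
  rewrite /P leqnn /= (_ : 2 * m - 1 <= 4 * m)%N /= -?leqNgt; last by clear; lia.
  rewrite (_ : 6 * m + 6 = (2 * m + 6) + 4 * m)%N; last by lia.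
  rewrite expnD mulnA leq_pmul2r ?expn_gt0 ?y0 // => h.
  apply: (@leq_trans ((2 * y ^ (2 * m + 6)) ^ 4)); first by rewrite leq_exp2r.
  rewrite expnMn -expnM; apply: leq_absorb; [move: yc; clear|clear]; lia.
have [j /and3P[l1 l2 lt] jmin] := ex_minnP (ex_intro P j1 Pj1).
have hs := gs j (_ : 2 * m - 1 <= j <= 4 * m)%N; rewrite l1 l2 in hs; move: (hs isT) => {}hs.
have y2 : (y ^ (2 * j) = y ^ j * y ^ j)%N by rewrite -expnD addnn mul2n.
have yp n : (0 < y ^ n)%N by rewrite expn_gt0 y0.
have hE : (y ^ j < E j d)%N.
  have : (y ^ (6 * m + 6) * (2 * y ^ j) < y ^ (6 * m + 6) * (y ^ j + E j d))%N.
    apply: leq_trans hs; have -> : (y ^ (6 * m + 6) * (2 * y ^ j) = 2 * y ^ (6 * m + 6) * y ^ j)%N by ring.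
    by rewrite y2 [(h3 d * (_ * _))%N]mulnA ltn_pmul2r.
  by rewrite ltn_pmul2l // mul2n -addnn ltn_add2l.
have j2m : (2 * m <= j)%N.
  have [//|c] := leqP (2 * m) j; move: hE; rewrite /E no_cubic_pairs //.
have h1 : (h3 d * y ^ j <= 2 * y ^ (6 * m + 7))%N.
  have : ~~ P j.-1 by apply/negP => /jmin; move: j2m m3; clear; lia.
  rewrite /P (_ : 2 * m - 1 <= j.-1)%N /=; last by move: j2m; clear; lia.
  rewrite (_ : j.-1 <= 4 * m)%N /= -?leqNgt; last by move: l2; clear; lia.
  move=> h; rewrite -(prednK (_ : 0 < j)%N); last by move: j2m m3; clear; lia.
  by rewrite expnSr mulnA addnS expnSr mulnA leq_mul2r h orbT.
have h2 : (h3 d * y ^ (2 * j) <= 2 * y ^ (6 * m + 6) * E j d)%N.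
  by apply: leq_trans hs _; rewrite -mulnA mulnCA leq_mul2l; apply/orP; right; move: hE; clear; lia.
apply: leq_trans (leq_addl _ _); rewrite (bigD1_seq j) ?iota_uniq //=; last by rewrite mem_index_iota j2m ltnS.
apply: leq_trans (leq_addr _ _); rewrite -(leq_pmul2r (yp (6 * j)%N)).
have -> : (h3 d ^ 4 * y ^ (6 * j) = (h3 d * y ^ (2 * j)) ^ 2 * (h3 d * y ^ j) ^ 2)%N.
  by rewrite y2 (_ : 6 * j = j * 6)%N ?expnM; [ring|lia].
apply: leq_trans (leq_mul (_ : _ <= (2 * y ^ (6 * m + 6) * E j d) ^ 2)%N (_ : _ <= (2 * y ^ (6 * m + 7)) ^ 2)%N) _.
- by rewrite leq_sqr.
- by rewrite leq_sqr.
have -> : ((2 * y ^ (6 * m + 6) * E j d) ^ 2 * (2 * y ^ (6 * m + 7)) ^ 2 = 16 * y ^ (24 * m + 26) * E j d ^ 2)%N.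
  have -> : (y ^ (24 * m + 26) = (y ^ (6 * m + 6)) ^ 2 * (y ^ (6 * m + 7)) ^ 2)%N.
    by rewrite -!expnM -expnD; congr expn; lia.
  by move: (y ^ (6 * m + 6))%N (y ^ (6 * m + 7))%N (E j d) => u v w; ring.
rewrite [leqRHS]mulnAC -expnD leq_mul2r; apply/orP; right; apply: leq_absorb; first by move: yc; clear; lia.
by move: l2; clear; lia.
Qed.

(** With Z about y^(3j-6m), the two terms of [moment_le] become y^(24m-j) and y^(18m+j) up to a
    bounded power of y; the range 2m <= j <= 4m is exactly where both stay below y^(22m). *)
Lemma moment_scale j : (2 * m <= j <= 4 * m)%N ->
  (y ^ (24 * m - 6 * j + 27) * \sum_(d <- Ds) E j d ^ 2 <= y ^ (22 * m + 33))%N.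
Proof.
move=> /andP[j1 j2]; set z := (3 * j - 6 * m)%N; pose Z := (2 * y ^ z)%N.
have yp n : (0 < y ^ n)%N by rewrite expn_gt0 y0.
have y4 c : (c <= 1000)%N -> (c <= y)%N by move: yc; clear; lia.
have ZL : (Z <= y ^ (6 * m + 1))%N by apply: leq_absorb; [exact: y4|rewrite /z; move: j2; clear; lia].
have M := @moment_le Ds (y ^ (12 * m)) V (y ^ (2 * j)) Z y uD.
have {}M : (\sum_(d <- Ds) E j d ^ 2 <= Z * (y ^ (2 * j) * (6 * y * (V * y + Z)) + (y ^ (2 * j)) ^ 2 * y))%N.
  apply: M.
  - by move=> d /hD bd; have [sf d1 d2] := bd; split=> //; exact: block_gt0.
  - move=> w; have -> : (4 * (y ^ (2 * j)) ^ 3 = y ^ (12 * m) * Z ^ 2)%N.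
      rewrite /Z expnMn mulnCA -expnM -expnM -expnD; congr (_ * _ ^ _)%N.
      by rewrite /z; move: j1; clear; lia.
    by rewrite leq_pmul2l // leq_sqr.
  - move=> w /andP[w0 wZ]; apply: leq_trans (leq_pmull _ (isT : 0 < 4)%N) (tauE _).
    rewrite expn_gt0 w0 /=; apply: (@leq_trans ((y ^ (6 * m + 1)) ^ 2)); first by rewrite leq_sqr (leq_trans wZ).
    by rewrite -expnM leq_pexp2l //; clear; lia.
  - move=> n /andP[n0 nA]; apply: leq_trans (leq_pmull _ (isT : 0 < 4)%N) (tauE _).
    rewrite n0 (leq_trans nA) // -expnM; apply: leq_absorb; first exact: y4.
    by move: j2; clear; lia.
  - move=> n /andP[n0 nV]; apply: leq_trans (leq_pmull _ (isT : 0 < 4)%N) (tauE _).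
    rewrite n0 (leq_trans nV) // (leq_trans VE) // leq_pexp2l //; clear; lia.
apply: leq_trans (leq_mul (leqnn _) M) _.
have VZ : (6 * y * (V * y + Z) <= y ^ (6 * m + 4))%N.
  apply: (@leq_trans (6 * y * (2 * y ^ (6 * m + 2)))).
    rewrite leq_mul2l; apply/orP; right; rewrite mul2n -addnn; apply: leq_add.
      by rewrite addn2 expnSr leq_mul2r VE orbT.
    by apply: leq_trans ZL _; rewrite leq_pexp2l //; clear; lia.
  rewrite (_ : 6 * y * _ = 12 * y ^ (6 * m + 3))%N; last by rewrite (addnS _ 2) expnS; ring.
  by apply: leq_absorb; [exact: y4|clear; lia].
apply: (@leq_trans (y ^ (24 * m - 6 * j + 27) * (Z * (y ^ (2 * j) * y ^ (6 * m + 4) + (y ^ (2 * j)) ^ 2 * y)))).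
  by rewrite leq_mul2l; apply/orP; right; rewrite leq_mul2l; apply/orP; right; rewrite leq_add2r leq_mul2l VZ orbT.
have -> : (y ^ (24 * m - 6 * j + 27) * (Z * (y ^ (2 * j) * y ^ (6 * m + 4) + (y ^ (2 * j)) ^ 2 * y)) =
    2 * y ^ (24 * m - 6 * j + 27 + z + 2 * j + (6 * m + 4)) + 2 * y ^ (24 * m - 6 * j + 27 + z + 2 * j + 2 * j + 1))%N.
  rewrite /Z; set a := (24 * m - _ + _)%N; set b := (6 * m + 4)%N; rewrite !expnD expn1; ring.
apply: (@leq_trans (4 * y ^ (22 * m + 32))); last by apply: leq_absorb; [exact: y4|clear; lia].
rewrite -[4%N]/(2 + 2)%N mulnDl; apply: leq_add; rewrite leq_mul2l leq_pexp2l //= /z; move: j1 j2; clear; lia.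
Qed.

(** At most y^23 of the d are bad at some scale, and the pointwise bound y^(5m+7) contributes
    y^(20m+51) for them. The others are covered by the second moments, summed over at most y
    scales. *)
Lemma block_le_sum : (\sum_(d <- Ds) h3 d ^ 4 <= y ^ (22 * m + 52))%N.
Proof.
have y4 c : (c <= 1000)%N -> (c <= y)%N by move: yc; clear; lia.
have yp n : (0 < y ^ n)%N by rewrite expn_gt0 y0.
pose J := index_iota (2 * m - 1) (4 * m).+1; pose B d := has (fun j => bad j d) J.
have sJ : (size J <= y)%N by rewrite size_iota; move: ym m3; clear; lia.
have cB : (count B Ds <= y ^ 23)%N.
  apply: (@leq_trans (\sum_(j <- J) count (bad j) Ds)).
    rewrite -sum1_count; under [leqRHS]eq_bigr => j _ do rewrite -sum1_count big_mkcond.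
    rewrite exchange_big /= [leqLHS]big_mkcond; apply: leq_sum => d _.
    by case: (boolP (B d)) => // /hasP[j jJ bj]; rewrite (big_rem j) //= bj.
  apply: (@leq_trans (\sum_(j <- J) y ^ 22)).
    rewrite big_seq [leqRHS]big_seq; apply: leq_sum => j; rewrite mem_index_iota ltnS => hj; exact: bad_few.
  by rewrite big_const_seq count_predT iter_addn_0 mulnC expnS leq_mul2r sJ orbT.
have sD : (size Ds <= y ^ (12 * m + 2))%N.
  apply: (@leq_trans (V ^ 2)).
    rewrite -(size_iota 0 (V ^ 2)); apply: uniq_leq_size => // d /hD[_ _ dV].
    by rewrite mem_iota add0n.
  apply: (@leq_trans ((y ^ (6 * m).+1) ^ 2)); first by rewrite leq_sqr.
  by rewrite -expnM leq_pexp2l //; clear; lia.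
rewrite (bigID B) /=.
have p1 : (\sum_(d <- Ds | B d) h3 d ^ 4 <= y ^ (22 * m + 51))%N.
  apply: (@leq_trans (\sum_(d <- Ds | B d) y ^ (20 * m + 28))).
    rewrite big_seq_cond [leqRHS]big_seq_cond; apply: leq_sum => d /andP[/hD bd _].
    apply: (@leq_trans ((y ^ (5 * m + 7)) ^ 4)); first by rewrite leq_exp2r // h3_pointwise.
    by rewrite -expnM leq_pexp2l //; clear; lia.
  rewrite big_const_seq iter_addn_0; apply: (@leq_trans (y ^ (20 * m + 28) * y ^ 23)).
    by rewrite leq_mul2l cB orbT.
  by rewrite -expnD leq_pexp2l //; clear; lia.
have p2 : (\sum_(d <- Ds | ~~ B d) h3 d ^ 4 <= 2 * y ^ (22 * m + 51))%N.
  apply: (@leq_trans (\sum_(d <- Ds) (y ^ (8 * m + 25) + \sum_(2 * m <= j < (4 * m).+1) y ^ (24 * m - 6 * j + 27) * E j d ^ 2))).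
    rewrite [leqLHS]big_mkcond big_seq [leqRHS]big_seq; apply: leq_sum => d /hD bd.
    case: (boolP (B d)) => // /hasPn gd; apply: h3_pow4 => // j hj.
    by apply: gd; rewrite mem_index_iota ltnS.
  rewrite big_split /= [leqRHS]mul2n -addnn; apply: leq_add.
    rewrite big_const_seq count_predT iter_addn_0; apply: (@leq_trans (y ^ (8 * m + 25) * y ^ (12 * m + 2))).
      by rewrite leq_mul2l sD orbT.
    by rewrite -expnD leq_pexp2l //; clear; lia.
  rewrite exchange_big /=; apply: (@leq_trans (\sum_(2 * m <= j < (4 * m).+1) y ^ (22 * m + 33))).
    rewrite big_nat [leqRHS]big_nat; apply: leq_sum => j hj.
    by rewrite -big_distrr /=; apply: moment_scale; rewrite -ltnS.
  rewrite sum_nat_const_nat; apply: (@leq_trans (y * y ^ (22 * m + 33))).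
    by rewrite leq_mul2r; apply/orP; right; move: ym; clear; lia.
  by rewrite -expnS leq_pexp2l //; clear; lia.
apply: leq_trans (leq_add p1 p2) _; rewrite -mulSn; apply: leq_absorb; [exact: y4|clear; lia].
Qed.
End Block.

Lemma block_bound (R : realType) m : (3 <= m)%N -> exists y0, forall y, (y0 <= y)%N ->
  forall Ds : seq nat, uniq Ds -> (forall d, d \in Ds -> [/\ squarefree d, (y ^ (12 * m) <= d)%N & (d < y.+1 ^ (12 * m))%N]) ->
  (\sum_(d <- Ds) h3 d ^ 4 <= y ^ (22 * m + 52))%N.
Proof.
move=> m3; have [y1 hy1] := tau_small (24 * m + 2); have [y2 hy2] := many_primes R (4 * m).
pose k := 20%N; have kE : k = 20%N by []; clearbody k.
exists (y1 + y2 + (1000 + 48 * (4 * 54 ^ 2)) + 2 ^ (6 * m) + 4 * (16 * k) ^ k + (2 * m + 2))%N => y hy Ds uD hD.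
have [c1 c2 c3 c4 [c5 c6]] : [/\ (y1 <= y)%N, (y2 <= y)%N, (1000 + 48 * (4 * 54 ^ 2) <= y)%N, (2 ^ (6 * m) <= y)%N &
    (4 * (16 * k) ^ k <= y)%N /\ (2 * m + 2 <= y)%N].
  by move: hy; move: (1000 + _)%N (2 ^ _)%N (4 * (16 * k) ^ k)%N => u v w; clear; split; lia.
have y0 : (0 < y)%N by move: c6; clear; lia.
have /choice[Q hQ] (j : nat) : exists W : seq nat * int * int, (0 < j <= 4 * m)%N ->
    [/\ uniq W.1.1, `|W.1.2| <= 1, `|W.2| <= 1, (y ^ j.-1 <= size W.1.1)%N &
    forall q, q \in W.1.1 -> [/\ prime q, (2 < q)%N, (q <= y ^ j)%N, (q %% 3 = 2)%N &
      leg (- 1 : 'F_q) = W.1.2 /\ leg (2%:R : 'F_q) = W.2]].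
  have [hj|] := boolP (0 < j <= 4 * m)%N; last by move=> _; exists ([::], 0, 0).
  by have [W [u [v h]]] := hy2 y c2 j hj; exists (W, u, v).
apply: (@block_le_sum R m y (fun j => (Q j).1.1) (fun j => (Q j).1.2) (fun j => (Q j).2) m3 c3 _ _ _ _ _ _ k) => //.
- apply: (@leq_trans ((2 * y) ^ (6 * m))); first by rewrite leq_exp2r; [lia|move: m3; clear; lia].
  by rewrite expnMn leq_absorb.
- exact: hy1.
- by move=> j /hQ[].
- by move=> j /hQ[].
- by move=> j /hQ[].
- by move=> j q /hQ[_ _ _ _]; apply.
move=> d /hD[sf d1 d2]; split=> //; rewrite -expnM (_ : 6 * m * 2 = 12 * m)%N //; clear; lia.
Qed.

(** Summing the block bounds over y < n costs one more power of n; the blocks below y0 form the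
    constant. *)
Lemma power_bound (R : realType) m : (3 <= m)%N -> exists C0, forall n,
  (\sum_(d <- [seq d <- iota 0 (n ^ (12 * m)) | `[< (0 < d)%N /\ squarefree d >]]) h3 d ^ 4 <= C0 + n ^ (22 * m + 53))%N.
Proof.
move=> m3; have [y0 hy0] := block_bound R m3.
pose G n := (\sum_(d <- [seq d <- iota 0 (n ^ (12 * m)) | `[< (0 < d)%N /\ squarefree d >]]) h3 d ^ 4)%N.
have step n : G n.+1 = (G n + \sum_(d <- [seq d <- iota (n ^ (12 * m)) (n.+1 ^ (12 * m) - n ^ (12 * m)) | `[< (0 < d)%N /\ squarefree d >]]) h3 d ^ 4)%N.
  have le : (n ^ (12 * m) <= n.+1 ^ (12 * m))%N by rewrite leq_exp2r //; move: m3; clear; lia.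
  by rewrite /G -{1}(subnKC le) iotaD filter_cat big_cat.
have mono : {homo G : i j / (i <= j)%N}.
  by apply: homo_leq => [//|i j l|n]; [exact: leq_trans|rewrite step leq_addr].
exists (G y0) => n; rewrite -/(G n).
have [h|h] := leqP n y0; first by apply: leq_trans (mono _ _ h) _; exact: leq_addr.
elim: n h => // n IH; rewrite ltnS => h.
have {}IH : (G n <= G y0 + n ^ (22 * m + 53))%N.
  by move: h; rewrite leq_eqVlt => /orP[/eqP<-|/IH //]; exact: leq_addr.
rewrite step; apply: leq_trans (leq_add IH (hy0 n h _ _ _)) _.
- by rewrite filter_uniq ?iota_uniq.
- move=> d; rewrite mem_filter mem_iota => /andP[/asboolP[_ sf] /andP[d1 d2]]; split=> //.
  by rewrite subnKC in d2 => //; rewrite leq_exp2r //; move: m3; clear; lia.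
rewrite -addnA leq_add2l (addnS _ 52) expnS -mulSnr [leqRHS]expnS leq_mul2l.
by rewrite leq_exp2r ?leqnSn //; clear; lia.
Qed.
(** * The fourth moment *)
From mathcomp Require Import all_classical all_reals all_analysis.
Local Open Scope classical_set_scope.

Theorem theorem2 (R : realType) (eps : R) (heps : 0 < eps) :
  exists2 C : R, 0 < C & forall X : R, 2 <= X ->
    \sum_(d \in [set d : nat | [/\ (0 < d)%N, squarefree d & (d%:R : R) < X]])
        ((h3 d)%:R : R) ^+ 4
      <= C * X `^ (11 / 6 + eps).
Proof.
(* This m makes 53 / (12 m) at most eps, and is at least 3 as the block bounds require. *)
pose m := (Num.bound (53%:R / (12%:R * eps)) + 3)%N.
have m3 : (3 <= m)%N by rewrite leq_addl.
have me : 53%:R <= 12%:R * eps * m%:R :> R.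
  rewrite mulrC -ler_pdivrMr ?mulr_gt0 // natrD; apply: ler_wpDr => //.
  by rewrite ltW // archi_boundP // divr_ge0 // mulr_ge0 // ltW.
have [C0 hC0] := power_bound R m3; clearbody m.
pose e := (22 * m + 53)%N; exists (C0%:R + 2 ^+ e); first by rewrite ltr_wpDl // exprn_gt0.
move=> X X2; have X1 : 1 <= X by lra.
have X0 : 0 <= X by lra.
have m0 : 0 < (12 * m)%N%:R :> R by rewrite ltr0n muln_gt0 (leq_trans _ m3).
pose r := X `^ ((12 * m)%N%:R)^-1.
have r1 : 1 <= r by rewrite -(powRr0 X) ler_powR // invr_ge0 ltW.
have r0 : 0 <= r by lra.
have rX : r ^+ (12 * m) = X by rewrite -powR_mulrn // -powRrM mulVf ?powRr1 // gt_eqF.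
(* The least integer above r = X^(1/(12m)); it is at most 2 r since r >= 1, whence the factor 2^e in
   the constant. *)
pose n := (Num.truncn r).+1.
have rn : r < n%:R by rewrite -truncn_lt_nat.
have nr : n%:R <= 2 * r.
  have : (Num.truncn r)%:R <= r by rewrite truncn_le.
  by rewrite /n -natr1; lra.
pose P d := `[< (0 < d)%N /\ squarefree d >].
pose s := [seq d <- iota 0 (n ^ (12 * m)) | P d].
have Xn : X < (n ^ (12 * m))%N%:R by rewrite natrX -rX ltrXn2r ?ltr0n // -lt0n muln_gt0 (leq_trans _ m3).
pose s' := [seq d <- s | (d%:R : R) < X].
have -> : [set d : nat | [/\ (0 < d)%N, squarefree d & (d%:R : R) < X]] = [set` s'].
  apply/seteqP; split=> d /=.
    move=> [d0 sf dX]; rewrite !mem_filter dX mem_iota add0n /=; apply/andP; split; first by apply/asboolP.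
    by rewrite -(ltr_nat R) (lt_trans dX).
  by rewrite !mem_filter => /and3P[dX /asboolP[d0 sf] _].
rewrite -fsbig_seq ?filter_uniq ?iota_uniq //.
apply: (@le_trans _ _ ((\sum_(d <- s) h3 d ^ 4)%N%:R)).
  rewrite natr_sum [leLHS]big_filter big_mkcond; apply: ler_sum => d _.
  by case: ifP; rewrite natrX // exprn_ge0.
apply: (@le_trans _ _ ((C0 + n ^ e)%N%:R)); first by rewrite ler_nat hC0.
rewrite natrD natrX mulrDl; apply: lerD.
  have E0 : 0 <= 11 / 6 + eps by move: heps; lra.
  by rewrite ler_peMr // -[leLHS](powRr0 X) ler_powR.
apply: (@le_trans _ _ ((2 * r) ^+ e)); first by apply: lerXn2r => //; rewrite nnegrE ?ler0n // mulr_ge0.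
rewrite exprMn ler_wpM2l ?exprn_ge0 // -powR_mulrn // -powRrM ler_powR //.
rewrite mulrC ler_pdivrMr // /e natrD !natrM.
by move: me; lra.
Qed.
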